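(* Let $n\ge1$ and $r>0$. For any points $z_k,\zeta_k$, $k=1,\dots,n$, lying on the circle $|z|=r$ and any pairwise disjoint domains $D_k\subset\overline{\mathbb C}$ possessing Green functions and such that $z_k,\zeta_k\in D_k$, $k=1,\dots,n$, we have $$\prod_{k=1}^nr(D_k,z_k)\,r(D_k,\zeta_k)\exp\bigl(-2g_k(z_k,\zeta_k)\bigr)\ \le\ (2r/n)^{2n},$$ where $g_k(z,\zeta)$ is the Green function of $D_k$ (with $\exp(-2g_k(z_k,\zeta_k))=0$ if $z_k=\zeta_k$). Equality is attained for the domains $$D_k^*=\Bigl\{z:\frac{2\pi k}{n}<\arg z<\frac{2\pi(k+1)}{n}\Bigr\}$$ and the points $$z_k^*=r\exp\Bigl(i\Bigl(\frac{\pi}{2n}+\frac{2\pi k}{n}\Bigr)\Bigr),\qquad \zeta_k^*=r\exp\Bigl(i\Bigl(\frac{3\pi}{2n}+\frac{2\pi k}{n}\Bigr)\Bigr),\qquad k=1,\dots,n.$$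
   Context: $\overline{\mathbb C}$ is the Riemann sphere. For a domain $G\subset\overline{\mathbb C}$ with Green function $g_G(z,z_0)$ (pole at the finite point $z_0\in G$), the inner radius of $G$ with respect to $z_0$ is $r(G,z_0)=\exp\{\lim_{z\to z_0}(g_G(z,z_0)+\log|z-z_0|)\}$. *)

(* Defs.v *)
From HB Require Import structures.
From mathcomp Require Import all_boot all_order all_algebra.
From mathcomp Require Import complex.
From mathcomp Require Import all_classical all_reals all_analysis.

Set Implicit Arguments.
Unset Strict Implicit.
Unset Printing Implicit Defensive.

Import Order.TTheory GRing.Theory Num.Theory.
Import numFieldNormedType.Exports.

Local Open Scope classical_set_scope.
Local Open Scope ring_scope.
Local Open Scope complex_scope.

(* [Some z] is the finite point z, [None] is the point at infinity; the
   topology of the plane is carried by the regular algebra R[i]^o. *)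
Notation riemann_sphere R := (one_point_compactification R[i]^o).

Section GreenFunctions.
Context {R : realType}.
Local Notation C := R[i]^o.
Local Notation Chat := (riemann_sphere R).
Implicit Types (f : C -> R) (z w : C) (u : Chat -> R) (D : set Chat).

Definition modulus z : R := Normc.normc z.

Definition polar (rho theta : R) : C := (rho * cos theta) +i* (rho * sin theta).

Definition derivable_x f z := derivable (fun t : R => f (t +i* complex.Im z)) (complex.Re z) 1.
Definition derivable_y f z := derivable (fun t : R => f (complex.Re z +i* t)) (complex.Im z) 1.
Definition dx f z : R := derive1 (fun t : R => f (t +i* complex.Im z)) (complex.Re z).
Definition dy f z : R := derive1 (fun t : R => f (complex.Re z +i* t)) (complex.Im z).

Definition C1 (U : set C) f := forall z, U z ->
  [/\ derivable_x f z, derivable_y f z,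
      {for z, continuous (dx f)} & {for z, continuous (dy f)}].

Definition C2 (U : set C) f := [/\ C1 U f, C1 U (dx f) & C1 U (dy f)].

(* Meant for open U; the values of f off U are then irrelevant. *)
Definition harmonic_on (U : set C) f :=
  C2 U f /\ forall z, U z -> dx (dx f) z + dy (dy f) z = 0.

(* The chart w |-> 1/w of the sphere around the point at infinity. *)
Definition chart_infty w : Chat := if w == 0 then None else Some w^-1.

Definition sphere_harmonic_on (W : set Chat) u :=
  harmonic_on (Some @^-1` W) (u \o Some) /\
  harmonic_on (chart_infty @^-1` W) (u \o chart_infty).

Definition domain D := [/\ open D, connected D & D !=set0].

(* u + log|z - w| extends harmonically across w. *)
Definition log_pole w u := exists (U : set C) (h : C -> R),
  [/\ open U, U w, harmonic_on U h &
      forall z, U z -> z != w -> u (Some z) = h z - ln (modulus (z - w))].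

Definition green_competitor D w u :=
  [/\ sphere_harmonic_on (D `\ Some w) u,
      forall p, (D `\ Some w) p -> 0 <= u p & log_pole w u].

(* The Green function of D with pole w is the least nonnegative harmonic
   function on D \ {w} with a logarithmic pole at w.  When there is a
   function vanishing continuously on the boundary, this is the same as the
   classical Green function; in general it is the limit of the Green functions
   of an exhaustion of D.  Its values outside D \ {w} are left unspecified. *)
Definition is_green D w u := green_competitor D w u /\
  forall v, green_competitor D w v ->
    forall p, (D `\ Some w) p -> u p <= v p.

Definition has_green D := forall w, D (Some w) -> exists u, is_green D w u.

Definition green D (p : Chat) w : R := xget (fun=> 0) (is_green D w) p.

Definition inner_radius D w : R :=
  expR (lim ((fun z => green D (Some z) w + ln (modulus (z - w))) @ w^')).

(* exp(-2 g_D(z, w)), read as 0 at the pole, where g_D is infinite. *)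
Definition exp_m2green D z w : R :=
  if z == w then 0 else expR (- 2 * green D (Some z) w).

Definition configuration (n : nat) (r : R) (D : 'I_n -> set Chat)
    (z zeta : 'I_n -> C) :=
  [/\ forall k, modulus (z k) = r /\ modulus (zeta k) = r,
      forall k, domain (D k) /\ has_green (D k),
      forall j k, j != k -> D j `&` D k = set0 &
      forall k, D k (Some (z k)) /\ D k (Some (zeta k))].

Definition radii_product (n : nat) (D : 'I_n -> set Chat)
    (z zeta : 'I_n -> C) : R :=
  \prod_(k < n) (inner_radius (D k) (z k) * inner_radius (D k) (zeta k)
                 * exp_m2green (D k) (z k) (zeta k)).

(* k : 'I_n stands for the index k + 1, which runs through 1, ..., n; the
   condition on arg z asks for some value of the argument in the interval. *)
Definition Dstar (n : nat) (k : 'I_n) : set Chat :=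
  [set p | exists rho theta : R,
    [/\ 0 < rho, 2 * pi * k.+1%:R / n%:R < theta,
        theta < 2 * pi * k.+2%:R / n%:R & p = Some (polar rho theta)]].

Definition zstar (n : nat) (r : R) (k : 'I_n) : C :=
  polar r (pi / (2 * n%:R) + 2 * pi * k.+1%:R / n%:R).

Definition zetastar (n : nat) (r : R) (k : 'I_n) : C :=
  polar r (3 * pi / (2 * n%:R) + 2 * pi * k.+1%:R / n%:R).

End GreenFunctions.

(* Main.v *)
(* The bound is an energy estimate in logarithmic coordinates w = r exp(s + i t).
   For each k take smooth compactly supported approximants V, V' of the Green
   functions of D_k with poles z_k and zeta_k, whose logarithmic poles are
   rounded off in discs of radius d, and let U_k = V - V'.  Up to errors that
   vanish in the limit, twice the charge pairing of U_k minus its Dirichlet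
   energy is at least the contribution of k to the logarithm of the product.
   The 2n points cut the circle into arcs, hence the cylinder into strips; on a
   strip of width l the functions U_k, with suitable signs, compete with the
   potential -log|tan(pi (w - p) / (2 l))| of unit charges at the two ends,
   rounded off in the same way, which has vanishing normal derivative on the
   sides.  Expanding |grad(U - h)|^2 >= 0 bounds the energy expression of the
   strip by log(2 r l / pi), and since the widths add up to 2 pi, concavity of
   the logarithm gives the theorem.  Green functions of arbitrary domains are
   reached through Perron's method.  For the sectors the Green function is
   explicit in logarithmic coordinates, and its minimality follows from the
   maximum principle because its superlevel sets are compact. *)
Require Import Defs.
From HB Require Import structures.
From mathcomp Require Import all_boot all_order all_algebra.
From mathcomp Require Import complex.
From mathcomp Require Import all_classical all_reals all_analysis.
From mathcomp Require Import ring lra.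

Set Implicit Arguments.
Unset Strict Implicit.
Unset Printing Implicit Defensive.

Import Order.TTheory GRing.Theory Num.Theory.
Import numFieldNormedType.Exports.

Local Open Scope classical_set_scope.
Local Open Scope ring_scope.
Local Open Scope complex_scope.

(** * Calculus on the plane *)

(** The domains are arbitrary, so their Green functions need not vanish continuously at the boundary
    and no Green formula is available for them. Integration by parts in the domains therefore acts
    on compactly supported [C2] approximants, of which only one-sided information survives: a charge
    at most that of the rounded pole, values below the Green function, and nearly the values of the
    rounded Green function around the pole. The cylinder misses 0 and infinity, which the domains
    may contain; since bounded harmonic functions extend across a point, deleting the two points
    leaves the Green function unchanged. The cyclic order of the 2n points is arbitrary, so
    neighbours need not have charges of opposite sign. As the [U_k] live on disjoint sets, each may
    change its sign from one strip to the next, and no alternation is required. The self-energies of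
    the rounded poles diverge as [d] tends to 0, but they enter the lower and the upper bound
    identically; every side of a strip cuts such a charge into two equal halves, whose common mass
    divides out, so neither has to be computed. *)

Section PlaneTopology.
Context {R : realType}.
Local Notation C := R[i]^o.
Implicit Types (z w c : C).

Lemma modulusE z : modulus z = Num.sqrt (complex.Re z ^+ 2 + complex.Im z ^+ 2).
Proof. by case: z. Qed.

Lemma modulus_ge0 z : 0 <= modulus z.
Proof. by rewrite modulusE sqrtr_ge0. Qed.

Lemma sqr_modulus z : modulus z ^+ 2 = complex.Re z ^+ 2 + complex.Im z ^+ 2.
Proof. by rewrite modulusE sqr_sqrtr// addr_ge0 ?sqr_ge0. Qed.

Lemma modulusD z w : modulus (z + w) <= modulus z + modulus w.
Proof. exact: le_normcD. Qed.

Lemma modulusN z : modulus (- z) = modulus z.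
Proof. exact: normcN. Qed.

Lemma modulusC z w : modulus (z - w) = modulus (w - z).
Proof. by rewrite -modulusN opprB. Qed.

Lemma modulus0 : modulus (0 : C) = 0.
Proof. exact: Normc.normc0. Qed.

Lemma modulus_eq0 z : modulus z = 0 -> z = 0.
Proof. exact: Normc.eq0_normc. Qed.

Lemma modulus_gt0 z : (0 < modulus z) = (z != 0).
Proof.
rewrite lt_neqAle modulus_ge0 andbT eq_sym; congr (~~ _).
by apply/eqP/eqP => [/modulus_eq0//|->]; rewrite modulus0.
Qed.

Lemma modulus_sub_gt0 z w : (0 < modulus (z - w)) = (z != w).
Proof. by rewrite modulus_gt0 subr_eq0. Qed.

Lemma normr_Re_le z : `|complex.Re z| <= modulus z.
Proof. by rewrite modulusE -sqrtr_sqr ler_wsqrtr// lerDl sqr_ge0. Qed.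

Lemma normr_Im_le z : `|complex.Im z| <= modulus z.
Proof. by rewrite modulusE -sqrtr_sqr ler_wsqrtr// lerDr sqr_ge0. Qed.

Lemma modulus_le z : modulus z <= `|complex.Re z| + `|complex.Im z|.
Proof.
rewrite -(ler_pXn2r (n := 2)) ?nnegrE ?modulus_ge0 ?addr_ge0//.
rewrite sqr_modulus -(real_normK (num_real (complex.Re z))).
rewrite -(real_normK (num_real (complex.Im z))).
have := mulr_ge0 (normr_ge0 (complex.Re z)) (normr_ge0 (complex.Im z)).
nra.
Qed.

Lemma ReB z w : complex.Re (z - w) = complex.Re z - complex.Re w.
Proof. by case: z; case: w. Qed.

Lemma ImB z w : complex.Im (z - w) = complex.Im z - complex.Im w.
Proof. by case: z; case: w. Qed.

Lemma complex_eta z : complex.Re z +i* complex.Im z = z.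
Proof. by case: z. Qed.

(** The norm of [R[i]] takes its values in [R[i]], so the radius of a ball is a complex number whose
    positivity forces the imaginary part to vanish. From here on neighbourhoods are described by the
    real-valued [modulus]. *)
Lemma nbhs_modulus z (A : set C) :
  nbhs z A <-> exists2 e : R, 0 < e & forall w, modulus (w - z) < e -> A w.
Proof.
split.
- case/nbhs_ballP => -[e e'] /=; rewrite ltcE /= => /andP[/eqP e'0 e0] zA.
  exists e => // w we; apply: zA; rewrite -ball_normE /ball_ /=.
  rewrite /Num.Def.normr /= ltcE/= e'0 eqxx /=.
  by have := we; rewrite modulusC.
- case=> e e0 zA; apply/nbhs_ballP; exists (e%:C); first by rewrite /= ltcE /= eqxx.
  move=> w; rewrite -ball_normE /ball_ /= /Num.Def.normr /= ltcE/= eqxx /= => we.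
  by apply: zA; rewrite modulusC.
Qed.

Lemma near_modulus z (e : R) : 0 < e -> \forall w \near z, modulus (w - z) < e.
Proof. by move=> e0; apply/nbhs_modulus; exists e. Qed.

Lemma openP_modulus (A : set C) :
  open A <-> forall z, A z -> exists2 e : R, 0 < e & forall w, modulus (w - z) < e -> A w.
Proof.
rewrite openE; split=> H z /H; first by move/nbhs_modulus.
by move=> ?; apply/nbhs_modulus.
Qed.

Lemma continuous_modulusP (f : C -> R) z : {for z, continuous f} <->
  forall e : R, 0 < e -> exists2 d : R, 0 < d & forall w, modulus (w - z) < d -> `|f w - f z| < e.
Proof.
split=> [cf e e0|H].
  apply/nbhs_modulus; move/cvgrPdist_lt: cf => /(_ _ e0); apply: filterS => w.
  by rewrite distrC.
apply/(@cvgrPdist_lt _ _ _ _ (nbhs_filter z)) => e e0; have [d d0 Hd] := H _ e0.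
by apply/nbhs_modulus; exists d => // w /Hd; rewrite distrC.
Qed.

Lemma continuous_Re z : {for z, continuous (@complex.Re R : C -> R)}.
Proof.
apply/continuous_modulusP => e e0; exists e => // w.
by apply: le_lt_trans; rewrite -ReB normr_Re_le.
Qed.

Lemma continuous_Im z : {for z, continuous (@complex.Im R : C -> R)}.
Proof.
apply/continuous_modulusP => e e0; exists e => // w.
by apply: le_lt_trans; rewrite -ImB normr_Im_le.
Qed.

Lemma cvg_complex (T : Type) (F : set_system T) (FF : Filter F) (A B : T -> R) (a b : R) :
  A @ F --> a -> B @ F --> b -> (fun t => A t +i* B t : C) @ F --> (a +i* b : C).
Proof.
move=> cA cB P /nbhs_modulus[e e0 eP].
have e20 : 0 < e / 2 by rewrite divr_gt0.
move/cvgrPdist_lt: cA => /(_ _ e20) hA; move/cvgrPdist_lt: cB => /(_ _ e20) hB.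
near=> t; apply: eP; apply: le_lt_trans (modulus_le _) _.
rewrite ReB ImB /= (splitr e) ltrD// distrC.
  by near: t.
by near: t.
Unshelve. all: by end_near. Qed.

Lemma continuous_complex (T : topologicalType) (A B : T -> R) t :
  {for t, continuous A} -> {for t, continuous B} ->
  {for t, continuous (fun t => A t +i* B t : C)}.
Proof. exact: cvg_complex. Qed.

Lemma continuous_complexP (T : topologicalType) (f : T -> C) t :
  {for t, continuous f} <->
  {for t, continuous (fun t => complex.Re (f t))} /\ {for t, continuous (fun t => complex.Im (f t))}.
Proof.
split=> [cf|[cA cB]].
  split.
    exact: (@continuous_comp _ _ _ f (@complex.Re R) t cf (@continuous_Re (f t))).
  exact: (@continuous_comp _ _ _ f (@complex.Im R) t cf (@continuous_Im (f t))).
have := continuous_complex cA cB.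
by rewrite (_ : (fun s => _ +i* _) = f)//; apply/funext => s; rewrite complex_eta.
Qed.

Lemma continuous_modulus z : {for z, continuous (@modulus R : C -> R)}.
Proof.
apply/continuous_modulusP => e e0; exists e => // w; apply: le_lt_trans.
rewrite ler_norml; have := modulusD (w - z) z; have := modulusD (z - w) w.
by rewrite !subrK (modulusC z w); lra.
Qed.

Lemma continuous_modulusB c z : {for z, continuous (fun w : C => modulus (w - c))}.
Proof.
apply/continuous_modulusP => e e0; exists e => // w; apply: le_lt_trans.
rewrite ler_norml; have := modulusD (w - z) (z - c); have := modulusD (z - w) (w - c).
by rewrite !subrKA (modulusC z w); lra.
Qed.

Definition odisc c (r : R) : set C := [set z | modulus (z - c) < r].
Definition cdisc c (r : R) : set C := [set z | modulus (z - c) <= r].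

Lemma open_odisc c r : open (odisc c r).
Proof.
apply/openP_modulus => z /= zr; exists (r - modulus (z - c)); first by rewrite subr_gt0.
by move=> w wz; rewrite /odisc/=; have := modulusD (w - z) (z - c); rewrite subrKA; lra.
Qed.

Lemma closed_cdisc c r : closed (cdisc c r).
Proof.
rewrite -openC; apply/openP_modulus => z /= /negP; rewrite -ltNge => zr.
exists (modulus (z - c) - r); first by rewrite subr_gt0.
move=> w wz; rewrite /cdisc/=; apply/negP; rewrite -ltNge.
by have := modulusD (z - w) (w - c); rewrite subrKA (modulusC z w); lra.
Qed.

Lemma compact_rect (a b c d : R) :
  compact [set z : C | a <= complex.Re z <= b /\ c <= complex.Im z <= d].
Proof.
pose g (p : R * R) : C := p.1 +i* p.2.
have := @continuous_compact _ _ g (`[a, b]%classic `*` `[c, d]%classic).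
set A := g @` _; have -> : [set z : C | a <= complex.Re z <= b /\ c <= complex.Im z <= d] = A.
  apply/seteqP; split=> z /=.
    move=> [h1 h2]; exists (complex.Re z, complex.Im z); last by rewrite /g /= complex_eta.
    by split; rewrite /= in_itv.
  by case=> -[x y] [/=]; rewrite !in_itv /= => h1 h2 <-.
apply; last by apply: compact_setX; exact: segment_compact.
apply: continuous_subspaceT => p; apply: continuous_complex.
  exact: cvg_fst.
exact: cvg_snd.
Qed.

Lemma bounded_closed_compact_plane (A : set C) (M : R) :
  closed A -> (forall z, A z -> modulus z <= M) -> compact A.
Proof.
move=> cA bA; apply: (subclosed_compact cA (@compact_rect (- M) M (- M) M)).
move=> z Az; have zM := bA _ Az; split; rewrite -ler_norml.
  exact: le_trans (normr_Re_le z) zM.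
exact: le_trans (normr_Im_le z) zM.
Qed.

Lemma compact_cdisc c r : compact (cdisc c r).
Proof.
apply: (@bounded_closed_compact_plane _ (r + modulus c) (@closed_cdisc _ _)).
move=> z zr; have := modulusD (z - c) c; rewrite subrK.
by move: zr; rewrite /cdisc/=; lra.
Qed.

Lemma hausdorff_plane : hausdorff_space C.
Proof. exact: norm_hausdorff. Qed.

Lemma compact_bounded_plane (K : set C) : compact K -> exists2 M : R, 0 < M & forall z, K z -> modulus z < M.
Proof.
move=> cK; have [->|/set0P K0] := eqVneq K set0; first by exists 1.
have [z0 Kz0 Hz0] : exists2 z0, K z0 & forall z, K z -> modulus z <= modulus z0.
  have := @compact_EVT_max _ _ (@modulus R : C -> R) K K0 cK.
  case; first by apply: continuous_subspaceT => z; exact: continuous_modulus.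
  by move=> z0 /set_mem Kz0 H; exists z0 => // z Kz; apply: H; apply: mem_set.
exists (modulus z0 + 1); first by have := modulus_ge0 z0; lra.
by move=> z /Hz0; lra.
Qed.

End PlaneTopology.

Section ContinuousAt.
Context {R : realType} {T : topologicalType}.
Implicit Types (f g : T -> R) (t : T).

Lemma cont_cst (a : R) t : {for t, continuous (fun=> a : R)}.
Proof. exact: cvg_cst. Qed.

Lemma contD f g t : {for t, continuous f} -> {for t, continuous g} ->
  {for t, continuous (fun s => f s + g s)}.
Proof. by move=> cf cg; exact: (cvgD cf cg). Qed.

Lemma contB f g t : {for t, continuous f} -> {for t, continuous g} ->
  {for t, continuous (fun s => f s - g s)}.
Proof. by move=> cf cg; exact: (cvgB cf cg). Qed.

Lemma contN f t : {for t, continuous f} -> {for t, continuous (fun s => - f s)}.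
Proof. by move=> cf; exact: (cvgN cf). Qed.

Lemma contM f g t : {for t, continuous f} -> {for t, continuous g} ->
  {for t, continuous (fun s => f s * g s)}.
Proof. by move=> cf cg; exact: (cvgM cf cg). Qed.

Lemma contX f t n : {for t, continuous f} -> {for t, continuous (fun s => f s ^+ n)}.
Proof.
move=> cf; elim: n => [|n IH].
  by rewrite (_ : (fun _ => _) = fun=> 1); [exact: cont_cst|apply/funext => s; rewrite expr0].
rewrite (_ : (fun _ => _) = fun s => f s * f s ^+ n); first exact: contM.
by apply/funext => s; rewrite exprS.
Qed.

Lemma contV f t : {for t, continuous f} -> f t != 0 -> {for t, continuous (fun s => (f s)^-1)}.
Proof. by move=> cf f0; exact: (cvgV f0 cf). Qed.

Lemma cont_comp (f : T -> R) (h : R -> R) t : {for t, continuous f} ->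
  {for f t, continuous h} -> {for t, continuous (fun s => h (f s))}.
Proof. by move=> cf ch; exact: (@continuous_comp _ _ _ f h t cf ch). Qed.

Lemma cont_max f g t : {for t, continuous f} -> {for t, continuous g} ->
  {for t, continuous (fun s => Num.max (f s) (g s))}.
Proof. by move=> cf cg; apply: (@continuous_max _ _ f g). Qed.

Lemma cont_near_eq (U : topologicalType) (f g : T -> U) t : {near t, f =1 g} -> {for t, continuous f} ->
  {for t, continuous g}.
Proof.
move=> fg cf; have fgt := nbhs_singleton fg.
rewrite /prop_for /continuous_at -fgt; apply: cvg_trans cf.
exact: near_eq_cvg.
Qed.

End ContinuousAt.

Lemma is_derive_cont (R : realType) (f : R -> R) (x a : R) : is_derive x 1 f a ->
  {for x, continuous f}.
Proof.
by move=> H; apply: differentiable_continuous; apply/derivable1_diffP; exact: ex_derive.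
Qed.

Section Calculus.
Context {R : realType}.
Local Notation C := R[i]^o.
Implicit Types (z w c : C) (f g : C -> R) (U V : set C).

Lemma MVT_abs (f df : R -> R) (x y : R) :
  (forall t, `|t - x| <= `|y - x| -> is_derive t 1 f (df t)) ->
  exists2 s, `|s - x| <= `|y - x| & f y - f x = df s * (y - x).
Proof.
move=> H; have [xy|yx|->] := ltgtP x y; last first.
  by exists y; rewrite ?subrr ?normr0 ?mulr0.
- have H' t : t \in `[y, x] -> is_derive t 1 f (df t).
    rewrite in_itv /= => /andP[yt tx]; apply: H.
    by rewrite !ler0_norm ?subr_le0 ?(ltW yx)// lerN2 lerB.
  have cf : {within `[y, x], continuous f}.
    by apply: derivable_within_continuous => t /H' ?; exact: ex_derive.
  have [s] := @MVT _ f df y x yx (fun t ht => H' t (subset_itv_oo_cc ht)) cf.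
  rewrite in_itv /= => /andP[ys sx] E; exists s; last by rewrite -opprB E -mulrN opprB.
  by rewrite !ltr0_norm ?subr_lt0// lerN2 lerB// ltW.
- have H' t : t \in `[x, y] -> is_derive t 1 f (df t).
    rewrite in_itv /= => /andP[xt ty]; apply: H.
    by rewrite !ger0_norm ?subr_ge0 ?(ltW xy)// lerB.
  have cf : {within `[x, y], continuous f}.
    by apply: derivable_within_continuous => t /H' ?; exact: ex_derive.
  have [s] := @MVT _ f df x y xy (fun t ht => H' t (subset_itv_oo_cc ht)) cf.
  rewrite in_itv /= => /andP[xs sy] E; exists s => //.
  by rewrite !gtr0_norm ?subr_gt0// lerB// ltW.
Qed.

Lemma modulus_mono (a b a' b' : R) : `|a| <= `|a'| -> `|b| <= `|b'| ->
  modulus (a +i* b) <= modulus (a' +i* b').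
Proof.
move=> ha hb; rewrite !modulusE /= ler_wsqrtr// lerD//.
  by rewrite -(real_normK (num_real a)) -(real_normK (num_real a')) ler_sqr ?nnegrE.
by rewrite -(real_normK (num_real b)) -(real_normK (num_real b')) ler_sqr ?nnegrE.
Qed.

Definition isdx f z a := is_derive (complex.Re z) (1 : R) (fun t : R => f (t +i* complex.Im z)) a.
Definition isdy f z a := is_derive (complex.Im z) (1 : R) (fun t : R => f (complex.Re z +i* t)) a.

Lemma isdxP f z a : isdx f z a <-> derivable_x f z /\ dx f z = a.
Proof.
rewrite /isdx /derivable_x /dx derive1E; split=> [H|[H <-]]; last exact: DeriveDef.
by split; [exact: ex_derive|rewrite derive_val].
Qed.

Lemma isdyP f z a : isdy f z a <-> derivable_y f z /\ dy f z = a.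
Proof.
rewrite /isdy /derivable_y /dy derive1E; split=> [H|[H <-]]; last exact: DeriveDef.
by split; [exact: ex_derive|rewrite derive_val].
Qed.

Lemma C1_isd U f z : C1 U f -> U z -> isdx f z (dx f z) /\ isdy f z (dy f z).
Proof. by move=> H /H[? ? _ _]; split; [apply/isdxP|apply/isdyP]. Qed.

Lemma C1_caratheodory U f z : open U -> C1 U f -> U z ->
  exists p q : C -> R, [/\ {for z, continuous p}, {for z, continuous q},
    p z = dx f z, q z = dy f z &
    forall w, f w - f z = p w * (complex.Re w - complex.Re z) + q w * (complex.Im w - complex.Im z)].
Proof.
move=> /openP_modulus oU cf Uz; have [_ dyz] := C1_isd cf Uz.
have [g [g1 g2 g3]] := (is_derive1_caratheodory _ _ _).1 dyz.
(* On the line [Re w = Re z] the quotient would be 0/0 and takes its limit value instead. *)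
pose p (w : C) := if complex.Re w == complex.Re z then dx f z else
  (f w - f (complex.Re z +i* complex.Im w)) / (complex.Re w - complex.Re z).
exists p, (fun w => g (complex.Im w)); split => //.
- apply/continuous_modulusP => e e0.
  have [_ _ cx _] := cf _ Uz.
  have [d1 d10 Hd1] := (continuous_modulusP _ _).1 cx _ e0.
  have [d2 d20 Hd2] := oU _ Uz.
  exists (Num.min d1 d2); first by rewrite lt_min d10.
  move=> w; rewrite lt_min => /andP[wd1 wd2]; rewrite /p eqxx.
  case: ifPn => [_|ne]; first by rewrite subrr normr0.
  have inU (t : R) : `|t - complex.Re z| <= `|complex.Re w - complex.Re z| ->
      modulus ((t +i* complex.Im w : C) - z) <= modulus (w - z).
    move=> ht; rewrite -(complex_eta (_ - z)) -(complex_eta (w - z)) !ReB !ImB /=.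
    exact: modulus_mono.
  have [s hs E] := @MVT_abs (fun t => f (t +i* complex.Im w)) (fun t => dx f (t +i* complex.Im w))
    (complex.Re z) (complex.Re w) (fun t ht => (C1_isd cf (Hd2 _ (le_lt_trans (inU _ ht) wd2))).1).
  rewrite -[in f w](complex_eta w) E mulfK ?subr_eq0//.
  by apply: Hd1; apply: le_lt_trans (inU _ hs) wd1.
- exact: (@continuous_comp _ _ _ (@complex.Im R : C -> R) g z (@continuous_Im _ z) g2).
- by rewrite /p eqxx.
- move=> w; rewrite /p; have := g1 (complex.Im w); rewrite complex_eta => <-.
  case: ifPn => [/eqP h|ne]; first by rewrite h subrr mulr0 add0r -h complex_eta.
  by rewrite mulfVK ?subr_eq0//; ring.
Qed.

Lemma C1_continuous U f z : open U -> C1 U f -> U z -> {for z, continuous f}.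
Proof.
move=> oU cf Uz; have [p [q [cp cq _ _ E]]] := C1_caratheodory oU cf Uz.
rewrite (_ : f = (fun w => f z + (p w * (complex.Re w - complex.Re z) + q w * (complex.Im w - complex.Im z)))); last first.
  by apply/funext => w; rewrite -E; ring.
have cRe := @continuous_Re _ z; have cIm := @continuous_Im _ z.
by apply: contD; [exact: cont_cst|apply: contD; (apply: contM => //; apply: contB => //; exact: cont_cst)].
Qed.

Lemma is_derive_curve U f (A B : R -> R) (t a b : R) : open U -> C1 U f -> U (A t +i* B t) ->
  is_derive t 1 A a -> is_derive t 1 B b ->
  is_derive t 1 (fun s => f (A s +i* B s)) (dx f (A t +i* B t) * a + dy f (A t +i* B t) * b).
Proof.
move=> oU cf Uz /is_derive1_caratheodory[gA [eA cA <-]] /is_derive1_caratheodory[gB [eB cB <-]].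
have [p [q [cp cq pz qz E]]] := C1_caratheodory oU cf Uz.
have contA : {for t, continuous A}.
  by apply: (@is_derive_cont _ _ _ (gA t)); apply/is_derive1_caratheodory; exists gA.
have contB' : {for t, continuous B}.
  by apply: (@is_derive_cont _ _ _ (gB t)); apply/is_derive1_caratheodory; exists gB.
have cc := continuous_complex contA contB'.
apply/is_derive1_caratheodory.
exists (fun s => p (A s +i* B s) * gA s + q (A s +i* B s) * gB s); split.
- by move=> s; rewrite E /= eA eB; ring.
- apply: contD; apply: contM => //.
    exact: (@continuous_comp _ _ _ (fun s => A s +i* B s : C) p t cc cp).
  exact: (@continuous_comp _ _ _ (fun s => A s +i* B s : C) q t cc cq).
- by rewrite pz qz.
Qed.

Lemma near_eq_is_derive1 (f g : R -> R) (x a : R) : {near x, f =1 g} ->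
  is_derive x 1 f a -> is_derive x 1 g a.
Proof.
move=> fg df; apply: DeriveDef.
  by apply: near_eq_derivable fg _; exact: ex_derive.
by rewrite -(@near_eq_derive _ _ _ f)// derive_val.
Qed.

Lemma near_slice_x (P : set C) z : (\forall w \near z, P w) ->
  \forall t \near (complex.Re z), P (t +i* complex.Im z).
Proof.
move=> H; have : {for complex.Re z, continuous (fun t : R => t +i* complex.Im z : C)}.
  by apply: continuous_complex; [exact: cvg_id|exact: cvg_cst].
by apply; rewrite /= complex_eta.
Qed.

Lemma near_slice_y (P : set C) z : (\forall w \near z, P w) ->
  \forall t \near (complex.Im z), P (complex.Re z +i* t).
Proof.
move=> H; have : {for complex.Im z, continuous (fun t : R => complex.Re z +i* t : C)}.
  by apply: continuous_complex; [exact: cvg_cst|exact: cvg_id].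
by apply; rewrite /= complex_eta.
Qed.

Lemma near_eq_isdx f g z a : {near z, f =1 g} -> isdx f z a -> isdx g z a.
Proof. by move=> /near_slice_x H Hf; apply: (near_eq_is_derive1 H Hf). Qed.

Lemma near_eq_isdy f g z a : {near z, f =1 g} -> isdy f z a -> isdy g z a.
Proof. by move=> /near_slice_y H Hf; apply: (near_eq_is_derive1 H Hf). Qed.
End Calculus.

Section C1Class.
Context {R : realType}.
Local Notation C := R[i]^o.
Implicit Types (z w c : C) (f g : C -> R) (U V : set C).

Lemma near_open U z (P : C -> Prop) : open U -> U z -> (forall w, U w -> P w) -> \forall w \near z, P w.
Proof. by move=> oU Uz H; near do apply: H; exact: open_nbhs_nbhs.
Unshelve. all: by end_near. Qed.

Lemma eq_dx U f g z : open U -> (forall w, U w -> f w = g w) -> U z -> dx f z = dx g z.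
Proof.
move=> oU fg Uz; rewrite /dx !derive1E; apply: near_eq_derive; apply: (@near_slice_x _ (fun w => f w = g w)).
exact: near_open oU Uz fg.
Qed.

Lemma eq_dy U f g z : open U -> (forall w, U w -> f w = g w) -> U z -> dy f z = dy g z.
Proof.
move=> oU fg Uz; rewrite /dy !derive1E; apply: near_eq_derive; apply: (@near_slice_y _ (fun w => f w = g w)).
exact: near_open oU Uz fg.
Qed.

(** [dx f] and [dy f] are limits and awkward to compute with, so concrete functions enter the class
    through explicit candidates [fx], [fy]. Openness of [U] makes the candidates agree with the
    partial derivatives on a neighbourhood, which transfers their continuity. *)
Lemma C1I U f fx fy : open U ->
  (forall z, U z -> isdx f z (fx z)) -> (forall z, U z -> isdy f z (fy z)) ->
  (forall z, U z -> {for z, continuous fx}) -> (forall z, U z -> {for z, continuous fy}) ->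
  [/\ C1 U f, forall z, U z -> dx f z = fx z & forall z, U z -> dy f z = fy z].
Proof.
move=> oU hx hy cx cy.
have ex z : U z -> dx f z = fx z by move=> /hx/isdxP[].
have ey z : U z -> dy f z = fy z by move=> /hy/isdyP[].
split=> // z Uz; split.
- by have /isdxP[] := hx _ Uz.
- by have /isdyP[] := hy _ Uz.
- by apply: (cont_near_eq _ (cx _ Uz)); apply: (near_open oU Uz) => w /ex.
- by apply: (cont_near_eq _ (cy _ Uz)); apply: (near_open oU Uz) => w /ey.
Qed.

Lemma C1_cdx U f z : C1 U f -> U z -> {for z, continuous (dx f)}.
Proof. by move=> H Uz; case: (H z Uz) => _ _ c _; exact: c. Qed.

Lemma C1_cdy U f z : C1 U f -> U z -> {for z, continuous (dy f)}.
Proof. by move=> H Uz; case: (H z Uz) => _ _ _ c; exact: c. Qed.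

Lemma eq_C1 U f g : open U -> (forall w, U w -> f w = g w) -> C1 U f -> C1 U g.
Proof.
move=> oU fg cf; have [] := @C1I U g (dx f) (dy f) oU; last by move=> c _ _; exact: c.
- move=> z Uz; have [h _] := C1_isd cf Uz; apply: near_eq_isdx h.
  exact: near_open oU Uz fg.
- move=> z Uz; have [_ h] := C1_isd cf Uz; apply: near_eq_isdy h.
  exact: near_open oU Uz fg.
- by move=> z; exact: C1_cdx.
- by move=> z; exact: C1_cdy.
Qed.

Lemma C1S U V f : V `<=` U -> C1 U f -> C1 V f.
Proof. by move=> VU cf z /VU/cf. Qed.

Lemma C1_local U f : (forall z, U z -> exists V, [/\ open V, V z & C1 V f]) -> C1 U f.
Proof. by move=> H z /H[V [_ Vz cf]]; exact: cf. Qed.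

Lemma C1_cstE U (a : R) : open U ->
  [/\ C1 U (fun=> a), forall z, U z -> dx (fun=> a) z = 0 & forall z, U z -> dy (fun=> a) z = 0].
Proof.
move=> oU; apply: C1I => // z _; try exact: cont_cst.
  exact: is_derive_cst.
exact: is_derive_cst.
Qed.

Lemma C1_ReE U : open U -> [/\ C1 U (@complex.Re R),
  forall z, U z -> dx (@complex.Re R) z = 1 & forall z, U z -> dy (@complex.Re R) z = 0].
Proof.
move=> oU; apply: C1I => // z _; try exact: cont_cst.
  exact: is_derive_id.
exact: is_derive_cst.
Qed.

Lemma C1_ImE U : open U -> [/\ C1 U (@complex.Im R),
  forall z, U z -> dx (@complex.Im R) z = 0 & forall z, U z -> dy (@complex.Im R) z = 1].
Proof.
move=> oU; apply: C1I => // z _; try exact: cont_cst.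
  exact: is_derive_cst.
exact: is_derive_id.
Qed.

Lemma C1DE U f g : open U -> C1 U f -> C1 U g -> [/\ C1 U (fun z => f z + g z),
  forall z, U z -> dx (fun z => f z + g z) z = dx f z + dx g z &
  forall z, U z -> dy (fun z => f z + g z) z = dy f z + dy g z].
Proof.
move=> oU cf cg; apply: C1I => // z Uz.
- have [h1 _] := C1_isd cf Uz; have [h2 _] := C1_isd cg Uz; exact: is_deriveD.
- have [_ h1] := C1_isd cf Uz; have [_ h2] := C1_isd cg Uz; exact: is_deriveD.
- exact: contD (C1_cdx cf Uz) (C1_cdx cg Uz).
- exact: contD (C1_cdy cf Uz) (C1_cdy cg Uz).
Qed.

Lemma C1ME U f g : open U -> C1 U f -> C1 U g -> [/\ C1 U (fun z => f z * g z),
  forall z, U z -> dx (fun z => f z * g z) z = f z * dx g z + g z * dx f z &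
  forall z, U z -> dy (fun z => f z * g z) z = f z * dy g z + g z * dy f z].
Proof.
move=> oU cf cg; apply: C1I => // z Uz.
- have [h1 _] := C1_isd cf Uz; have [h2 _] := C1_isd cg Uz.
  by have := is_deriveM h1 h2; rewrite complex_eta.
- have [_ h1] := C1_isd cf Uz; have [_ h2] := C1_isd cg Uz.
  by have := is_deriveM h1 h2; rewrite complex_eta.
- apply: contD; apply: contM.
  + exact: C1_continuous oU cf Uz.
  + exact: C1_cdx cg Uz.
  + exact: C1_continuous oU cg Uz.
  + exact: C1_cdx cf Uz.
- apply: contD; apply: contM.
  + exact: C1_continuous oU cf Uz.
  + exact: C1_cdy cg Uz.
  + exact: C1_continuous oU cg Uz.
  + exact: C1_cdy cf Uz.
Qed.

Lemma C1_comp1E U f (h h1 : R -> R) : open U -> C1 U f ->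
  (forall z, U z -> is_derive (f z) 1 h (h1 (f z))) ->
  (forall z, U z -> {for f z, continuous h1}) ->
  [/\ C1 U (fun z => h (f z)),
  forall z, U z -> dx (fun z => h (f z)) z = h1 (f z) * dx f z &
  forall z, U z -> dy (fun z => h (f z)) z = h1 (f z) * dy f z].
Proof.
move=> oU cf hd hc; apply: C1I => // z Uz.
- have [k _] := C1_isd cf Uz; apply: is_derive1_comp; last exact: k.
  by rewrite complex_eta; exact: hd.
- have [_ k] := C1_isd cf Uz; apply: is_derive1_comp; last exact: k.
  by rewrite complex_eta; exact: hd.
- apply: contM; last exact: C1_cdx cf Uz.
  by apply: cont_comp; [exact: C1_continuous oU cf Uz|exact: hc].
- apply: contM; last exact: C1_cdy cf Uz.
  by apply: cont_comp; [exact: C1_continuous oU cf Uz|exact: hc].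
Qed.

Lemma C1_compE U V f (A B : C -> R) : open U -> open V -> C1 U f -> C1 V A -> C1 V B ->
  (forall z, V z -> U (A z +i* B z)) ->
  [/\ C1 V (fun z => f (A z +i* B z)),
  forall z, V z -> dx (fun z => f (A z +i* B z)) z =
    dx f (A z +i* B z) * dx A z + dy f (A z +i* B z) * dx B z &
  forall z, V z -> dy (fun z => f (A z +i* B z)) z =
    dx f (A z +i* B z) * dy A z + dy f (A z +i* B z) * dy B z].
Proof.
move=> oU oV cf cA cB VU.
have cc z : V z -> {for z, continuous (fun z => A z +i* B z : C)}.
  by move=> Vz; apply: continuous_complex; exact: C1_continuous oV _ Vz.
apply: C1I => // z Vz.
- have [kA _] := C1_isd cA Vz; have [kB _] := C1_isd cB Vz.
  by have := is_derive_curve oU cf _ kA kB; rewrite complex_eta; apply; exact: VU.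
- have [_ kA] := C1_isd cA Vz; have [_ kB] := C1_isd cB Vz.
  by have := is_derive_curve oU cf _ kA kB; rewrite complex_eta; apply; exact: VU.
- apply: contD; apply: contM.
  + exact: (@continuous_comp _ _ _ (fun z => A z +i* B z : C) (dx f) z (cc _ Vz) (C1_cdx cf (VU _ Vz))).
  + exact: C1_cdx cA Vz.
  + exact: (@continuous_comp _ _ _ (fun z => A z +i* B z : C) (dy f) z (cc _ Vz) (C1_cdy cf (VU _ Vz))).
  + exact: C1_cdx cB Vz.
- apply: contD; apply: contM.
  + exact: (@continuous_comp _ _ _ (fun z => A z +i* B z : C) (dx f) z (cc _ Vz) (C1_cdx cf (VU _ Vz))).
  + exact: C1_cdy cA Vz.
  + exact: (@continuous_comp _ _ _ (fun z => A z +i* B z : C) (dy f) z (cc _ Vz) (C1_cdy cf (VU _ Vz))).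
  + exact: C1_cdy cB Vz.
Qed.

Lemma C1M U f g : open U -> C1 U f -> C1 U g -> C1 U (fun z => f z * g z).
Proof. by move=> oU cf cg; have [] := C1ME oU cf cg. Qed.

Lemma C1_cst U (a : R) : open U -> C1 U (fun=> a).
Proof. by move=> oU; have [] := C1_cstE a oU. Qed.

End C1Class.

Opaque dx dy C1.

(* [ring] may otherwise try to unify distinct partial derivatives by unfolding limits. *)
Ltac gen_partials := repeat match goal with
  | |- context [dx ?f ?z] => generalize (dx f z); intro
  | |- context [dy ?f ?z] => generalize (dy f z); intro
  end.

Section C2Class.
Context {R : realType}.
Local Notation C := R[i]^o.
Implicit Types (z w c : C) (f g : C -> R) (U V : set C).

Definition lap f z : R := dx (dx f) z + dy (dy f) z.

Lemma C2_C1 U f : C2 U f -> C1 U f.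
Proof. by case. Qed.

Lemma C2S U V f : V `<=` U -> C2 U f -> C2 V f.
Proof. by move=> VU [*]; split; apply: C1S VU _. Qed.

Lemma C2_local U f : (forall z, U z -> exists V, [/\ open V, V z & C2 V f]) -> C2 U f.
Proof. by move=> H; split; apply: C1_local => z /H[V [oV Vz []]]; exists V. Qed.

Lemma C2I U f fx fy : open U -> C1 U f ->
  (forall z, U z -> dx f z = fx z) -> (forall z, U z -> dy f z = fy z) ->
  C1 U fx -> C1 U fy -> C2 U f /\ forall z, U z -> lap f z = dx fx z + dy fy z.
Proof.
move=> oU cf ex ey cx cy; split; last first.
  by move=> z Uz; rewrite /lap (eq_dx oU ex Uz) (eq_dy oU ey Uz).
split; first exact: cf.
  by apply: (eq_C1 oU _ cx) => w Uw; rewrite ex.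
by apply: (eq_C1 oU _ cy) => w Uw; rewrite ey.
Qed.

Lemma eq_C2 U f g : open U -> (forall w, U w -> f w = g w) -> C2 U f -> C2 U g.
Proof.
move=> oU fg [h1 h2 h3].
have [] := @C2I U g (dx f) (dy f) oU (eq_C1 oU fg h1) _ _ h2 h3; last by move=> c _; exact: c.
  by move=> z Uz; rewrite -(eq_dx oU fg Uz).
by move=> z Uz; rewrite -(eq_dy oU fg Uz).
Qed.

Lemma eq_lap U f g z : open U -> (forall w, U w -> f w = g w) -> U z -> lap f z = lap g z.
Proof.
move=> oU fg Uz; rewrite /lap.
have -> : dx (dx f) z = dx (dx g) z.
  by apply: (eq_dx oU _ Uz) => w Uw; exact: eq_dx oU fg Uw.
have -> // : dy (dy f) z = dy (dy g) z.
by apply: (eq_dy oU _ Uz) => w Uw; exact: eq_dy oU fg Uw.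
Qed.

Lemma C2_cstE U (a : R) : open U -> C2 U (fun=> a) /\ forall z, U z -> lap (fun=> a) z = 0.
Proof.
move=> oU; have [h1 h2 h3] := C1_cstE a oU; have [k1 k2 k3] := C1_cstE 0 oU.
have [c2 E] := C2I oU h1 h2 h3 k1 k1.
split; first exact: c2.
by move=> z Uz; rewrite (E _ Uz) (k2 _ Uz) (k3 _ Uz) addr0.
Qed.

Lemma C2_ReE U : open U -> C2 U (@complex.Re R) /\ forall z, U z -> lap (@complex.Re R) z = 0.
Proof.
move=> oU; have [h1 h2 h3] := C1_ReE oU; have [k1 k2 k3] := C1_cstE 0 oU.
have [l1 l2 l3] := C1_cstE 1 oU.
have [c2 E] := C2I oU h1 h2 h3 l1 k1.
split; first exact: c2.
by move=> z Uz; rewrite (E _ Uz) (l2 _ Uz) (k3 _ Uz) addr0.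
Qed.

Lemma C2_ImE U : open U -> C2 U (@complex.Im R) /\ forall z, U z -> lap (@complex.Im R) z = 0.
Proof.
move=> oU; have [h1 h2 h3] := C1_ImE oU; have [k1 k2 k3] := C1_cstE 0 oU.
have [l1 l2 l3] := C1_cstE 1 oU.
have [c2 E] := C2I oU h1 h2 h3 k1 l1.
split; first exact: c2.
by move=> z Uz; rewrite (E _ Uz) (k2 _ Uz) (l3 _ Uz) addr0.
Qed.

Lemma C2DE U f g : open U -> C2 U f -> C2 U g -> C2 U (fun z => f z + g z) /\
  forall z, U z -> lap (fun z => f z + g z) z = lap f z + lap g z.
Proof.
move=> oU [f1 fx fy] [g1 gx gy]; have [h1 h2 h3] := C1DE oU f1 g1.
have [k1 k2 _] := C1DE oU fx gx; have [l1 _ l2] := C1DE oU fy gy.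
have [c2 E] := C2I oU h1 h2 h3 k1 l1.
split; first exact: c2.
by move=> z Uz; rewrite (E _ Uz) (k2 _ Uz) (l2 _ Uz) /lap; gen_partials; ring.
Qed.

Lemma C2ME U f g : open U -> C2 U f -> C2 U g -> C2 U (fun z => f z * g z) /\
  forall z, U z -> lap (fun z => f z * g z) z =
    f z * lap g z + g z * lap f z + 2 * (dx f z * dx g z + dy f z * dy g z).
Proof.
move=> oU [f1 fx fy] [g1 gx gy]; have [h1 h2 h3] := C1ME oU f1 g1.
have [a1 a2 _] := C1ME oU f1 gx; have [b1 b2 _] := C1ME oU g1 fx.
have [a1' _ a2'] := C1ME oU f1 gy; have [b1' _ b2'] := C1ME oU g1 fy.
have [k1 k2 _] := C1DE oU a1 b1; have [l1 _ l2] := C1DE oU a1' b1'.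
have [c2 E] := C2I oU h1 h2 h3 k1 l1.
split; first exact: c2.
by move=> z Uz; rewrite (E _ Uz) (k2 _ Uz) (l2 _ Uz) (a2 _ Uz) (b2 _ Uz) (a2' _ Uz) (b2' _ Uz) /lap; gen_partials; ring.
Qed.

Lemma C2ZE U (a : R) f : open U -> C2 U f -> C2 U (fun z => a * f z) /\
  forall z, U z -> lap (fun z => a * f z) z = a * lap f z.
Proof.
move=> oU cf; have [ca la] := C2_cstE a oU; have [c E] := C2ME oU ca cf.
have [_ h2 h3] := C1_cstE a oU.
split; first exact: c.
by move=> z Uz; rewrite (E _ Uz) (la _ Uz) (h2 _ Uz) (h3 _ Uz); move: (lap f z) => l; ring.
Qed.

Lemma C2BE U f g : open U -> C2 U f -> C2 U g -> C2 U (fun z => f z - g z) /\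
  forall z, U z -> lap (fun z => f z - g z) z = lap f z - lap g z.
Proof.
move=> oU cf cg; have [cg' lg] := C2ZE (-1) oU cg.
have [c E] := C2DE oU cf cg'.
have e : (fun z => f z + -1 * g z) = (fun z => f z - g z) by apply/funext => z; rewrite mulN1r.
by rewrite e in c E; split; [exact: c|move=> z Uz; rewrite (E _ Uz) (lg _ Uz) mulN1r].
Qed.

Lemma C2_comp1E U f (h h1 h2 : R -> R) : open U -> C2 U f ->
  (forall z, U z -> is_derive (f z) 1 h (h1 (f z))) ->
  (forall z, U z -> is_derive (f z) 1 h1 (h2 (f z))) ->
  (forall z, U z -> {for f z, continuous h2}) ->
  C2 U (fun z => h (f z)) /\
  forall z, U z -> lap (fun z => h (f z)) z =
    h2 (f z) * (dx f z ^+ 2 + dy f z ^+ 2) + h1 (f z) * lap f z.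
Proof.
move=> oU [f1 fx fy] d1 d2 ch2.
have c1 z : U z -> {for f z, continuous h1} by move=> Uz; exact: is_derive_cont (d2 _ Uz).
have [a1 a2 a3] := C1_comp1E oU f1 d1 c1.
have [b1 b2 b3] := C1_comp1E oU f1 d2 ch2.
have [k1 k2 _] := C1ME oU b1 fx; have [l1 _ l3] := C1ME oU b1 fy.
have [c2 E] := C2I oU a1 a2 a3 k1 l1.
split; first exact: c2.
by move=> z Uz; rewrite (E _ Uz) (k2 _ Uz) (l3 _ Uz) (b2 _ Uz) (b3 _ Uz) /lap; gen_partials; ring.
Qed.

(** The Cauchy-Riemann equations make [A + iB] holomorphic: the mixed second derivatives of [f]
    cancel, the first-order terms carry the Laplacians of [A] and [B], and what remains is the
    factor [|(A + iB)'|^2]. *)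
Lemma C2_compE U V f (A B : C -> R) : open U -> open V -> C2 U f -> C2 V A -> C2 V B ->
  (forall z, V z -> U (A z +i* B z)) ->
  (forall z, V z -> [/\ dx A z = dy B z, dy A z = - dx B z, lap A z = 0 & lap B z = 0]) ->
  C2 V (fun z => f (A z +i* B z)) /\
  forall z, V z -> lap (fun z => f (A z +i* B z)) z =
    lap f (A z +i* B z) * (dx A z ^+ 2 + dx B z ^+ 2).
Proof.
move=> oU oV [f1 fx fy] [A1 Ax Ay] [B1 Bx By] VU cr.
have [a1 a2 a3] := C1_compE oU oV f1 A1 B1 VU.
have [p1 p2 p3] := C1_compE oU oV fx A1 B1 VU.
have [q1 q2 q3] := C1_compE oU oV fy A1 B1 VU.
have [k1 k2 _] := C1ME oV p1 Ax; have [l1 l2 _] := C1ME oV q1 Bx.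
have [k1' _ k2'] := C1ME oV p1 Ay; have [l1' _ l2'] := C1ME oV q1 By.
have [m1 m2 _] := C1DE oV k1 l1; have [n1 _ n2] := C1DE oV k1' l1'.
have [c2 E] := C2I oV a1 a2 a3 m1 n1.
split; first exact: c2.
move=> z Vz; rewrite (E _ Vz) (m2 _ Vz) (n2 _ Vz) (k2 _ Vz) (l2 _ Vz) (k2' _ Vz) (l2' _ Vz) (p2 _ Vz) (p3 _ Vz) (q2 _ Vz) (q3 _ Vz).
have [e1 e2 la lb] := cr _ Vz.
move: la lb; rewrite /lap => la lb.
move/(canRL (addrK _)): la; rewrite sub0r => ->; move/(canRL (addrK _)): lb; rewrite sub0r => ->.
rewrite -e1 e2; gen_partials; ring.
Qed.

Lemma C2B U f g : open U -> C2 U f -> C2 U g -> C2 U (fun z => f z - g z).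
Proof. by move=> oU cf cg; have [] := C2BE oU cf cg. Qed.
Lemma C2_continuous U f z : open U -> C2 U f -> U z -> {for z, continuous f}.
Proof. by move=> oU [cf _ _]; exact: C1_continuous. Qed.

End C2Class.

Transparent dx dy C1.

(** * Harmonic functions *)

Section Harmonic.
Context {R : realType}.
Local Notation C := R[i]^o.
Implicit Types (z w c : C) (f g : C -> R) (U V : set C).

Lemma harmonic_C2 U f : harmonic_on U f -> C2 U f.
Proof. by case. Qed.

Lemma harmonic_lap U f z : harmonic_on U f -> U z -> lap f z = 0.
Proof. by case=> _; exact. Qed.

Lemma harmonicI U f : C2 U f -> (forall z, U z -> lap f z = 0) -> harmonic_on U f.
Proof. by []. Qed.

Lemma harmonic_continuous U f z : open U -> harmonic_on U f -> U z -> {for z, continuous f}.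
Proof. by move=> oU [c _]; exact: C2_continuous. Qed.

Lemma harmonicS U V f : V `<=` U -> harmonic_on U f -> harmonic_on V f.
Proof. by move=> VU [c l]; split; [exact: C2S VU c|move=> z /VU/l]. Qed.

Lemma harmonic_local U f :
  (forall z, U z -> exists V, [/\ open V, V z & harmonic_on V f]) -> harmonic_on U f.
Proof.
move=> H; split; last by move=> z /H[V [_ Vz [_ l]]]; exact: l.
by apply: C2_local => z /H[V [oV Vz [c _]]]; exists V; split.
Qed.

Lemma eq_harmonic U f g : open U -> (forall w, U w -> f w = g w) -> harmonic_on U f -> harmonic_on U g.
Proof.
move=> oU fg [c l]; split; first exact: eq_C2 oU fg c.
by move=> z Uz; rewrite -/(lap g z) -(eq_lap oU fg Uz); exact: l.
Qed.

Lemma harmonic_cst U (a : R) : open U -> harmonic_on U (fun=> a).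
Proof. by move=> oU; have [c l] := C2_cstE a oU. Qed.

Lemma harmonic_Re U : open U -> harmonic_on U (@complex.Re R).
Proof. by move=> oU; have [c l] := @C2_ReE R U oU. Qed.

Lemma harmonic_Im U : open U -> harmonic_on U (@complex.Im R).
Proof. by move=> oU; have [c l] := @C2_ImE R U oU. Qed.

Lemma harmonicD U f g : open U -> harmonic_on U f -> harmonic_on U g -> harmonic_on U (fun z => f z + g z).
Proof.
move=> oU [cf lf] [cg lg]; have [c l] := C2DE oU cf cg; split; first exact: c.
move=> z Uz; rewrite -/(lap _ z) l//.
by rewrite (lf z Uz : lap f z = 0) (lg z Uz : lap g z = 0) addr0.
Qed.

Lemma harmonicZ U (a : R) f : open U -> harmonic_on U f -> harmonic_on U (fun z => a * f z).
Proof.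
move=> oU [cf lf]; have [c l] := C2ZE a oU cf; split; first exact: c.
move=> z Uz; rewrite -/(lap _ z) l//.
by rewrite (lf z Uz : lap f z = 0) mulr0.
Qed.

Lemma harmonicB U f g : open U -> harmonic_on U f -> harmonic_on U g -> harmonic_on U (fun z => f z - g z).
Proof.
move=> oU [cf lf] [cg lg]; have [c l] := C2BE oU cf cg; split; first exact: c.
move=> z Uz; rewrite -/(lap _ z) l//.
by rewrite (lf z Uz : lap f z = 0) (lg z Uz : lap g z = 0) subr0.
Qed.

Lemma harmonic_affine U (a b d : R) : open U ->
  harmonic_on U (fun z => a + b * complex.Re z + d * complex.Im z).
Proof.
move=> oU; apply: harmonicD => //; last exact: harmonicZ (harmonic_Im oU).
by apply: harmonicD => //; [exact: harmonic_cst|exact: harmonicZ (harmonic_Re oU)].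
Qed.

Lemma harmonic_comp U V f (A B : C -> R) : open U -> open V -> harmonic_on U f ->
  harmonic_on V A -> harmonic_on V B -> (forall z, V z -> U (A z +i* B z)) ->
  (forall z, V z -> dx A z = dy B z /\ dy A z = - dx B z) ->
  harmonic_on V (fun z => f (A z +i* B z)).
Proof.
move=> oU oV [cf lf] [cA lA] [cB lB] VU cr.
have [c l] := C2_compE oU oV cf cA cB VU (fun z Vz =>
  And4 (cr z Vz).1 (cr z Vz).2 (lA z Vz) (lB z Vz)).
split; first exact: c.
move=> z Vz; rewrite -/(lap _ z) l//.
by rewrite (lf _ (VU z Vz) : lap f _ = 0) mul0r.
Qed.

Definition sqdist c z : R := (complex.Re z - complex.Re c) ^+ 2 + (complex.Im z - complex.Im c) ^+ 2.

Lemma sqdistE c z : sqdist c z = modulus (z - c) ^+ 2.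
Proof. by rewrite sqr_modulus ReB ImB. Qed.

Lemma is_derive_sqr_shift (a b x : R) : is_derive x 1 (fun t : R => (t - a) ^+ 2 + b) (2 * (x - a)).
Proof. by apply: is_derive_eq; rewrite /GRing.scale/=; ring. Qed.

Lemma is_derive_lin_shift (a b x : R) : is_derive x 1 (fun t : R => b * (t - a)) b.
Proof. by apply: is_derive_eq; rewrite /GRing.scale/=; ring. Qed.

Lemma isdx_Re (h : R -> R) z a : is_derive (complex.Re z) 1 h a -> isdx (fun z => h (complex.Re z)) z a.
Proof. exact. Qed.
Lemma isdy_Im (h : R -> R) z a : is_derive (complex.Im z) 1 h a -> isdy (fun z => h (complex.Im z)) z a.
Proof. exact. Qed.
Lemma isdy_Re (h : R -> R) z : isdy (fun z => h (complex.Re z)) z 0.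
Proof. exact: (is_derive_cst (h (complex.Re z))). Qed.
Lemma isdx_Im (h : R -> R) z : isdx (fun z => h (complex.Im z)) z 0.
Proof. exact: (is_derive_cst (h (complex.Im z))). Qed.

Lemma C2_sqdist U c : open U -> C2 U (sqdist c) /\ forall z, U z ->
  [/\ dx (sqdist c) z = 2 * (complex.Re z - complex.Re c),
      dy (sqdist c) z = 2 * (complex.Im z - complex.Im c) & lap (sqdist c) z = 4].
Proof.
move=> oU.
have [a1 a2 a3] : [/\ C1 U (fun z => 2 * (complex.Re z - complex.Re c)),
   forall z, U z -> dx (fun z => 2 * (complex.Re z - complex.Re c)) z = 2 &
   forall z, U z -> dy (fun z => 2 * (complex.Re z - complex.Re c)) z = 0].
  apply: C1I => // z _; [exact: (isdx_Re (h := fun t => 2 * (t - complex.Re c)) (is_derive_lin_shift _ _ _))| |exact: cont_cst|exact: cont_cst].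
  exact: (isdy_Re (fun t => 2 * (t - complex.Re c))).
have [b1 b2 b3] : [/\ C1 U (fun z => 2 * (complex.Im z - complex.Im c)),
   forall z, U z -> dx (fun z => 2 * (complex.Im z - complex.Im c)) z = 0 &
   forall z, U z -> dy (fun z => 2 * (complex.Im z - complex.Im c)) z = 2].
  apply: C1I => // z _; [|exact: (isdy_Im (h := fun t => 2 * (t - complex.Im c)) (is_derive_lin_shift _ _ _))|exact: cont_cst|exact: cont_cst].
  exact: (isdx_Im (fun t => 2 * (t - complex.Im c))).
have [c1 c2 c3] : [/\ C1 U (sqdist c),
   forall z, U z -> dx (sqdist c) z = 2 * (complex.Re z - complex.Re c) &
   forall z, U z -> dy (sqdist c) z = 2 * (complex.Im z - complex.Im c)].
  apply: C1I => // z Uz.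
  - by rewrite /isdx /sqdist /=; exact: is_derive_sqr_shift.
  - rewrite /isdy /sqdist /= (_ : (fun _ => _) = (fun t : R => (t - complex.Im c) ^+ 2 + (complex.Re z - complex.Re c) ^+ 2)).
      exact: is_derive_sqr_shift.
    by apply/funext => t; rewrite addrC.
  - exact: C1_continuous oU a1 Uz.
  - exact: C1_continuous oU b1 Uz.
have [d1 d2] := C2I oU c1 c2 c3 a1 b1.
split; first exact: d1.
move=> z Uz; split; [exact: c2|exact: c3|].
by rewrite (d2 _ Uz) (a2 _ Uz) (b3 _ Uz) -natrD.
Qed.

Lemma C2_radial U c (h h1 h2 : R -> R) : open U ->
  (forall z, U z -> is_derive (sqdist c z) 1 h (h1 (sqdist c z))) ->
  (forall z, U z -> is_derive (sqdist c z) 1 h1 (h2 (sqdist c z))) ->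
  (forall z, U z -> {for sqdist c z, continuous h2}) ->
  C2 U (fun z => h (sqdist c z)) /\ forall z, U z ->
    lap (fun z => h (sqdist c z)) z = 4 * (sqdist c z * h2 (sqdist c z) + h1 (sqdist c z)).
Proof.
move=> oU d1 d2 c2; have [cs e] := @C2_sqdist U c oU.
have [k l] := C2_comp1E oU cs d1 d2 c2; split; first exact: k.
move=> z Uz; rewrite (l _ Uz); have [-> -> ->] := e _ Uz.
by rewrite /sqdist; ring.
Qed.

Lemma sqdist_ge0 c z : 0 <= sqdist c z.
Proof. by rewrite addr_ge0// sqr_ge0. Qed.

Lemma sqdist_gt0 c z : (0 < sqdist c z) = (z != c).
Proof. by rewrite sqdistE lt_neqAle sqr_ge0 andbT eq_sym sqrf_eq0 -modulus_sub_gt0 lt_neqAle modulus_ge0 andbT eq_sym. Qed.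

Lemma ln_modulusE c z : ln (modulus (z - c)) = 2^-1 * ln (sqdist c z).
Proof.
have [->|zc] := eqVneq z c.
  by rewrite sqdistE !subrr modulus0 expr0n /= ln0// mulr0.
by rewrite sqdistE expr2 lnM ?posrE ?modulus_sub_gt0//; field.
Qed.

Lemma harmonic_ln_modulus c : harmonic_on [set z | z != c] (fun z => ln (modulus (z - c))).
Proof.
have oU : open [set z : C | z != c].
  apply/openP_modulus => z /=; rewrite -modulus_sub_gt0 => zc; exists (modulus (z - c)) => // w wz.
  rewrite -modulus_sub_gt0; have := modulusD (z - w) (w - c).
  by rewrite subrKA (modulusC z w); lra.
rewrite (_ : (fun z => _) = (fun z : C => 2^-1 * ln (sqdist c z))); last by apply/funext => z; exact: ln_modulusE.
have [] := @C2_radial [set z | z != c] c (fun t => 2^-1 * ln t) (fun t => 2^-1 * t^-1) (fun t => - 2^-1 * t ^- 2) oU.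
- move=> z /=; rewrite -sqdist_gt0 => zc.
  by have dl := is_derive1_ln zc; apply: is_derive_eq.
- move=> z /=; rewrite -sqdist_gt0 => zc.
  have h : sqdist c z != 0 by rewrite gt_eqF.
  by have dv := is_deriveV (f := id) h (is_derive_id _ _); apply: is_derive_eq; rewrite /GRing.scale/=; field.
- move=> z /=; rewrite -sqdist_gt0 => zc.
  apply: contM; first exact: cont_cst.
  by apply: contV; [apply: contX; exact: cvg_id|rewrite expf_eq0 gt_eqF].
move=> k l; split; first exact: k.
move=> z zc; rewrite -/(lap _ z) (l _ zc).
have h : sqdist c z != 0 by rewrite gt_eqF// sqdist_gt0.
by field.
Qed.
End Harmonic.

(** * The maximum principle *)

Section MaximumPrinciple.
Context {R : realType}.
Local Notation C := R[i]^o.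
Implicit Types (z w c : C) (f g : C -> R) (U V K : set C).

(** A continuous [g] with [g x] nonzero keeps its sign near [x], whereas [t - x] changes sign. With
    [g] the difference quotient at a local maximum, this is the vanishing of the first
    derivative. *)
Lemma near_nonneg_slope (g : R -> R) x : {for x, continuous g} ->
  (\forall t \near x, g t * (t - x) <= 0) -> g x = 0.
Proof.
move=> cg H; apply/eqP/negPn/negP => gx.
have gx2 : 0 < `|g x| by rewrite normr_gt0.
have : \forall t \near x, `|g x - g t| < `|g x| /\ g t * (t - x) <= 0.
  near=> t; split; last by near: t.
  by near: t; move/cvgrPdist_lt : cg; exact.
case/nbhs_ballP => e /= e0 He.
have e2 : 0 < e / 2 by rewrite divr_gt0.
have [g0|g0|g0] := ltgtP (g x) 0.
- have [] := He (x - e / 2).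
    by rewrite /ball /= opprD addrA subrr sub0r opprK gtr0_norm//; lra.
  rewrite (_ : x - e / 2 - x = - (e/2)); last by lra.
  by rewrite (ltr0_norm g0) ltr_norml => /andP[h1 h2]; nra.
- have [] := He (x + e / 2).
    by rewrite /ball /= opprD addrA subrr sub0r normrN gtr0_norm//; lra.
  rewrite (_ : x + e / 2 - x = e/2); last by lra.
  by rewrite (gtr0_norm g0) ltr_norml => /andP[h1 h2]; nra.
- by rewrite g0 eqxx in gx.
Unshelve. all: by end_near. Qed.

(** If [a] were positive, [f1], which vanishes at [x], would be positive just to the right of it,
    and [f] would exceed [f x] there. *)
Lemma second_derivative_at_max (f f1 : R -> R) (x a : R) :
  (\forall t \near x, f t <= f x) -> (\forall t \near x, is_derive (t : R) (1 : R) f (f1 t)) ->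
  is_derive x 1 f1 a -> a <= 0.
Proof.
move=> fmax df d2.
have f10 : f1 x = 0.
  have /is_derive1_caratheodory[g [E cg <-]] := nbhs_singleton df.
  apply: near_nonneg_slope cg _; near=> t; rewrite -E subr_le0.
  by near: t.
rewrite leNgt; apply/negP => a0.
have /is_derive1_caratheodory[g [E cg gx]] := d2.
have : \forall t \near x, [/\ f t <= f x, is_derive t 1 f (f1 t) & `|g x - g t| < a].
  near=> t; split; [by near: t|by near: t|].
  by near: t; move/cvgrPdist_lt : cg; exact.
case/nbhs_ballP => e /= e0 He.
have Hb t : `|t - x| <= `|(x + e / 2) - x| -> ball x e t.
  rewrite (_ : x + e / 2 - x = e/2); last by lra.
  by rewrite distrC /ball /= => h; apply: le_lt_trans h _; rewrite gtr0_norm; lra.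
have xy : x < x + e / 2 by lra.
have cf : {within `[x, x + e / 2], continuous f}.
  apply: derivable_within_continuous => t; rewrite in_itv /= => ht.
  have [|_ h _] := He t; last exact: ex_derive.
  by apply: Hb; rewrite ger0_norm ?ger0_norm; lra.
have [|s hs] := @MVT _ f f1 x (x + e / 2) xy _ cf.
  move=> t; rewrite in_itv /= => ht; have [|_ h _] := He t; last exact: h.
  by apply: Hb; rewrite ger0_norm ?ger0_norm; lra.
move: hs; rewrite in_itv /= => hs.
have [|h1 _ _] := He (x + e / 2); first by apply: Hb.
have [|_ _ h2] := He s; first by apply: Hb; rewrite ger0_norm ?ger0_norm; lra.
have h3 : f1 s = g s * (s - x) by rewrite -E f10 subr0.
move: h2; rewrite gx ltr_norml => /andP[h2 h4] h5.
have h6 : 0 < f1 s by rewrite h3 mulr_gt0; lra.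
have h7 : 0 < f1 s * (x + e / 2 - x) by rewrite mulr_gt0//; lra.
by move: h7; rewrite -h5; lra.
Unshelve. all: by end_near. Qed.

Lemma lap_at_max U f z : open U -> C2 U f -> U z -> (forall w, U w -> f w <= f z) -> lap f z <= 0.
Proof.
move=> oU [f1 fx fy] Uz H.
have [h1 _] := C1_isd fx Uz; have [_ h2] := C1_isd fy Uz.
have nU : \forall w \near z, U w by exact: open_nbhs_nbhs.
have a1 : dx (dx f) z <= 0.
  apply: (second_derivative_at_max (f := fun t => f (t +i* complex.Im z)) _ _ h1).
    by apply: filterS (near_slice_x nU) => t /H; rewrite complex_eta.
  by apply: filterS (near_slice_x nU) => t Ut; have [] := C1_isd f1 Ut.
have a2 : dy (dy f) z <= 0.
  apply: (second_derivative_at_max (f := fun t => f (complex.Re z +i* t)) _ _ h2).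
    by apply: filterS (near_slice_y nU) => t /H; rewrite complex_eta.
  by apply: filterS (near_slice_y nU) => t Ut; have [] := C1_isd f1 Ut.
by have := lerD a1 a2; rewrite addr0.
Qed.

(** Adding a small multiple of [|z|^2] makes the Laplacian strictly positive, which is impossible at
    an interior maximum. A neighbourhood inside [K] is asked for only where [f] is positive: this
    encodes nonpositive boundary values without naming a boundary of [K]. *)
Lemma maximum_principle_C2 K f : compact K -> {within K, continuous f} ->
  (forall z, K z -> 0 < f z -> exists U, [/\ open U, U z, U `<=` K, C2 U f & 0 <= lap f z]) ->
  forall z, K z -> f z <= 0.
Proof.
move=> cK cf H z0 Kz0; rewrite leNgt; apply/negP => f0.
have [M M0 HM] := compact_bounded_plane cK.
(* [e M^2 < f z0] keeps [f] positive at the maximum of [f + e |z|^2], because [|z| < M] on [K]. *)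
pose e := f z0 / (2 * (M ^+ 2 + 1)).
have M1 : 0 < M ^+ 2 + 1 by nra.
have e0 : 0 < e by rewrite divr_gt0// mulr_gt0.
have eM : e * M ^+ 2 < f z0.
  have : e * (M ^+ 2 + 1) = f z0 / 2 by rewrite /e; field; rewrite gt_eqF.
  nra.
pose F z := f z + e * sqdist 0 z.
have [z1 /set_mem Kz1 Hz1] : exists2 z1, z1 \in K & forall t, t \in K -> F t <= F z1.
  apply: compact_EVT_max => //; first by exists z0.
  have cs : {within K, continuous (sqdist 0 : C -> R)}.
    apply: continuous_subspaceT => w.
    by have [c _] := @C2_sqdist R setT 0 openT; exact: C2_continuous openT c I.
  move=> x; apply: (@contD R (subspace K) f (fun z => e * sqdist 0 z) x (cf x)).
  exact: (@contM R (subspace K) (fun=> e) (sqdist 0) x (@cont_cst R (subspace K) e x) (cs x)).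
have s2 z : K z -> 0 <= sqdist 0 z <= M ^+ 2.
  move=> /HM h; rewrite sqdist_ge0 sqdistE subr0.
  by have := modulus_ge0 z; nra.
have f1 : 0 < f z1.
  have := Hz1 z0 (mem_set Kz0); rewrite /F.
  by have := s2 _ Kz0; have := s2 _ Kz1; nra.
have [U [oU Uz1 UK hf lf]] := H _ Kz1 f1.
have [cs ls] := @C2_sqdist R U 0 oU.
have [c1 l1] := C2ZE e oU cs; have [c2 l2] := C2DE oU hf c1.
have : lap F z1 <= 0.
  by apply: (lap_at_max oU c2 Uz1) => w /UK Kw; exact: Hz1 (mem_set Kw).
rewrite /F (l2 _ Uz1) (l1 _ Uz1); have [_ _ ->] := ls _ Uz1.
by move: lf; move: (lap f z1) => l; lra.
Qed.

Lemma maximum_principle K f : compact K -> {within K, continuous f} ->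
  (forall z, K z -> 0 < f z -> exists U, [/\ open U, U z, U `<=` K & harmonic_on U f]) ->
  forall z, K z -> f z <= 0.
Proof.
move=> cK cf H; apply: maximum_principle_C2 => // z Kz fz.
have [U [oU Uz UK hf]] := H z Kz fz; exists U; split => //; first exact: harmonic_C2.
by rewrite (harmonic_lap hf Uz).
Qed.

End MaximumPrinciple.

(** * Integrals of continuous functions *)

Section Integral.
Context {R : realType}.
Implicit Types (f g F : R -> R) (a b c : R).

Definition Int a b f : R := (\int[lebesgue_measure]_(t in `[a, b]) f t)%R.

Definition cont_on a b f := forall t, a <= t <= b -> {for t, continuous f}.

Lemma cont_on_within a b f : cont_on a b f -> {within `[a, b], continuous f}.
Proof.
move=> cf; apply: continuous_in_subspaceT => t /set_mem /=; rewrite in_itv /=; exact: cf.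
Qed.

Lemma cont_onS a b c d f : a <= c -> d <= b -> cont_on a b f -> cont_on c d f.
Proof. by move=> ac db cf t /andP[h1 h2]; apply: cf; rewrite (le_trans ac)//= (le_trans h2). Qed.

Lemma cont_on_int a b f : cont_on a b f -> lebesgue_measure.-integrable `[a, b] (EFin \o f).
Proof.
move=> /cont_on_within cf; apply: continuous_compact_integrable => //; exact: segment_compact.
Qed.

Lemma eq_Int a b f g : (forall t, a <= t <= b -> f t = g t) -> Int a b f = Int a b g.
Proof. by move=> fg; apply: eq_Rintegral => t /set_mem /=; rewrite in_itv /=; exact: fg. Qed.

Lemma IntD a b f g : cont_on a b f -> cont_on a b g ->
  Int a b (fun t => f t + g t) = Int a b f + Int a b g.
Proof. by move=> /cont_on_int cf /cont_on_int cg; rewrite /Int RintegralD. Qed.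

Lemma IntB a b f g : cont_on a b f -> cont_on a b g ->
  Int a b (fun t => f t - g t) = Int a b f - Int a b g.
Proof. by move=> /cont_on_int cf /cont_on_int cg; rewrite /Int RintegralB. Qed.

Lemma IntZ a b (k : R) f : cont_on a b f -> Int a b (fun t => k * f t) = k * Int a b f.
Proof. by move=> /cont_on_int cf; rewrite /Int RintegralZl. Qed.

Lemma Int_cst a b (k : R) : a <= b -> Int a b (fun=> k) = k * (b - a).
Proof.
move=> ab; rewrite /Int Rintegral_cst//= lebesgue_measure_itv /= lte_fin.
have [_|ba] := ltP a b; first by rewrite -EFinB.
by rewrite (_ : a = b) ?subrr//; apply/eqP; rewrite eq_le ab.
Qed.

Lemma le_Int a b f g : cont_on a b f -> cont_on a b g -> (forall t, a <= t <= b -> f t <= g t) ->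
  Int a b f <= Int a b g.
Proof.
by move=> /cont_on_int cf /cont_on_int cg fg; exact: le_Rintegral.
Qed.

Lemma Int_ge0 a b f : (forall t, a <= t <= b -> 0 <= f t) -> 0 <= Int a b f.
Proof. by move=> f0; apply: Rintegral_ge0 => t /=; rewrite in_itv /=; exact: f0. Qed.

Lemma cont_on_cst a b (k : R) : cont_on a b (fun=> k).
Proof. by move=> t _; exact: cont_cst. Qed.

Lemma Int_abs a b f (M : R) : a <= b -> cont_on a b f -> (forall t, a <= t <= b -> `|f t| <= M) ->
  `|Int a b f| <= M * (b - a).
Proof.
move=> ab cf fM; rewrite ler_norml -mulNr -!Int_cst//; apply/andP; split.
  by apply: le_Int => // [|t /fM]; [exact: cont_on_cst|rewrite ler_norml => /andP[]].
by apply: le_Int => // [|t /fM]; [exact: cont_on_cst|rewrite ler_norml => /andP[]].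
Qed.

Lemma Int_cat a b c f : a <= b -> b <= c -> cont_on a c f -> Int a c f = Int a b f + Int b c f.
Proof.
move=> ab bc cf.
have := @Rintegral_itvB _ f (BLeft a) (BRight c) b (cont_on_int cf).
rewrite !bnd_simp => /(_ ab bc) /(canRL (subrK _)) h.
rewrite [Int a c f]h addrC /Int Rintegral_itv_obnd_cbnd//.
apply: integrableS (cont_on_int (cont_onS ab (lexx c) cf)) => //.
by apply: subset_itvr; rewrite bnd_simp.
Qed.

Lemma Int_FTC1 a b f x : cont_on a b f -> a < x < b -> is_derive x 1 (fun x => Int a x f) (f x).
Proof.
move=> cf /andP[ax xb].
have [] := @continuous_FTC1_closed _ f a x b xb (cont_on_int cf) ax.
  by apply: cf; rewrite !ltW.
by move=> h1 h2; apply: DeriveDef; [exact: h1|rewrite -derive1E; exact: h2].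
Qed.

Lemma Int_FTC2 a b f F : a <= b -> cont_on a b f ->
  (forall t, a <= t <= b -> is_derive t 1 F (f t)) -> Int a b f = F b - F a.
Proof.
rewrite le_eqVlt => /orP[/eqP <- _ _|ab cf dF].
  by rewrite /Int set_itv1 Rintegral_set1 subrr.
have cF t : a <= t <= b -> {for t, continuous F} by move=> /dF /is_derive_cont.
rewrite /Int /Rintegral (@continuous_FTC2 _ f F a b ab (cont_on_within cf)) //.
- split.
  + move=> t; rewrite in_itv /= => /andP[h1 h2]; have := dF t; rewrite !ltW// => /(_ isT) h.
    exact: ex_derive.
  + by apply: cvg_at_right_filter; apply: cF; rewrite lexx ltW.
  + by apply: cvg_at_left_filter; apply: cF; rewrite lexx ltW.
- move=> t; rewrite in_itv /= => /andP[h1 h2]; have := dF t; rewrite !ltW// => /(_ isT) h.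
  by rewrite derive1E derive_val.
Qed.

Lemma Int_gt0 a b f t0 : a < b -> cont_on a b f -> (forall t, a <= t <= b -> 0 <= f t) ->
  a < t0 < b -> 0 < f t0 -> 0 < Int a b f.
Proof.
move=> ab cf f0 t0ab ft0.
have : \forall t \near t0, [/\ a < t, t < b & f t0 / 2 < f t].
  have /andP[at0 t0b] := t0ab; near=> t; split; near: t.
  - exact: lt_nbhsr.
  - exact: lt_nbhsl.
  - have c0 : {for t0, continuous f} by apply: cf; rewrite !ltW.
    by apply: (cvgr_gt (f t0)); [exact: c0|lra].
case/nbhs_ballP => e /= e0 He.
have e2 : 0 < e / 2 by rewrite divr_gt0.
have Hb t : t0 - e / 2 <= t <= t0 + e / 2 -> [/\ a < t, t < b & f t0 / 2 < f t].
  by move=> ht; apply: He; rewrite /ball /= ltr_norml; lra.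
have [|h1 h2 _] := Hb (t0 - e / 2); first by lra.
have [|h3 h4 _] := Hb (t0 + e / 2); first by lra.
rewrite (@Int_cat a (t0 - e / 2)) //; [|lra|lra].
rewrite (@Int_cat (t0 - e / 2) (t0 + e / 2)) //; [|lra|lra|apply: cont_onS cf; lra].
have h5 : 0 <= Int a (t0 - e / 2) f by apply: Int_ge0 => t ht; apply: f0; lra.
have h6 : 0 <= Int (t0 + e / 2) b f by apply: Int_ge0 => t ht; apply: f0; lra.
suff : 0 < Int (t0 - e / 2) (t0 + e / 2) f by lra.
apply: (@lt_le_trans _ _ (Int (t0 - e / 2) (t0 + e / 2) (fun=> f t0 / 2))).
  by rewrite Int_cst; [apply: mulr_gt0; lra|lra].
apply: le_Int; [exact: cont_on_cst|apply: cont_onS cf; lra|].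
by move=> t /Hb[_ _ /ltW].
Unshelve. all: by end_near. Qed.

Lemma antiderivative f : (forall t, {for t, continuous f}) ->
  exists F, forall t : R, is_derive t 1 F (f t).
Proof.
move=> cf; have cfon a b : cont_on a b f by move=> t _; exact: cf.
(* [Int] integrates over a set and carries no orientation, hence the separate sign for negative [x].
   Near a given point both cases are the integral from [- N] up to one constant. *)
pose F x := if 0 <= x then Int 0 x f else - Int x 0 f.
exists F => x; pose N : R := `|x| + 1.
have xN : - N < x < N by rewrite /N; have := ler_norm x; have := ler_norm (- x); rewrite normrN; lra.
have N0 : 0 < N by rewrite /N; have := normr_ge0 x; lra.
have H : is_derive x 1 (fun t => Int (- N) t f - Int (- N) 0 f) (f x).
  have h := @Int_FTC1 (- N) N f x (cfon _ _) xN.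
  by apply: is_derive_eq; rewrite subr0.
apply: near_eq_is_derive1 H; near=> t.
have tN : - N < t by near: t; apply: lt_nbhsr; case/andP: xN.
rewrite /F; case: ifPn => [t0|]; last rewrite -ltNge => t0.
  by rewrite (@Int_cat (- N) 0 t) //; [ring|lra].
by rewrite (@Int_cat (- N) t 0) //; [ring|lra|lra].
Unshelve. all: by end_near. Qed.

Lemma Int_shift a b c f : a <= b -> (forall t, {for t, continuous f}) ->
  Int a b (fun t => f (t - c)) = Int (a - c) (b - c) f.
Proof.
move=> ab cf; have [F dF] := antiderivative cf.
have ab' : a - c <= b - c by lra.
rewrite (Int_FTC2 ab' (fun t _ => cf t) (fun t _ => dF t)).
apply: (Int_FTC2 (F := fun t => F (t - c)) ab).
  move=> t _; apply: (@cont_comp _ _ (fun t => t - c) f); last exact: cf.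
  by apply: contB; [exact: cvg_id|exact: cont_cst].
move=> t _; have h := dF (t - c).
have h2 : is_derive t 1 (fun t : R => t - c) 1 by apply: is_derive_eq; rewrite subr0.
by have := is_derive1_comp (g := fun t => t - c) h h2; rewrite mulr1.
Qed.

Lemma Int_reflect a b c f : a <= b -> (forall t, {for t, continuous f}) ->
  Int a b (fun t => f (c - t)) = Int (c - b) (c - a) f.
Proof.
move=> ab cf; have [F dF] := antiderivative cf.
have ab' : c - b <= c - a by lra.
rewrite (Int_FTC2 ab' (fun t _ => cf t) (fun t _ => dF t)).
rewrite -[F (c - a)]opprK addrC.
apply: (Int_FTC2 (F := fun t => - F (c - t)) ab).
  move=> t _; apply: (@cont_comp _ _ (fun t => c - t) f); last exact: cf.
  by apply: contB; [exact: cont_cst|exact: cvg_id].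
move=> t _; have h := dF (c - t).
have h2 : is_derive t 1 (fun t : R => c - t) (-1) by apply: is_derive_eq; rewrite add0r mul1r.
have h3 := is_derive1_comp (g := fun t => c - t) h h2.
by apply: is_derive_eq; rewrite mulrN1 opprK.
Qed.

(** Compactness of the segment turns joint continuity at every [(x0, t)] into closeness uniform in
    [t], as in the tube lemma. *)
Lemma Int_uniform (T : topologicalType) (f : T -> R -> R) a b x0 (e : R) : 0 < e ->
  (forall t, a <= t <= b -> {for (x0, t), continuous (fun p : T * R => f p.1 p.2)}) ->
  \forall x \near x0, forall t, a <= t <= b -> `|f x t - f x0 t| < e.
Proof.
move=> e0 cf.
have /compact_near_coveringP := @segment_compact R a b.
move/(_ T (nbhs x0) (fun x t => `|f x t - f x0 t| < e) _).
move=> H; have : \forall x \near x0, `[a, b]%classic `<=` (fun t => `|f x t - f x0 t| < e).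
  apply: H => t /=; rewrite in_itv /= => /cf /cvgrPdist_lt ct.
  have e2 : 0 < e / 2 by rewrite divr_gt0.
  have {}ct := ct _ e2.
  have [[A B] [/= hA hB] AB] := ct.
  exists (B, A) => //= -[t' x] /= [Bt Ax].
  have h1 := AB (x, t') (conj Ax Bt).
  have h2 := AB (x0, t') (conj (nbhs_singleton hA) Bt).
  rewrite /= in h1 h2.
  have := ler_distD (f x0 t) (f x t') (f x0 t').
  by rewrite (distrC (f x t') (f x0 t)); lra.
by apply: filterS => x H' t ht; apply: H'; rewrite /= in_itv.
Qed.

Lemma Int_cont_param (T : topologicalType) (f : T -> R -> R) a b x0 : a <= b ->
  (forall t, a <= t <= b -> {for (x0, t), continuous (fun p : T * R => f p.1 p.2)}) ->
  (\forall x \near x0, cont_on a b (f x)) ->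
  {for x0, continuous (fun x => Int a b (f x))}.
Proof.
move=> ab cf cx; apply/cvgrPdist_lt => e e0.
(* The added 1 covers the degenerate interval [a = b]. *)
have e1 : 0 < e / (b - a + 1) by rewrite divr_gt0//; lra.
have cx0 := nbhs_singleton cx.
near=> x.
have cfx : cont_on a b (f x) by near: x.
have H : forall t, a <= t <= b -> `|f x t - f x0 t| < e / (b - a + 1).
  by near: x; exact: Int_uniform.
rewrite -IntB//; apply: (@le_lt_trans _ _ (e / (b - a + 1) * (b - a))).
  apply: Int_abs => // [t ht|t ht]; first by apply: contB; [exact: cx0|exact: cfx].
  by rewrite distrC ltW// H.
rewrite mulrAC ltr_pdivrMr; last by lra.
by rewrite ltr_pM2l//; lra.
Unshelve. all: by end_near. Qed.

(** For each [t] the difference quotient of the integrand is a value of [f1] at a nearby parameter,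
    by the mean value theorem, and [f1] is close to [f1 x0] uniformly in [t]. *)
Lemma Int_derive_param (f f1 : R -> R -> R) (a b x0 : R) : a <= b ->
  (forall t, a <= t <= b -> {for (x0, t), continuous (fun p : R * R => f1 p.1 p.2)}) ->
  (\forall x \near x0, cont_on a b (f x)) -> cont_on a b (f1 x0) ->
  (\forall x \near x0, forall t, a <= t <= b -> is_derive (x : R) 1 (fun s => f s t) (f1 x t)) ->
  is_derive x0 1 (fun x => Int a b (f x)) (Int a b (f1 x0)).
Proof.
move=> ab cf1 cx c10 df.
have cx0 := nbhs_singleton cx.
apply/is_derive1_caratheodory.
exists (fun x => if x == x0 then Int a b (f1 x0) else (Int a b (f x) - Int a b (f x0)) / (x - x0)).
split; last by rewrite eqxx.
  move=> x; case: ifPn => [/eqP ->|xx0]; first by rewrite !subrr mulr0.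
  by rewrite mulfVK// subr_eq0.
apply/(@cvgrPdist_lt _ _ _ _ (nbhs_filter x0)) => e e0; rewrite eqxx.
have e1 : 0 < e / (b - a + 1) by rewrite divr_gt0//; lra.
have : \forall x \near x0, (forall t, a <= t <= b -> `|f1 x t - f1 x0 t| < e / (b - a + 1)) /\ (forall t, a <= t <= b -> is_derive (x : R) 1 (fun s => f s t) (f1 x t)).
  by apply: filterS2 (Int_uniform e1 cf1) df => x h1 h2; split.
case/nbhs_ballP => d /= d0 Hd.
near=> x.
case: ifPn => [_|xx0]; first by rewrite subrr normr0.
have cfx : cont_on a b (f x) by near: x.
have xd : ball x0 d x by near: x; exact: nbhsx_ballx.
have Hs (s : R) : `|s - x0| <= `|x - x0| -> ball x0 d s.
  by rewrite /ball /= distrC => h; rewrite (le_lt_trans h)// distrC.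
have xne : x - x0 != 0 by rewrite subr_eq0.
rewrite -IntB// -[in X in `|X|](mulfK xne (Int a b (f1 x0))) -mulrBl normrM normfV.
rewrite ltr_pdivrMr ?normr_gt0// mulrC -[X in `|X - _|]IntZ// -IntB; last 2 first.
- by move=> t ht; apply: contM; [exact: cont_cst|exact: c10].
- by move=> t ht; apply: contB; [exact: cfx|exact: cx0].
apply: (@le_lt_trans _ _ (e / (b - a + 1) * `|x - x0| * (b - a))).
  apply: Int_abs => // [t ht|t ht].
    apply: contB; first by apply: contM; [exact: cont_cst|exact: c10].
    by apply: contB; [exact: cfx|exact: cx0].
  have [s hs ->] := @MVT_abs _ (fun s => f s t) (fun s => f1 s t) x0 x
    (fun s hs => (Hd s (Hs s hs)).2 t ht).
  rewrite mulrC -mulrBl normrM ler_wpM2r//.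
  by rewrite distrC ltW// (Hd s (Hs s hs)).1.
have -> : e / (b - a + 1) * `|x - x0| * (b - a) = e * `|x - x0| * ((b - a) / (b - a + 1)) by field; lra.
rewrite gtr_pMr; last by rewrite mulr_gt0// normr_gt0.
by rewrite ltr_pdivrMr; lra.
Unshelve. all: by end_near. Qed.
End Integral.

Lemma cont_ext (R : realType) (T : topologicalType) (f g : T -> R) t :
  (forall s, f s = g s) -> {for t, continuous f} -> {for t, continuous g}.
Proof. by move=> /funext <-. Qed.

(** * The Poisson integral on the unit disc *)

Section Poisson.
Context {R : realType}.
Local Notation C := R[i]^o.
Implicit Types (z w c : C) (U V K : set C).

Lemma is_derive_translate (h : R -> R) (c t a : R) : is_derive (t - c) 1 h a ->
  is_derive t 1 (fun s => h (s - c)) a.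
Proof.
move=> dh; have h2 : is_derive t 1 (fun t : R => t - c) 1 by apply: is_derive_eq; rewrite subr0.
by have := is_derive1_comp (g := fun t => t - c) dh h2; rewrite mulr1.
Qed.

(* The real and imaginary parts of 1/w, -1/w^2 and 2/w^3, as functions of w = q + ip. *)
Definition ratA (q p : R) := q / (q ^+ 2 + p ^+ 2).
Definition ratB (q p : R) := p / (q ^+ 2 + p ^+ 2).
Definition ratE (q p : R) := (p ^+ 2 - q ^+ 2) / (q ^+ 2 + p ^+ 2) ^+ 2.
Definition ratF (q p : R) := - (2 * q * p) / (q ^+ 2 + p ^+ 2) ^+ 2.
Definition ratG (q p : R) := 2 * (q ^+ 3 - 3 * q * p ^+ 2) / (q ^+ 2 + p ^+ 2) ^+ 3.
Definition ratH (q p : R) := 2 * (3 * q ^+ 2 * p - p ^+ 3) / (q ^+ 2 + p ^+ 2) ^+ 3.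

Lemma is_derive_quot (f g : R -> R) (x a b : R) : is_derive x 1 f a -> is_derive x 1 g b -> g x != 0 ->
  is_derive x 1 (fun t => f t / g t) ((a * g x - f x * b) / g x ^+ 2).
Proof.
move=> df dg g0; have dv := is_deriveV g0 dg; apply: is_derive_eq.
by rewrite /GRing.scale /=; field.
Qed.

Lemma is_derive_congr (f : R -> R) (x a b : R) : is_derive x 1 f a -> a = b -> is_derive x 1 f b.
Proof. by move=> h <-. Qed.

Lemma is_derive_norm2_q (q p : R) : is_derive q 1 (fun q => q ^+ 2 + p ^+ 2) (2 * q).
Proof. by apply: is_derive_eq; rewrite /GRing.scale/=; ring. Qed.
Lemma is_derive_norm2_p (q p : R) : is_derive p 1 (fun p => q ^+ 2 + p ^+ 2) (2 * p).
Proof. by apply: is_derive_eq; rewrite /GRing.scale/=; ring. Qed.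

Section Rat.
Variables (q p : R).
Hypothesis D0 : q ^+ 2 + p ^+ 2 != 0.
Let dq := is_derive_norm2_q q p.
Let dp := is_derive_norm2_p q p.
Let dq2 : is_derive q 1 (fun q => (q ^+ 2 + p ^+ 2) ^+ 2) (4 * q * (q ^+ 2 + p ^+ 2)).
Proof. by apply: is_derive_eq; rewrite /GRing.scale/=; ring. Qed.
Let dp2 : is_derive p 1 (fun p => (q ^+ 2 + p ^+ 2) ^+ 2) (4 * p * (q ^+ 2 + p ^+ 2)).
Proof. by apply: is_derive_eq; rewrite /GRing.scale/=; ring. Qed.
Let D20 : (q ^+ 2 + p ^+ 2) ^+ 2 != 0. Proof. by rewrite expf_neq0. Qed.

Lemma is_derive_ratA : is_derive q 1 (fun q => ratA q p) (ratE q p) /\ is_derive p 1 (fun p => ratA q p) (ratF q p).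
Proof.
rewrite /ratA; split.
  apply: (is_derive_congr (is_derive_quot (is_derive_id q 1) dq D0)); rewrite /ratE /cst; field; exact: D0.
apply: (is_derive_congr (is_derive_quot (is_derive_cst q p 1) dp D0)); rewrite /ratF /cst; field; exact: D0.
Qed.

Lemma is_derive_ratB : is_derive q 1 (fun q => ratB q p) (ratF q p) /\ is_derive p 1 (fun p => ratB q p) (- ratE q p).
Proof.
rewrite /ratB; split.
  apply: (is_derive_congr (is_derive_quot (is_derive_cst p q 1) dq D0)); rewrite /ratF /cst; field; exact: D0.
apply: (is_derive_congr (is_derive_quot (is_derive_id p 1) dp D0)); rewrite /ratE /cst; field; exact: D0.
Qed.

Lemma is_derive_ratE : is_derive q 1 (fun q => ratE q p) (ratG q p) /\ is_derive p 1 (fun p => ratE q p) (ratH q p).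
Proof.
rewrite /ratE; split.
  have h : is_derive q 1 (fun q => p ^+ 2 - q ^+ 2) (- (2 * q)) by apply: is_derive_eq; rewrite /GRing.scale/=; ring.
  apply: (is_derive_congr (is_derive_quot h dq2 D20)); rewrite /ratG; field; exact: D0.
have h : is_derive p 1 (fun p => p ^+ 2 - q ^+ 2) (2 * p) by apply: is_derive_eq; rewrite /GRing.scale/=; ring.
apply: (is_derive_congr (is_derive_quot h dp2 D20)); rewrite /ratH; field; exact: D0.
Qed.

Lemma is_derive_ratF : is_derive q 1 (fun q => ratF q p) (ratH q p) /\ is_derive p 1 (fun p => ratF q p) (- ratG q p).
Proof.
rewrite /ratF; split.
  have h : is_derive q 1 (fun q => - (2 * q * p)) (- (2 * p)) by apply: is_derive_eq; rewrite /GRing.scale/=; ring.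
  apply: (is_derive_congr (is_derive_quot h dq2 D20)); rewrite /ratH; field; exact: D0.
have h : is_derive p 1 (fun p => - (2 * q * p)) (- (2 * q)) by apply: is_derive_eq; rewrite /GRing.scale/=; ring.
apply: (is_derive_congr (is_derive_quot h dp2 D20)); rewrite /ratG; field; exact: D0.
Qed.

End Rat.
Lemma cont_fst (h : C -> R) z (t : R) : {for z, continuous h} ->
  {for (z, t), continuous (fun w : C * R => h w.1)}.
Proof.
by move=> ch; apply: (@continuous_comp _ _ _ (fun w : C * R => w.1) h (z, t)); [exact: cvg_fst|exact: ch].
Qed.

Lemma cont_snd (h : R -> R) z (t : R) : {for t, continuous h} ->
  {for (z, t), continuous (fun w : C * R => h w.2)}.
Proof.
by move=> ch; apply: (@continuous_comp _ _ _ (fun w : C * R => w.2) h (z, t)); [exact: cvg_snd|exact: ch].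
Qed.

Definition jointly_continuous U (k : C -> R -> R) := forall z t, U z ->
  {for (z, t), continuous (fun p : C * R => k p.1 p.2)}.

Lemma jc_cont_on U k z a b : jointly_continuous U k -> U z -> cont_on a b (k z).
Proof.
move=> ck Uz t _.
apply: (@continuous_comp _ _ _ (fun t : R => (z, t)) (fun p : C * R => k p.1 p.2) t).
  by apply: (@cvg_pair _ _ _ _ (nbhs z) (nbhs t)); [exact: cvg_cst|exact: cvg_id].
exact: ck.
Qed.

Lemma Int_C1 U (k kx ky : C -> R -> R) a b : open U -> a <= b ->
  jointly_continuous U k -> jointly_continuous U kx -> jointly_continuous U ky ->
  (forall z t, U z -> isdx (fun z => k z t) z (kx z t)) ->
  (forall z t, U z -> isdy (fun z => k z t) z (ky z t)) ->
  [/\ C1 U (fun z => Int a b (k z)),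
      forall z, U z -> dx (fun z => Int a b (k z)) z = Int a b (kx z) &
      forall z, U z -> dy (fun z => Int a b (k z)) z = Int a b (ky z)].
Proof.
move=> oU ab ck ckx cky dkx dky.
have nU z : U z -> \forall w \near z, U w by move=> Uz; exact: open_nbhs_nbhs.
apply: C1I => // z Uz.
- suff : isdx (fun z => Int a b (k z)) z (Int a b (kx (complex.Re z +i* complex.Im z))) by rewrite complex_eta.
  apply: (@Int_derive_param _ (fun s t => k (s +i* complex.Im z) t) (fun s t => kx (s +i* complex.Im z) t)) => //.
  + move=> t _.
    apply: (@continuous_comp _ _ _ (fun p : R * R => (p.1 +i* complex.Im z : C, p.2)) (fun p : C * R => kx p.1 p.2)).
      apply: (@cvg_pair _ _ _ _ (nbhs _) (nbhs _)); last exact: cvg_snd.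
      by apply: cvg_complex; [exact: cvg_fst|exact: cvg_cst].
    by rewrite /= complex_eta; exact: ckx.
  + by apply: filterS (near_slice_x (nU _ Uz)) => s Us; exact: jc_cont_on ck Us.
  + by rewrite complex_eta; exact: jc_cont_on ckx Uz.
  + by apply: filterS (near_slice_x (nU _ Uz)) => s Us t _; exact: (dkx _ t Us).
- suff : isdy (fun z => Int a b (k z)) z (Int a b (ky (complex.Re z +i* complex.Im z))) by rewrite complex_eta.
  apply: (@Int_derive_param _ (fun s t => k (complex.Re z +i* s) t) (fun s t => ky (complex.Re z +i* s) t)) => //.
  + move=> t _.
    apply: (@continuous_comp _ _ _ (fun p : R * R => (complex.Re z +i* p.1 : C, p.2)) (fun p : C * R => ky p.1 p.2)).
      apply: (@cvg_pair _ _ _ _ (nbhs _) (nbhs _)); last exact: cvg_snd.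
      by apply: cvg_complex; [exact: cvg_cst|exact: cvg_fst].
    by rewrite /= complex_eta; exact: cky.
  + by apply: filterS (near_slice_y (nU _ Uz)) => s Us; exact: jc_cont_on ck Us.
  + by rewrite complex_eta; exact: jc_cont_on cky Uz.
  + by apply: filterS (near_slice_y (nU _ Uz)) => s Us t _; exact: (dky _ t Us).
- apply: Int_cont_param => // [t _|]; first exact: ckx.
  by apply: filterS (nU _ Uz) => w Uw; exact: jc_cont_on ckx Uw.
- apply: Int_cont_param => // [t _|]; first exact: cky.
  by apply: filterS (nU _ Uz) => w Uw; exact: jc_cont_on cky Uw.
Qed.

Local Notation udisc := (odisc (0 : C) 1).
Local Notation dq z t := (complex.Re z - cos t).
Local Notation dp z t := (complex.Im z - sin t).

Lemma udiscE z : udisc z = (complex.Re z ^+ 2 + complex.Im z ^+ 2 < 1) :> Prop.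
Proof.
rewrite /odisc /= subr0 -sqr_modulus; congr (is_true _).
by rewrite expr_lt1 ?modulus_ge0.
Qed.

Lemma denominator_gt0 z t : udisc z -> 0 < dq z t ^+ 2 + dp z t ^+ 2.
Proof.
rewrite udiscE => zU; rewrite lt_neqAle addr_ge0 ?sqr_ge0// andbT eq_sym paddr_eq0 ?sqr_ge0//.
rewrite !sqrf_eq0 !subr_eq0; apply/negP => /andP[/eqP h1 /eqP h2].
by move: zU; rewrite h1 h2 cos2Dsin2 ltxx.
Qed.

Lemma jc_rational (g : R -> R) (N : R -> R -> R) n : (forall t, {for t, continuous g}) ->
  (forall z t, udisc z -> {for (z, t), continuous (fun w : C * R => N (dq w.1 w.2) (dp w.1 w.2))}) ->
  jointly_continuous udisc (fun z t => g t * (N (dq z t) (dp z t) / (dq z t ^+ 2 + dp z t ^+ 2) ^+ n)).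
Proof.
move=> cg cN z t Uz.
apply: contM; first exact: (cont_snd (cg t)).
apply: contM; first exact: cN.
apply: contV; last by rewrite expf_neq0// gt_eqF// denominator_gt0.
apply: contX; apply: contD; apply: contX; apply: contB.
- exact: (cont_fst (@continuous_Re _ z)).
- exact: (cont_snd (@continuous_cos _ t)).
- exact: (cont_fst (@continuous_Im _ z)).
- exact: (cont_snd (@continuous_sin _ t)).
Qed.
Lemma cont_dq z t : {for (z, t), continuous (fun w : C * R => dq w.1 w.2)}.
Proof.
by apply: contB; [exact: (cont_fst (@continuous_Re _ z))|exact: (cont_snd (@continuous_cos _ t))].
Qed.

Lemma cont_dp z t : {for (z, t), continuous (fun w : C * R => dp w.1 w.2)}.
Proof.
by apply: contB; [exact: (cont_fst (@continuous_Im _ z))|exact: (cont_snd (@continuous_sin _ t))].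
Qed.

Lemma open_udisc : open udisc. Proof. exact: open_odisc. Qed.

Section Weight.
Variable g : R -> R.
Hypothesis cg : forall t, {for t, continuous g}.

Definition weighted (h : R -> R -> R) z t := g t * h (dq z t) (dp z t).

Lemma jcA : jointly_continuous udisc (weighted ratA).
Proof. by apply: (jc_rational (N := fun q p => q) (n := 1)) => // z t _; exact: cont_dq. Qed.

Lemma jcB : jointly_continuous udisc (weighted ratB).
Proof. by apply: (jc_rational (N := fun q p => p) (n := 1)) => // z t _; exact: cont_dp. Qed.

Lemma jcE : jointly_continuous udisc (weighted ratE).
Proof.
apply: (jc_rational (N := fun q p => p ^+ 2 - q ^+ 2) (n := 2)) => // z t _.
by apply: contB; apply: contX; [exact: cont_dp|exact: cont_dq].
Qed.

Lemma jcF : jointly_continuous udisc (weighted ratF).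
Proof.
apply: (jc_rational (N := fun q p => - (2 * q * p)) (n := 2)) => // z t _.
apply: contN; apply: contM; last exact: cont_dp.
by apply: contM; [exact: cont_cst|exact: cont_dq].
Qed.

Lemma jcG : jointly_continuous udisc (weighted ratG).
Proof.
apply: (jc_rational (N := fun q p => 2 * (q ^+ 3 - 3 * q * p ^+ 2)) (n := 3)) => // z t _.
apply: contM; first exact: cont_cst.
apply: contB; first by apply: contX; exact: cont_dq.
by apply: contM; [apply: contM; [exact: cont_cst|exact: cont_dq]|apply: contX; exact: cont_dp].
Qed.

Lemma jcH : jointly_continuous udisc (weighted ratH).
Proof.
apply: (jc_rational (N := fun q p => 2 * (3 * q ^+ 2 * p - p ^+ 3)) (n := 3)) => // z t _.
apply: contM; first exact: cont_cst.
apply: contB; last by apply: contX; exact: cont_dp.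
by apply: contM; [apply: contM; [exact: cont_cst|apply: contX; exact: cont_dq]|exact: cont_dp].
Qed.

Lemma jcN h : jointly_continuous udisc (weighted h) ->
  jointly_continuous udisc (weighted (fun q p => - h q p)).
Proof.
move=> ch z t Uz; apply: cont_ext (contN (ch z t Uz)).
by move=> w; rewrite /weighted mulrN.
Qed.

Lemma is_deriveCM (c : R) (f : R -> R) (x a : R) : is_derive x 1 f a -> is_derive x 1 (fun t => c * f t) (c * a).
Proof.
by move=> df; apply: (is_derive_congr (is_deriveM (is_derive_cst c x 1) df)); rewrite /GRing.scale /= mulr0 addr0.
Qed.

Lemma weighted_isdx (h hq : R -> R -> R) z t :
  (forall q p : R, q ^+ 2 + p ^+ 2 != 0 -> is_derive q 1 (fun q => h q p) (hq q p)) ->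
  udisc z -> isdx (fun z => weighted h z t) z (weighted hq z t).
Proof.
move=> H Uz; apply: is_deriveCM; apply: (is_derive_translate (h := fun s => h s (dp z t))).
by apply: H; rewrite gt_eqF// denominator_gt0.
Qed.

Lemma weighted_isdy (h hp : R -> R -> R) z t :
  (forall q p : R, q ^+ 2 + p ^+ 2 != 0 -> is_derive p 1 (fun p => h q p) (hp q p)) ->
  udisc z -> isdy (fun z => weighted h z t) z (weighted hp z t).
Proof.
move=> H Uz; apply: is_deriveCM; apply: (is_derive_translate (h := fun s => h (dq z t) s)).
by apply: H; rewrite gt_eqF// denominator_gt0.
Qed.

Let W h z := Int 0 (2 * pi) (weighted h z).
Let twopi_ge0 : 0 <= 2 * pi :> R. Proof. by rewrite mulr_ge0// pi_ge0. Qed.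

Lemma weighted_C1 (h hq hp : R -> R -> R) :
  (forall q p : R, q ^+ 2 + p ^+ 2 != 0 -> is_derive q 1 (fun q => h q p) (hq q p) /\
    is_derive p 1 (fun p => h q p) (hp q p)) ->
  jointly_continuous udisc (weighted h) -> jointly_continuous udisc (weighted hq) ->
  jointly_continuous udisc (weighted hp) ->
  [/\ C1 udisc (W h), forall z, udisc z -> dx (W h) z = W hq z & forall z, udisc z -> dy (W h) z = W hp z].
Proof.
move=> H c0 c1 c2; apply: (Int_C1 open_udisc twopi_ge0 c0 c1 c2) => z t Uz.
  by apply: weighted_isdx => // ? ? /H[].
by apply: weighted_isdy => // ? ? /H[].
Qed.

Lemma W_opp h z : jointly_continuous udisc (weighted h) -> udisc z ->
  W (fun q p => - h q p) z = - W h z.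
Proof.
move=> ch Uz; rewrite -mulN1r /W -IntZ; last exact: jc_cont_on ch Uz.
by apply: eq_Int => t _; rewrite /weighted mulN1r mulrN.
Qed.

(** Differentiation leads from [ratA], [ratB] to [ratE], [ratF] and from there to [ratG], [ratH],
    always up to sign, so the second derivatives under the integral cancel in pairs. *)
Lemma weighted_harmonic : harmonic_on udisc (W ratA) /\ harmonic_on udisc (W ratB).
Proof.
have [a1 a2 a3] := weighted_C1 is_derive_ratA jcA jcE jcF.
have [b1 b2 b3] := weighted_C1 is_derive_ratB jcB jcF (jcN jcE).
have [e1 e2 e3] := weighted_C1 is_derive_ratE jcE jcG jcH.
have [f1 f2 f3] := weighted_C1 is_derive_ratF jcF jcH (jcN jcG).
split.
  have [c l] := C2I open_udisc a1 a2 a3 e1 f1; split; first exact: c.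
  by move=> z Uz; rewrite -/(lap _ z) (l _ Uz) (e2 _ Uz) (f3 _ Uz) (W_opp jcG Uz) subrr.
have NE : forall z, udisc z -> - 1 * W ratE z = W (fun q p => - ratE q p) z.
  by move=> z Uz; rewrite (W_opp jcE Uz) mulN1r.
have [k1 k2 k3] := C1ME open_udisc (C1_cst (-1) open_udisc) e1.
have [_ _ k5] := C1_cstE (-1) open_udisc.
have g1 := eq_C1 open_udisc NE k1.
have [c l] := C2I open_udisc b1 b2 b3 f1 g1; split; first exact: c.
move=> z Uz; rewrite -/(lap _ z) (l _ Uz) (f2 _ Uz) -(eq_dy open_udisc NE Uz) (k3 _ Uz) (e3 _ Uz) (k5 _ Uz).
by rewrite mulr0 addr0 mulN1r subrr.
Qed.

End Weight.

Local Notation W g h z := (Int 0 (2 * pi) (weighted g h z)).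
Let twopi_ge0 : 0 <= 2 * pi :> R. Proof. by rewrite mulr_ge0// pi_ge0. Qed.
Let twopi_gt0 : 0 < 2 * pi :> R. Proof. by rewrite mulr_gt0// pi_gt0. Qed.

(** The Poisson kernel as the real part of [(e^(it) + z) / (e^(it) - z)], that is, of
    [-1 - 2 e^(it) / (z - e^(it))]. Harmonicity in [z] is visible in this form, which combines the
    weighted fractions above; [pkernelE] has the usual quotient. *)
Definition pkernel z t := -1 - 2 * (cos t * ratA (dq z t) (dp z t) + sin t * ratB (dq z t) (dp z t)).

Definition poisson (f : R -> R) z := (2 * pi)^-1 * Int 0 (2 * pi) (fun t => f t * pkernel z t).

Lemma poissonE (f : R -> R) z : (forall t, {for t, continuous f}) -> udisc z ->
  poisson f z = (2 * pi)^-1 * (- Int 0 (2 * pi) f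
    - 2 * W (fun t => f t * cos t) ratA z - 2 * W (fun t => f t * sin t) ratB z).
Proof.
move=> cf Uz; congr (_ * _).
have cfc t : {for t, continuous (fun t => f t * cos t)} by apply: contM; [exact: cf|exact: continuous_cos].
have cfs t : {for t, continuous (fun t => f t * sin t)} by apply: contM; [exact: cf|exact: continuous_sin].
have cA := jc_cont_on (a := 0) (b := 2 * pi) (jcA cfc) Uz; have cB := jc_cont_on (a := 0) (b := 2 * pi) (jcB cfs) Uz.
have c0 : cont_on 0 (2 * pi) f by move=> t _; exact: cf.
have c2 h : cont_on 0 (2 * pi) h -> cont_on 0 (2 * pi) (fun t => 2 * h t : R).
  by move=> ch t ht; apply: contM; [exact: cont_cst|exact: ch].
have c1 : cont_on 0 (2 * pi) (fun t => -1 * f t) by move=> t _; apply: contM; [exact: cont_cst|exact: cf].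
rewrite -mulN1r -!IntZ// -IntB// -?IntB//; [|by move=> t ht; apply: contB; [exact: c1|exact: c2]|exact: c2|exact: c2].
by apply: eq_Int => t _; rewrite /pkernel /weighted; ring.
Qed.

Lemma poisson_harmonic (f : R -> R) : (forall t, {for t, continuous f}) -> harmonic_on udisc (poisson f).
Proof.
move=> cf.
have cfc t : {for t, continuous (fun t => f t * cos t)} by apply: contM; [exact: cf|exact: continuous_cos].
have cfs t : {for t, continuous (fun t => f t * sin t)} by apply: contM; [exact: cf|exact: continuous_sin].
have hA := (weighted_harmonic cfc).1; have hB := (weighted_harmonic cfs).2.
apply: (eq_harmonic open_udisc (fun w Uw => esym (poissonE cf Uw))).
apply: harmonicZ open_udisc _; apply: harmonicB open_udisc _ (harmonicZ 2 open_udisc hB).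
exact: harmonicB open_udisc (harmonic_cst _ open_udisc) (harmonicZ 2 open_udisc hA).
Qed.

Lemma pkernelE z t : udisc z -> pkernel z t =
  (1 - (complex.Re z ^+ 2 + complex.Im z ^+ 2)) / (dq z t ^+ 2 + dp z t ^+ 2).
Proof.
move=> Uz; have D0 := denominator_gt0 t Uz.
have := cos2Dsin2 t; rewrite /pkernel /ratA /ratB.
move: D0; set x := complex.Re z; set y := complex.Im z; set c := cos t; set s := sin t => D0 cs.
have D1 : (x - c) ^+ 2 + (y - s) ^+ 2 != 0 by rewrite gt_eqF.
rewrite -[X in X - (_ + _)]cs; field; exact: D1.
Qed.

Lemma pkernel_ge0 z t : udisc z -> 0 <= pkernel z t.
Proof.
move=> Uz; rewrite pkernelE// divr_ge0// ?ltW ?denominator_gt0//.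
by move: Uz; rewrite udiscE; lra.
Qed.

Lemma cos_sin_le_modulus z t : complex.Re z * cos t + complex.Im z * sin t <= modulus z.
Proof.
apply: le_trans (ler_norm _) _; rewrite -(ler_pXn2r (n := 2)) ?nnegrE ?modulus_ge0//.
rewrite real_normK ?num_real// sqr_modulus.
have := cos2Dsin2 t; have := sqr_ge0 (complex.Re z * sin t - complex.Im z * cos t).
set x := complex.Re z; set y := complex.Im z; set c := cos t; set s := sin t => h cs.
have -> : x ^+ 2 + y ^+ 2 = (x ^+ 2 + y ^+ 2) * (c ^+ 2 + s ^+ 2) by rewrite cs mulr1.
rewrite -subr_ge0; apply: le_trans h _; rewrite le_eqVlt; apply/orP; left; apply/eqP; ring.
Qed.

(** The kernel is at most [(1 - |z|^2) / (1 - |z|)^2 = (1 + |z|) / (1 - |z|)], which is 3 at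
    [|z| = 1/2]. This is the constant of Harnack's inequality below. *)
Lemma pkernel_le3 z t : modulus z <= 2^-1 -> pkernel z t <= 3.
Proof.
move=> z2; have Uz : udisc z by rewrite /odisc /= subr0; lra.
rewrite pkernelE// ler_pdivrMr ?denominator_gt0//.
have := cos_sin_le_modulus z t; have := cos2Dsin2 t.
have := modulus_ge0 z; have := sqr_modulus z.
move: z2; set m := modulus z; set x := complex.Re z; set y := complex.Im z; set c := cos t; set s := sin t.
move=> m2 mE m0 cs cm.
have -> : (x - c) ^+ 2 + (y - s) ^+ 2 = m ^+ 2 + (c ^+ 2 + s ^+ 2) - 2 * (x * c + y * s) by rewrite mE; ring.
rewrite -mE cs; nra.
Qed.

Lemma pkernel0 t : pkernel 0 t = 1.
Proof.
rewrite pkernelE; last by rewrite udiscE /= expr0n /= addr0.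
by rewrite /= !sub0r !sqrrN cos2Dsin2 expr0n /= addr0 subr0 divr1.
Qed.

Lemma cont_pkernel : jointly_continuous udisc pkernel.
Proof.
move=> z t Uz; apply: contB; first exact: cont_cst.
apply: contM; first exact: cont_cst.
by apply: contD; [exact: (jcA (@continuous_cos R))|exact: (jcB (@continuous_sin R))].
Qed.

(** The path from [z] vertically to the real axis and then along it to 0 stays in the disc, and the
    mean value theorem applies to each leg. *)
Lemma const_on_udisc (u : C -> R) : C1 udisc u ->
  (forall z, udisc z -> dx u z = 0) -> (forall z, udisc z -> dy u z = 0) ->
  forall z, udisc z -> u z = u 0.
Proof.
move=> cu ux uy z Uz.
have sq (a b : R) : `|a| <= `|b| -> a ^+ 2 <= b ^+ 2.
  by move=> h; rewrite -(real_normK (num_real a)) -(real_normK (num_real b)) ler_sqr ?nnegrE.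
have in1 s : `|s| <= `|complex.Im z| -> udisc (complex.Re z +i* s).
  by move=> /sq h; move: Uz; rewrite !udiscE /=; lra.
have in2 s : `|s| <= `|complex.Re z| -> udisc (s +i* 0).
  by move=> /sq h; move: Uz; rewrite !udiscE /=; have := sqr_ge0 (complex.Im z); lra.
have e1 : u z = u (complex.Re z +i* 0).
  apply/eqP; rewrite -subr_eq0 -[z in u z]complex_eta; apply/eqP.
  have [s hs ->] := @MVT_abs R (fun s => u (complex.Re z +i* s)) (fun s => dy u (complex.Re z +i* s)) 0 (complex.Im z)
    (fun s hs => (C1_isd cu (in1 s (ltac:(move: hs; rewrite !subr0; exact)))).2).
  by rewrite uy ?mul0r//; apply: in1; rewrite !subr0 in hs.
rewrite e1; apply/eqP; rewrite -subr_eq0; apply/eqP.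
have [s hs ->] := @MVT_abs R (fun s => u (s +i* 0)) (fun s => dx u (s +i* 0)) 0 (complex.Re z)
    (fun s hs => (C1_isd cu (in2 s (ltac:(move: hs; rewrite !subr0; exact)))).1).
by rewrite ux ?mul0r//; apply: in2; rewrite !subr0 in hs.
Qed.

(** The partial derivatives of the integrand in [z] are, up to a factor, also derivatives in [t], of
    [ratB] and of [- ratA], and these are periodic in [t]. Their integrals over a period vanish, so
    the integral is constant in [z], and at the origin the kernel is 1. *)
Lemma Int_pkernel z : udisc z -> Int 0 (2 * pi) (pkernel z) = 2 * pi.
Proof.
have cc := @continuous_cos R; have cs := @continuous_sin R.
have e0 w : udisc w -> poisson (fun=> 1) w = (2 * pi)^-1 * Int 0 (2 * pi) (pkernel w).
  by move=> Uw; congr (_ * _); apply: eq_Int => t _; rewrite mul1r.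
have [a1 a2 a3] := weighted_C1 is_derive_ratA (jcA cc) (jcE cc) (jcF cc).
have [b1 b2 b3] := weighted_C1 is_derive_ratB (jcB cs) (jcF cs) (jcN (jcE cs)).
have [m1 m2 m3] := C1DE open_udisc a1 b1.
have dder w (t : R) : udisc w -> is_derive t 1 (fun t => ratB (dq w t) (dp w t))
   (weighted cos ratE w t + weighted sin ratF w t).
  move=> Uw; have D0 : dq w t ^+ 2 + dp w t ^+ 2 != 0 by rewrite gt_eqF// denominator_gt0.
  have h1 : is_derive t 1 (fun t => dp w t) (- cos t) by apply: is_derive_eq; ring.
  have h2 : is_derive t 1 (fun t => dq w t ^+ 2 + dp w t ^+ 2) (2 * (dq w t * sin t - dp w t * cos t)).
    by apply: is_derive_eq; rewrite /GRing.scale /=; ring.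
  apply: (is_derive_congr (is_derive_quot h1 h2 D0)); rewrite /weighted /ratE /ratF; field; exact: D0.
have ider w (t : R) : udisc w -> is_derive t 1 (fun t => - ratA (dq w t) (dp w t))
   (weighted cos ratF w t + weighted sin (fun q p => - ratE q p) w t).
  move=> Uw; have D0 : dq w t ^+ 2 + dp w t ^+ 2 != 0 by rewrite gt_eqF// denominator_gt0.
  have h1 : is_derive t 1 (fun t => - dq w t) (- sin t) by apply: is_derive_eq; ring.
  have h2 : is_derive t 1 (fun t => dq w t ^+ 2 + dp w t ^+ 2) (2 * (dq w t * sin t - dp w t * cos t)).
    by apply: is_derive_eq; rewrite /GRing.scale /=; ring.
  rewrite (_ : (fun t => _) = (fun t => - dq w t / (dq w t ^+ 2 + dp w t ^+ 2))); last first.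
    by apply/funext => s; rewrite /ratA mulNr.
  apply: (is_derive_congr (is_derive_quot h1 h2 D0)); rewrite /weighted /ratE /ratF; field; exact: D0.
have conD (h1 h2 : C -> R -> R) w : jointly_continuous udisc h1 -> jointly_continuous udisc h2 -> udisc w ->
   Int 0 (2 * pi) (h1 w) + Int 0 (2 * pi) (h2 w) = Int 0 (2 * pi) (fun t => h1 w t + h2 w t) /\
   cont_on 0 (2 * pi) (fun t => h1 w t + h2 w t).
  move=> c1 c2 Uw; have d1 := jc_cont_on (a := 0) (b := 2 * pi) c1 Uw; have d2 := jc_cont_on (a := 0) (b := 2 * pi) c2 Uw.
  by split; [rewrite IntD|move=> t ht; apply: contD; [exact: d1|exact: d2]].
have periodic : forall h : R -> R -> R, forall w, h (dq w (2 * pi)) (dp w (2 * pi)) = h (dq w 0) (dp w 0).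
  by move=> h w; rewrite mulr_natl cos2pi sin2pi cos0 sin0.
have H := const_on_udisc m1.
have H' w : udisc w -> W cos ratA w + W sin ratB w = W cos ratA 0 + W sin ratB 0.
  apply: H => {}w Uw; rewrite ?(m2 _ Uw) ?(m3 _ Uw) ?(a2 _ Uw) ?(a3 _ Uw) ?(b2 _ Uw) ?(b3 _ Uw).
    have [-> cn] := conD _ _ _ (jcE cc) (jcF cs) Uw.
    by rewrite (Int_FTC2 twopi_ge0 cn (fun t _ => dder w t Uw)) periodic subrr.
  have [-> cn] := conD _ _ _ (jcF cc) (jcN (jcE cs)) Uw.
  by rewrite (Int_FTC2 twopi_ge0 cn (fun t _ => ider w t Uw)) periodic subrr.
have U0 : udisc 0 by rewrite udiscE /= expr0n /= addr0.
have E w : udisc w -> Int 0 (2 * pi) (pkernel w) = - (2 * pi) - 2 * (W cos ratA w + W sin ratB w).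
  move=> Uw; have [-> cn] := conD _ _ _ (jcA cc) (jcB cs) Uw.
  rewrite -IntZ// -[- (2 * pi)](_ : Int 0 (2 * pi) (fun=> -1) = _); last by rewrite Int_cst// subr0 mulN1r.
  by rewrite -IntB//; [exact: cont_on_cst|move=> t ht; apply: contM; [exact: cont_cst|exact: cn]].
move=> Uz; rewrite E// H'// -E//.
by rewrite (eq_Int (g := fun=> 1)) ?Int_cst ?subr0 ?mul1r// => t _; rewrite pkernel0.
Qed.
End Poisson.

(** * The Dirichlet problem on discs *)

Section Dirichlet.
Context {R : realType}.
Local Notation C := R[i]^o.
Implicit Types (z w c : C) (f g : C -> R) (U V K : set C).

Lemma within_continuousP K f : {within K, continuous f} <->
  forall z, K z -> forall e : R, 0 < e ->
    exists2 d : R, 0 < d & forall w, K w -> modulus (w - z) < d -> `|f w - f z| < e.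
Proof.
rewrite subspace_continuousP; split=> H z Kz.
  move=> e e0; have /cvgrPdist_lt /(_ _ e0) := H z Kz.
  rewrite /within /= => /nbhs_modulus[d d0 Hd]; exists d => // w Kw wd.
  by rewrite distrC; apply: Hd.
apply/cvgrPdist_lt => e e0; have [d d0 Hd] := H z Kz e e0.
by apply/nbhs_modulus; exists d => // w wd Kw; rewrite distrC; apply: Hd.
Qed.

Lemma continuous_within K f : (forall z, K z -> {for z, continuous f}) -> {within K, continuous f}.
Proof.
move=> H; apply/within_continuousP => z Kz e e0.
have [d d0 Hd] := (continuous_modulusP _ _).1 (H z Kz) e e0.
by exists d => // w _; exact: Hd.
Qed.

Definition expi (t : R) : C := cos t +i* sin t.

Lemma modulus_expi t : modulus (expi t) = 1.
Proof. by rewrite modulusE /= cos2Dsin2 sqrtr1. Qed.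

Lemma continuous_expi t : {for t, continuous expi}.
Proof. by apply: continuous_complex; [exact: continuous_cos|exact: continuous_sin]. Qed.

Lemma continuous_circle f : {within [set z | modulus z = 1], continuous f} ->
  forall t, {for t, continuous (fun t => f (expi t))}.
Proof.
move=> /within_continuousP cf t; apply/(@cvgrPdist_lt _ _ _ _ (nbhs_filter t)) => e e0.
have [d d0 Hd] := cf _ (modulus_expi t) e e0.
have H : \forall s \near t, modulus (expi s - expi t) < d := @continuous_expi t _ (near_modulus (expi t) d0).
apply: (@filterS _ _ (nbhs_filter t) _ _ _ H) => s hs.
by rewrite distrC; apply: Hd => //; exact: modulus_expi.
Qed.

Local Notation udisc := (odisc (0 : C) 1).

Lemma denominatorE z t : (complex.Re z - cos t) ^+ 2 + (complex.Im z - sin t) ^+ 2 = modulus (z - expi t) ^+ 2.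
Proof. by rewrite sqr_modulus ReB ImB. Qed.

Lemma poissonB (g : R -> R) (a : R) z : (forall t, {for t, continuous g}) -> udisc z ->
  poisson g z - a = (2 * pi)^-1 * Int 0 (2 * pi) (fun t => (g t - a) * pkernel z t).
Proof.
move=> cg Uz.
have p0 : 2 * pi != 0 :> R by rewrite mulf_neq0// gt_eqF// pi_gt0.
have ck : cont_on 0 (2 * pi) (pkernel z) by exact: jc_cont_on (@cont_pkernel R) Uz.
rewrite (eq_Int (g := fun t => g t * pkernel z t - a * pkernel z t)); last by move=> t _; rewrite mulrBl.
rewrite IntB; [|by move=> t ht; apply: contM; [exact: cg|exact: ck]|by move=> t ht; apply: contM; [exact: cont_cst|exact: ck]].
by rewrite IntZ// Int_pkernel// mulrBr -/(poisson g z) mulrCA mulVf// mulr1.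
Qed.

(** Parameters near [e0] contribute at most [e / 2], as the normalised kernel has total mass 1; the
    others contribute at most [e / 4], as the kernel tends to 0 away from [e0]. *)
Lemma poisson_boundary (f : C -> R) e0 (e : R) : {within [set z | modulus z = 1], continuous f} ->
  modulus e0 = 1 -> 0 < e ->
  exists2 d : R, 0 < d & forall z, udisc z -> modulus (z - e0) < d ->
    `|poisson (fun t => f (expi t)) z - f e0| < e.
Proof.
move=> cf me0 e_gt0; have cg := continuous_circle cf.
have twopi_gt0 : 0 < 2 * pi :> R by rewrite mulr_gt0// pi_gt0.
have [M HM] : exists M, forall t, 0 <= t <= 2 * pi -> `|f (expi t) - f e0| <= M.
  have [] := @compact_EVT_max _ _ (fun t => `|f (expi t) - f e0|) `[0, 2 * pi].
  - by exists 0; rewrite /= in_itv /= lexx ltW.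
  - exact: segment_compact.
  - apply: cont_on_within => t _; apply: (@cont_comp _ _ (fun t => f (expi t) - f e0) Num.Def.normr).
      by apply: contB; [exact: cg|exact: cont_cst].
    exact: norm_continuous.
  by move=> t0 _ H; exists (`|f (expi t0) - f e0|) => t ht; apply: H; rewrite inE /= in_itv.
have M0 : 0 <= M by apply: le_trans (HM 0 _) => //; rewrite lexx ltW.
have [h h0 Hh] := (within_continuousP _ _).1 cf e0 me0 (e / 2) (ltac:(by rewrite divr_gt0)).
(* With [d <= h / 2], a point of the circle at distance at least [h] from [e0] is at distance at
   least [h / 2] from [z]. The kernel is then at most [2 d / (h^2 / 4)], and the second bound makes
   this at most [e / (4 (M + 1))]. *)
pose d := Num.min (h / 2) (e * h ^+ 2 / (32 * (M + 1))).
have h2 : 0 < h ^+ 2 by rewrite exprn_gt0.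
have d0 : 0 < d by rewrite lt_min !divr_gt0// ?mulr_gt0//; lra.
exists d => // z Uz; rewrite lt_min => /andP[zd1 zd2].
have m1 : 1 - modulus z <= modulus (z - e0).
  by have := modulusD (e0 - z) z; rewrite subrK me0 (modulusC e0); lra.
have z1 : modulus z < 1 by move: Uz; rewrite /odisc /= subr0.
have mz := modulus_ge0 z.
have K0 t : 0 <= pkernel z t by exact: pkernel_ge0.
have key t : 0 <= t <= 2 * pi -> `|(f (expi t) - f e0) * pkernel z t| <= e / 2 * pkernel z t + e / 4.
  move=> ht; rewrite normrM (ger0_norm (K0 t)).
  have [te|te] := ltP (modulus (expi t - e0)) h.
    have := Hh _ (modulus_expi t) te; have := K0 t; nra.
  have Kb : pkernel z t <= e / (4 * (M + 1)).
    rewrite pkernelE// denominatorE -sqr_modulus.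
    have far : h / 2 <= modulus (z - expi t).
      have := modulusD (expi t - z) (z - e0); rewrite subrKA (modulusC (expi t) z); lra.
    have D0 : 0 < modulus (z - expi t) ^+ 2 by rewrite exprn_gt0//; lra.
    rewrite ler_pdivrMr// .
    have n1 : 1 - modulus z ^+ 2 <= 2 * modulus (z - e0) by nra.
    have n2 : h ^+ 2 / 4 <= modulus (z - expi t) ^+ 2 by nra.
    apply: le_trans n1 _; apply: (@le_trans _ _ (e / (4 * (M + 1)) * (h ^+ 2 / 4))); last first.
      by rewrite ler_pM2l// divr_gt0// mulr_gt0//; lra.
    rewrite (_ : e / (4 * (M + 1)) * (h ^+ 2 / 4) = 2 * (e * h ^+ 2 / (32 * (M + 1)))); first lra.
    by field; lra.
  have := HM t ht; have := K0 t => k0 hM.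
  have : `|f (expi t) - f e0| * pkernel z t <= M * (e / (4 * (M + 1))) by apply: ler_pM.
  have : M * (e / (4 * (M + 1))) <= e / 4.
    rewrite (_ : M * (e / (4 * (M + 1))) = e / 4 * (M / (M + 1))); last by field; lra.
    by rewrite ger_pMr ?divr_gt0// ler_pdivrMr; lra.
  by nra.
have ck : cont_on 0 (2 * pi) (pkernel z) by exact: jc_cont_on (@cont_pkernel R) Uz.
have cfk : cont_on 0 (2 * pi) (fun t => (f (expi t) - f e0) * pkernel z t).
  by move=> t ht; apply: contM; [apply: contB; [exact: cg|exact: cont_cst]|exact: ck].
have ce : cont_on 0 (2 * pi) (fun t => e / 2 * pkernel z t + e / 4).
  by move=> t ht; apply: contD; [apply: contM; [exact: cont_cst|exact: ck]|exact: cont_cst].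
have Ie : Int 0 (2 * pi) (fun t => e / 2 * pkernel z t + e / 4) = 3 / 4 * e * (2 * pi).
  rewrite IntD; [|by move=> t ht; apply: contM; [exact: cont_cst|exact: ck]|exact: cont_on_cst].
  rewrite (IntZ _ ck) (Int_pkernel Uz) (Int_cst _ (ltW twopi_gt0)) subr0.
  by move: (2 * pi) => P; field.
rewrite (@poissonB _ (f e0) z cg Uz) normrM gtr0_norm ?invr_gt0// ltr_pdivrMl//.
apply: (@le_lt_trans _ _ (3 / 4 * e * (2 * pi))); last first.
  by rewrite mulrC ltr_pM2l//; lra.
rewrite -Ie ler_norml; apply/andP; split.
  rewrite -mulN1r -IntZ//; apply: le_Int => // [t ht|t ht]; first by apply: contM; [exact: cont_cst|exact: ce].
  by have := key t ht; rewrite ler_norml mulN1r => /andP[].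
by apply: le_Int => // t ht; have := key t ht; rewrite ler_norml => /andP[].
Qed.

(** The last clause is Harnack's inequality, included here because the solution is afterwards known
    only through its properties and no longer as an integral. *)
Lemma dirichlet_unit (f : C -> R) : {within [set z | modulus z = 1], continuous f} ->
  exists u : C -> R, [/\ harmonic_on udisc u, {within cdisc 0 1, continuous u},
    (forall z, modulus z = 1 -> u z = f z) &
    (forall z, modulus z = 1 -> 0 <= f z) -> forall z, modulus z <= 2^-1 -> u z <= 3 * u 0].
Proof.
move=> cf; have cg := continuous_circle cf.
have hp := poisson_harmonic cg.
pose u z := if modulus z < 1 then poisson (fun t => f (expi t)) z else f z.
have uE z : udisc z -> poisson (fun t => f (expi t)) z = u z.
  by rewrite /odisc /= subr0 /u => ->.
have hu : harmonic_on udisc u := eq_harmonic (@open_udisc R) uE hp.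
exists u; split => //.
- apply/within_continuousP => z; rewrite /cdisc /= subr0 le_eqVlt => /orP[/eqP mz|mz] e e0; last first.
    have Uz : udisc z by rewrite /odisc /= subr0.
    have [d d0 Hd] := (continuous_modulusP _ _).1 (harmonic_continuous (@open_udisc R) hu Uz) e e0.
    by exists d => // w _; exact: Hd.
  have [d1 d10 Hd1] := poisson_boundary cf mz e0.
  have [d2 d20 Hd2] := (within_continuousP _ _).1 cf z mz e e0.
  exists (Num.min d1 d2); first by rewrite lt_min d10.
  move=> w; rewrite /= subr0 lt_min => mw /andP[wd1 wd2].
  have -> : u z = f z by rewrite /u mz ltxx.
  rewrite /u; case: ifPn => [w1|]; first by apply: Hd1; rewrite ?/odisc /= ?subr0.
  by rewrite -leNgt => w1; apply: Hd2 => //=; apply/eqP; rewrite eq_le mw.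
- by move=> z mz; rewrite /u mz ltxx.
- move=> f0 z z2.
  have Uz : udisc z by rewrite /odisc /= subr0; lra.
  have U0 : udisc 0 by rewrite udiscE /= expr0n /= addr0.
  rewrite -!uE// /poisson mulrCA ler_pM2l ?invr_gt0 ?mulr_gt0 ?pi_gt0//.
  have ck w : udisc w -> cont_on 0 (2 * pi) (fun t => f (expi t) * pkernel w t).
    by move=> Uw t ht; apply: contM; [exact: cg|exact: (jc_cont_on (@cont_pkernel R) Uw ht)].
  rewrite -IntZ; last exact: ck.
  apply: le_Int; [exact: ck|by move=> t ht; apply: contM; [exact: cont_cst|exact: (ck _ U0)]|].
  move=> t _; have := pkernel_le3 t z2; rewrite pkernel0 mulr1.
  have : 0 <= f (expi t) by apply: f0; exact: modulus_expi.
  nra.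
Qed.

Lemma dirichlet c (r : R) (f : C -> R) : 0 < r -> {within [set z | modulus (z - c) = r], continuous f} ->
  exists u : C -> R, [/\ harmonic_on (odisc c r) u, {within cdisc c r, continuous u},
    (forall z, modulus (z - c) = r -> u z = f z) &
    (forall z, modulus (z - c) = r -> 0 <= f z) -> forall z, modulus (z - c) <= r / 2 -> u z <= 3 * u c].
Proof.
move=> r0 cf.
pose S w : C := (complex.Re c + r * complex.Re w) +i* (complex.Im c + r * complex.Im w).
pose T z : C := (r^-1 * (complex.Re z - complex.Re c)) +i* (r^-1 * (complex.Im z - complex.Im c)).
have rn : r != 0 by rewrite gt_eqF.
have ST z : S (T z) = z.
  by rewrite /S /T /= !mulrA !mulfV// !mul1r !(addrC _ (_ - _)) !subrK complex_eta.
have md (k a b : R) : 0 <= k -> modulus (k * a +i* (k * b)) = k * modulus (a +i* b).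
  move=> k0; rewrite !modulusE /= !exprMn -mulrDr sqrtrM ?sqr_ge0// sqrtr_sqr ger0_norm//.
have mT z z' : modulus (T z - T z') = r^-1 * modulus (z - z').
  rewrite -[T z - T z']complex_eta -[z - z']complex_eta !ReB !ImB -md ?invr_ge0 ?ltW//.
  by congr (modulus (_ +i* _)); rewrite /T /=; ring.
have mS z z' : modulus (S z - S z') = r * modulus (z - z').
  rewrite -[S z - S z']complex_eta -[z - z']complex_eta !ReB !ImB -md ?ltW//.
  by congr (modulus (_ +i* _)); rewrite /S /=; ring.
have S0 : S 0 = c by rewrite /S /= !mulr0 !addr0 complex_eta.
have T0 : T c = 0 by rewrite /T !subrr !mulr0.
have cfS : {within [set z | modulus z = 1], continuous (fun w => f (S w))}.
  apply/within_continuousP => z /= mz e e0.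
  have mSz w : modulus w = 1 -> modulus (S w - c) = r by move=> h; rewrite -S0 mS subr0 h mulr1.
  have [d d0 Hd] := (within_continuousP _ _).1 cf (S z) (mSz z mz) e e0.
  exists (r^-1 * d); first by rewrite mulr_gt0// invr_gt0.
  by move=> w /= mw wd; apply: Hd; [exact: mSz|rewrite mS -ltr_pdivlMl].
have [u [hu cu uf Hu]] := dirichlet_unit cfS.
have mT0 z : modulus (T z) = r^-1 * modulus (z - c) by rewrite -[T z]subr0 -T0 mT.
exists (fun z => u (T z)); split.
- have oD := @open_odisc R c r.
  have dT1 : [/\ C1 (odisc c r) (fun z => r^-1 * (complex.Re z - complex.Re c)),
     forall z, odisc c r z -> dx (fun z => r^-1 * (complex.Re z - complex.Re c)) z = r^-1 &
     forall z, odisc c r z -> dy (fun z => r^-1 * (complex.Re z - complex.Re c)) z = 0].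
    apply: C1I => // z _; [exact: (isdx_Re (h := fun t => r^-1 * (t - complex.Re c)) (is_derive_lin_shift _ _ _))| |exact: cont_cst|exact: cont_cst].
    exact: (isdy_Re (fun t => r^-1 * (t - complex.Re c))).
  have dT2 : [/\ C1 (odisc c r) (fun z => r^-1 * (complex.Im z - complex.Im c)),
     forall z, odisc c r z -> dx (fun z => r^-1 * (complex.Im z - complex.Im c)) z = 0 &
     forall z, odisc c r z -> dy (fun z => r^-1 * (complex.Im z - complex.Im c)) z = r^-1].
    apply: C1I => // z _; [|exact: (isdy_Im (h := fun t => r^-1 * (t - complex.Im c)) (is_derive_lin_shift _ _ _))|exact: cont_cst|exact: cont_cst].
    exact: (isdx_Im (fun t => r^-1 * (t - complex.Im c))).
  apply: (harmonic_comp (@open_udisc R) oD hu).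
  + apply: harmonicZ => //; apply: harmonicB => //; [exact: harmonic_Re|exact: harmonic_cst].
  + apply: harmonicZ => //; apply: harmonicB => //; [exact: harmonic_Im|exact: harmonic_cst].
  + by move=> z zr; change (modulus (T z - 0) < 1); rewrite subr0 mT0 mulrC ltr_pdivrMr// mul1r.
  + by case: dT1 dT2 => [_ a1 a2] [_ b1 b2] z zr; rewrite a1// a2// b1// b2// oppr0.
- apply/within_continuousP => z zr e e0.
  have inT w : cdisc c r w -> cdisc 0 1 (T w).
    by move=> h; change (modulus (T w - 0) <= 1); rewrite subr0 mT0 mulrC ler_pdivrMr// mul1r.
  have [d d0 Hd] := (within_continuousP _ _).1 cu (T z) (inT _ zr) e e0.
  exists (r * d); first by rewrite mulr_gt0.
  by move=> w wr wd; apply: Hd; [exact: inT|rewrite mT ltr_pdivrMl].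
- by move=> z zr; rewrite uf ?ST// mT0 zr mulVf.
- move=> f0 z zr; rewrite T0; apply: Hu.
    by move=> w w1; apply: f0; rewrite -S0 mS subr0 w1 mulr1.
  by rewrite mT0 ler_pdivrMl.
Qed.

End Dirichlet.

Section C2Partials.
Context {R : realType}.
Local Notation C := R[i]^o.
Implicit Types (f g : C -> R) (U : set C).

Lemma C2_dx U f : C2 U f -> C1 U (dx f).
Proof. by case. Qed.

Lemma C2_dy U f : C2 U f -> C1 U (dy f).
Proof. by case. Qed.

Lemma C1BE U f g : open U -> C1 U f -> C1 U g -> [/\ C1 U (fun z => f z - g z),
  forall z, U z -> dx (fun z => f z - g z) z = dx f z - dx g z &
  forall z, U z -> dy (fun z => f z - g z) z = dy f z - dy g z].
Proof.
move=> oU cf cg; have [k1 k2 k3] := C1_cstE (-1) oU.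
have [a1 a2 a3] := C1ME oU k1 cg; have [b1 b2 b3] := C1DE oU cf a1.
have E w : U w -> f w + -1 * g w = f w - g w by rewrite mulN1r.
split; first exact: (eq_C1 oU E b1).
  by move=> z Uz; rewrite -(eq_dx oU E Uz) b2// a2// k2//; ring.
by move=> z Uz; rewrite -(eq_dy oU E Uz) b3// a3// k3//; ring.
Qed.

End C2Partials.

Opaque C2 harmonic_on.

(** * Harnack's inequality, uniform limits and removable singularities *)

Section HarmonicFunctions.
Context {R : realType}.
Local Notation C := R[i]^o.
Implicit Types (z w c : C) (f g h u H : C -> R) (U V K : set C).

Lemma open_punctured c : open [set z : C | z != c].
Proof.
apply/openP_modulus => z /=; rewrite -modulus_sub_gt0 => zc; exists (modulus (z - c)) => // w wz.
rewrite -modulus_sub_gt0; have := modulusD (z - w) (w - c).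
by rewrite subrKA (modulusC z w); lra.
Qed.

Lemma odisc_cdisc c r : odisc c r `<=` cdisc c r.
Proof. by move=> z; exact: ltW. Qed.

Lemma cdisc_center c (r : R) : 0 <= r -> cdisc c r c.
Proof. by move=> r0; change (modulus (c - c) <= r); rewrite subrr modulus0. Qed.

Lemma odisc_center c (r : R) : 0 < r -> odisc c r c.
Proof. by move=> r0; change (modulus (c - c) < r); rewrite subrr modulus0. Qed.

Lemma cdisc_split c r z : cdisc c r z -> modulus (z - c) = r \/ odisc c r z.
Proof.
by move=> h; have := h : modulus (z - c) <= r; rewrite le_eqVlt => /orP[/eqP|]; [left|right].
Qed.

Lemma open_cdisc U z : open U -> U z -> exists2 r : R, 0 < r & cdisc z r `<=` U.
Proof.
move=> /openP_modulus oU /oU[e e0 He]; exists (e / 2); first by rewrite divr_gt0.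
by move=> w h; apply: He; have : modulus (w - z) <= e / 2 := h; lra.
Qed.

Lemma withinB K f g : {within K, continuous f} -> {within K, continuous g} ->
  {within K, continuous (fun z => f z - g z)}.
Proof. by move=> cf cg x; exact: (@contB R (subspace K) f g x (cf x) (cg x)). Qed.

Lemma withinZ K (a : R) f : {within K, continuous f} -> {within K, continuous (fun z => a * f z)}.
Proof.
move=> cf x; exact: (@contM R (subspace K) (fun=> a) f x (@cont_cst R (subspace K) a x) (cf x)).
Qed.

Lemma within_cst K (a : R) : {within K, continuous (fun=> a : R)}.
Proof. by apply: continuous_within => z _; exact: cont_cst. Qed.

Lemma withinS K K' f : K' `<=` K -> {within K, continuous f} -> {within K', continuous f}.
Proof. exact: continuous_subspaceW. Qed.

Lemma maximum_principle_disc c (r : R) f : harmonic_on (odisc c r) f -> {within cdisc c r, continuous f} ->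
  (forall z, modulus (z - c) = r -> f z <= 0) -> forall z, cdisc c r z -> f z <= 0.
Proof.
move=> hf cf f0; apply: maximum_principle => //; first exact: compact_cdisc.
move=> z /cdisc_split[/f0 h|zr fz]; first by rewrite ltNge h.
by exists (odisc c r); split => //; [exact: open_odisc|exact: odisc_cdisc].
Qed.

Lemma harmonic_eq_disc c (r : R) f g : harmonic_on (odisc c r) f -> {within cdisc c r, continuous f} ->
  harmonic_on (odisc c r) g -> {within cdisc c r, continuous g} ->
  (forall z, modulus (z - c) = r -> f z = g z) -> forall z, cdisc c r z -> f z = g z.
Proof.
move=> hf cf hg cg fg z zr; have oD := @open_odisc R c r.
apply/eqP; rewrite eq_le -!(subr_le0 _ (_ z)); apply/andP; split.
  apply: (@maximum_principle_disc c r (fun z => f z - g z)).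
  - exact: harmonicB oD hf hg.
  - exact: withinB cf cg.
  - by move=> w /fg ->; rewrite subrr.
  - exact: zr.
apply: (@maximum_principle_disc c r (fun z => g z - f z)).
- exact: harmonicB oD hg hf.
- exact: withinB cg cf.
- by move=> w /fg ->; rewrite subrr.
- exact: zr.
Qed.

(** Uniqueness identifies [H] with the Dirichlet solution of its own boundary values, for which the
    estimate is known. *)
Lemma harnack c (r : R) H : 0 < r -> harmonic_on (odisc c r) H -> {within cdisc c r, continuous H} ->
  (forall z, modulus (z - c) = r -> 0 <= H z) -> forall z, modulus (z - c) <= r / 2 -> H z <= 3 * H c.
Proof.
move=> r0 hH cH H0 z zr.
have cc : {within [set z | modulus (z - c) = r], continuous H}.
  by apply: withinS cH => w /= wr; change (modulus (w - c) <= r); rewrite wr.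
have [u [hu cu uH hau]] := dirichlet r0 cc.
have E w : cdisc c r w -> H w = u w by apply: harmonic_eq_disc => // v /uH.
rewrite !E; [exact: hau|exact: cdisc_center (ltW r0)|change (modulus (z - c) <= r); lra].
Qed.

Lemma harmonic_within c (r : R) U H : open U -> cdisc c r `<=` U -> harmonic_on U H ->
  harmonic_on (odisc c r) H /\ {within cdisc c r, continuous H}.
Proof.
move=> oU sU hH; split; first by apply: harmonicS hH => z /odisc_cdisc/sU.
by apply: continuous_within => z /sU; exact: harmonic_continuous.
Qed.

(** On a small disc the limit is continuous. The maximum principle compares the Dirichlet solution
    for its boundary values with each approximating [H], so this solution is the limit itself;
    derivatives of the [H] are never followed. *)
Lemma harmonic_uniform_limit U f : open U ->
  (forall e : R, 0 < e -> exists2 H, harmonic_on U H & forall z, U z -> `|f z - H z| <= e) ->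
  harmonic_on U f.
Proof.
move=> oU lim_f; apply: harmonic_local => c Uc.
have [r r0 rU] := open_cdisc oU Uc.
have cf : {within cdisc c r, continuous f}.
  apply/within_continuousP => z zr e e0.
  have [H hH fH] := lim_f (e / 4) (ltac:(by rewrite divr_gt0)).
  have [d d0 Hd] := (continuous_modulusP _ _).1 (harmonic_continuous oU hH (rU _ zr)) (e / 4) (ltac:(by rewrite divr_gt0)).
  exists d => // w wr /Hd; have := fH z (rU _ zr); have := fH w (rU _ wr).
  rewrite !ler_norml !ltr_norml; lra.
have cc : {within [set z | modulus (z - c) = r], continuous f}.
  by apply: withinS cf => w /= wr; change (modulus (w - c) <= r); rewrite wr.
have [u [hu cu uf _]] := dirichlet r0 cc.
exists (odisc c r); split; [exact: open_odisc|exact: odisc_center|].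
apply: (eq_harmonic (@open_odisc R c r) _ hu) => z zr.
have key e : 0 < e -> `|u z - f z| <= e.
  move=> e0; have [H hH fH] := lim_f (e / 2) (ltac:(by rewrite divr_gt0)).
  have [hH1 cH1] := harmonic_within oU rU hH.
  have oD := @open_odisc R c r.
  have b1 : u z - H z - e / 2 <= 0.
    apply: (@maximum_principle_disc c r (fun z => u z - H z - e / 2)); last exact: odisc_cdisc.
    - exact: harmonicB oD (harmonicB oD hu hH1) (harmonic_cst _ oD).
    - exact: withinB (withinB cu cH1) (@within_cst _ _).
    - move=> w wr; rewrite uf//; have := fH w (rU w (ltac:(by change (modulus (w - c) <= r); rewrite wr))).
      by rewrite ler_norml; lra.
  have b2 : H z - u z - e / 2 <= 0.
    apply: (@maximum_principle_disc c r (fun z => H z - u z - e / 2)); last exact: odisc_cdisc.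
    - exact: harmonicB oD (harmonicB oD hH1 hu) (harmonic_cst _ oD).
    - exact: withinB (withinB cH1 cu) (@within_cst _ _).
    - move=> w wr; rewrite uf//; have := fH w (rU w (ltac:(by change (modulus (w - c) <= r); rewrite wr))).
      by rewrite ler_norml; lra.
  have := fH z (rU _ (odisc_cdisc zr)); rewrite !ler_norml; lra.
apply/eqP; rewrite -subr_eq0 -normr_eq0 eq_le normr_ge0 andbT leNgt; apply/negP => n0.
by have := key (`|u z - f z| / 2) (ltac:(by rewrite divr_gt0)); lra.
Qed.

(** The extension is the Dirichlet solution on a smaller disc. Its difference from [f] is bounded
    and vanishes on the circle, hence lies below [e ln (s / |z - c|)] for every [e > 0], and [e]
    tends to 0. *)
Lemma removable_singularity c (r M : R) f : 0 < r ->
  harmonic_on [set z | odisc c r z /\ z != c] f ->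
  (forall z, odisc c r z -> z != c -> `|f z| <= M) ->
  exists2 H, harmonic_on (odisc c r) H & forall z, odisc c r z -> z != c -> H z = f z.
Proof.
move=> r0 hf fM; pose s := r / 2.
have s0 : 0 < s by rewrite divr_gt0.
have oP : open [set z | odisc c r z /\ z != c].
  by apply: openI; [exact: open_odisc|exact: open_punctured].
have sr z : cdisc c s z -> odisc c r z.
  by move=> h; have : modulus (z - c) <= s := h; rewrite /s => h'; change (modulus (z - c) < r); lra.
have cf z : odisc c r z -> z != c -> {for z, continuous f}.
  by move=> zr zc; exact: harmonic_continuous oP hf (conj zr zc).
have cc : {within [set z | modulus (z - c) = s], continuous f}.
  apply: continuous_within => z /= zs; apply: cf; last by rewrite -modulus_sub_gt0 zs.
  by apply: sr; change (modulus (z - c) <= s); rewrite zs.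
have [u [hu cu uf _]] := dirichlet s0 cc.
have M0 : 0 <= M.
  have cs : modulus ((c + s%:C) - c) = s.
    rewrite addrC addKr modulusE /= expr0n /= addr0 sqrtr_sqr ger0_norm// ltW//.
  apply: le_trans (fM (c + s%:C) _ _); [exact: normr_ge0| |by rewrite -modulus_sub_gt0 cs].
  by apply: sr; change (modulus (c + s%:C - c) <= s); rewrite cs.
have fM' z : modulus (z - c) = s -> `|f z| <= M.
  move=> zs; apply: fM; last by rewrite -modulus_sub_gt0 zs.
  by apply: sr; change (modulus (z - c) <= s); rewrite zs.
have oD := @open_odisc R c s.
have uM z : cdisc c s z -> `|u z| <= M.
  move=> zs; rewrite ler_norml; apply/andP; split.
    rewrite -subr_le0; apply: (@maximum_principle_disc c s (fun z => - M - u z)).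
    - exact: harmonicB oD (harmonic_cst _ oD) hu.
    - exact: withinB (@within_cst _ _) cu.
    - by move=> w ws; rewrite uf//; have := fM' w ws; rewrite ler_norml; lra.
    - exact: zs.
  rewrite -subr_le0; apply: (@maximum_principle_disc c s (fun z => u z - M)).
  - exact: harmonicB oD hu (harmonic_cst _ oD).
  - exact: withinB cu (@within_cst _ _).
  - by move=> w ws; rewrite uf//; have := fM' w ws; rewrite ler_norml; lra.
  - exact: zs.
have onesided (a : R) z e : `|a| = 1 -> 0 < e -> cdisc c s z -> z != c ->
    a * (f z - u z) <= e * (ln s - ln (modulus (z - c))).
  (* At radius [k] the logarithmic barrier has reached [2 M], the bound for [|f - u|], so the
     maximum principle is applied on the annulus outside. The sign [a] treats both one-sided
     estimates at once. *)
  move=> a1 e0 zs zc; pose k := s * expR (- (2 * M / e)).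
  have k0 : 0 < k by rewrite mulr_gt0// expR_gt0.
  have ka (w : C) : modulus (w - c) <= k -> 0 < modulus (w - c) -> 2 * M <= e * (ln s - ln (modulus (w - c))).
    move=> wk w0; have : ln (modulus (w - c)) <= ln k by rewrite ler_ln.
    rewrite /k lnM ?posrE ?expR_gt0// expRK => h.
    have : 2 * M = e * (2 * M / e) by field; rewrite gt_eqF.
    nra.
  have fu w : cdisc c s w -> w != c -> a * (f w - u w) <= 2 * M.
    move=> ws wc; apply: le_trans (ler_norm _) _; rewrite normrM a1 mul1r.
    by have := fM w (sr _ ws) wc; have := uM w ws; rewrite !ler_norml; lra.
  have zc0 : 0 < modulus (z - c) by rewrite modulus_sub_gt0.
  have [zk|zk] := leP (modulus (z - c)) k; first exact: le_trans (fu z zs zc) (ka z zk zc0).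
  pose K := [set w | cdisc c s w /\ k <= modulus (w - c)].
  have Kc w : K w -> w != c by case=> _ h; rewrite -modulus_sub_gt0; lra.
  rewrite -subr_le0; apply: (@maximum_principle R K (fun z => a * (f z - u z) - e * (ln s - ln (modulus (z - c))))).
  - apply: (@subclosed_compact _ _ (cdisc c s)); [|exact: compact_cdisc|by move=> w []].
    apply: closedI; first exact: closed_cdisc.
    rewrite -openC; apply/openP_modulus => w /= /negP; rewrite -ltNge => wk.
    exists (k - modulus (w - c)); first by rewrite subr_gt0.
    move=> v vw; apply/negP; rewrite -ltNge.
    by have := modulusD (v - w) (w - c); rewrite subrKA; lra.
  - apply: withinB.
      apply: withinZ; apply: withinB; last by apply: withinS cu => w [].
      by apply: continuous_within => w Kw; apply: cf; [apply: sr; case: Kw|exact: Kc].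
    apply: withinZ; apply: continuous_within => w /Kc wc; apply: contB; first exact: cont_cst.
    exact: harmonic_continuous (@open_punctured c) (harmonic_ln_modulus c) wc.
  - move=> w [ws wk] pos; exists (odisc c s `&` [set w | k < modulus (w - c)]).
    have w0 : 0 < modulus (w - c) by lra.
    have oV : open (odisc c s `&` [set w | k < modulus (w - c)]).
      apply: openI => //; apply/openP_modulus => v /= vk; exists (modulus (v - c) - k); first by rewrite subr_gt0.
      by move=> x xv; have := modulusD (v - x) (x - c); rewrite subrKA (modulusC v x); lra.
    have VP : odisc c s `&` [set w | k < modulus (w - c)] `<=` [set z | odisc c r z /\ z != c].
      by move=> v [/odisc_cdisc/sr ? /= vk]; split => //; rewrite -modulus_sub_gt0; lra.
    split.
    + exact: oV.
    + split.
        have [h|//] := cdisc_split ws; move: pos; rewrite uf// h !subrr !mulr0 subrr ltxx//.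
      rewrite /= lt_neqAle wk andbT; apply/negP => /eqP h.
      have := ka w (ltac:(by rewrite h)) w0; have := fu w ws (ltac:(by rewrite -modulus_sub_gt0)); lra.
    + by move=> v [/odisc_cdisc ? /= /ltW].
    + have hf' := harmonicS VP hf.
      have hu' : harmonic_on (odisc c s `&` [set w | k < modulus (w - c)]) u by apply: harmonicS hu => v [].
      have hl : harmonic_on (odisc c s `&` [set w | k < modulus (w - c)]) (fun z => ln (modulus (z - c))).
        by apply: harmonicS (harmonic_ln_modulus c) => v /VP[].
      exact: harmonicB oV (harmonicZ a oV (harmonicB oV hf' hu')) (harmonicZ e oV (harmonicB oV (harmonic_cst _ oV) hl)).
  - by split => //; exact: ltW.
have E z : cdisc c s z -> z != c -> u z = f z.
  move=> zs zc; apply/eqP; rewrite -subr_eq0 -normr_eq0 eq_le normr_ge0 andbT leNgt; apply/negP => n0.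
  have l0 : 0 <= ln s - ln (modulus (z - c)).
    by rewrite subr_ge0 ler_ln ?posrE ?modulus_sub_gt0//.
  pose e := `|u z - f z| / (2 * (ln s - ln (modulus (z - c)) + 1)).
  have e0 : 0 < e by rewrite divr_gt0// mulr_gt0//; lra.
  have he : e * (ln s - ln (modulus (z - c))) < `|u z - f z|.
    have : e * (ln s - ln (modulus (z - c)) + 1) = `|u z - f z| / 2 by rewrite /e; field; lra.
    nra.
  have h1 := onesided 1 z e (normr1 _) e0 zs zc.
  have h2 := onesided (-1) z e (ltac:(by rewrite normrN1)) e0 zs zc.
  have : `|u z - f z| <= e * (ln s - ln (modulus (z - c))) by rewrite ler_norml; lra.
  lra.
exists (fun z => if z == c then u c else f z); last by move=> z _ /negPf ->.
apply: harmonic_local => z zr; have [->|zc] := eqVneq z c.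
  exists (odisc c s); split; [exact: oD|exact: odisc_center|].
  apply: (eq_harmonic oD _ hu) => w ws; case: eqVneq => [->//|wc]; apply: E => //; exact: odisc_cdisc.
exists [set z | odisc c r z /\ z != c]; split; [exact: oP|by []|].
by apply: (eq_harmonic oP _ hf) => w [_ /negPf ->].
Qed.

End HarmonicFunctions.

(** * Subharmonic functions and Perron's method *)

Section Subharmonic.
Context {R : realType}.
Local Notation C := R[i]^o.
Implicit Types (z w c : C) (f g h u v H L : C -> R) (U V K : set C).

(** Domination by harmonic functions on discs serves as the definition: it involves neither
    derivatives nor mean values and is stable under maxima and Poisson modification, which is what
    Perron's method uses. *)
Definition subharmonic U f := forall c (r : R) H, 0 < r -> cdisc c r `<=` U ->
  harmonic_on (odisc c r) H -> {within cdisc c r, continuous H} ->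
  (forall z, modulus (z - c) = r -> f z <= H z) -> forall z, cdisc c r z -> f z <= H z.

Lemma subharmonicS U V f : V `<=` U -> subharmonic U f -> subharmonic V f.
Proof.
by move=> VU sf c r H r0 cV; apply: sf => //; exact: subset_trans cV VU.
Qed.

Lemma eq_subharmonic U f g : (forall z, U z -> f z = g z) -> subharmonic U f -> subharmonic U g.
Proof.
move=> fg sf c r H r0 cU hH cH gH z zr; rewrite -fg; last exact: cU.
apply: (sf c r H r0 cU hH cH _ z zr) => w wr; rewrite fg; first exact: gH.
by apply: cU; change (modulus (w - c) <= r); rewrite wr.
Qed.

Lemma subharmonic_max U f g : subharmonic U f -> subharmonic U g ->
  subharmonic U (fun z => Num.max (f z) (g z)).
Proof.
move=> sf sg c r H r0 cU hH cH fgH z zr; rewrite ge_max; apply/andP; split.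
  by apply: (sf c r H r0 cU hH cH _ z zr) => w /fgH; rewrite ge_max => /andP[].
by apply: (sg c r H r0 cU hH cH _ z zr) => w /fgH; rewrite ge_max => /andP[].
Qed.

Lemma subharmonicB U f h : open U -> subharmonic U f -> harmonic_on U h ->
  subharmonic U (fun z => f z - h z).
Proof.
move=> oU sf hh c r H r0 cU hH cH fH z zr; rewrite lerBlDr.
have [h1 h2] := harmonic_within oU cU hh.
have oD := @open_odisc R c r.
apply: (sf c r (fun z => H z + h z) r0 cU _ _ _ z zr).
- exact: harmonicD oD hH h1.
- by move=> x; exact: (@contD R (subspace (cdisc c r)) H h x (cH x) (h2 x)).
- by move=> w wr; rewrite -lerBlDr; exact: fH.
Qed.

Lemma subharmonic_C2 U f : open U -> C2 U f -> (forall z, U z -> 0 <= lap f z) -> subharmonic U f.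
Proof.
move=> oU cf lf c r H r0 cU hH cH fH z zr; rewrite -subr_le0.
have oD := @open_odisc R c r.
apply: (@maximum_principle_C2 R (cdisc c r) (fun z => f z - H z)).
- exact: compact_cdisc.
- apply: withinB cH; apply: continuous_within => w /cU Uw; exact: C2_continuous oU cf Uw.
- move=> w wr; rewrite subr_gt0 => fw; have [h|wr'] := cdisc_split wr.
    by have := fH w h; rewrite leNgt fw.
  have DU : odisc c r `<=` U by move=> v /odisc_cdisc/cU.
  have [a b] := C2BE oD (C2S DU cf) (harmonic_C2 hH).
  exists (odisc c r); split; [exact: oD|exact: wr'|exact: odisc_cdisc|exact: a|].
  by rewrite (b _ wr') (harmonic_lap hH wr') subr0; apply: lf; exact: DU.
- exact: zr.
Qed.

(** Without derivatives there is no Laplacian to test at a maximum. Instead, let [z1] be a maximum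
    of [f + e |z|^2] on [K]. On a circle centred at [z1] the term [e |z|^2] coincides with an affine
    function, and the resulting affine function [l] dominates [f] on the circle but is smaller than
    [f z1] by [e r^2] at the centre. *)
Lemma subharmonic_maximum U K f : open U -> compact K -> K `<=` U -> subharmonic U f ->
  (forall z, U z -> {for z, continuous f}) -> (forall z, U z -> ~ K z -> f z <= 0) ->
  forall z, U z -> f z <= 0.
Proof.
move=> oU cK KU sf cf fK z0 Uz0; rewrite leNgt; apply/negP => f0.
have Kz0 : K z0 by apply: contrapT => /(fK _ Uz0); rewrite leNgt f0.
have [M M0 HM] := compact_bounded_plane cK.
pose e := f z0 / (2 * (M ^+ 2 + 1)).
have M1 : 0 < M ^+ 2 + 1 by nra.
have e0 : 0 < e by rewrite divr_gt0// mulr_gt0.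
have eM : e * M ^+ 2 < f z0.
  have : e * (M ^+ 2 + 1) = f z0 / 2 by rewrite /e; field; rewrite gt_eqF.
  nra.
pose F z := f z + e * sqdist 0 z.
have [z1 /set_mem Kz1 Hz1] : exists2 z1, z1 \in K & forall t, t \in K -> F t <= F z1.
  apply: compact_EVT_max; [by exists z0|exact: cK|].
  apply: continuous_within => z /KU Uz; apply: contD; first exact: cf.
  apply: contM; first exact: cont_cst.
  by have [c _] := @C2_sqdist R setT 0 openT; exact: C2_continuous openT c I.
have s2 z : K z -> 0 <= sqdist 0 z <= M ^+ 2.
  move=> /HM h; rewrite sqdist_ge0 sqdistE subr0.
  by have := modulus_ge0 z; nra.
have f1 : 0 < f z1.
  by have := Hz1 z0 (mem_set Kz0); rewrite /F; have := s2 _ Kz0; have := s2 _ Kz1; nra.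
have [r1 r10 r1U] := open_cdisc oU (KU _ Kz1).
pose a := complex.Re z1; pose b := complex.Im z1.
(* The last bound keeps [l] nonnegative on the circle, which may leave [K]; there only [f <= 0] is
   known. *)
pose r := Num.min r1 (Num.min 1 (f z1 / (e * (2 * (`|a| + `|b|) + 1)))).
have D0 : 0 < e * (2 * (`|a| + `|b|) + 1).
  by rewrite mulr_gt0//; have := normr_ge0 a; have := normr_ge0 b; lra.
have r0 : 0 < r by rewrite !lt_min r10 ltr01 divr_gt0.
have [rr1 r1' rD] : [/\ r <= r1, r <= 1 & r * (e * (2 * (`|a| + `|b|) + 1)) <= f z1].
  split; rewrite /r ?ge_min ?lexx ?orbT//.
  by rewrite -ler_pdivlMr// !ge_min lexx !orbT.
pose l z := f z1 - e * r ^+ 2 - 2 * e * a * (complex.Re z - a) - 2 * e * b * (complex.Im z - b).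
have key : f z1 <= l z1.
  apply: (sf z1 r l r0).
  - move=> z zr; apply: r1U; have h : modulus (z - z1) <= r := zr; exact: le_trans h rr1.
  - have oD := @open_odisc R z1 r.
    have := harmonic_affine (f z1 - e * r ^+ 2 + 2 * e * a * a + 2 * e * b * b) (- (2 * e * a)) (- (2 * e * b)) oD.
    by apply: eq_harmonic => // w _; rewrite /l; ring.
  - have := harmonic_affine (f z1 - e * r ^+ 2 + 2 * e * a * a + 2 * e * b * b) (- (2 * e * a)) (- (2 * e * b)) (@openT C) => h.
    apply: continuous_within => z _.
    apply: cont_ext (harmonic_continuous (@openT C) h I) => w; rewrite /l; ring.
  - move=> z zr.
    have sz : sqdist z1 z = r ^+ 2 by rewrite sqdistE zr.
    have sE : sqdist 0 z = sqdist 0 z1 + 2 * a * (complex.Re z - a) + 2 * b * (complex.Im z - b) + r ^+ 2.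
      by rewrite -sz /sqdist /= /a /b; ring.
    have hl : l z = f z1 + e * sqdist 0 z1 - e * sqdist 0 z by rewrite /l sE; ring.
    rewrite hl; have [Kz|nKz] := pselect (K z).
      by have := Hz1 z (mem_set Kz); rewrite /F; lra.
    have : f z <= 0.
      apply: fK => //; apply: r1U; change (modulus (z - z1) <= r1); by rewrite zr.
    have ha : a * (complex.Re z - a) <= `|a| * r.
      apply: le_trans (ler_norm _) _; rewrite normrM ler_wpM2l// -zr -ReB; exact: normr_Re_le.
    have hb : b * (complex.Im z - b) <= `|b| * r.
      apply: le_trans (ler_norm _) _; rewrite normrM ler_wpM2l// -zr -ImB; exact: normr_Im_le.
    have : e * (2 * (a * (complex.Re z - a)) + 2 * (b * (complex.Im z - b)) + r ^+ 2) <=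
        r * (e * (2 * (`|a| + `|b|) + 1)).
      have r2 : r ^+ 2 <= r by nra.
      by rewrite [X in _ <= X]mulrCA ler_pM2l//; lra.
    rewrite sE; nra.
  - exact: cdisc_center (ltW r0).
have : 0 < e * r ^+ 2 by rewrite mulr_gt0// exprn_gt0.
by move: key; rewrite /l /a /b !subrr !mulr0; lra.
Qed.

Section PoissonModification.
Variables (U : set C) (f : C -> R) (c : C) (r : R) (u : C -> R).
Hypotheses (oU : open U) (cf : forall z, U z -> {for z, continuous f}) (sf : subharmonic U f)
  (r0 : 0 < r) (cU : cdisc c r `<=` U) (hu : harmonic_on (odisc c r) u)
  (cu : {within cdisc c r, continuous u}) (uf : forall z, modulus (z - c) = r -> u z = f z).

Definition pmod z := if modulus (z - c) < r then u z else f z.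

Lemma pmod_in z : cdisc c r z -> pmod z = u z.
Proof.
by move=> /cdisc_split[h|h]; rewrite /pmod; [rewrite h ltxx uf|rewrite (h : modulus (z - c) < r)].
Qed.

Lemma pmod_out z : ~ odisc c r z -> pmod z = f z.
Proof. by move=> h; rewrite /pmod; case: ifPn. Qed.

Lemma le_pmod z : f z <= pmod z.
Proof.
have [h|h] := pselect (odisc c r z); last by rewrite pmod_out.
rewrite pmod_in; last exact: odisc_cdisc.
by apply: (sf r0 cU hu cu _ (odisc_cdisc h)) => w /uf ->.
Qed.

Lemma pmod_continuous z : U z -> {for z, continuous pmod}.
Proof.
move=> Uz; apply/continuous_modulusP => e e0.
have [h|h] := pselect (odisc c r z).
  have oD := @open_odisc R c r.
  have [d d0 Hd] := (continuous_modulusP _ _).1 (harmonic_continuous oD hu h) e e0.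
  have [d' d'0 Hd'] := (openP_modulus _).1 oD z h.
  exists (Num.min d d'); first by rewrite lt_min d0.
  move=> w; rewrite lt_min => /andP[wd wd'].
  rewrite !pmod_in; [exact: Hd|exact: odisc_cdisc|exact/odisc_cdisc/Hd'].
have [d d0 Hd] := (continuous_modulusP _ _).1 (cf Uz) e e0.
have [h2|h2] := pselect (cdisc c r z).
  have [//|zr] := (cdisc_split h2); last by [].
  have [d' d'0 Hd'] := (within_continuousP _ _).1 cu z h2 e e0.
  exists (Num.min d d'); first by rewrite lt_min d0.
  move=> w; rewrite lt_min => /andP[wd wd'].
  have [k|k] := pselect (odisc c r w).
    rewrite !pmod_in//; last exact: odisc_cdisc.
    by apply: Hd' => //; exact: odisc_cdisc.
  by rewrite !pmod_out//; exact: Hd.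
have [d' d'0 Hd'] := (openP_modulus _).1 (closed_openC (@closed_cdisc R c r)) z h2.
exists (Num.min d d'); first by rewrite lt_min d0.
move=> w; rewrite lt_min => /andP[wd wd'].
rewrite !pmod_out//; first exact: Hd.
by move=> /odisc_cdisc; exact: Hd'.
Qed.

(** A disc on which [pmod] is compared with [H] may overlap [cdisc c r] only partly. Outside
    [odisc c r] the function is [f]. On the intersection the maximum principle applies, since a
    boundary point lies on one of the two circles, where [pmod <= H] is already known. *)
Lemma pmod_subharmonic : subharmonic U pmod.
Proof.
move=> c' r' H r'0 c'U hH cH wH.
have fH z : cdisc c' r' z -> f z <= H z.
  by apply: (sf r'0 c'U hH cH) => w /wH; exact: le_trans (le_pmod w).
move=> z zr'; have [zr|zr] := pselect (odisc c r z); last by rewrite pmod_out//; exact: fH.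
rewrite -subr_le0.
have cp : {within cdisc c r `&` cdisc c' r', continuous pmod}.
  by apply: continuous_within => w [/cU Uw _]; exact: pmod_continuous.
have cH' : {within cdisc c r `&` cdisc c' r', continuous H} by apply: withinS cH => w [].
apply: (@maximum_principle R (cdisc c r `&` cdisc c' r') (fun z => pmod z - H z)).
- apply: (@subclosed_compact _ _ (cdisc c r)); [|exact: compact_cdisc|by move=> w []].
  by apply: closedI; exact: closed_cdisc.
- exact: withinB cp cH'.
- move=> w [wr wr']; rewrite subr_gt0 => pw.
  have oV : open (odisc c r `&` odisc c' r') by apply: openI; exact: open_odisc.
  exists (odisc c r `&` odisc c' r'); split; [exact: oV| | |].
  + split.
      have [h|//] := cdisc_split wr.
      move: pw; rewrite pmod_out; first by rewrite ltNge fH.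
      by move=> h'; move: (h' : modulus (w - c) < r); rewrite h ltxx.
    have [h|//] := cdisc_split wr'.
    by move: pw; rewrite ltNge wH.
  + by move=> v [/odisc_cdisc ? /odisc_cdisc ?].
  + apply: (@harmonicB _ _ pmod H oV); last by apply: harmonicS hH => v [].
    apply: (@eq_harmonic _ _ u pmod oV); last by apply: harmonicS hu => v [].
    by move=> v [/odisc_cdisc h _]; rewrite pmod_in.
- by split; [exact: odisc_cdisc|].
Qed.

End PoissonModification.
End Subharmonic.

Section Perron.
Context {R : realType}.
Local Notation C := R[i]^o.
Implicit Types (z w c : C) (f g h u v H L : C -> R) (U V K : set C).

(** For [L] the potential of a rounded pole, subharmonicity of [v - L] says that the charge of [v]
    is at most that of the pole, and compact support stands for boundary values 0. The supremum of
    the class is the Green potential of the rounded charge, whatever the boundary of [U] looks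
    like. *)
Definition perron_class U L v := [/\ forall z, {for z, continuous v}, forall z, 0 <= v z,
  exists K, [/\ compact K, K `<=` U & forall z, ~ K z -> v z = 0] &
  subharmonic U (fun z => v z - L z)].

Definition perron U L z : R := sup [set x | exists2 v, perron_class U L v & v z = x].

Lemma perron_classS U V L v : V `<=` U -> (exists K, [/\ compact K, K `<=` V & forall z, ~ K z -> v z = 0]) ->
  perron_class U L v -> perron_class V L v.
Proof. by move=> VU hK [a b _ d]; split => //; exact: subharmonicS VU d. Qed.

Section Fixed.
Variables (U : set C) (L M : C -> R).
Hypotheses (oU : open U) (cL : forall z, {for z, continuous L})
  (sL : subharmonic U (fun z => - L z))
  (HM : forall v, perron_class U L v -> forall z, U z -> v z <= M z).

Lemma perron_class0 : perron_class U L (fun=> 0).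
Proof.
split => //; first by move=> z; exact: cont_cst.
- by exists set0; split => //; exact: compact0.
- by apply: eq_subharmonic sL => z _; rewrite sub0r.
Qed.

Lemma perron_ub v z : perron_class U L v -> U z -> v z <= perron U L z.
Proof.
move=> hv Uz; apply: ub_le_sup; last by exists v.
by exists (M z) => x [w hw <-]; exact: HM.
Qed.

Lemma perron_le z a : (forall v, perron_class U L v -> v z <= a) -> perron U L z <= a.
Proof.
move=> H; apply: ge_sup; last by move=> x [v /H h <-].
by exists 0; exists (fun=> 0) => //; exact: perron_class0.
Qed.

Lemma perron_ge0 z : U z -> 0 <= perron U L z.
Proof. exact: perron_ub perron_class0. Qed.

Lemma perron_near z e : 0 < e -> exists2 v, perron_class U L v & perron U L z - e < v z.
Proof.
move=> e0; apply: contrapT => H.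
have : perron U L z <= perron U L z - e.
  by apply: perron_le => v hv; rewrite leNgt; apply/negP => h; apply: H; exists v.
lra.
Qed.

Lemma perron_class_max v (w : C -> R) : perron_class U L v -> perron_class U L w ->
  perron_class U L (fun z => Num.max (v z) (w z)).
Proof.
move=> [cv v0 [K [cK KU Kv]] sv] [cw w0 [K' [cK' K'U K'w]] sw]; split.
- by move=> z; exact: cont_max.
- by move=> z; rewrite le_max v0.
- exists (K `|` K'); split; [exact: compactU|by move=> z [/KU|/K'U]|].
  by move=> z /not_orP[/Kv -> /K'w ->]; rewrite maxxx.
- by apply: eq_subharmonic (subharmonic_max sv sw) => z _; rewrite addr_maxl.
Qed.

(** Poisson modification of [v - L] raises [v] and enlarges its support by at most the disc, so
    compactness of the support survives. *)
Lemma perron_class_pmod v c (r : R) : perron_class U L v -> 0 < r -> cdisc c r `<=` U ->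
  exists w : C -> R, [/\ perron_class U L w, forall z, v z <= w z,
    harmonic_on (odisc c r) (fun z => w z - L z) &
    {within cdisc c r, continuous (fun z => w z - L z)}].
Proof.
move=> [cv v0 [K [cK KU Kv]] sv] r0 cU.
pose f z := v z - L z.
have cf z : {for z, continuous f} by apply: contB; [exact: cv|exact: cL].
have cc : {within [set z | modulus (z - c) = r], continuous f} by apply: continuous_within => z _; exact: cf.
have [u [hu cu uf _]] := dirichlet r0 cc.
pose w z := pmod f c r u z + L z.
have vw z : v z <= w z.
  by rewrite /w -lerBlDr; exact: (le_pmod sv r0 cU hu cu uf).
have wL : (fun z => w z - L z) = pmod f c r u by apply/funext => z; rewrite /w addrK.
exists w; split.
- split.
  + move=> z; apply: contD; last exact: cL.
    exact: (@pmod_continuous R setT f c r u (fun z _ => cf z) hu cu uf z I).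
  + by move=> z; exact: le_trans (v0 z) (vw z).
  + exists (K `|` cdisc c r); split.
    * by apply: compactU => //; exact: compact_cdisc.
    * by move=> z [/KU|/cU].
    * move=> z /not_orP[/Kv vz zr]; rewrite /w pmod_out ?/f ?vz; first by ring.
      by move=> /odisc_cdisc.
  + by rewrite wL; exact: (pmod_subharmonic (fun z _ => cf z) sv r0 cU hu cu uf).
- exact: vw.
- rewrite wL; apply: (@eq_harmonic R _ u _ (@open_odisc R c r)); last exact: hu.
  by move=> z zr; rewrite pmod_in//; exact: odisc_cdisc.
- rewrite wL; apply: continuous_within => z _.
  exact: (@pmod_continuous R setT f c r u (fun z _ => cf z) hu cu uf z I).
Qed.

(** One member [w] of the class serves a whole disc. If it is within [e / 3] of the supremum at the
    centre and [w'] is a larger member, modified in the same disc, then [w' - w] is a nonnegative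
    harmonic function, less than [e / 3] at the centre; Harnack's constant 3 gives [e] on the half
    disc. *)
Lemma perron_approx c (r e : R) : 0 < r -> cdisc c r `<=` U -> 0 < e ->
  exists w : C -> R, [/\ perron_class U L w, harmonic_on (odisc c r) (fun z => w z - L z) &
    forall z, modulus (z - c) <= r / 2 -> perron U L z <= w z + e].
Proof.
move=> r0 cU e0.
have Uc : U c by apply: cU; exact: cdisc_center (ltW r0).
have [v hv vc] := @perron_near c (e / 3) (ltac:(by rewrite divr_gt0)).
have [w [hw vw hwL cwL]] := perron_class_pmod hv r0 cU.
exists w; split; [exact: hw|exact: hwL|] => z zr.
apply: perron_le => v' hv'.
have [w' [hw' vw' hw'L cw'L]] := perron_class_pmod (perron_class_max hv' hw) r0 cU.
have oD := @open_odisc R c r.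
have := @harnack R c r (fun z => w' z - L z - (w z - L z)) r0 (harmonicB oD hw'L hwL)
   (withinB cw'L cwL) _ z zr.
have h1 : w z <= w' z by apply: le_trans (vw' z); rewrite le_max lexx orbT.
have h2 : v' z <= w' z by apply: le_trans (vw' z); rewrite le_max lexx.
have h3 : w' c <= perron U L c by exact: perron_ub.
have h4 := vw c.
move=> H; have {}H : w' z - L z - (w z - L z) <= 3 * (w' c - L c - (w c - L c)).
  apply: H => x _; have : w x <= w' x by apply: le_trans (vw' x); rewrite le_max lexx orbT.
  lra.
lra.
Qed.

(** Locally this is a uniform limit of the functions [w - L] supplied by [perron_approx], in place
    of the usual monotone sequences. *)
Lemma perron_harmonic : harmonic_on U (fun z => perron U L z - L z).
Proof.
apply: harmonic_local => c Uc; have [r r0 rU] := open_cdisc oU Uc.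
have r20 : 0 < r / 2 by rewrite divr_gt0.
have sub : odisc c (r / 2) `<=` odisc c r.
  by move=> z zr; have h : modulus (z - c) < r / 2 := zr; change (modulus (z - c) < r); lra.
exists (odisc c (r / 2)); split; [exact: open_odisc|exact: odisc_center|].
apply: harmonic_uniform_limit; first exact: open_odisc.
move=> e e0; have [w [hw hwL Hw]] := perron_approx r0 rU e0.
exists (fun z => w z - L z); first exact: harmonicS sub hwL.
move=> z zr; have Uz : U z by apply: rU; apply: odisc_cdisc; exact: sub.
have := Hw z (ltW zr); have := perron_ub hw Uz.
rewrite ler_norml; lra.
Qed.

End Fixed.
End Perron.

(** * Smooth approximation of Green functions *)

Section Gluing.
Context {R : realType}.
Implicit Types (f g d : R -> R).

Definition glue_at (a : R) f g t := if a <= t then f t else g t.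

Lemma glue_cont_at (a : R) f g : {for a, continuous f} -> {for a, continuous g} -> f a = g a ->
  {for a, continuous (glue_at a f g)}.
Proof.
move=> cf cg E; apply/(@cvgrPdist_lt _ _ _ _ (nbhs_filter a)) => e e0.
move/(@cvgrPdist_lt _ _ _ _ (nbhs_filter a)) : cf => /(_ _ e0) hf.
move/(@cvgrPdist_lt _ _ _ _ (nbhs_filter a)) : cg => /(_ _ e0) hg.
apply: (@filterS2 _ _ (nbhs_filter a) _ _ _ _ hf hg) => t h1 h2.
by rewrite /glue_at lexx; case: ifPn => // _; rewrite E.
Qed.

Lemma glue_near (a t : R) f g : t != a -> {near t, glue_at a f g =1 if a <= t then f else g}.
Proof.
move=> ta; case: ifPn => [at_|].
  have {}at_ : a < t by rewrite lt_neqAle eq_sym ta.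
  near=> s; rewrite /glue_at ifT//; near: s.
  by apply: filterS (lt_nbhsr at_) => s /ltW.
rewrite -ltNge => at_; near=> s; rewrite /glue_at ifF//; apply/negbTE; rewrite -ltNge; near: s.
exact: lt_nbhsl.
Unshelve. all: by end_near. Qed.

Lemma glue_cont (a : R) f g : (forall t, a <= t -> {for t, continuous f}) ->
  (forall t, t <= a -> {for t, continuous g}) -> f a = g a -> forall t, {for t, continuous (glue_at a f g)}.
Proof.
move=> cf cg E t; have [->|ta] := eqVneq t a; first by apply: glue_cont_at => //; [exact: cf|exact: cg].
have := @glue_near a t f g ta; case: ifPn => [at_|]; last rewrite -ltNge => at_.
  by move=> H; apply: cont_near_eq (cf t at_); apply: filterS H => s ->.
by move=> H; apply: cont_near_eq (cg t (ltW at_)); apply: filterS H => s ->.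
Qed.

Lemma glue_derive (a : R) f g d d' : (forall t : R, a <= t -> is_derive t 1 f (d t)) ->
  (forall t : R, t <= a -> is_derive t 1 g (d' t)) -> f a = g a -> d a = d' a ->
  forall t : R, is_derive t 1 (glue_at a f g) (glue_at a d d' t).
Proof.
move=> df dg E E' t; have [->|ta] := eqVneq t a.
  have /is_derive1_caratheodory[p [p1 p2 p3]] := df a (lexx a).
  have /is_derive1_caratheodory[q [q1 q2 q3]] := dg a (lexx a).
  apply/is_derive1_caratheodory; exists (glue_at a p q); split.
  - move=> s; rewrite /glue_at lexx; case: ifPn => _; first exact: p1.
    by rewrite E; exact: q1.
  - by apply: glue_cont_at => //; rewrite p3 q3.
  - by rewrite /glue_at lexx.
have := @glue_near a t f g ta; rewrite /glue_at; case: ifPn => [at_|]; last rewrite -ltNge => at_.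
  by move=> H; apply: near_eq_is_derive1 (df t at_); apply: filterS H => s ->.
by move=> H; apply: near_eq_is_derive1 (dg t (ltW at_)); apply: filterS H => s ->.
Qed.
End Gluing.

(** * Rounded logarithmic poles and a convex truncation *)

Section Bump.
Context {R : realType}.
Local Notation C := R[i]^o.
Implicit Types (z a : C).

Section Profile.
Variable (d : R).
Hypothesis d0 : 0 < d.
Let q := d ^+ 2.
Let q0 : 0 < q. Proof. by rewrite exprn_gt0. Qed.
Let qn : q != 0. Proof. by rewrite gt_eqF. Qed.

(* [- ln sqrt t] for [t >= d ^ 2], continued by its second-order Taylor expansion. *)
Definition psi := glue_at (d ^+ 2) (fun t : R => - 2^-1 * ln t)
  (fun t => - ln d + 2^-1 * (1 - t / d ^+ 2) + 4^-1 * (1 - t / d ^+ 2) ^+ 2).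
Definition psi1 := glue_at (d ^+ 2) (fun t : R => - 2^-1 * t^-1)
  (fun t => - (2 * d ^+ 2)^-1 * (1 + (1 - t / d ^+ 2))).
Definition psi2 := glue_at (d ^+ 2) (fun t : R => 2^-1 * t ^- 2) (fun t => (2 * (d ^+ 2) ^+ 2)^-1).

Lemma is_derive_psi (t : R) : is_derive t 1 psi (psi1 t).
Proof.
apply: glue_derive.
- move=> s qs; have s0 : 0 < s := lt_le_trans q0 qs.
  exact: is_deriveCM (is_derive1_ln s0).
- by move=> s _; apply: is_derive_eq; rewrite /GRing.scale/= -/q; field; exact: qn.
- rewrite -/q divff// subrr expr0n /= !mulr0 !addr0 /q expr2 lnM// -/q.
  by move: (ln d) => l; field.
- by rewrite -/q divff// subrr addr0 mulr1; field; exact: qn.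
Qed.

Lemma is_derive_psi1 (t : R) : is_derive t 1 psi1 (psi2 t).
Proof.
apply: glue_derive.
- move=> s qs; have s0 : s != 0 by rewrite gt_eqF// (lt_le_trans q0 qs).
  apply: (is_derive_congr (is_deriveCM _ (is_deriveV (f := id) s0 (is_derive_id s 1)))).
  by rewrite /GRing.scale/=; field.
- by move=> s _; apply: is_derive_eq; rewrite /GRing.scale/= -/q; field; exact: qn.
- by rewrite -/q divff// subrr addr0 mulr1; field; exact: qn.
- by rewrite -/q; field; exact: qn.
Qed.

Lemma cont_psi2 t : {for t, continuous psi2}.
Proof.
apply: glue_cont.
- move=> s qs; have s0 : s != 0 by rewrite gt_eqF// (lt_le_trans q0 qs).
  apply: contM; first exact: cont_cst.
  by apply: contV; [apply: contX; exact: cvg_id|rewrite expf_eq0 /= s0].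
- by move=> s _; exact: cont_cst.
- by rewrite -/q; field; exact: qn.
Qed.

(** Minus the Laplacian of the rounded pole. The expansion in [psi] has order two exactly so that
    this density is continuous and vanishes at the rim [t = d^2]. *)
Definition bump_charge (t : R) := glue_at (d ^+ 2) (fun=> 0) (fun t => 4 / d ^+ 2 * (1 - t / d ^+ 2)) t.

Lemma bump_charge_cont t : {for t, continuous bump_charge}.
Proof.
apply: glue_cont => [s _|s _|]; first exact: cont_cst.
  apply: contM; first exact: cont_cst.
  by apply: contB; [exact: cont_cst|apply: contM; [exact: cvg_id|exact: cont_cst]].
by rewrite -/q divff// subrr mulr0.
Qed.

Lemma bump_charge_ge0 t : 0 <= bump_charge t.
Proof.
rewrite /bump_charge /glue_at; case: ifPn => //; rewrite -ltNge -/q => tq.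
apply: mulr_ge0; first by rewrite divr_ge0// ltW.
by rewrite subr_ge0 ler_pdivrMr// mul1r ltW.
Qed.

Lemma psi_lap t : 4 * (t * psi2 t + psi1 t) = - bump_charge t.
Proof.
rewrite /psi2 /psi1 /bump_charge /glue_at; case: ifPn => [qt|_].
  have t0 : t != 0 by rewrite gt_eqF// (lt_le_trans q0 qt).
  by rewrite oppr0; field.
by rewrite -/q; field; exact: qn.
Qed.

(** For [x = t / d^2 < 1] the gap between the two sides is half of [- k x], and [k] has derivative
    [(1 - s)^2 / s >= 0] and vanishes at 1. *)
Lemma psi_le t : 0 < t -> psi t <= - 2^-1 * ln t.
Proof.
move=> t0; rewrite /psi /glue_at; case: ifPn => //; rewrite -ltNge -/q => tq.
pose k (s : R) := ln s + (1 - s) + 2^-1 * (1 - s) ^+ 2.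
have dk (s : R) : 0 < s -> is_derive s 1 k ((1 - s) ^+ 2 / s).
  move=> s0; have sn : s != 0 by rewrite gt_eqF.
  have h := is_derive1_ln s0; apply: is_derive_eq; rewrite /GRing.scale /=; field; exact: sn.
pose x := t / q.
have x0 : 0 < x by rewrite divr_gt0.
have x1 : x < 1 by rewrite ltr_pdivrMr// mul1r.
have [s hs E] : exists2 s, s \in `]x, 1[ & k 1 - k x = (1 - s) ^+ 2 / s * (1 - x).
  apply: MVT => // [s|].
    by rewrite in_itv /= => /andP[h1 _]; apply: dk; lra.
  by apply: derivable_within_continuous => s; rewrite in_itv /= => /andP[h1 _]; have h := dk s (lt_le_trans x0 h1); exact: ex_derive.
have k1 : k 1 = 0 by rewrite /k ln1 subrr expr0n /= mulr0 !addr0.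
have kx : k x <= 0.
  have s01 : 0 < s by move: hs; rewrite in_itv /=; lra.
  have : 0 <= (1 - s) ^+ 2 / s * (1 - x).
    by rewrite mulr_ge0 ?subr_ge0 ?(ltW x1)// divr_ge0 ?sqr_ge0// ltW.
  by rewrite -E k1; lra.
have lx : ln t = 2 * ln d + ln x by rewrite -[t](divfK qn) -/x lnM ?posrE// addrC /q expr2 lnM ?posrE//; ring.
by move: kx; rewrite /k lx -/x; lra.
Qed.

End Profile.

Definition log_bump d a z := psi d (sqdist a z).
Definition rho d a z := bump_charge d (sqdist a z).

Lemma bump_C2 d a : 0 < d -> C2 setT (log_bump d a) /\ forall z, lap (log_bump d a) z = - rho d a z.
Proof.
move=> d0; have [c l] := @C2_radial R setT a (psi d) (psi1 d) (psi2 d) openT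
  (fun z _ => is_derive_psi d0 _) (fun z _ => is_derive_psi1 d0 _) (fun z _ => cont_psi2 d0 (t := _)).
by split; [exact: c|move=> z; rewrite (l z I) (psi_lap d0)].
Qed.

Lemma sqdist_le (d : R) a z : 0 <= d -> (d ^+ 2 <= sqdist a z) = (d <= modulus (z - a)).
Proof. by move=> d0; rewrite sqdistE ler_sqr ?nnegrE ?modulus_ge0. Qed.

Lemma bump_out d a z : 0 < d -> d <= modulus (z - a) -> log_bump d a z = - ln (modulus (z - a)).
Proof.
by move=> d0 dz; rewrite /log_bump /psi /glue_at (sqdist_le _ _ (ltW d0)) dz ln_modulusE mulNr.
Qed.

Lemma bump_le d a z : 0 < d -> z != a -> log_bump d a z <= - ln (modulus (z - a)).
Proof. by move=> d0 za; rewrite ln_modulusE -mulNr; apply: psi_le => //; rewrite sqdist_gt0. Qed.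

Lemma rho_out d a z : 0 < d -> d <= modulus (z - a) -> rho d a z = 0.
Proof. by move=> d0 dz; rewrite /rho /bump_charge /glue_at (sqdist_le _ _ (ltW d0)) dz. Qed.

Lemma rho_ge0 d a z : 0 < d -> 0 <= rho d a z.
Proof. by move=> d0; exact: bump_charge_ge0. Qed.

Lemma sqdist_continuous a z : {for z, continuous (sqdist a)}.
Proof. by have [c _] := @C2_sqdist R setT a openT; exact: C2_continuous openT c I. Qed.

Lemma rho_continuous d a z : 0 < d -> {for z, continuous (rho d a)}.
Proof.
move=> d0; apply: (@continuous_comp _ _ _ (sqdist a) (bump_charge d) z (@sqdist_continuous a z)).
exact: bump_charge_cont.
Qed.

Lemma bump_continuous d a z : 0 < d -> {for z, continuous (log_bump d a)}.
Proof. by move=> d0; have [c _] := bump_C2 a d0; exact: C2_continuous openT c I. Qed.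

Lemma subharmonic_bump d a U : 0 < d -> open U -> subharmonic U (fun z => - log_bump d a z).
Proof.
move=> d0 oU; have [c l] := bump_C2 a d0.
have [c' l'] := C2ZE (-1) oU (C2S (@subsetT _ U) c).
apply: (@eq_subharmonic _ _ (fun z => -1 * log_bump d a z)); first by move=> z _; rewrite mulN1r.
apply: subharmonic_C2 => // z Uz; rewrite (l' _ Uz) l mulN1r opprK; exact: rho_ge0.
Qed.

Lemma harmonic_bump_out d a : 0 < d -> harmonic_on (~` cdisc a d) (log_bump d a).
Proof.
move=> d0; have oU := closed_openC (@closed_cdisc R a d).
have out z : (~` cdisc a d) z -> d < modulus (z - a) by move=> /negP; rewrite -ltNge.
apply: (@eq_harmonic _ _ (fun z => -1 * ln (modulus (z - a)))) => //.
  by move=> z /out h; rewrite mulN1r bump_out// ltW.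
apply: harmonicZ => //; apply: harmonicS (harmonic_ln_modulus a) => z /out h /=.
by rewrite -modulus_sub_gt0; lra.
Qed.

(* A convex truncation: [phi e] vanishes on [t <= e] and has slope between 0 and 1. *)
Definition phi (e : R) := glue_at e (fun t => e * ((t - e) / e - atan ((t - e) / e))) (fun=> 0).
Definition phi1 (e : R) := glue_at e (fun t => 1 - (1 + ((t - e) / e) ^+ 2)^-1) (fun=> 0).
Definition phi2 (e : R) := glue_at e (fun t => 2 * ((t - e) / e ^+ 2) / (1 + ((t - e) / e) ^+ 2) ^+ 2) (fun=> 0).

Lemma is_derive_phi (e t : R) : 0 < e -> is_derive t 1 (phi e) (phi1 e t).
Proof.
move=> e0; have en : e != 0 by rewrite gt_eqF.
apply: glue_derive.
- move=> s _; have h : is_derive s 1 (fun t => (t - e) / e) e^-1.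
    by apply: is_derive_eq; rewrite /GRing.scale /=; field.
  have h2 := is_derive1_comp (g := fun t => (t - e) / e) (is_derive1_atan ((s - e) / e)) h.
  have h3 : is_derive s 1 (fun t => (t - e) / e - atan ((t - e) / e)) (e^-1 - (1 + ((s - e) / e) ^+ 2)^-1 * e^-1).
    exact: is_deriveB h h2.
  apply: (is_derive_congr (is_deriveCM e h3)).
  set D := (1 + _)^-1; by rewrite mulrBr mulfV// mulrCA mulfV// mulr1.
- by rewrite subrr mul0r atan0 subrr mulr0.
- by rewrite subrr mul0r expr0n /= addr0 invr1 subrr.
Qed.

Lemma is_derive_phi1 (e t : R) : 0 < e -> is_derive t 1 (phi1 e) (phi2 e t).
Proof.
move=> e0; have en : e != 0 by rewrite gt_eqF.
apply: glue_derive.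
- move=> s _; have D0 : 1 + ((s - e) / e) ^+ 2 != 0 by rewrite gt_eqF// ltr_wpDr// sqr_ge0.
  have h : is_derive s 1 (fun t => 1 + ((t - e) / e) ^+ 2) (2 * ((s - e) / e ^+ 2)).
    by apply: is_derive_eq; rewrite /GRing.scale /=; field.
  have h2 := is_deriveV (f := fun t : R => 1 + ((t - e) / e) ^+ 2) D0 h.
  have h3 := is_deriveB (is_derive_cst (1 : R) s (1 : R)) h2.
  apply: (@is_derive_congr _ (fun t : R => 1 - (1 + ((t - e) / e) ^+ 2)^-1) _ _ _ h3).
  by rewrite /GRing.scale /= sub0r mulNr opprK mulrC.
- by rewrite subrr mul0r expr0n /= addr0 invr1 subrr.
- by rewrite subrr !mul0r mulr0 mul0r.
Qed.

Lemma phi2_cont (e t : R) : 0 < e -> {for t, continuous (phi2 e)}.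
Proof.
move=> e0; have en : e != 0 by rewrite gt_eqF.
have c1 (k s : R) : {for s, continuous (fun t : R => (t - e) / k)}.
  by apply: contM; [apply: contB; [exact: cvg_id|exact: cont_cst]|exact: cont_cst].
apply: glue_cont => [s _|s _|].
- apply: contM; first by apply: contM; [exact: cont_cst|exact: c1].
  apply: contV; last by rewrite expf_neq0// gt_eqF// ltr_wpDr// sqr_ge0.
  by apply: contX; apply: contD; [exact: cont_cst|apply: contX; exact: c1].
- exact: cont_cst.
- by rewrite subrr !mul0r mulr0 mul0r.
Qed.

Lemma phi1_bounds (e t : R) : 0 <= phi1 e t <= 1.
Proof.
rewrite /phi1 /glue_at; case: ifPn => _; last by rewrite lexx ler01.
have h : 1 <= 1 + ((t - e) / e) ^+ 2 by rewrite lerDl sqr_ge0.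
have := invr_ge0 (1 + ((t - e) / e) ^+ 2); rewrite (le_trans _ h)// => h0.
by rewrite subr_ge0 invf_le1 ?(lt_le_trans ltr01 h)// h /= gerDl oppr_le0.
Qed.

Lemma phi2_ge0 (e t : R) : 0 < e -> 0 <= phi2 e t.
Proof.
move=> e0; rewrite /phi2 /glue_at; case: ifPn => // et.
by rewrite divr_ge0 ?sqr_ge0// mulr_ge0// divr_ge0 ?sqr_ge0// subr_ge0.
Qed.

Lemma phi_eq0 (e t : R) : t <= e -> phi e t = 0.
Proof.
rewrite le_eqVlt /phi /glue_at => /orP[/eqP ->|te]; first by rewrite lexx subrr mul0r atan0 subrr mulr0.
by rewrite ifF//; apply/negbTE; rewrite -ltNge.
Qed.

(** The truncation loses [e] by the shift and at most [e pi / 2] through [atan]. *)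
Lemma phi_ge (e t : R) : 0 < e -> t - (1 + pi / 2) * e <= phi e t.
Proof.
move=> e0; have p0 := pi_gt0 R; rewrite /phi /glue_at; case: ifPn => [et|]; last rewrite -ltNge => te.
  have := atan_ltpi2 ((t - e) / e); rewrite mulrBr mulrCA mulfV ?gt_eqF// mulr1 => h.
  have : e * atan ((t - e) / e) <= e * (pi / 2) by rewrite ler_pM2l// ltW.
  by lra.
have : 0 < pi / 2 * e by rewrite mulr_gt0// divr_gt0.
lra.
Qed.

Lemma phi_le (e t : R) : 0 < e -> 0 <= t -> phi e t <= t.
Proof.
move=> e0 t0; rewrite /phi /glue_at; case: ifPn => // et.
have h : 0 <= atan ((t - e) / e).
  have s0 : 0 <= (t - e) / e by rewrite divr_ge0 ?subr_ge0// ltW.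
  have [<-|s1] := eqVneq 0 ((t - e) / e); first by rewrite atan0.
  have s2 : 0 < (t - e) / e by rewrite lt_neqAle s1.
  rewrite -atan0; apply/ltW; exact: lt_atan.
rewrite mulrBr mulrCA mulfV ?gt_eqF// mulr1.
have : 0 <= e * atan ((t - e) / e) by rewrite mulr_ge0// ltW.
lra.
Qed.

Lemma phi_ge0 (e t : R) : 0 < e -> 0 <= phi e t.
Proof.
move=> e0; have [te|et] := leP t e; first by rewrite phi_eq0.
have h s : s \in `]e, t[ -> is_derive s 1 (phi e) (phi1 e s) by move=> _; exact: is_derive_phi.
have [|s _ E] := @MVT _ (phi e) (phi1 e) e t et h.
  by apply: derivable_within_continuous => s _; have k := is_derive_phi s e0; exact: ex_derive.
have := phi1_bounds e s => /andP[p0 _].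
have : 0 <= phi e t - phi e e by rewrite E mulr_ge0// subr_ge0 ltW.
by rewrite (phi_eq0 (lexx e)) subr0.
Qed.

End Bump.

(** * Compactly supported approximants *)

Section Exhaustion.
Context {R : realType}.
Local Notation C := R[i]^o.
Implicit Types (z w c : C) (f u v : C -> R) (U V K : set C).

(** Each point of [K] has a disc inside [U], so every small [t] works for all points near it;
    compactness yields one [t] for all of [K]. *)
Lemma compact_open_separation K U : compact K -> open U -> K `<=` U ->
  exists2 t : R, 0 < t & forall z w, K z -> ~ U w -> t <= modulus (z - w).
Proof.
move=> /compact_near_coveringP cK oU KU.
have := cK R (0^'+) (fun t z => forall w, ~ U w -> t <= modulus (z - w)) _.
move=> H; have : \forall t \near 0^'+, K `<=` (fun z => forall w, ~ U w -> t <= modulus (z - w)).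
  apply: H => z /KU Uz; have [e e0 He] := (openP_modulus _).1 oU z Uz.
  exists (odisc z (e / 2), [set t | t < e / 2]).
    split => /=; first by apply: open_nbhs_nbhs; split; [exact: open_odisc|apply: odisc_center; rewrite divr_gt0].
    by apply: nbhs_right_lt; rewrite divr_gt0.
  move=> [z' t] /= [z'e te] w nUw; rewrite leNgt; apply/negP => h; apply: nUw; apply: He.
  have : modulus (z' - z) < e / 2 := z'e.
  by have := modulusD (w - z') (z' - z); rewrite subrKA (modulusC w z'); lra.
move=> Ht; have [t [t0 tP]] : exists t : R, 0 < t /\ K `<=` (fun z => forall w, ~ U w -> t <= modulus (z - w)).
  near (0 : R)^'+ => t; exists t; split; first by near: t; exact: nbhs_right_gt.
  by near: t.
by exists t => // z w Kz; exact: tP.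
Unshelve. all: by end_near. Qed.

Variables (Om : set C) (a : C) (h : C -> R) (d r0 : R).
Hypotheses (oOm : open Om) (Om0 : ~ Om 0) (hh : harmonic_on Om h)
  (h_ge : forall z, Om z -> z != a -> 0 <= h z - ln (modulus (z - a)))
  (d0 : 0 < d) (dr0 : d < r0) (ra : cdisc a r0 `<=` Om).

Let r0_gt0 : 0 < r0 := lt_trans d0 dr0.

Local Notation L := (log_bump d a).

(** Outside the small disc [h + L] is the nonnegative function [h - ln |z - a|], and [v] vanishes
    off its compact support. The maximum principle therefore applies to the subharmonic function
    [v - L - h]. *)
Lemma perron_class_majorant U v : open U -> U `<=` Om -> cdisc a d `<=` U ->
  perron_class U L v -> forall z, U z -> v z <= h z + L z.
Proof.
move=> oU UO dU [cv v0 [K [cK KU Kv]] sv] z Uz.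
have hhU : harmonic_on U h := harmonicS UO hh.
have := @subharmonic_maximum R U (K `|` cdisc a d) (fun z => v z - L z - h z) oU _ _ (subharmonicB oU sv hhU) _ _ z Uz.
rewrite subr_le0 lerBlDr; apply.
- by apply: compactU => //; exact: compact_cdisc.
- by move=> w [/KU|/dU].
- move=> w Uw; apply: contB; first by apply: contB; [exact: cv|exact: bump_continuous].
  exact: harmonic_continuous oU hhU Uw.
- move=> w Uw /not_orP[/Kv vw /negP]; rewrite -ltNge => dw.
  rewrite vw (bump_out d0 (ltW dw)) sub0r opprK.
  have wa : w != a by rewrite -modulus_sub_gt0; exact: lt_trans d0 dw.
  by have := h_ge (UO _ Uw) wa; lra.
Qed.

(** The boundary of [Om] need not admit barriers, so truncating the Perron function of [Om] may
    leave a support that is not compact. It is replaced by the Perron function [G] of a smaller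
    bounded domain [D], whose complement is a union of discs of a fixed radius and the outside of a
    large disc. There logarithms are explicit barriers, the superlevel sets of [G] lie in compact
    subsets of [D], and a convex truncation does the rest. Since [D] still contains the support of
    [w0], [G] lies above [w0]. *)
Lemma smooth_approximant (w0 : C -> R) (eta : R) : perron_class Om L w0 -> 0 < eta ->
  exists V : C -> R, [/\ C2 setT V, forall z, 0 <= V z,
    exists K, [/\ compact K, K `<=` Om & forall z, ~ K z -> V z = 0],
    forall z, - lap V z <= rho d a z &
    (forall z, Om z -> V z <= h z + L z) /\ forall z, cdisc a r0 z -> w0 z - eta <= V z].
Proof.
move=> hw0 eta0; have [cw w0ge [K0 [cK0 K0O K0w]] sw] := hw0.
pose K := K0 `|` cdisc a r0.
have cK : compact K by apply: compactU => //; exact: compact_cdisc.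
have KO : K `<=` Om by move=> z [/K0O|/ra].
have [M M0 HM] := compact_bounded_plane cK.
(* The factors 2 in [B] and 1/2 in [t] make both kinds of barrier at least [ln 2] on [K]. *)
pose B := 2 * M; have B0 : 0 < B by rewrite /B; lra.
have [t2 t20 Ht2] := compact_open_separation cK oOm KO.
pose t := t2 / 2; have t0 : 0 < t by rewrite /t; lra.
pose A := cdisc 0 B `\` Om.
have A0 : A 0 by split => //; apply: cdisc_center; exact: ltW.
have cA : compact A.
  apply: (@subclosed_compact _ _ (cdisc (0 : C) B)); [|exact: compact_cdisc|by move=> z []].
  by apply: closedI; [exact: closed_cdisc|exact: open_closedC].
pose D := [set z : C | modulus z < B /\ forall c, A c -> t < modulus (z - c)].
have oD : open D.
  apply/openP_modulus => z [zB zA].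
  have [c0 /set_mem Ac0 Hc0] : exists2 c0, c0 \in A & forall c, c \in A -> modulus (c0 - z) <= modulus (c - z).
    apply: compact_EVT_min; [by exists 0|exact: cA|].
    by apply: continuous_within => c _; exact: continuous_modulusB.
  exists (Num.min (B - modulus z) (modulus (z - c0) - t)).
    by rewrite lt_min !subr_gt0 zB zA.
  move=> w; rewrite lt_min => /andP[w1 w2]; split.
    by have := modulusD (w - z) z; rewrite subrK; lra.
  move=> c Ac; have := Hc0 c (mem_set Ac); rewrite (modulusC c0) => h1.
  by have := modulusD (c - w) (w - z); rewrite subrKA (modulusC c w); lra.
have DO : D `<=` Om.
  move=> z [zB zA]; apply: contrapT => nO.
  have Az : A z by split => //; change (modulus (z - 0) <= B); rewrite subr0 ltW.
  by have := zA z Az; rewrite subrr modulus0 ltNge (ltW t0).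
have KD : K `<=` D.
  move=> z Kz; split; first by have := HM z Kz; rewrite /B; lra.
  by move=> c [_ /(Ht2 z c Kz)]; rewrite /t; lra.
have raD : cdisc a r0 `<=` D by move=> z zr; apply: KD; right.
have dD : cdisc a d `<=` D.
  by move=> z zr; apply: raD; have k : modulus (z - a) <= d := zr; exact: (le_trans k (ltW dr0)).
have sD := @subharmonic_bump R d a D d0 oD.
have cL z := @bump_continuous R d a z d0.
have majD v (hv : perron_class D L v) := perron_class_majorant oD DO dD hv.
pose G := perron D L.
have hG : harmonic_on D (fun z => G z - L z) := perron_harmonic oD cL sD majD.
have w0D : perron_class D L w0.
  by apply: perron_classS hw0 => //; exists K0; split => // z Kz; apply: KD; left.
have w0G z : D z -> w0 z <= G z by move=> Dz; exact: (perron_ub majD w0D Dz).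
have GM z : D z -> G z <= h z + L z.
  by move=> Dz; apply: (perron_le sD) => v hv; exact: majD.
have G0 z : D z -> 0 <= G z by move=> Dz; exact: (perron_ge0 sD majD Dz).
(* [S] bounds every member of the class on [cdisc a r0]. Since a barrier is at least [ln 2] there,
   its multiple by [Q = S / ln 2] dominates. *)
have [S [S0 HS]] : exists S : R, 0 < S /\ forall z, cdisc a r0 z -> h z + L z <= S.
  have [z1 _ Hz1] : exists2 z1, z1 \in cdisc a r0 & forall z, z \in cdisc a r0 -> h z + L z <= h z1 + L z1.
    apply: compact_EVT_max; [by exists a; apply: cdisc_center; exact: ltW|exact: compact_cdisc|].
    apply: continuous_within => z /ra Oz; apply: contD; last exact: cL.
    exact: harmonic_continuous oOm hh Oz.
  exists (`|h z1 + L z1| + 1); split; first by have := normr_ge0 (h z1 + L z1); lra.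
  by move=> z zr; have := Hz1 z (mem_set zr); have := ler_norm (h z1 + L z1); lra.
have l2 : 0 < ln 2 :> R by rewrite ln_gt0// ltr1n.
pose Q := S / ln 2; have Q0 : 0 < Q by rewrite divr_gt0.
(* The comparison takes place off [cdisc a d], where [L] is harmonic and so [v] itself subharmonic;
   [v] is 0 off its support and at most [Q b] on [cdisc a r0]. *)
have barrier (b : C -> R) : harmonic_on D b -> (forall z, D z -> 0 <= b z) -> (forall z, K z -> ln 2 <= b z) ->
    forall z, D z -> ~ cdisc a r0 z -> G z <= Q * b z.
  move=> hb b0 bK z Dz nz; apply: (perron_le sD) => v hv.
  have [cv v0 [Kv [cKv KvD Kv0]] sv] := hv.
  pose U := D `\` cdisc a d.
  have oU : open U by apply: openI => //; exact: closed_openC (@closed_cdisc R a d).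
  have UD : U `<=` D by move=> x [].
  have hL : harmonic_on U (fun z => -1 * L z).
    by apply: harmonicZ => //; apply: harmonicS (harmonic_bump_out a d0) => x [].
  have sv1 := subharmonicB oU (subharmonicS UD sv) hL.
  have sv2 := subharmonicB oU sv1 (harmonicZ Q oU (harmonicS UD hb)).
  have Uz : U z.
    split => // zd; apply: nz; have k : modulus (z - a) <= d := zd; exact: (le_trans k (ltW dr0)).
  have vE x : v x - L x - -1 * L x - Q * b x = v x - Q * b x by ring.
  rewrite -subr_le0 -vE.
  apply: (@subharmonic_maximum R U (Kv `\` odisc a r0) (fun z => v z - L z - -1 * L z - Q * b z) oU _ _ sv2 _ _ z Uz).
  - apply: (@subclosed_compact _ _ Kv); [|exact: cKv|by move=> x []].
    apply: closedI; first by apply: compact_closed cKv; exact: hausdorff_plane.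
    by apply: open_closedC; exact: open_odisc.
  - move=> x [/KvD Dx nx]; split => // xd; apply: nx.
    by have k : modulus (x - a) <= d := xd; exact: (le_lt_trans k dr0).
  - move=> x Ux; apply: contB; last first.
      by apply: contM; [exact: cont_cst|exact: (harmonic_continuous oD hb (UD _ Ux))].
    apply: contB; first by apply: contB; [exact: cv|exact: cL].
    by apply: contM; [exact: cont_cst|exact: cL].
  - move=> x Ux nx; rewrite vE subr_le0.
    have [/Kv0 ->|xr] : ~ Kv x \/ odisc a r0 x.
      by apply: contrapT => /not_orP[/contrapT k1 k2]; apply: nx.
    + by rewrite mulr_ge0 ?(ltW Q0)// b0//; exact: UD.
    + have xr' := odisc_cdisc xr.
      have h1 := majD v hv x (UD _ Ux); have h2 := HS x xr'.
      have h3 : ln 2 <= b x by apply: bK; right.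
      have h4 : S <= Q * b x by rewrite /Q mulrAC ler_pdivlMr// ler_pM2l.
      lra.
pose p := 1 + pi / 2 : R; have p0 : 0 < p by rewrite /p; have := pi_gt0 R; lra.
(* [p] is the constant of [phi_ge], so truncation at this level costs at most [eta]. *)
pose e := eta / p; have e0 : 0 < e by rewrite divr_gt0.
(* Off [cdisc a r0], [G >= e] forces every barrier to be at least [e / Q]; for [ln (B / |z|)] and
   [ln (|z - c| / t)] these are the two inequalities here. The first barrier is harmonic because 0
   belongs to [A], hence not to [D]. *)
pose Se := cdisc a r0 `|` [set z : C | modulus z <= B * expR (- (e / Q)) /\
   forall c, A c -> t * expR (e / Q) <= modulus (z - c)].
have eQ : 0 < e / Q by rewrite divr_gt0.
have SD : Se `<=` D.
  move=> z [/raD//|[zB zA]]; split.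
    by apply: le_lt_trans zB _; rewrite gtr_pMr// expR_lt1 oppr_lt0.
  by move=> c /zA; apply: lt_le_trans; rewrite ltr_pMr// expR_gt1.
have cS : compact Se.
  apply: compactU; first exact: compact_cdisc.
  apply: (@bounded_closed_compact_plane _ _ (B * expR (- (e / Q)))); last by move=> z [].
  apply: closedI.
    have := @closed_cdisc R 0 (B * expR (- (e / Q))).
    by rewrite (_ : cdisc 0 _ = [set z | modulus z <= B * expR (- (e / Q))])//; apply/seteqP; split => z /=; rewrite /cdisc /= subr0.
  rewrite (_ : (fun x => _) = \bigcap_(c in A) ~` odisc c (t * expR (e / Q))).
    by apply: closed_bigI => c _; apply: open_closedC; exact: open_odisc.
  by apply/seteqP; split => z /= H c Ac; have := H c Ac; rewrite /odisc /= leNgt => /negP.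
have D_ne0 z : D z -> 0 < modulus z.
  by move=> [_ /(_ 0 A0)]; rewrite subr0; exact: lt_trans.
have GS z : D z -> e <= G z -> Se z.
  move=> Dz eG; have [|nz] := pselect (cdisc a r0 z); [by left|right].
  have lowb b : harmonic_on D b -> (forall z, D z -> 0 <= b z) -> (forall z, K z -> ln 2 <= b z) -> e / Q <= b z.
    move=> h1 h2 h3; rewrite ler_pdivrMr// mulrC.
    exact: le_trans eG (barrier b h1 h2 h3 z Dz nz).
  split.
  - have := lowb (fun z => ln B - ln (modulus (z - 0))).
    rewrite subr0 => H.
    have {}H : e / Q <= ln B - ln (modulus z).
      apply: H.
      + have hl : harmonic_on D (fun z => ln (modulus (z - 0))).
          apply: harmonicS (harmonic_ln_modulus 0) => x Dx /=.
          by rewrite -modulus_gt0; exact: D_ne0.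
        exact: harmonicB oD (harmonic_cst _ oD) hl.
      + move=> x Dx; rewrite subr0 subr_ge0 ler_ln ?posrE ?D_ne0//.
        by case: Dx => /ltW.
      + move=> x Kx; rewrite subr0 lerBrDr -lerBrDl -ln_div ?posrE//.
        have Dx := KD _ Kx; rewrite ler_ln ?posrE ?D_ne0 ?divr_gt0//.
        have -> : B / 2 = M by rewrite /B; field.
        exact: ltW (HM x Kx).
    rewrite -ler_ln ?posrE ?D_ne0 ?mulr_gt0 ?expR_gt0// lnM ?posrE ?expR_gt0// expRK; lra.
  - move=> c Ac; have tc x : D x -> t < modulus (x - c) by case=> _; exact.
    have tc0 x : D x -> 0 < modulus (x - c) by move=> /tc; exact: lt_trans.
    have := lowb (fun z => ln (modulus (z - c)) - ln t) => H.
    have {}H : e / Q <= ln (modulus (z - c)) - ln t.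
      apply: H.
      + have hl : harmonic_on D (fun z => ln (modulus (z - c))).
          by apply: harmonicS (harmonic_ln_modulus c) => x Dx /=; rewrite -modulus_sub_gt0; exact: tc0.
        exact: harmonicB oD hl (harmonic_cst _ oD).
      + by move=> x Dx; rewrite subr_ge0 ler_ln ?posrE ?tc0// ltW// tc.
      + move=> x Kx; have Dx := KD _ Kx; rewrite -ln_div ?posrE ?tc0// ler_ln ?posrE ?divr_gt0 ?tc0//.
        rewrite ler_pdivlMr//; case: Ac => _ /(Ht2 x c Kx); rewrite /t; lra.
    rewrite -ler_ln ?posrE ?tc0 ?mulr_gt0 ?expR_gt0// lnM ?posrE ?expR_gt0// expRK; lra.
pose V z := if `[< D z >] then phi e (G z) else 0.
have VD z : D z -> phi e (G z) = V z by move=> Dz; rewrite /V asboolT.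
have VS z : ~ Se z -> V z = 0.
  rewrite /V; case: asboolP => // Dz nS; apply: phi_eq0; rewrite leNgt; apply/negP => k.
  by apply: nS; apply: GS => //; exact: ltW.
have [cL2 lL] := bump_C2 a d0.
have [cG lG] := C2DE oD (harmonic_C2 hG) (C2S (@subsetT _ D) cL2).
have GE z : G z - L z + L z = G z by rewrite subrK.
have {}cG : C2 D G by apply: eq_C2 oD _ cG => z _; exact: GE.
have {}lG z : D z -> lap G z = - rho d a z.
  move=> Dz; rewrite -(eq_lap oD (fun z _ => GE z) Dz) (lG _ Dz) (harmonic_lap hG Dz) lL add0r//.
have [cV lV] := C2_comp1E oD cG (fun z _ => is_derive_phi (G z) e0) (fun z _ => is_derive_phi1 (G z) e0)
   (fun z _ => phi2_cont (t := G z) e0).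
have oN : open (~` Se).
  by apply: closed_openC; apply: compact_closed cS; exact: hausdorff_plane.
have [z0c z0l] := C2_cstE (0 : R) oN.
exists V; split.
- apply: C2_local => z _; have [Dz|nDz] := pselect (D z).
    by exists D; split; [exact: oD|exact: Dz|exact: (eq_C2 oD VD cV)].
  exists (~` Se); split; [exact: oN|by move=> /SD|].
  by apply: (eq_C2 oN _ z0c) => x nx; rewrite VS.
- by move=> z; rewrite /V; case: asboolP => // _; exact: phi_ge0.
- by exists Se; split => //; exact: subset_trans SD DO.
- move=> z; have [Dz|nDz] := pselect (D z).
    (* The Laplacian of the truncation is [phi2 |grad G|^2 - phi1 rho], with [phi2 >= 0] by
       convexity and [phi1] between 0 and 1. *)
    rewrite -(eq_lap oD VD Dz) (lV _ Dz) (lG _ Dz).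
    have := phi1_bounds e (G z); have := phi2_ge0 (G z) e0; have := rho_ge0 a z d0.
    have := sqr_ge0 (dx G z); have := sqr_ge0 (dy G z).
    move: (rho d a z) (dx G z) (dy G z) (phi1 e (G z)) (phi2 e (G z)) => r x y p1 p2; nra.
  have nS : (~` Se) z by move=> /SD.
  rewrite -(eq_lap oN (fun x nx => esym (VS x nx)) nS) (z0l _ nS) oppr0; exact: rho_ge0.
- split.
    move=> z Oz; have [Dz|nDz] := pselect (D z).
      by rewrite -VD//; apply: le_trans (GM z Dz); apply: phi_le => //; exact: G0.
    rewrite /V asboolF//; have := perron_class_majorant oOm (fun _ => id) _ hw0 Oz.
    move=> H; apply: le_trans (H _); first exact: w0ge.
    by move=> x /dD/DO.
  move=> z zr; have Dz := raD _ zr; rewrite -VD//.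
  apply: le_trans (phi_ge _ e0); have := w0G z Dz.
  by rewrite -/p /e mulrC divfK ?gt_eqF//; lra.
Qed.
End Exhaustion.

(** * Green functions on the sphere *)

Section Sphere.
Context {R : realType}.
Local Notation C := R[i]^o.
Local Notation Chat := (riemann_sphere R).
Implicit Types (z w c : C) (f v : C -> R) (U V K : set C) (D : set Chat) (u : Chat -> R).

Lemma complex_inv z : z^-1 = ratA (complex.Re z) (complex.Im z) +i* (- ratB (complex.Re z) (complex.Im z)).
Proof. by case: z => x y; rewrite /GRing.inv /= /ratA /ratB. Qed.

Lemma norm2_neq0 z : z != 0 -> complex.Re z ^+ 2 + complex.Im z ^+ 2 != 0.
Proof. by rewrite -sqr_modulus expf_eq0 /= -modulus_gt0 => /gt_eqF ->. Qed.

Lemma C1_rat (h hq hp : R -> R -> R) :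
  (forall q p : R, q ^+ 2 + p ^+ 2 != 0 -> is_derive q 1 (fun q => h q p) (hq q p) /\
    is_derive p 1 (fun p => h q p) (hp q p)) ->
  (forall z, z != 0 -> {for z, continuous (fun z => hq (complex.Re z) (complex.Im z))}) ->
  (forall z, z != 0 -> {for z, continuous (fun z => hp (complex.Re z) (complex.Im z))}) ->
  let f (k : R -> R -> R) z := k (complex.Re z) (complex.Im z) in
  [/\ C1 [set z | z != 0] (f h), forall z, z != 0 -> dx (f h) z = f hq z &
     forall z, z != 0 -> dy (f h) z = f hp z].
Proof.
move=> H c1 c2 f; apply: (@C1I _ [set z : C | z != 0]);  [exact: (@open_punctured R 0)| | |exact: c1|exact: c2].
  by move=> z /norm2_neq0 z0; have [h1 _] := H _ _ z0.
by move=> z /norm2_neq0 z0; have [_ h1] := H _ _ z0.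
Qed.

Lemma rat_cont (N : C -> R) n z : z != 0 -> {for z, continuous N} ->
  {for z, continuous (fun z => N z / (complex.Re z ^+ 2 + complex.Im z ^+ 2) ^+ n)}.
Proof.
move=> z0 cN; apply: contM => //; apply: contV; last by rewrite expf_neq0// norm2_neq0.
by apply: contX; apply: contD; apply: contX; [exact: continuous_Re|exact: continuous_Im].
Qed.

Lemma harmonic_inverse : let A z := ratA (complex.Re z) (complex.Im z) in
  let B z := - ratB (complex.Re z) (complex.Im z) in
  [/\ harmonic_on [set z | z != 0] A, harmonic_on [set z | z != 0] B &
   forall z, z != 0 -> dx A z = dy B z /\ dy A z = - dx B z].
Proof.
have cR := @continuous_Re R; have cI := @continuous_Im R.
have cE z : z != 0 -> {for z, continuous (fun z => ratE (complex.Re z) (complex.Im z))}.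
  move=> z0; apply: (@rat_cont (fun z => complex.Im z ^+ 2 - complex.Re z ^+ 2) 2) => //.
  by apply: contB; apply: contX; [exact: cI|exact: cR].
have cF z : z != 0 -> {for z, continuous (fun z => ratF (complex.Re z) (complex.Im z))}.
  move=> z0; apply: (@rat_cont (fun z => - (2 * complex.Re z * complex.Im z)) 2) => //.
  apply: contN; apply: contM; last exact: cI.
  by apply: contM; [exact: cont_cst|exact: cR].
have cG z : z != 0 -> {for z, continuous (fun z => ratG (complex.Re z) (complex.Im z))}.
  move=> z0; apply: (@rat_cont (fun z => 2 * (complex.Re z ^+ 3 - 3 * complex.Re z * complex.Im z ^+ 2)) 3) => //.
  apply: contM; first exact: cont_cst.
  apply: contB; first by apply: contX; exact: cR.
  by apply: contM; [apply: contM; [exact: cont_cst|exact: cR]|apply: contX; exact: cI].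
have cH z : z != 0 -> {for z, continuous (fun z => ratH (complex.Re z) (complex.Im z))}.
  move=> z0; apply: (@rat_cont (fun z => 2 * (3 * complex.Re z ^+ 2 * complex.Im z - complex.Im z ^+ 3)) 3) => //.
  apply: contM; first exact: cont_cst.
  apply: contB; last by apply: contX; exact: cI.
  by apply: contM; [apply: contM; [exact: cont_cst|apply: contX; exact: cR]|exact: cI].
have cE' z (z0 : z != 0) := contN (cE z z0); have cF' z (z0 : z != 0) := contN (cF z z0).
have cG' z (z0 : z != 0) := contN (cG z z0); have cH' z (z0 : z != 0) := contN (cH z z0).
have oU := @open_punctured R 0.
have [a1 a2 a3] := C1_rat (@is_derive_ratA R) cE cF.
have [e1 e2 e3] := C1_rat (@is_derive_ratE R) cG cH.
have [f1 f2 f3] := C1_rat (@is_derive_ratF R) cH cG'.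
have [b1 b2 b3] : [/\ C1 [set z | z != 0] (fun z => - ratB (complex.Re z) (complex.Im z)),
   forall z, z != 0 -> dx (fun z => - ratB (complex.Re z) (complex.Im z)) z = - ratF (complex.Re z) (complex.Im z) &
   forall z, z != 0 -> dy (fun z => - ratB (complex.Re z) (complex.Im z)) z = ratE (complex.Re z) (complex.Im z)].
  apply: (C1_rat (h := fun q p => - ratB q p) (hq := fun q p => - ratF q p) (hp := ratE)); [|exact: cF'|exact: cE].
  move=> q p D0; have [h1 h2] := is_derive_ratB D0; split; first exact: is_deriveN h1.
  by have := is_deriveN h2; rewrite opprK.
have [g1 g2 g3] : [/\ C1 [set z | z != 0] (fun z => - ratF (complex.Re z) (complex.Im z)),
   forall z, z != 0 -> dx (fun z => - ratF (complex.Re z) (complex.Im z)) z = - ratH (complex.Re z) (complex.Im z) &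
   forall z, z != 0 -> dy (fun z => - ratF (complex.Re z) (complex.Im z)) z = ratG (complex.Re z) (complex.Im z)].
  apply: (C1_rat (h := fun q p => - ratF q p) (hq := fun q p => - ratH q p) (hp := ratG)); [|exact: cH'|exact: cG].
  move=> q p D0; have [h1 h2] := is_derive_ratF D0; split; first exact: is_deriveN h1.
  by have := is_deriveN h2; rewrite opprK.
move=> A B; split.
- have [c l] := C2I oU a1 a2 a3 e1 f1; apply: (harmonicI c) => z z0.
  by rewrite (l _ z0) (e2 _ z0) (f3 _ z0) subrr.
- have [c l] := C2I oU b1 b2 b3 g1 e1; apply: (harmonicI c) => z z0.
  by rewrite (l _ z0) (g2 _ z0) (e3 _ z0) addNr.
- by move=> z z0; rewrite a2// b3// a3// b2// opprK.
Qed.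

Lemma harmonic_comp_inverse U V f : open U -> open V -> harmonic_on U f ->
  (forall z, V z -> z != 0 /\ U z^-1) -> harmonic_on V (fun z => f z^-1).
Proof.
move=> oU oV hf VU; have [hA hB cr] := harmonic_inverse.
have VN : V `<=` [set z | z != 0] by move=> z /VU[].
have -> : (fun z => f z^-1) = (fun z => f (ratA (complex.Re z) (complex.Im z) +i* (- ratB (complex.Re z) (complex.Im z)))).
  by apply/funext => z; rewrite complex_inv.
apply: (harmonic_comp oU oV hf (harmonicS VN hA) (harmonicS VN hB)).
  by move=> z /VU[_]; rewrite complex_inv.
by move=> z /VN; exact: cr.
Qed.

Lemma open_inverse_preimage U : open U -> open [set z : C | z != 0 /\ U z^-1].
Proof.
move=> oU; apply/openP_modulus => z [/= z0 Uz].
have [h1 h2 _] := harmonic_inverse.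
have ci : {for z, continuous (fun z : C => z^-1 : C)}.
  apply/continuous_complexP; split.
    apply: cont_ext (harmonic_continuous (@open_punctured R 0) h1 z0) => w.
    by rewrite complex_inv.
  apply: cont_ext (harmonic_continuous (@open_punctured R 0) h2 z0) => w.
  by rewrite complex_inv.
have : \forall w \near z, w != 0 /\ U w^-1.
  apply: filterI; first by apply: open_nbhs_nbhs; split => //; exact: (@open_punctured R 0).
  by apply: ci; apply: open_nbhs_nbhs.
by move/nbhs_modulus.
Qed.

Lemma open_finite_part D : open D -> open [set z : C | D (Some z)].
Proof. by rewrite !openE => oD z Dz; exact: (oD _ Dz). Qed.

Lemma open_nbhs_infty D : open D -> D None -> exists2 M : R, 0 < M & forall z, M <= modulus z -> D (Some z).
Proof.
rewrite openE => oD /oD[K [cK _] KD]; have [M M0 HM] := compact_bounded_plane cK.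
exists M => // z Mz; apply: KD; left; exists z => //= Kz.
by have := HM z Kz; rewrite ltNge Mz.
Qed.

Lemma modulusV z : modulus z^-1 = (modulus z)^-1.
Proof. exact: Normc.normcV. Qed.

(** Near the pole the definition of a logarithmic pole provides the harmonic extension, elsewhere
    [v + ln |z - a|] is harmonic as a sum. The two agree where both are defined, so one [h] serves
    all of the finite part of [D]. *)
Lemma competitor_regular_part (D : set Chat) (a : C) (v : Chat -> R) : open D -> green_competitor D a v ->
  exists2 h : C -> R, harmonic_on [set z | D (Some z)] h &
    forall z, z != a -> v (Some z) = h z - ln (modulus (z - a)).
Proof.
move=> oD [[hv _] v0 [W [h0 [oW Wa hh0 Wv]]]].
have oDom : open [set z : C | D (Some z)] := open_finite_part oD.
pose h z := if z == a then h0 a else v (Some z) + ln (modulus (z - a)).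
exists h; last by move=> z za; rewrite /h (negPf za) addrK.
apply: harmonic_local => z Dz; have [->|za] := eqVneq z a.
  exists W; split; [exact: oW|exact: Wa|].
  apply: (eq_harmonic oW _ hh0) => w Ww; rewrite /h; case: eqVneq => [->//|wa].
  by rewrite Wv// subrK.
have oP : open ([set z : C | D (Some z)] `&` [set z | z != a]).
  by apply: openI; [exact: oDom|exact: open_punctured].
exists ([set z : C | D (Some z)] `&` [set z | z != a]); split; [exact: oP|by []|].
have h1 : harmonic_on ([set z : C | D (Some z)] `&` [set z | z != a]) (fun z => v (Some z)).
  by apply: harmonicS hv => w [Dw /= wa]; split => //= -[] /eqP; rewrite (negPf wa).
have h2 : harmonic_on ([set z : C | D (Some z)] `&` [set z | z != a]) (fun z => ln (modulus (z - a))).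
  by apply: harmonicS (harmonic_ln_modulus a) => w [].
by apply: (eq_harmonic oP _ (harmonicD oP h1 h2)) => w [_ /= /negPf wa]; rewrite /h wa.
Qed.

Section Green.
Variables (D : set Chat) (a : C) (u : Chat -> R).
Hypotheses (oD : open D) (Da : D (Some a)) (a0 : a != 0) (gu : is_green D a u).

Let Dom : set C := [set z | D (Some z)].
Let Om : set C := [set z | D (Some z) /\ z != 0].
Let oDom : open Dom. Proof. exact: open_finite_part. Qed.
Let oOm : open Om. Proof. by apply: openI => //; exact: open_punctured. Qed.

Lemma green_regular_part : exists2 h : C -> R, harmonic_on Dom h &
  forall z, z != a -> u (Some z) = h z - ln (modulus (z - a)).
Proof. by case: gu => c _; exact: competitor_regular_part oD c. Qed.

Section Competitor.
Variables (h : C -> R) (d r0 : R).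
Hypotheses (hh : harmonic_on Dom h)
  (hu : forall z, z != a -> u (Some z) = h z - ln (modulus (z - a)))
  (d0 : 0 < d) (dr0 : d < r0) (ra : cdisc a r0 `<=` Om).

Local Notation L := (log_bump d a).
Local Notation G := (perron Om L).

Let OmD : Om `<=` Dom. Proof. by move=> z []. Qed.
Let Om0 : ~ Om 0. Proof. by move=> []; rewrite eqxx. Qed.
Let hhO : harmonic_on Om h. Proof. exact: harmonicS OmD hh. Qed.
Let dOm : cdisc a d `<=` Om.
Proof. by move=> z zd; apply: ra; have k : modulus (z - a) <= d := zd; exact: (le_trans k (ltW dr0)). Qed.
Let sL : subharmonic Om (fun z => - L z). Proof. exact: subharmonic_bump. Qed.
Let cL z : {for z, continuous L}. Proof. exact: bump_continuous. Qed.

Let h_ge z : Om z -> z != a -> 0 <= h z - ln (modulus (z - a)).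
Proof.
have [[_ u0 _] _] := gu => Oz za; rewrite -hu//; apply: u0; split; first exact: OmD.
by move=> /= -[] /eqP; rewrite (negPf za).
Qed.

Let maj v : perron_class Om L v -> forall z, Om z -> v z <= h z + L z.
Proof. by move=> hv z Oz; exact: (perron_class_majorant hhO h_ge d0 oOm (@subset_refl _ Om) dOm hv Oz). Qed.

Let hG : harmonic_on Om (fun z => G z - L z) := perron_harmonic oOm cL sL maj.
(** [G] with its rounded pole exchanged for a true one: the candidate to be compared with the Green
    function [u]. *)
Let U0 z := G z - L z - ln (modulus (z - a)).
Let Oma : set C := Om `&` [set z | z != a].
Let oOma : open Oma. Proof. by apply: openI => //; exact: open_punctured. Qed.

Let hU0 : harmonic_on Oma U0.
Proof.
have h1 : harmonic_on Oma (fun z => G z - L z) by apply: harmonicS hG => z [].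
have h2 : harmonic_on Oma (fun z => ln (modulus (z - a))) by apply: harmonicS (harmonic_ln_modulus a) => z [].
exact: harmonicB oOma h1 h2.
Qed.

Let U0_ge0 z : Oma z -> 0 <= U0 z.
Proof.
move=> [Oz za]; rewrite /U0; have := perron_ge0 sL maj Oz; have := bump_le d0 za; lra.
Qed.

Let U0_le z : Oma z -> U0 z <= u (Some z).
Proof.
move=> [Oz za]; rewrite /U0 hu//; have : G z <= h z + L z by apply: (perron_le sL) => v hv; exact: maj.
lra.
Qed.

Let Oma_D z : z != 0 -> (D `\ Some a) (Some z) -> Oma z.
Proof. by move=> z0 [Dz za]; split => //; apply/eqP => e; apply: za; rewrite /= e. Qed.

(** If 0 belongs to [D], then near 0 the function [U0] lies between 0 and the bounded function [u],
    so the singularity is removable; nonnegativity at 0 itself follows by continuity. *)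
Let extension_at0 : exists2 H : C -> R, forall z, z != 0 -> H z = U0 z &
  harmonic_on [set z | (D `\ Some a) (Some z)] H /\ forall z, (D `\ Some a) (Some z) -> 0 <= H z.
Proof.
have oDa : open [set z : C | (D `\ Some a) (Some z)].
  rewrite (_ : mkset _ = Dom `&` [set z | z != a]); first by apply: openI => //; exact: open_punctured.
  apply/seteqP; split=> z [Dz za]; split => //; first by apply/eqP => e; apply: za; rewrite /= e.
  by move=> /= -[] /eqP; rewrite (negPf za).
have [D0|nD0] := pselect (D (Some 0)); last first.
  exists U0 => //; rewrite (_ : [set z : C | _] = Oma).
    split; first exact: hU0.
    move=> z hz; apply: U0_ge0; apply: Oma_D => //.
    by apply/eqP => e; apply: nD0; case: hz; rewrite e.
  apply/seteqP; split=> z; first by move=> hz; apply: Oma_D => //; apply/eqP => e; apply: nD0; case: hz; rewrite e.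
  by move=> [[Dz _] /= za]; split => //= -[] /eqP; rewrite (negPf za).
have [r r0' rD] := open_cdisc oDa (conj D0 (fun e : Some 0 = Some a => negP a0 (introT eqP (esym (Some_inj e))))).
have cu0 : {for 0, continuous h} := harmonic_continuous oDom hh D0.
have clm : {for 0, continuous (fun z : C => ln (modulus (z - a)))}.
  by apply: (harmonic_continuous (@open_punctured R a) (harmonic_ln_modulus a)); rewrite /= eq_sym.
have [s s0 Hs] := (continuous_modulusP _ _).1 (contB cu0 clm) 1 ltr01.
pose t := Num.min r s; have t0 : 0 < t by rewrite lt_min r0'.
have tO z : odisc 0 t z -> z != 0 -> Oma z.
  move=> zt z0; apply: Oma_D => //; apply: rD.
  by have k : modulus (z - 0) < t := zt; move: k; rewrite lt_min => /andP[k _]; exact: ltW k.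
have [H hH HU] : exists2 H, harmonic_on (odisc 0 t) H & forall z, odisc 0 t z -> z != 0 -> H z = U0 z.
  apply: (@removable_singularity R 0 t (`|h 0 - ln (modulus (0 - a))| + 1)) => //.
    by apply: harmonicS hU0 => z [zt z0]; exact: tO.
  move=> z zt z0; have Oz := tO z zt z0; rewrite ger0_norm; last exact: U0_ge0.
  apply: le_trans (U0_le Oz) _; rewrite hu; last by case: Oz.
  have k : modulus (z - 0) < t := zt; move: k; rewrite lt_min => /andP[_ /Hs].
  have := ler_norm (h 0 - ln (modulus (0 - a))); rewrite ltr_norml; lra.
pose H' z := if z == 0 then H 0 else U0 z.
exists H'; first by move=> z /negPf z0; rewrite /H' z0.
have hH' : harmonic_on (odisc 0 t) H'.
  apply: (eq_harmonic (@open_odisc R 0 t) _ hH) => z zt; rewrite /H'.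
  by case: eqVneq => [->//|z0]; exact: HU.
split.
  apply: harmonic_local => z Dz; have [->|z0] := eqVneq z 0.
    by exists (odisc 0 t); split; [exact: open_odisc|exact: odisc_center|exact: hH'].
  have oV : open (Oma `&` [set z | z != 0]) by apply: openI => //; exact: open_punctured.
  exists (Oma `&` [set z | z != 0]); split; [exact: oV|by split => //; exact: Oma_D|].
  apply: (eq_harmonic oV _ (harmonicS _ hU0)); first by move=> w [_ /= /negPf w0]; rewrite /H' w0.
  by move=> w [].
move=> z Dz; have [->|z0] := eqVneq z 0; last by rewrite /H' (negPf z0); apply: U0_ge0; exact: Oma_D.
rewrite leNgt; apply/negP => H0.
have c0 := harmonic_continuous (@open_odisc R 0 t) hH' (odisc_center 0 t0).
have [k k0 Hk] := (continuous_modulusP _ _).1 c0 (- H' 0) (ltac:(by rewrite oppr_gt0)).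
pose x := Num.min k t / 2; have x0 : 0 < x by rewrite divr_gt0// lt_min k0.
have mx : modulus (x%:C : C) = x by rewrite modulusE /= expr0n /= addr0 sqrtr_sqr ger0_norm// ltW.
have xn : (x%:C : C) != 0 by rewrite -modulus_gt0 mx.
have xm : x < Num.min k t.
  have m0 : 0 < Num.min k t by rewrite lt_min k0.
  by rewrite /x; move: (Num.min k t) m0 => m m0; lra.
move: (xm); rewrite lt_min => /andP[xk xt].
have := Hk x%:C; rewrite subr0 mx => /(_ xk).
have : 0 <= H' x%:C.
  rewrite /H' (negPf xn); apply: U0_ge0; apply: tO => //.
  by change (modulus (x%:C - 0) < t); rewrite subr0 mx.
rewrite ltr_norml; lra.
Qed.

(** The argument used at 0, carried out in the chart [1/z], with [u] bounded near infinity. *)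
Let extension_at_infty : D None -> exists2 H : C -> R, forall z, z != 0 -> H z = U0 z^-1 &
  exists2 t, 0 < t & harmonic_on (odisc 0 t) H /\ 0 <= H 0.
Proof.
move=> Dinf; have [M M0 HM] := open_nbhs_infty oD Dinf.
have ma : 0 < modulus a by rewrite modulus_gt0.
(* The two bounds keep the inverted disc inside [D] and away from the pole [a]. *)
pose t1 := Num.min M^-1 ((modulus a)^-1 / 2).
have t10 : 0 < t1 by rewrite lt_min invr_gt0 M0 divr_gt0 ?invr_gt0.
have tO z : odisc 0 t1 z -> z != 0 -> Oma z^-1.
  move=> zt z0; have mz : 0 < modulus z by rewrite modulus_gt0.
  have k : modulus (z - 0) < t1 := zt; move: k; rewrite subr0 lt_min => /andP[k1 k2].
  split; first split.
  - apply: HM; rewrite modulusV -[M]invrK lef_pV2 ?posrE ?invr_gt0//; exact: ltW.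
  - by rewrite invr_eq0.
  - rewrite /=; apply/eqP => e; move: k2; rewrite -e modulusV invrK; lra.
have [[_ hinf] _ _] := gu.1.
have Dc0 : (D `\ Some a) (chart_infty 0) by rewrite /chart_infty eqxx; split.
have oc : open (odisc (0 : C) t1) by exact: open_odisc.
have oDa : open (chart_infty @^-1` (D `\ Some a) : set C).
  rewrite (_ : _ @^-1` _ = [set z | odisc 0 t1 z] `|` [set z | z != 0 /\ Oma z^-1]).
    by apply: openU => //; exact: open_inverse_preimage.
  apply/seteqP; split=> z /=.
    rewrite /chart_infty; case: eqVneq => [-> _|z0 Dz]; first by left; exact: odisc_center.
    by right; split => //; apply: Oma_D => //; rewrite invr_eq0.
  rewrite /chart_infty; case: eqVneq => [-> _|z0 [zt|[_ [[Dz _] /= za]]]]; first by split.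
    by have [[Dz _] /= za] := tO z zt z0; split => //= -[] /eqP; rewrite (negPf za).
  by split => //= -[] /eqP; rewrite (negPf za).
have cinf := harmonic_continuous oDa hinf Dc0.
have [s s0 Hs] := (continuous_modulusP _ _).1 cinf 1 ltr01.
pose t := Num.min t1 s; have t0 : 0 < t by rewrite lt_min t10.
have tO' z : odisc 0 t z -> z != 0 -> Oma z^-1.
  move=> zt; apply: tO; have k : modulus (z - 0) < t := zt.
  by move: k; rewrite lt_min => /andP[k _]; exact: k.
have oP : open [set z | odisc (0 : C) t z /\ z != 0].
  by apply: openI; [exact: open_odisc|exact: open_punctured].
have hV : harmonic_on [set z | odisc 0 t z /\ z != 0] (fun z => U0 z^-1).
  by apply: (harmonic_comp_inverse oOma oP hU0) => z [zt z0]; split => //; exact: tO'.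
have uc z : z != 0 -> (u \o chart_infty) z = u (Some z^-1).
  by move=> /negPf z0; rewrite /= /chart_infty z0.
have [H hH HU] : exists2 H, harmonic_on (odisc 0 t) H & forall z, odisc 0 t z -> z != 0 -> H z = U0 z^-1.
  apply: (@removable_singularity R 0 t (`|(u \o chart_infty) 0| + 1)) => //.
  move=> z zt z0; have Oz := tO' z zt z0; rewrite ger0_norm; last exact: U0_ge0.
  apply: le_trans (U0_le Oz) _; rewrite -uc//.
  have k : modulus (z - 0) < t := zt; move: k; rewrite lt_min => /andP[_ /Hs].
  have := ler_norm ((u \o chart_infty) 0); rewrite ltr_norml; lra.
pose H' z := if z == 0 then H 0 else U0 z^-1.
exists H'; first by move=> z /negPf z0; rewrite /H' z0.
have hH' : harmonic_on (odisc 0 t) H'.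
  apply: (eq_harmonic (@open_odisc R 0 t) _ hH) => z zt; rewrite /H'.
  by case: eqVneq => [->//|z0]; exact: HU.
exists t => //; split => //.
rewrite leNgt; apply/negP => H0.
have c0 := harmonic_continuous (@open_odisc R 0 t) hH' (odisc_center 0 t0).
have [k k0 Hk] := (continuous_modulusP _ _).1 c0 (- H' 0) (ltac:(by rewrite oppr_gt0)).
pose x := Num.min k t / 2; have x0 : 0 < x by rewrite divr_gt0// lt_min k0.
have mx : modulus (x%:C : C) = x by rewrite modulusE /= expr0n /= addr0 sqrtr_sqr ger0_norm// ltW.
have xn : (x%:C : C) != 0 by rewrite -modulus_gt0 mx.
have xm : x < Num.min k t.
  have m0 : 0 < Num.min k t by rewrite lt_min k0.
  by rewrite /x; move: (Num.min k t) m0 => m m0; lra.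
move: (xm); rewrite lt_min => /andP[xk xt].
have := Hk x%:C; rewrite subr0 mx => /(_ xk).
have : 0 <= H' x%:C.
  rewrite /H' (negPf xn); apply: U0_ge0; apply: tO' => //.
  by change (modulus (x%:C - 0) < t); rewrite subr0 mx.
rewrite ltr_norml; lra.
Qed.

(** This is where the minimality of the Green function enters: [U0], extended over 0 and infinity,
    is a competitor for [D] and so lies above [u]. Hence puncturing the domain does not lower the
    Green function. The pole itself is covered by continuity. *)
Lemma green_le_perron z : Om z -> h z + L z <= G z.
Proof.
have [H0 H0U [hH0 H0ge]] := extension_at0.
have [Hi Hext] : exists Hi : C -> R, D None -> (forall z, z != 0 -> Hi z = U0 z^-1) /\
    exists2 t, 0 < t & harmonic_on (odisc 0 t) Hi /\ 0 <= Hi 0.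
  have [Dn|Dn] := pselect (D None); last by exists (fun=> 0).
  by have [H HU HH] := extension_at_infty Dn; exists H.
pose v (p : Chat) := if p is Some z then H0 z else Hi 0.
have compv : green_competitor D a v.
  split.
  - split; first exact: hH0.
    apply: harmonic_local => w; rewrite /preimage /= /chart_infty; case: eqVneq => [-> [Dn _]|w0 Dw].
      have [HiU [t t0 [hHi _]]] := Hext Dn.
      exists (odisc 0 t); split; [exact: open_odisc|exact: odisc_center|].
      apply: (eq_harmonic (@open_odisc R 0 t) _ hHi) => x _; rewrite /= /chart_infty /v.
      by case: eqVneq => [->//|x0]; rewrite HiU// H0U// invr_eq0.
    have oV := open_inverse_preimage oOma.
    exists [set w | w != 0 /\ Oma w^-1]; split; [exact: oV| |].
      by split => //; apply: Oma_D => //; rewrite invr_eq0.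
    apply: (eq_harmonic oV _ (harmonic_comp_inverse oOma oV hU0 (fun _ => id))).
    by move=> x [x0 _]; rewrite /= /chart_infty (negPf x0) /v H0U// invr_eq0.
  - move=> [x|] Dx; first exact: H0ge.
    by have [_ [t _ []]] := Hext Dx.1.
  - exists Om, (fun z => G z - L z); split; [exact: oOm|by split|exact: hG|].
    by move=> x [_ x0] _; rewrite /v H0U.
have le1 x : Oma x -> h x <= G x - L x.
  move=> [[Dx x0] xa].
  have := gu.2 v compv (Some x); rewrite /v H0U// /U0 hu//.
  have Dax : (D `\ Some a) (Some x) by split => //= -[] /eqP; rewrite (negPf xa).
  by move=> /(_ Dax); lra.
move=> Oz; have [->|za] := eqVneq z a; last by have := le1 z (conj Oz za); lra.
suff : h a <= G a - L a by lra.
have Oa : Om a by split.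
rewrite leNgt; apply/negP => H.
have [k k0 Hk] := (continuous_modulusP _ _).1
   (contB (harmonic_continuous oOm hhO Oa) (harmonic_continuous oOm hG Oa))
   (h a - (G a - L a)) (ltac:(by rewrite subr_gt0)).
have [k' k'0 Hk'] := (openP_modulus _).1 oOm a Oa.
pose m := Num.min k k'; have m0 : 0 < m by rewrite lt_min k0.
pose x := a + (m / 2)%:C.
have mx : modulus (x - a) = m / 2.
  rewrite /x addrC addKr modulusE /= expr0n /= addr0 sqrtr_sqr ger0_norm// divr_ge0// ltW//.
have xa : x != a by rewrite -modulus_sub_gt0 mx divr_gt0.
have half (y : R) : 0 < y -> y / 2 < y by lra.
have xm : modulus (x - a) < m by rewrite mx; exact: half.
move: (xm); rewrite lt_min => /andP[/Hk h1 /Hk' h2].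
by have := le1 x (conj h2 xa); move: h1; rewrite ltr_norml; lra.
Qed.

(** A member of the Perron class uniformly close to [G] on the half disc is made smooth; each of the
    two steps costs [eta / 2]. *)
Lemma green_smooth_approximant eta : 0 < eta ->
  exists V : C -> R, [/\ C2 setT V, forall z, 0 <= V z,
    exists K, [/\ compact K, K `<=` Om & forall z, ~ K z -> V z = 0],
    forall z, - lap V z <= rho d a z &
    (forall z, Om z -> V z <= h z + L z) /\
    forall z, modulus (z - a) <= r0 / 2 -> h z + L z - eta <= V z].
Proof.
move=> eta0; have e20 : 0 < eta / 2 by rewrite divr_gt0.
have r00 : 0 < r0 := lt_trans d0 dr0.
have [w [hw _ Hw]] := perron_approx cL sL maj r00 ra e20.
have [V [c1 c2 c3 c4 [c5 c6]]] := smooth_approximant oOm Om0 hhO h_ge d0 dr0 ra hw e20.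
exists V; split; [exact: c1|exact: c2|exact: c3|exact: c4|split; first exact: c5].
move=> z zr; have zr0 : cdisc a r0 z by change (modulus (z - a) <= r0); lra.
have := c6 z zr0; have := Hw z zr; have := green_le_perron (ra zr0); lra.
Qed.

End Competitor.
End Green.
End Sphere.

(** * Energies on the logarithmic cylinder *)

Section DoubleIntegral.
Context {R : realType}.
Local Notation C := R[i]^o.
Implicit Types (z w : C) (F G P Q : C -> R) (a b c d : R).

Definition Int2 a b c d F := Int a b (fun s => Int c d (fun t => F (s +i* t))).

(** Continuity is asked along the whole strip, beyond the box of integration, so that inner
    integrals are continuous on both sides of the ends [a] and [b]. *)
Definition cont_strip c d F := forall z, c <= complex.Im z <= d -> {for z, continuous F}.

Lemma cont_strip_section c d F s : cont_strip c d F -> cont_on c d (fun t => F (s +i* t)).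
Proof.
move=> cF t ht; apply: (@continuous_comp _ _ _ (fun t : R => s +i* t : C) F).
  by apply: continuous_complex; [exact: cvg_cst|exact: cvg_id].
exact: cF.
Qed.

Lemma near_all (T : topologicalType) (x : T) (P : T -> Prop) : (forall y, P y) -> \forall y \near x, P y.
Proof. by move=> H; near=> y; exact: H.
Unshelve. all: by end_near. Qed.

Lemma cont_strip_Int c d F s : c <= d -> cont_strip c d F ->
  {for s, continuous (fun s => Int c d (fun t => F (s +i* t)))}.
Proof.
move=> cd cF; apply: (@Int_cont_param _ _ (fun s t => F (s +i* t))) => //.
  move=> t ht; apply: (@continuous_comp _ _ _ (fun p : R * R => p.1 +i* p.2 : C) F (s, t)).
    by apply: continuous_complex; [exact: cvg_fst|exact: cvg_snd].
  exact: cF.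
by apply: near_all => x; exact: cont_strip_section.
Qed.

Lemma cont_stripD c d F G : cont_strip c d F -> cont_strip c d G -> cont_strip c d (fun z => F z + G z).
Proof. by move=> cF cG z hz; exact: contD (cF z hz) (cG z hz). Qed.

Lemma cont_stripB c d F G : cont_strip c d F -> cont_strip c d G -> cont_strip c d (fun z => F z - G z).
Proof. by move=> cF cG z hz; exact: contB (cF z hz) (cG z hz). Qed.

Lemma cont_stripM c d F G : cont_strip c d F -> cont_strip c d G -> cont_strip c d (fun z => F z * G z).
Proof. by move=> cF cG z hz; exact: contM (cF z hz) (cG z hz). Qed.

Lemma cont_strip_cst c d (k : R) : cont_strip c d (fun=> k).
Proof. by move=> z _; exact: cont_cst. Qed.

Lemma cont_stripZ c d (k : R) F : cont_strip c d F -> cont_strip c d (fun z => k * F z).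
Proof. by move=> cF z hz; exact: contM (@cont_cst _ _ k z) (cF z hz). Qed.

Lemma cont_stripS c d c' d' F : c <= c' -> d' <= d -> cont_strip c d F -> cont_strip c' d' F.
Proof. by move=> h1 h2 cF z /andP[h3 h4]; apply: cF; rewrite (le_trans h1 h3) (le_trans h4 h2). Qed.

Section Box.
Variables (a b c d : R).
Hypotheses (ab : a <= b) (cd : c <= d).

Lemma eq_Int2 F G : (forall z, a <= complex.Re z <= b -> c <= complex.Im z <= d -> F z = G z) ->
  Int2 a b c d F = Int2 a b c d G.
Proof. by move=> FG; apply: eq_Int => s hs; apply: eq_Int => t ht; exact: FG. Qed.

Lemma Int2D F G : cont_strip c d F -> cont_strip c d G ->
  Int2 a b c d (fun z => F z + G z) = Int2 a b c d F + Int2 a b c d G.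
Proof.
move=> cF cG; rewrite /Int2 -IntD.
- by apply: eq_Int => s _; rewrite IntD//; exact: cont_strip_section.
- by move=> s _; exact: cont_strip_Int.
- by move=> s _; exact: cont_strip_Int.
Qed.

Lemma Int2Z (k : R) F : cont_strip c d F -> Int2 a b c d (fun z => k * F z) = k * Int2 a b c d F.
Proof.
move=> cF; rewrite /Int2 -IntZ.
  by apply: eq_Int => s _; rewrite IntZ//; exact: cont_strip_section.
by move=> s _; exact: cont_strip_Int.
Qed.

Lemma Int2B F G : cont_strip c d F -> cont_strip c d G ->
  Int2 a b c d (fun z => F z - G z) = Int2 a b c d F - Int2 a b c d G.
Proof.
move=> cF cG; rewrite /Int2 -IntB.
- by apply: eq_Int => s _; rewrite IntB//; exact: cont_strip_section.
- by move=> s _; exact: cont_strip_Int.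
- by move=> s _; exact: cont_strip_Int.
Qed.

Lemma Int2_ge0 F : (forall z, a <= complex.Re z <= b -> c <= complex.Im z <= d -> 0 <= F z) ->
  0 <= Int2 a b c d F.
Proof. by move=> F0; apply: Int_ge0 => s hs; apply: Int_ge0 => t ht; exact: F0. Qed.

Lemma le_Int2 F G : cont_strip c d F -> cont_strip c d G ->
  (forall z, a <= complex.Re z <= b -> c <= complex.Im z <= d -> F z <= G z) ->
  Int2 a b c d F <= Int2 a b c d G.
Proof.
move=> cF cG FG; rewrite -subr_ge0 -Int2B//; apply: Int2_ge0 => z h1 h2.
by rewrite subr_ge0; exact: FG.
Qed.

Lemma divergence_x (U : set C) P : open U -> C1 U P -> (forall z, c <= complex.Im z <= d -> U z) ->
  Int2 a b c d (dx P) = Int c d (fun t => P (b +i* t)) - Int c d (fun t => P (a +i* t)).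
Proof.
move=> oU cP HU.
have cx : cont_strip c d (dx P) by move=> z /HU; exact: C1_cdx.
have cc : cont_strip c d P by move=> z /HU; exact: C1_continuous.
apply: (Int_FTC2 (F := fun s => Int c d (fun t => P (s +i* t))) ab).
  by move=> s _; exact: cont_strip_Int.
move=> s _; apply: (@Int_derive_param _ (fun s t => P (s +i* t)) (fun s t => dx P (s +i* t))) => //.
- move=> t ht; apply: (@continuous_comp _ _ _ (fun p : R * R => p.1 +i* p.2 : C) (dx P) (s, t)).
    by apply: continuous_complex; [exact: cvg_fst|exact: cvg_snd].
  exact: cx.
- by apply: near_all => x; exact: cont_strip_section.
- exact: cont_strip_section.
- apply: near_all => x t ht; have Ux : U (x +i* t) by apply: HU.
  exact: (C1_isd cP Ux).1.
Qed.

Lemma divergence_y (U : set C) Q : open U -> C1 U Q -> (forall z, c <= complex.Im z <= d -> U z) ->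
  Int2 a b c d (dy Q) = Int a b (fun s => Q (s +i* d) - Q (s +i* c)).
Proof.
move=> oU cQ HU; apply: eq_Int => s _.
have cy : cont_strip c d (dy Q) by move=> z /HU; exact: C1_cdy.
apply: (Int_FTC2 (F := fun t => Q (s +i* t)) cd); first exact: cont_strip_section.
move=> t ht; have Ux : U (s +i* t) by apply: HU.
exact: (C1_isd cQ Ux).2.
Qed.

End Box.

Lemma Int2_cat a b c d e F : a <= b -> c <= d -> d <= e -> cont_strip c e F ->
  Int2 a b c e F = Int2 a b c d F + Int2 a b d e F.
Proof.
move=> ab cd de cF; have c1 := cont_stripS (lexx c) de cF; have c2 := cont_stripS cd (lexx e) cF.
rewrite /Int2 -IntD; [|by move=> s _; exact: cont_strip_Int|by move=> s _; exact: cont_strip_Int].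
by apply: eq_Int => s _; apply: Int_cat => //; exact: cont_strip_section.
Qed.

Lemma open_Im_gt (k : R) : open [set z : C | k < complex.Im z].
Proof.
by apply: (@open_comp _ _ (fun z : C => complex.Im z) [set x : R | k < x]) => [z _|]; [exact: continuous_Im|exact: open_gt].
Qed.

Lemma open_Im_lt (k : R) : open [set z : C | complex.Im z < k].
Proof.
by apply: (@open_comp _ _ (fun z : C => complex.Im z) [set x : R | x < k]) => [z _|]; [exact: continuous_Im|exact: open_lt].
Qed.

Definition periodic_y p F := forall z, F (complex.Re z +i* (complex.Im z + p)) = F z.

Lemma periodic_dy p F : periodic_y p F -> periodic_y p (dy F).
Proof.
move=> pF z.
have E : (fun h : R => h^-1 *: (F (complex.Re z +i* (h + (complex.Im z + p))) - F (complex.Re z +i* (complex.Im z + p))))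
       = (fun h : R => h^-1 *: (F (complex.Re z +i* (h + complex.Im z)) - F (complex.Re z +i* complex.Im z))).
  apply/funext => h; rewrite addrA (pF (complex.Re z +i* complex.Im z)).
  by rewrite (pF (complex.Re z +i* (h + complex.Im z))).
by rewrite /dy /= /derive1 E.
Qed.

(** Vanishing at the two ends kills the flux of [P], and periodicity makes the fluxes of [Q] through
    the lines at heights [c] and [c + p] cancel. *)
Lemma divergence_cylinder (S c p : R) P Q : 0 <= S -> 0 <= p -> C1 setT P -> C1 setT Q ->
  (forall z, S <= `|complex.Re z| -> P z = 0) -> periodic_y p Q ->
  Int2 (- S) S c (c + p) (fun z => dx P z + dy Q z) = 0.
Proof.
move=> S0 p0 cP cQ P0 pQ; have SS : - S <= S by lra.
have cp : c <= c + p by lra.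
have c1 : cont_strip c (c + p) (dx P) by move=> z _; exact: C1_cdx cP I.
have c2 : cont_strip c (c + p) (dy Q) by move=> z _; exact: C1_cdy cQ I.
rewrite Int2D// (divergence_x SS cp openT cP)// (divergence_y _ _ cp openT cQ)//.
have -> : Int c (c + p) (fun t => P (S +i* t)) = Int c (c + p) (fun=> 0).
  by apply: eq_Int => t _; apply: P0; rewrite /= ger0_norm.
have -> : Int c (c + p) (fun t => P (- S +i* t)) = Int c (c + p) (fun=> 0).
  by apply: eq_Int => t _; apply: P0; rewrite /= normrN ger0_norm.
rewrite subrr add0r -[RHS](mul0r (S - - S)) -Int_cst//; apply: eq_Int => s _.
by rewrite (pQ (s +i* c)) subrr.
Qed.

Lemma cont_strip_sum (I : Type) (r : seq I) c d (F : I -> C -> R) : (forall i, cont_strip c d (F i)) ->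
  cont_strip c d (fun z => \sum_(i <- r) F i z).
Proof.
move=> cF; elim: r => [|i r IH].
  by under [X in cont_strip _ _ X]funext do rewrite big_nil; exact: cont_strip_cst.
by under [X in cont_strip _ _ X]funext do rewrite big_cons; exact: cont_stripD.
Qed.

Lemma Int2_sum (I : Type) (r : seq I) a b c d (F : I -> C -> R) : c <= d ->
  (forall i, cont_strip c d (F i)) ->
  Int2 a b c d (fun z => \sum_(i <- r) F i z) = \sum_(i <- r) Int2 a b c d (F i).
Proof.
move=> cd cF; elim: r => [|i r IH].
  rewrite big_nil; under [X in Int2 _ _ _ _ X]funext do rewrite big_nil.
  rewrite (_ : (fun=> 0) = (fun z : C => 0 * 0)); last by apply/funext => z; rewrite mul0r.
  by rewrite Int2Z// ?mul0r//; exact: cont_strip_cst.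
under [X in Int2 _ _ _ _ X]funext do rewrite big_cons.
by rewrite Int2D ?big_cons ?IH//; exact: cont_strip_sum.
Qed.

End DoubleIntegral.

Opaque dx dy.

(** * Logarithmic coordinates *)

Section LogCoordinates.
Context {R : realType}.
Local Notation C := R[i]^o.
Implicit Types (z w : C) (f : C -> R) (U : set C) (th : R).
Variable r : R.
Hypothesis r0 : 0 < r.

Definition expX z : R := r * expR (complex.Re z) * cos (complex.Im z).
Definition expY z : R := r * expR (complex.Re z) * sin (complex.Im z).
Definition expC z : C := expX z +i* expY z.

Lemma continuous_expX z : {for z, continuous expX}.
Proof.
have c1 : {for z, continuous (fun z : C => expR (complex.Re z))}.
  by apply: (@continuous_comp _ _ _ (fun z : C => complex.Re z) expR); [exact: continuous_Re|exact: continuous_expR].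
have c2 : {for z, continuous (fun z : C => cos (complex.Im z))}.
  by apply: (@continuous_comp _ _ _ (fun z : C => complex.Im z) cos); [exact: continuous_Im|exact: continuous_cos].
exact: contM (contM (@cont_cst _ _ r z) c1) c2.
Qed.

Lemma continuous_expY z : {for z, continuous expY}.
Proof.
have c1 : {for z, continuous (fun z : C => expR (complex.Re z))}.
  by apply: (@continuous_comp _ _ _ (fun z : C => complex.Re z) expR); [exact: continuous_Re|exact: continuous_expR].
have c2 : {for z, continuous (fun z : C => sin (complex.Im z))}.
  by apply: (@continuous_comp _ _ _ (fun z : C => complex.Im z) sin); [exact: continuous_Im|exact: continuous_sin].
exact: contM (contM (@cont_cst _ _ r z) c1) c2.
Qed.

Lemma continuous_expC z : {for z, continuous expC}.
Proof. by apply: continuous_complex; [exact: continuous_expX|exact: continuous_expY]. Qed.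

Lemma C1_expX : [/\ C1 setT expX, forall z, setT z -> dx expX z = expX z &
  forall z, setT z -> dy expX z = - expY z].
Proof.
apply: (C1I openT) => [z _|z _|z _|z _].
- by rewrite /isdx /expX /=; apply: is_derive_eq; rewrite /GRing.scale /= ; ring.
- by rewrite /isdy /expX /expY /=; apply: is_derive_eq; rewrite /GRing.scale /= ; ring.
- exact: continuous_expX.
- exact: contN (@continuous_expY z).
Qed.

Lemma C1_expY : [/\ C1 setT expY, forall z, setT z -> dx expY z = expY z &
  forall z, setT z -> dy expY z = expX z].
Proof.
apply: (C1I openT) => [z _|z _|z _|z _].
- by rewrite /isdx /expY /=; apply: is_derive_eq; rewrite /GRing.scale /= ; ring.
- by rewrite /isdy /expX /expY /=; apply: is_derive_eq; rewrite /GRing.scale /= ; ring.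
- exact: continuous_expY.
- exact: continuous_expX.
Qed.

Lemma harmonic_exp : harmonic_on setT expX /\ harmonic_on setT expY.
Proof.
have [x1 x2 x3] := C1_expX; have [y1 y2 y3] := C1_expY.
have cN f : C1 setT f -> [/\ C1 setT (fun z => (-1) * f z),
    forall z, setT z -> dx (fun z => (-1) * f z) z = - dx f z &
    forall z, setT z -> dy (fun z => (-1) * f z) z = - dy f z].
  move=> cf; have [a1 a2 a3] := C1_cstE (-1) (@openT C).
  have [b1 b2 b3] := C1ME openT a1 cf; split; first exact: b1.
    by move=> z Uz; rewrite b2// a2//; ring.
  by move=> z Uz; rewrite b3// a3//; ring.
have [m1 m2 m3] := cN _ y1.
have e z : setT z -> dy expX z = (-1) * expY z by move=> Uz; rewrite x3//; ring.
have [c l] := C2I openT x1 x2 e x1 m1.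
have [c' l'] := C2I openT y1 y2 y3 y1 x1.
split; split; [exact: c| |exact: c'|].
  by move=> z Uz; have := l z Uz; rewrite /lap => ->; rewrite x2// m3// y3// subrr.
by move=> z Uz; have := l' z Uz; rewrite /lap => ->; rewrite y2// x3// subrr.
Qed.

Lemma exp_CR z : dx expX z = dy expY z /\ dy expX z = - dx expY z.
Proof.
have [x1 x2 x3] := C1_expX; have [y1 y2 y3] := C1_expY.
by rewrite x2// x3// y2// y3.
Qed.

Lemma open_expC U : open U -> open (expC @^-1` U).
Proof. by move=> oU; apply: (@open_comp _ _ expC U) => // z _; exact: continuous_expC. Qed.

(** [expC] is the holomorphic map [z -> r e^z], whose derivative has modulus [r e^s]; its square
    multiplies the Laplacian. *)
Lemma C2_expC U f : open U -> C2 U f -> C2 (expC @^-1` U) (f \o expC) /\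
  forall z, U (expC z) -> lap (f \o expC) z = lap f (expC z) * (r * expR (complex.Re z)) ^+ 2.
Proof.
move=> oU cf; have [hX hY] := harmonic_exp; have oV := open_expC oU.
have [c l] := C2_compE oU oV cf (C2S (@subsetT _ _) (harmonic_C2 hX)) (C2S (@subsetT _ _) (harmonic_C2 hY))
  (fun z Vz => Vz) (fun z Vz => And4 (exp_CR z).1 (exp_CR z).2 (harmonic_lap hX I) (harmonic_lap hY I)).
split; first exact: c.
move=> z Uz; have := l z Uz; rewrite -/(expC _) => ->.
have [x1 x2 x3] := C1_expX; have [y1 y2 y3] := C1_expY.
rewrite x2// y2//; congr (_ * _); rewrite /expX /expY !exprMn -mulrDr.
by rewrite cos2Dsin2 mulr1.
Qed.

Lemma harmonic_expC U f : open U -> harmonic_on U f -> harmonic_on (expC @^-1` U) (f \o expC).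
Proof.
move=> oU hf; have [hX hY] := harmonic_exp; have oV := open_expC oU.
exact: (harmonic_comp oU oV hf (harmonicS (@subsetT _ _) hX) (harmonicS (@subsetT _ _) hY)
  (fun z Vz => Vz) (fun z _ => exp_CR z)).
Qed.

Lemma modulus_polar (k th' : R) : 0 <= k -> modulus (polar k th' : C) = k.
Proof.
by move=> k0; rewrite modulusE /= !exprMn -mulrDr cos2Dsin2 mulr1 sqrtr_sqr ger0_norm.
Qed.

Lemma expCE z : expC z = polar (r * expR (complex.Re z)) (complex.Im z).
Proof. by []. Qed.

Lemma modulus_expC z : modulus (expC z) = r * expR (complex.Re z).
Proof. by rewrite expCE modulus_polar// mulr_ge0// ?expR_ge0// ltW. Qed.

Lemma expC0 th : expC (0 +i* th) = polar r th.
Proof. by rewrite expCE /= expR0 mulr1. Qed.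

Lemma periodic_expC f : periodic_y (2 * pi) (f \o expC).
Proof.
move=> z; rewrite /= /expC /expX /expY /=.
by rewrite mulr_natl cosD2pi sinD2pi.
Qed.

Lemma sqdist_expC th z : sqdist (polar r th) (expC z) =
  r ^+ 2 * (expR (complex.Re z) ^+ 2 + 1 - 2 * expR (complex.Re z) * cos (complex.Im z - th)).
Proof.
rewrite /sqdist /expC /expX /expY /polar /= cosB.
have h1 := cos2Dsin2 th; have h2 := cos2Dsin2 (complex.Im z).
set e := expR _; transitivity (r ^+ 2 * (e ^+ 2 * (cos (complex.Im z) ^+ 2 + sin (complex.Im z) ^+ 2) +
  (cos th ^+ 2 + sin th ^+ 2) - 2 * e * (cos (complex.Im z) * cos th + sin (complex.Im z) * sin th))); first by ring.
by rewrite h1 h2; ring.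
Qed.

(** Whatever the radius, the angle alone bounds the distance from below. Together with the next
    bound, which uses the radius alone, this localises small discs about points of the circle on the
    cylinder. *)
Lemma sqdist_expC_ge_cos th z : r ^+ 2 * ((1 - cos (complex.Im z - th)) / 2) <= sqdist (polar r th) (expC z).
Proof.
rewrite sqdist_expC ler_pM2l ?exprn_gt0//.
have := cos_le1 (complex.Im z - th); have := cos_geN1 (complex.Im z - th).
have := expR_gt0 (complex.Re z); set c := cos _; set e := expR _ => e0 c1 c2.
have := sqr_ge0 (e - c); have := sqr_ge0 (e - 1); nra.
Qed.

Lemma sqdist_expC_ge_exp th z : (r * (expR (complex.Re z) - 1)) ^+ 2 <= sqdist (polar r th) (expC z).
Proof.
rewrite sqdist_expC exprMn ler_pM2l ?exprn_gt0//.
have := cos_le1 (complex.Im z - th).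
have := expR_gt0 (complex.Re z); set c := cos _; set e := expR _ => e0 c1; nra.
Qed.

Lemma cos_lt1 (x : R) : 0 < x < 2 * pi -> cos x < 1.
Proof.
move=> /andP[x0 x2]; have s0 : 0 < sin (x / 2) by apply: sin_gt0_pi; rewrite divr_gt0//=; lra.
have -> : x = (x / 2) *+ 2 by rewrite mulr2n; lra.
rewrite cos_mulr2n; have := cos2Dsin2 (x / 2); have := exprn_gt0 2 s0.
rewrite mulr2n; lra.
Qed.

Lemma polar_surj (a : C) : modulus a = r -> exists2 th, 0 <= th < 2 * pi & a = polar r th.
Proof.
move=> ar; pose x := complex.Re a / r; have rn : r != 0 by rewrite gt_eqF.
have E : complex.Re a ^+ 2 + complex.Im a ^+ 2 = r ^+ 2 by rewrite -sqr_modulus ar.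
have x1 : -1 <= x <= 1.
  rewrite /x ler_pdivlMr// ler_pdivrMr// mulN1r mul1r -ler_norml -(ger0_norm (ltW r0)) -ler_sqr ?nnegrE//.
  by rewrite !real_normK ?num_real// -E lerDl sqr_ge0.
have sE : Num.sqrt (1 - x ^+ 2) = `|complex.Im a| / r.
  rewrite (_ : 1 - x ^+ 2 = (complex.Im a / r) ^+ 2); first by rewrite sqrtr_sqr normrM normfV (gtr0_norm r0).
  by rewrite /x !expr_div_n -[1](divff (expf_neq0 2 rn)) -{1}E; field.
have [h1 h2] := acos_def x1; have pi0 := pi_gt0 R.
have cx : r * x = complex.Re a by rewrite /x mulrCA mulfV// mulr1.
have [i0|i0] := leP 0 (complex.Im a).
  exists (acos x); first by case/andP: h1 => -> /=; lra.
  by rewrite /polar h2 sin_acos// sE ger0_norm// cx mulrCA mulfV// mulr1 complex_eta.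
(* With a negative imaginary part [acos x] is nonzero, which keeps this angle below [2 pi]. *)
exists (- acos x + 2 * pi).
  have p0 : acos x != 0.
    apply/eqP => e; have := sin_acos x1; rewrite e sin0 sE => /esym/eqP.
    by rewrite mulf_eq0 invr_eq0 (negPf rn) orbF normr_eq0 lt_eqF.
  by case/andP: h1; rewrite le_eqVlt eq_sym (negPf p0) /=; lra.
rewrite /polar mulr_natl cosD2pi sinD2pi cosN sinN h2 sin_acos// sE ltr0_norm// cx.
by rewrite mulNr opprK mulrCA mulfV// mulr1 complex_eta.
Qed.

End LogCoordinates.

(** * The energy of a pair of approximants *)

Section Energy.
Context {R : realType}.
Local Notation C := R[i]^o.
Implicit Types (z w : C) (f g A B : C -> R) (U Om K : set C).

Definition grad_sq f z : R := dx f z ^+ 2 + dy f z ^+ 2.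

Lemma dx_out K A z : closed K -> (forall z, ~ K z -> A z = 0) -> ~ K z ->
  [/\ dx A z = 0, dy A z = 0 & lap A z = 0].
Proof.
move=> cK A0 Kz; have oK := closed_openC cK.
have [_ x0 y0] := @C1_cstE R (~` K) 0 oK.
have ex w : (~` K) w -> dx A w = 0 by move=> Kw; rewrite (eq_dx oK A0 Kw) x0.
have ey w : (~` K) w -> dy A w = 0 by move=> Kw; rewrite (eq_dy oK A0 Kw) y0.
split; [exact: ex|exact: ey|].
by rewrite /lap (eq_dx oK ex Kz) (eq_dy oK ey Kz) x0// y0// addr0.
Qed.

Section Flux.
Variables (Om K : set C) (A B g : C -> R).
Hypotheses (oOm : open Om) (cK : closed K) (KOm : K `<=` Om) (A0 : forall z, ~ K z -> A z = 0)
  (cA : C2 setT A) (cB : C2 setT B) (cg : C2 Om g).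

(** [A] and [B] approximate the Green functions with poles [z_k] and [zeta_k], and [g] is the
    rounded Green function with pole [zeta_k]. In the divergence the first three terms complete the
    square [|grad (A - B)|^2] up to Laplacians, and [2 (g DA - A Dg)] is Green's second identity,
    which moves the mutual energy of the poles onto the charge of [A]. [D] stands for [dx] or
    [dy]. *)
Definition flux (D : (C -> R) -> C -> R) z : R :=
  A z * D A z + B z * D B z - 2 * (B z * D A z) + 2 * (g z * D A z - A z * D g z).

Lemma C1_flux (D : (C -> R) -> C -> R) : D = dx \/ D = dy ->
  [/\ C1 setT (flux D),
   forall z, Om z -> dx (flux D) z = dx A z * D A z + A z * dx (D A) z + dx B z * D B z + B z * dx (D B) z
     - 2 * (dx B z * D A z + B z * dx (D A) z)
     + 2 * (dx g z * D A z + g z * dx (D A) z - dx A z * D g z - A z * dx (D g) z) &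
   forall z, Om z -> dy (flux D) z = dy A z * D A z + A z * dy (D A) z + dy B z * D B z + B z * dy (D B) z
     - 2 * (dy B z * D A z + B z * dy (D A) z)
     + 2 * (dy g z * D A z + g z * dy (D A) z - dy A z * D g z - A z * dy (D g) z)].
Proof.
move=> hD.
have cDA : C1 setT (D A) by case: hD => ->; [exact: C2_dx|exact: C2_dy].
have cDB : C1 setT (D B) by case: hD => ->; [exact: C2_dx|exact: C2_dy].
have cDg : C1 Om (D g) by case: hD => ->; [exact: C2_dx|exact: C2_dy].
have c1A := C2_C1 cA; have c1B := C2_C1 cB; have c1g := C2_C1 cg.
have main U : open U -> U `<=` Om -> [/\ C1 U (flux D),
   forall z, U z -> dx (flux D) z = dx A z * D A z + A z * dx (D A) z + dx B z * D B z + B z * dx (D B) z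
     - 2 * (dx B z * D A z + B z * dx (D A) z)
     + 2 * (dx g z * D A z + g z * dx (D A) z - dx A z * D g z - A z * dx (D g) z) &
   forall z, U z -> dy (flux D) z = dy A z * D A z + A z * dy (D A) z + dy B z * D B z + B z * dy (D B) z
     - 2 * (dy B z * D A z + B z * dy (D A) z)
     + 2 * (dy g z * D A z + g z * dy (D A) z - dy A z * D g z - A z * dy (D g) z)].
  move=> oU UOm.
  have S f : C1 setT f -> C1 U f by apply: C1S.
  have SO f : C1 Om f -> C1 U f by apply: C1S.
  have [a1 a2 a3] := C1ME oU (S _ c1A) (S _ cDA).
  have [b1 b2 b3] := C1ME oU (S _ c1B) (S _ cDB).
  have [d1 d2 d3] := C1ME oU (S _ c1B) (S _ cDA).
  have [e1 e2 e3] := C1ME oU (SO _ c1g) (S _ cDA).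
  have [f1 f2 f3] := C1ME oU (S _ c1A) (SO _ cDg).
  have [k1 k2 k3] := C1_cstE (- 2) oU.
  have [l1 l2 l3] := C1_cstE 2 oU.
  have [n1 n2 n3] := C1_cstE (-1) oU.
  have [m1 m2 m3] := C1DE oU a1 b1.
  have [p1 p2 p3] := C1ME oU k1 d1.
  have [q1 q2 q3] := C1ME oU n1 f1.
  have [r1 r2 r3] := C1DE oU e1 q1.
  have [s1 s2 s3] := C1ME oU l1 r1.
  have [t1 t2 t3] := C1DE oU m1 p1.
  have [u1 u2 u3] := C1DE oU t1 s1.
  have E w : U w -> A w * D A w + B w * D B w + - 2 * (B w * D A w) +
      2 * (g w * D A w + -1 * (A w * D g w)) = flux D w by move=> _; rewrite /flux; ring.
  split; first exact: (eq_C1 oU E u1).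
    move=> z Uz; rewrite -(eq_dx oU E Uz) u2// t2// s2// r2// q2// p2// m2// a2// b2// d2// e2// f2//.
    by rewrite k2// l2// n2//; ring.
  move=> z Uz; rewrite -(eq_dy oU E Uz) u3// t3// s3// r3// q3// p3// m3// a3// b3// d3// e3// f3//.
  by rewrite k3// l3// n3//; ring.
have [c1 c2 c3] := main _ oOm (@subset_refl _ _).
split; [|exact: c2|exact: c3].
(* [g] is regular only on [Om], but off the support of [A] the field reduces to [B DB], so it is
   [C1] everywhere. *)
apply: C1_local => z _; have [Kz|Kz] := pselect (K z).
  by exists Om; split; [exact: oOm|exact: KOm|exact: c1].
have oK := closed_openC cK; exists (~` K); split; [exact: oK|exact: Kz|].
have cb : C1 (~` K) (fun z => B z * D B z).
  exact: C1S (@subsetT _ _) (C1M openT c1B cDB).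
apply: (eq_C1 oK _ cb) => w Kw; have [hx hy _] := dx_out cK A0 Kw.
have DA0 : D A w = 0 by case: hD => ->.
by rewrite /flux DA0 A0//; ring.
Qed.

Lemma div_flux z : Om z -> dx (flux dx) z + dy (flux dy) z =
  grad_sq (fun z => A z - B z) z + A z * lap A z + B z * lap B z - 2 * (B z * lap A z)
  + 2 * (g z * lap A z) - 2 * (A z * lap g z).
Proof.
move=> Oz; have [_ h1 _] := C1_flux (or_introl erefl); have [_ _ h2] := C1_flux (or_intror erefl).
have [_ bx by_] := C1BE openT (C2_C1 cA) (C2_C1 cB).
rewrite h1// h2// /grad_sq bx// by_// /lap; gen_partials; ring.
Qed.

Lemma div_flux_out z : ~ K z -> dx (flux dx) z + dy (flux dy) z = grad_sq B z + B z * lap B z.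
Proof.
move=> Kz; have oK := closed_openC cK; have c1B := C2_C1 cB.
have cx := C2_dx cB; have cy := C2_dy cB.
have E (D : (C -> R) -> C -> R) w : D = dx \/ D = dy -> (~` K) w -> flux D w = B w * D B w.
  move=> hD Kw; have [hx hy _] := dx_out cK A0 Kw.
  by have DA0 : D A w = 0 by [case: hD => ->]; rewrite /flux DA0 A0//; ring.
rewrite (eq_dx oK (fun w => E dx w (or_introl erefl)) Kz) (eq_dy oK (fun w => E dy w (or_intror erefl)) Kz).
have [_ h1 _] := C1ME openT c1B cx; have [_ _ h2] := C1ME openT c1B cy.
rewrite h1// h2// /grad_sq /lap; gen_partials; ring.
Qed.

Variables (qA qB : C -> R).
Hypotheses (lA : forall z, - lap A z <= qA z) (lB : forall z, - lap B z <= qB z)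
  (Age0 : forall z, 0 <= A z) (Bge0 : forall z, 0 <= B z)
  (qA0 : forall z, ~ Om z -> qA z = 0)
  (lg : forall z, Om z -> lap g z = - qB z) (Bg : forall z, Om z -> B z <= g z).

Definition energy_density z : R :=
  2 * (qA z - qB z) * (A z - B z) - grad_sq (fun z => A z - B z) z.

(** On [Om] the right side exceeds the left by [A (qA + lap A) + B (qB + lap B) + 2 (g - B) (qA +
    lap A)], in which every factor is nonnegative by the one-sided properties of the approximants;
    off [Om] only the term with [B] remains. The factor [A - 2 g] is what puts the Green function
    between [z_k] and [zeta_k] into the bound. *)
Lemma energy_density_ge z :
  qA z * (A z - 2 * g z) + qB z * B z <= energy_density z + (dx (flux dx) z + dy (flux dy) z).
Proof.
have pos (a b : R) : - b <= a -> 0 <= a + b by rewrite -lerBlDl sub0r lerNl.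
have [Oz|Oz] := pselect (Om z).
  rewrite div_flux// /energy_density lg//.
  have h1 : 0 <= A z * (qA z + lap A z) by exact: mulr_ge0 (Age0 z) (pos _ _ (lA z)).
  have h2 : 0 <= B z * (qB z + lap B z) by exact: mulr_ge0 (Bge0 z) (pos _ _ (lB z)).
  have gB : 0 <= g z - B z by rewrite subr_ge0; exact: Bg.
  have h3 : 0 <= (g z - B z) * (qA z + lap A z) by exact: mulr_ge0 gB (pos _ _ (lA z)).
  rewrite -subr_ge0 (_ : _ - _ = A z * (qA z + lap A z) + B z * (qB z + lap B z) + 2 * ((g z - B z) * (qA z + lap A z))).
    exact: addr_ge0 (addr_ge0 h1 h2) (mulr_ge0 (ler0n _ 2) h3).
  by move: (grad_sq _ z) (lap A z) (lap B z) (qA z) (qB z) (A z) (B z) (g z) => *; ring.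
have Kz : ~ K z by move=> /KOm.
have [ax ay al] := dx_out cK A0 Kz.
have [_ bx by_] := C1BE openT (C2_C1 cA) (C2_C1 cB).
rewrite div_flux_out// /energy_density /grad_sq bx// by_// ax ay A0// qA0//.
have h2 : 0 <= B z * (qB z + lap B z) by exact: mulr_ge0 (Bge0 z) (pos _ _ (lB z)).
rewrite -subr_ge0 (_ : _ - _ = B z * (qB z + lap B z)) //.
by move: (lap B z) (qB z) (B z); gen_partials => *; ring.
Qed.

Variables (S c p : R).
Hypotheses (S0 : 0 <= S) (p0 : 0 <= p) (sK : forall z, K z -> `|complex.Re z| < S)
  (sB : forall z, S <= `|complex.Re z| -> B z = 0)
  (pA : periodic_y p A) (pB : periodic_y p B) (pg : periodic_y p g)
  (cqA : forall z, {for z, continuous qA}) (cqB : forall z, {for z, continuous qB}).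

Lemma continuous_grad_sq f z : C2 setT f -> {for z, continuous (grad_sq f)}.
Proof.
move=> cf'; have cf := C2_C1 cf'; have cx := C1_cdx cf (I : setT z); have cy := C1_cdy cf (I : setT z).
exact: contD (contX (n := 2) cx) (contX (n := 2) cy).
Qed.

Lemma continuous_energy_density z : {for z, continuous energy_density}.
Proof.
have cA' := C2_continuous openT cA (I : setT z); have cB' := C2_continuous openT cB (I : setT z).
have cgr := @continuous_grad_sq (fun z => A z - B z) z (C2B openT cA cB).
apply: contB; last exact: cgr.
apply: contM; last exact: contB cA' cB'.
apply: contM; first exact: cont_cst.
exact: contB (@cqA z) (@cqB z).
Qed.

(** Over a full turn of the cylinder the divergence of [flux] integrates to 0, as the field vanishes
    for [|Re z| >= S] and is periodic; so the pointwise bound can be integrated. *)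
Lemma energy_lower_bound (F : C -> R) : cont_strip c (c + p) F ->
  (forall z, F z <= qA z * (A z - 2 * g z) + qB z * B z) ->
  Int2 (- S) S c (c + p) F <= Int2 (- S) S c (c + p) energy_density.
Proof.
move=> cF hF; have cp : c <= c + p by rewrite lerDl.
have [cx _ _] := C1_flux (or_introl erefl); have [cy _ _] := C1_flux (or_intror erefl).
have P0 z : S <= `|complex.Re z| -> flux dx z = 0.
  move=> Sz; have Kz : ~ K z by move=> /sK; rewrite ltNge Sz.
  by have [ax _ _] := dx_out cK A0 Kz; rewrite /flux (sB Sz) (A0 Kz) ax; ring.
have pQ : periodic_y p (flux dy).
  move=> z; rewrite /flux (pA z) (pB z) (pg z) (periodic_dy pA z) (periodic_dy pB z).
  by rewrite (periodic_dy pg z).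
have h0 := divergence_cylinder c S0 p0 cx cy P0 pQ.
have cd : cont_strip c (c + p) (fun z => dx (flux dx) z + dy (flux dy) z).
  by move=> z _; exact: contD (C1_cdx cx I) (C1_cdy cy I).
have ce : cont_strip c (c + p) energy_density by move=> z _; exact: continuous_energy_density.
rewrite -[leRHS]addr0 -h0 -Int2D//; apply: le_Int2 => //; first exact: cont_stripD.
by move=> z _ _; exact: le_trans (hF z) (energy_density_ge z).
Qed.

End Flux.
End Energy.

(** * The comparison potential of a strip *)

Section Affine.
Context {R : realType}.
Local Notation C := R[i]^o.
Implicit Types (z w : C) (f : C -> R) (U : set C).

Lemma dx_affine (a b d : R) z :
  dx (fun z : C => a + b * complex.Re z + d * complex.Im z) z = b /\
  dy (fun z : C => a + b * complex.Re z + d * complex.Im z) z = d.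
Proof.
split.
  have /isdxP[_ ->//] : isdx (fun z : C => a + b * complex.Re z + d * complex.Im z) z b.
  by rewrite /isdx /=; apply: is_derive_eq; rewrite /GRing.scale /=; ring.
have /isdyP[_ ->//] : isdy (fun z : C => a + b * complex.Re z + d * complex.Im z) z d.
by rewrite /isdy /=; apply: is_derive_eq; rewrite /GRing.scale /=; ring.
Qed.

Definition dilate (k a b : R) z : C := (a + k * complex.Re z) +i* (b + k * complex.Im z).

Lemma dilateE k a b : dilate k a b = fun z =>
  (a + k * complex.Re z + 0 * complex.Im z) +i* (b + 0 * complex.Re z + k * complex.Im z).
Proof. by apply/funext => z; rewrite /dilate !mul0r !addr0. Qed.

Lemma continuous_dilate k a b z : {for z, continuous (dilate k a b)}.
Proof.
apply: continuous_complex; apply: contD; first exact: cont_cst.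
- by apply: contM; [exact: cont_cst|exact: continuous_Re].
- exact: cont_cst.
- by apply: contM; [exact: cont_cst|exact: continuous_Im].
Qed.

Lemma open_dilate k a b U : open U -> open (dilate k a b @^-1` U).
Proof. by move=> oU; apply: (@open_comp _ _ (dilate k a b) U) => // z _; exact: continuous_dilate. Qed.

Lemma harmonic_dilate k a b U f : open U -> harmonic_on U f ->
  harmonic_on (dilate k a b @^-1` U) (f \o dilate k a b).
Proof.
move=> oU hf; have oV := @open_dilate k a b U oU; move: oV; rewrite dilateE => oV.
apply: (harmonic_comp oU oV hf (harmonic_affine a k 0 oV) (harmonic_affine b 0 k oV)) => // z _.
have [a1 a2] := dx_affine a k 0 z; have [b1 b2] := dx_affine b 0 k z.
by rewrite a1 a2 b1 b2 oppr0.
Qed.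

End Affine.

Section Comparison.
Context {R : realType}.
Local Notation C := R[i]^o.
Implicit Types (z w : C) (f : C -> R) (U : set C) (th d m b : R).

Definition ch (x : R) : R := (expR x + expR (- x)) / 2.
Definition sh (x : R) : R := (expR x - expR (- x)) / 2.

Lemma is_derive_ch (x : R) : is_derive x 1 ch (sh x).
Proof. by rewrite /ch; apply: is_derive_eq; rewrite /GRing.scale /= /sh; field. Qed.

Lemma is_derive_sh (x : R) : is_derive x 1 sh (ch x).
Proof. by rewrite /sh; apply: is_derive_eq; rewrite /GRing.scale /= /ch; field. Qed.

Lemma chN x : ch (- x) = ch x.
Proof. by rewrite /ch opprK addrC. Qed.

Lemma ch_sqr x : ch x = 1 + 2 * sh (x / 2) ^+ 2.
Proof.
rewrite /ch /sh; have -> : expR x = expR (x / 2) ^+ 2 by rewrite -expRM_natl; congr expR; field.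
have -> : expR (- x) = expR (- (x / 2)) ^+ 2 by rewrite -expRM_natl; congr expR; field.
have := expRxMexpNx_1 (x / 2); set p := expR _; set q := expR _ => pq.
transitivity (1 + ((p ^+ 2 + q ^+ 2) / 2 - p * q)); [by rewrite pq; field|by field].
Qed.

Lemma sh_gt0 x : (0 < sh x) = (0 < x).
Proof. by rewrite /sh pmulr_lgt0 ?invr_gt0// subr_gt0 ltr_expR; apply/idP/idP; lra. Qed.

Lemma shN x : sh (- x) = - sh x.
Proof. by rewrite /sh opprK -mulNr opprB. Qed.

Lemma sh_eq0 x : (sh x == 0) = (x == 0).
Proof.
have [x0|x0|<-] := ltgtP 0 x; last by rewrite /sh oppr0 subrr mul0r eqxx.
  by rewrite gt_eqF ?sh_gt0// gt_eqF.
have h : 0 < sh (- x) by rewrite sh_gt0 oppr_gt0.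
by rewrite lt_eqF// -oppr_gt0 -shN.
Qed.

Lemma continuous_ch (x : R) : {for x, continuous ch}.
Proof. exact: is_derive_cont (is_derive_ch x). Qed.

(** This is [2 |sinh (m z / 2)|^2], so that [strip_log m] is [ln |sinh (m z / 2)|] up to the
    constant [ln 2 / 2]. *)
Definition chcos m z : R := ch (m * complex.Re z) - cos (m * complex.Im z).
Definition strip_log m z : R := 2^-1 * ln (chcos m z).

Lemma chcosE m z : chcos m z = 2 * (sh (m * complex.Re z / 2) ^+ 2 + sin (m * complex.Im z / 2) ^+ 2).
Proof.
rewrite /chcos ch_sqr; have -> : m * complex.Im z = (m * complex.Im z / 2) *+ 2 by rewrite mulr2n; lra.
rewrite cos_mulr2n; have := cos2Dsin2 (m * complex.Im z / 2).
have -> : (m * complex.Im z / 2) *+ 2 / 2 = m * complex.Im z / 2 by rewrite mulr2n; lra.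
rewrite mulr2n; lra.
Qed.

Lemma chcos_ge0 m z : 0 <= chcos m z.
Proof. by rewrite chcosE mulr_ge0// addr_ge0// sqr_ge0. Qed.

Lemma sin_neq0 (x : R) : x != 0 -> `|x| < pi -> sin x != 0.
Proof.
move=> x0; rewrite ltr_norml => /andP[h1 h2]; case: (ltgtP x 0) x0 => // [xn|xp] _.
  by have : 0 < sin (- x) by [apply: sin_gt0_pi; lra]; rewrite sinN oppr_gt0 => /lt_eqF ->.
by rewrite gt_eqF// sin_gt0_pi// xp.
Qed.

Lemma chcos_gt0 m z : m != 0 -> `|m * complex.Im z| < 2 * pi -> z != 0 -> 0 < chcos m z.
Proof.
move=> m0 h z0; rewrite lt_neqAle chcos_ge0 andbT eq_sym chcosE mulf_eq0 pnatr_eq0 /=.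
rewrite paddr_eq0 ?sqr_ge0// !sqrf_eq0 sh_eq0; apply/negP => /andP[].
rewrite !mulf_eq0 (negPf m0) invr_eq0 pnatr_eq0 orbF /= => /eqP s0.
have [t0|t0] := eqVneq (complex.Im z) 0.
  by case/negP: z0; rewrite -(complex_eta z) s0 t0.
apply/negP/sin_neq0; first by rewrite !mulf_eq0 (negPf m0) (negPf t0) invr_eq0 pnatr_eq0.
by rewrite normrM normfV (@ger0_norm _ 2)//; lra.
Qed.

Lemma chcos_scale m z : chcos m z = chcos 1 (dilate m 0 0 z).
Proof. by rewrite /chcos /dilate /= !add0r !mul1r. Qed.

(** This links Euclidean poles with potentials of strips: taking logarithms, the distance to a point
    of the circle becomes [strip_log 1] up to an affine function. *)
Lemma sqdist_chcos (r : R) th z : sqdist (polar r th) (expC r z) =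
  2 * r ^+ 2 * expR (complex.Re z) * chcos 1 (complex.Re z +i* (complex.Im z - th)).
Proof.
rewrite sqdist_expC /chcos /= !mul1r /ch; have := expRxMexpNx_1 (complex.Re z).
set p := expR _; set q := expR _ => pq; set c := cos _.
transitivity (r ^+ 2 * (p ^+ 2 + p * q - 2 * p * c)); [by rewrite pq|by field].
Qed.

Lemma ln_modulus_expC (r : R) th z : 0 < r -> 0 < chcos 1 (complex.Re z +i* (complex.Im z - th)) ->
  ln (modulus (expC r z - polar r th)) =
  ln r + 2^-1 * ln 2 + complex.Re z / 2 + strip_log 1 (complex.Re z +i* (complex.Im z - th)).
Proof.
move=> r0 k0; rewrite ln_modulusE sqdist_chcos /strip_log.
have e0 := expR_gt0 (complex.Re z); have r20 : 0 < r ^+ 2 by rewrite exprn_gt0.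
rewrite !lnM ?posrE ?mulr_gt0// expRK; by [field|].
Qed.

(** After dilation by [m], the function is [ln |expC 1 z - 1|] minus an affine function, so
    harmonicity is inherited without differentiating [chcos]. *)
Lemma harmonic_strip_log m (U : set C) : open U -> (forall z, U z -> 0 < chcos m z) -> harmonic_on U (strip_log m).
Proof.
move=> oU U0; have [a ae] : exists a : C, a = polar 1 0 by exists (polar 1 0).
have hl := harmonic_ln_modulus a; have oa := @open_punctured R a.
have h1 := harmonic_expC 1 oa hl.
have h2 := harmonic_dilate m 0 0 (open_expC (r := 1) oa) h1.
have h3 := harmonic_affine (2^-1 * ln 2) (m / 2) 0 oU.
have US : U `<=` (dilate m 0 0 @^-1` (expC 1 @^-1` [set z | z != a])).
  move=> z Uz /=; rewrite -sqdist_gt0 ae sqdist_chcos subr0 complex_eta -chcos_scale.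
  by rewrite !mulr_gt0// ?expR_gt0 ?U0.
apply: (eq_harmonic oU _ (harmonicB oU (harmonicS US h2) h3)) => z Uz.
rewrite /= ae ln_modulus_expC// ?subr0 ?complex_eta -?chcos_scale; [|exact: U0].
have -> : strip_log m z = strip_log 1 (dilate m 0 0 z) by rewrite /strip_log (chcos_scale m z).
by move: (strip_log _ _) => k; rewrite ln1 /dilate /=; field.
Qed.

Lemma derive_small (f df : R -> R) (e : R) : (forall t : R, is_derive t 1 f (df t)) ->
  {for 0, continuous df} -> df 0 = 1 -> f 0 = 0 -> 0 < e ->
  exists2 d : R, 0 < d & forall x, `|x| < d -> `|f x - x| <= e * `|x|.
Proof.
move=> hf cf d1 f0 e0; have /(@cvgrPdist_lt _ _ _ _ (nbhs_filter (0 : R))) /(_ e e0) := cf.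
move=> /nbhs_ballP[d /= d0 Hd]; exists d => // x xd.
have hg (t : R) : `|t - 0| <= `|x - 0| -> is_derive t 1 (fun t => f t - t) (df t - 1).
  by move=> _; exact: is_deriveB.
have [s sx] := MVT_abs hg; rewrite f0 subr0 !subr0 => ->; rewrite normrM ler_wpM2r//.
have /Hd : ball (0 : R) d s by rewrite /ball /= sub0r normrN; move: sx; rewrite !subr0; lra.
by rewrite /= d1 distrC => /ltW.
Qed.

Lemma strip_log_near0 (e : R) : 0 < e -> exists2 d : R, 0 < d &
  forall z, z != 0 -> modulus z < d -> `|strip_log 1 z - ln (modulus z) + 2^-1 * ln 2| <= e.
Proof.
(* Chosen so that [ln (1 - k) = - e]; then also [ln (1 + k) <= e], and a relative error [k] costs at
   most [e] in the logarithm. *)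
move=> e0; pose k := 1 - expR (- e).
have x0 : 0 < expR (- e) := expR_gt0 _.
have x1 : expR (- e) < 1 by rewrite expR_lt1; lra.
have k0 : 0 < k by rewrite /k; lra.
have k1 : k < 1 by rewrite /k; lra.
have lk : ln (1 - k) = - e by rewrite /k opprB addrC subrK expRK.
have lk' : ln (1 + k) <= e.
  have : ln ((1 + k) * (1 - k)) <= ln 1.
    rewrite ler_ln ?posrE ?mulr_gt0//; [|lra|lra]; have := sqr_ge0 k; lra.
  by rewrite lnM ?posrE; [|lra|lra]; rewrite ln1 lk; lra.
have [d1 d10 H1] := derive_small is_derive_sh (@continuous_ch 0) (ltac:(by rewrite /ch oppr0 expR0; lra))
  (ltac:(by rewrite /sh oppr0 subrr mul0r)) k0.
have [d2 d20 H2] := derive_small (@is_derive_sin R) (@continuous_cos R 0) (@cos0 R) (@sin0 R) k0.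
exists (Num.min d1 d2); first by rewrite lt_min d10.
move=> z z0; rewrite lt_min => /andP[zd1 zd2].
have hs (f : R -> R) (d x : R) : (forall x, `|x| < d -> `|f x - x| <= k * `|x|) -> `|x| <= modulus z ->
    modulus z < d -> (1 - k) ^+ 2 * (x / 2) ^+ 2 <= f (x / 2) ^+ 2 <= (1 + k) ^+ 2 * (x / 2) ^+ 2.
  move=> Hf xz zd; set y := x / 2; have yd : `|y| < d.
    by rewrite /y normrM normfV (@ger0_norm _ 2)//; have := normr_ge0 x; lra.
  have hy := Hf y yd; rewrite -[f y ^+ 2]real_normK ?num_real// -[y ^+ 2]real_normK ?num_real// -!exprMn.
  have h1 : `|f y| <= (1 + k) * `|y|.
    by have := ler_normD (f y - y) y; rewrite subrK; lra.
  have h2 : (1 - k) * `|y| <= `|f y|.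
    by have := ler_normD (f y) (y - f y); rewrite addrC subrK (distrC y); lra.
  by rewrite !ler_sqr ?nnegrE ?mulr_ge0//; [rewrite h1 h2|lra|lra].
have /andP[a1 a2] : (1 - k) ^+ 2 * (complex.Re z / 2) ^+ 2 <= sh (complex.Re z / 2) ^+ 2 <= (1 + k) ^+ 2 * (complex.Re z / 2) ^+ 2.
  apply: (hs sh d1) => //; rewrite modulusE -sqrtr_sqr ler_wsqrtr// lerDl; exact: sqr_ge0.
have /andP[b1 b2] : (1 - k) ^+ 2 * (complex.Im z / 2) ^+ 2 <= sin (complex.Im z / 2) ^+ 2 <= (1 + k) ^+ 2 * (complex.Im z / 2) ^+ 2.
  apply: (hs sin d2) => //; rewrite modulusE -sqrtr_sqr ler_wsqrtr// lerDr; exact: sqr_ge0.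
have m0 : 0 < modulus z by rewrite modulus_gt0.
have mE : modulus z ^+ 2 = complex.Re z ^+ 2 + complex.Im z ^+ 2 by rewrite sqr_modulus.
have cE : chcos 1 z = 2 * (sh (complex.Re z / 2) ^+ 2 + sin (complex.Im z / 2) ^+ 2) by rewrite chcosE !mul1r.
have c1 : (1 - k) ^+ 2 * modulus z ^+ 2 / 2 <= chcos 1 z by rewrite mE cE; nra.
have c2 : chcos 1 z <= (1 + k) ^+ 2 * modulus z ^+ 2 / 2 by rewrite mE cE; nra.
have lE (q : R) : 0 < q -> 2^-1 * ln (q ^+ 2 * modulus z ^+ 2 / 2) = ln q + ln (modulus z) - 2^-1 * ln 2.
  move=> q0; rewrite ln_div ?posrE ?mulr_gt0 ?exprn_gt0// lnM ?posrE ?exprn_gt0//.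
  by rewrite !lnXn// !mulr2n; field.
have p1 : 0 < (1 - k) ^+ 2 * modulus z ^+ 2 / 2 by rewrite !mulr_gt0 ?exprn_gt0//; lra.
have p2 := lt_le_trans p1 c1.
have l1 : ln ((1 - k) ^+ 2 * modulus z ^+ 2 / 2) <= ln (chcos 1 z) by rewrite ler_ln ?posrE.
have l2 : ln (chcos 1 z) <= ln ((1 + k) ^+ 2 * modulus z ^+ 2 / 2).
  by rewrite ler_ln ?posrE//; exact: lt_le_trans p2 c2.
have e1 := lE (1 - k) (ltac:(lra)); have e2 := lE (1 + k) (ltac:(lra)).
by rewrite /strip_log ler_norml; apply/andP; split; lra.
Qed.

Lemma dilate0 m : dilate m 0 0 = fun z => (m * complex.Re z) +i* (m * complex.Im z) :> C.
Proof. by apply/funext => z; rewrite /dilate !add0r. Qed.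

Lemma strip_log_scale m z : strip_log m z = strip_log 1 (dilate m 0 0 z).
Proof. by rewrite /strip_log chcos_scale. Qed.

Lemma modulus_dilate m z : 0 < m -> modulus (dilate m 0 0 z) = m * modulus z.
Proof.
move=> m0; rewrite dilate0 !modulusE /= !exprMn -mulrDr sqrtrM ?sqr_ge0// sqrtr_sqr ger0_norm//; exact: ltW.
Qed.

Lemma strip_log_quotient_near0 m (e : R) : 0 < m -> 0 < e -> exists2 d : R, 0 < d &
  forall z, z != 0 -> modulus z < d -> `|strip_log 1 z - strip_log m z + ln m| <= e.
Proof.
move=> m0 e0; have e20 : 0 < e / 2 by lra.
have [d d0 Hd] := strip_log_near0 e20.
exists (Num.min d (d / m)); first by rewrite lt_min d0 divr_gt0.
move=> z z0; rewrite lt_min => /andP[h1 h2].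
have p0 : 0 < modulus z by rewrite modulus_gt0.
have w0 : dilate m 0 0 z != 0 by rewrite -modulus_gt0 modulus_dilate// mulr_gt0.
have w1 : modulus (dilate m 0 0 z) < d by rewrite modulus_dilate// mulrC -ltr_pdivlMr.
have := Hd z z0 h1; have := Hd _ w0 w1.
rewrite (strip_log_scale m) modulus_dilate// lnM ?posrE// !ler_norml => /andP[? ?] /andP[? ?].
by apply/andP; split; lra.
Qed.

Definition strip b : set C := [set z | - b < complex.Im z < b].

Lemma open_strip b : open (strip b).
Proof.
have -> : strip b = [set z | - b < complex.Im z] `&` [set z | complex.Im z < b].
  by apply/seteqP; split=> z /=; [move/andP|case=> h1 h2; apply/andP].
by apply: openI; [exact: open_Im_gt|exact: open_Im_lt].
Qed.

Lemma strip_chcos_gt0 m b z : 0 < m -> m * b <= 2 * pi -> strip b z -> z != 0 -> 0 < chcos m z.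
Proof.
move=> m0 mb /andP[h1 h2] z0; apply: chcos_gt0 => //; first by rewrite gt_eqF.
rewrite normrM (gtr0_norm m0); apply: lt_le_trans mb; rewrite ltr_pM2l// ltr_norml; lra.
Qed.

(** Both terms are [ln |z|] plus a constant up to o(1) at 0, so the singularity of the difference is
    removable, and scaling gives the value [- ln m]. The two bounds on [b] keep the other zeros of
    [chcos 1] and [chcos m] out of the strip. Adding [q] later trades a Euclidean pole for the pole
    of a strip. *)
Lemma regular_quotient m b : 0 < m -> 0 < b <= 2 * pi -> m * b <= 2 * pi ->
  exists q : C -> R, [/\ harmonic_on (strip b) q,
    forall z, strip b z -> z != 0 -> q z = strip_log 1 z - strip_log m z & q 0 = - ln m].
Proof.
move=> m0 /andP[b0 b2] mb.
have o0 : open [set z : C | strip b z /\ z != 0] by apply: openI; [exact: open_strip|exact: open_punctured].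
have hf : harmonic_on [set z : C | strip b z /\ z != 0] (fun z => strip_log 1 z - strip_log m z).
  apply: (harmonicB o0); apply: harmonic_strip_log => // z [zs z0].
    by apply: (strip_chcos_gt0 _ _ zs z0) => //; rewrite mul1r.
  exact: (strip_chcos_gt0 _ _ zs z0).
have [d d0 Hd] := strip_log_quotient_near0 m0 (@ltr01 R).
have [c c0 Hc] : exists2 c : R, 0 < c <= b & c <= d.
  by exists (Num.min b d); rewrite ?lt_min ?b0 ?d0 ?ge_min ?lexx// orbT.
have /andP[c00 cb] := c0.
have Im_le z : `|complex.Im z| <= modulus z.
  by rewrite modulusE -sqrtr_sqr ler_wsqrtr// lerDr; exact: sqr_ge0.
have cs : odisc 0 c `<=` strip b.
  move=> z zc; have k : modulus (z - 0) < c := zc; move: k; rewrite subr0 => k.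
  by have := Im_le z; rewrite /strip /= ler_norml; lra.
have hf' : harmonic_on [set z : C | odisc 0 c z /\ z != 0] (fun z => strip_log 1 z - strip_log m z).
  by apply: harmonicS hf => z [zc z0]; split; [exact: cs|exact: z0].
have fM z : odisc 0 c z -> z != 0 -> `|strip_log 1 z - strip_log m z| <= `|ln m| + 1.
  move=> zc z0; have k : modulus (z - 0) < c := zc; rewrite subr0 in k.
  have h1 := Hd z z0 (lt_le_trans k Hc).
  have := ler_normB (strip_log 1 z - strip_log m z + ln m) (ln m); rewrite addrK; lra.
have [H hH HE] := removable_singularity c00 hf' fM.
have H0 : H 0 = - ln m.
  apply/eqP; rewrite -subr_eq0 opprK -normr_eq0 eq_le normr_ge0 andbT.
  apply/ler_addgt0Pr => e e0; rewrite add0r.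
  have e20 : 0 < e / 2 by lra.
  have [d1 d10 H1] := strip_log_quotient_near0 m0 e20.
  have cH := harmonic_continuous (@open_odisc R 0 c) hH (odisc_center 0 c00).
  have [d2 d20 H2] := (continuous_modulusP _ _).1 cH (e / 2) e20.
  have [x x0 [x1 x2 x3]] : exists2 x : R, 0 < x & [/\ x < c, x < d1 & x < d2].
    exists (Num.min c (Num.min d1 d2) / 2); first by rewrite divr_gt0// !lt_min c00 d10.
    have : Num.min c (Num.min d1 d2) / 2 < Num.min c (Num.min d1 d2).
      by rewrite ltr_pdivrMr// ltr_pMr ?ltr1n// !lt_min c00 d10.
    by rewrite !lt_min => /and3P[].
  have mx : modulus (x%:C : C) = x by rewrite modulusE /= expr0n /= addr0 sqrtr_sqr gtr0_norm.
  have xn : (x%:C : C) != 0 by rewrite -modulus_gt0 mx.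
  have xc : odisc 0 c (x%:C : C) by change (modulus ((x%:C : C) - 0) < c); rewrite subr0 mx.
  have := H1 x%:C xn; rewrite mx => /(_ x2).
  have := H2 x%:C; rewrite subr0 mx => /(_ x3); rewrite (HE _ xc xn) !ltr_norml !ler_norml.
  by move=> /andP[? ?] /andP[? ?]; apply/andP; split; lra.
pose q z := if z == 0 then H 0 else strip_log 1 z - strip_log m z.
exists q; split; last by rewrite /q eqxx.
  apply: harmonic_local => z zs; have [->|z0] := eqVneq z 0.
    exists (odisc 0 c); split; [exact: open_odisc|exact: odisc_center|].
    apply: (eq_harmonic (@open_odisc R 0 c) _ hH) => w wc; rewrite /q.
    by case: eqVneq => [->//|w0]; exact: HE.
  exists [set z : C | strip b z /\ z != 0]; split; [exact: o0|by split|].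
  by apply: (eq_harmonic o0 _ hf) => w [_ /negPf w0]; rewrite /q w0.
by move=> z _ /negPf z0; rewrite /q z0.
Qed.

End Comparison.

Section Translation.
Context {R : realType}.
Local Notation C := R[i]^o.
Implicit Types (z w : C) (f : C -> R) (U : set C) (th : R).

Definition tr th z : C := complex.Re z +i* (complex.Im z - th).

Lemma trE th : tr th = dilate 1 0 (- th).
Proof. by apply/funext => z; rewrite /tr /dilate !mul1r add0r addrC. Qed.

Lemma open_tr th U : open U -> open (tr th @^-1` U).
Proof. by move=> oU; rewrite trE; exact: open_dilate. Qed.

Lemma harmonic_tr th U f : open U -> harmonic_on U f -> harmonic_on (tr th @^-1` U) (f \o tr th).
Proof. by move=> oU hf; rewrite trE; exact: harmonic_dilate. Qed.

Lemma tr_tr a b z : tr a (tr b z) = tr (a + b) z.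
Proof. by rewrite /tr /= -addrA -opprD (addrC b). Qed.

(** Reflection in the line [Im z = th] makes the derivative equal to its own negative. This yields
    the Neumann condition on the side of a strip that passes through the rounded pole itself. *)
Lemma dy_even f (D b th : R) z : 0 < b -> complex.Im z = th -> isdy f z D ->
  (forall x, `|x| < b -> f (complex.Re z +i* (th + x)) = f (complex.Re z +i* (th - x))) -> D = 0.
Proof.
move=> b0 zt; rewrite /isdy zt => hD ev.
pose F x := f (complex.Re z +i* (th + x)).
have s1 : is_derive (0 : R) 1 F D.
  rewrite (_ : F = fun x => (fun t => f (complex.Re z +i* t)) (x - - th)).
    by apply: (is_derive_translate (h := fun t : R => f (complex.Re z +i* t))); rewrite sub0r opprK.
  by apply/funext => x; rewrite /F opprK addrC.
have s2 : is_derive (0 : R) 1 (fun x => F (- x)) (D * -1).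
  have n1 : is_derive (0 : R) 1 (fun x : R => - x) (-1).
    by apply: is_derive_eq.
  by have s1' := s1; rewrite -oppr0 in s1'; exact: (is_derive1_comp (g := fun x : R => - x) s1' n1).
have s3 : is_derive (0 : R) 1 F (D * -1).
  apply: near_eq_is_derive1 s2; apply/nbhs_ballP; exists b => //= x; rewrite /ball /= sub0r normrN => xb.
  by rewrite /F -ev// opprK.
have e1 := @derive_val _ _ _ _ _ _ _ s1; have e2 := @derive_val _ _ _ _ _ _ _ s3.
by have : D = D * -1 by [rewrite -{1}e1 e2]; lra.
Qed.

End Translation.

Section ArcGap.
Context {R : realType}.

Lemma arc_gap (a b th : R) : a <= b -> (forall t, a <= t <= b -> cos (t - th) < 1) ->
  exists2 k : R, 0 < k & forall t, a <= t <= b -> k <= 1 - cos (t - th).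
Proof.
move=> ab h; pose f t : R := 1 - cos (t - th).
have cf : {within `[a, b], continuous f}.
  apply: cont_on_within => t _; apply: contB; first exact: cont_cst.
  apply: (@continuous_comp _ _ _ (fun t : R => t - th) cos); last exact: continuous_cos.
  by apply: contB; [exact: cvg_id|exact: cont_cst].
have [c cab Hc] := EVT_min ab cf.
exists (f c); first by rewrite subr_gt0; apply: h; move: cab; rewrite in_itv.
by move=> t tab; apply: Hc; rewrite in_itv.
Qed.

(** Within an angle [l < 2 pi] of [th], the point [polar r th] has a single preimage, so closeness
    in the plane gives closeness on the cylinder. By rotation invariance [d] is independent of
    [th]. *)
Lemma expC_near (r l e : R) : 0 < r -> 0 < l < 2 * pi -> 0 < e ->
  exists2 d : R, 0 < d & forall th (z : R[i]^o), `|complex.Im (tr th z)| <= l ->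
    modulus (expC r z - polar r th) < d -> modulus (tr th z) < e.
Proof.
move=> r0 /andP[l0 l2] e0; have e20 : 0 < e / 2 by lra.
have [k k0 Hk] : exists2 k : R, 0 < k & forall t, e / 2 <= t <= l -> k <= 1 - cos t.
  have [el|le] := leP (e / 2) l; last first.
    by exists 1 => // t /andP[h1 h2]; have := le_lt_trans (le_trans h1 h2) le; rewrite ltxx.
  have [|k k0 Hk] := @arc_gap (e / 2) l 0 el.
    move=> t /andP[h1 h2]; rewrite subr0; apply: cos_lt1; apply/andP; split; lra.
  by exists k => // t /Hk; rewrite subr0.
pose d1 := r * (1 - expR (- (e / 2))).
have x1 : expR (- (e / 2)) < 1 by rewrite expR_lt1; lra.
have d10 : 0 < d1 by rewrite mulr_gt0// subr_gt0.
pose d2 := Num.sqrt (r ^+ 2 * (k / 2)).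
have d20 : 0 < d2 by rewrite sqrtr_gt0 mulr_gt0 ?exprn_gt0// divr_gt0.
exists (Num.min d1 d2); first by rewrite lt_min d10.
move=> th z zl; rewrite lt_min => /andP[h1 h2].
have m0 := modulus_ge0 (expC r z - polar r th).
have hI : `|complex.Im (tr th z)| < e / 2.
  rewrite ltNge; apply/negP => h; have := Hk _ (introT andP (conj h zl)).
  have ec : cos `|complex.Im (tr th z)| = cos (complex.Im (tr th z)).
    by have [h'|h'] := leP 0 (complex.Im (tr th z)); [rewrite ger0_norm|rewrite ltr0_norm// cosN].
  rewrite ec => hk.
  have := sqdist_expC_ge_cos r0 th z; rewrite sqdistE; apply/negP; rewrite -ltNge.
  have : modulus (expC r z - polar r th) ^+ 2 < d2 ^+ 2 by rewrite ltr_sqr ?nnegrE// ltW.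
  have -> : d2 ^+ 2 = r ^+ 2 * (k / 2).
    by rewrite /d2 sqr_sqrtr// mulr_ge0 ?sqr_ge0// divr_ge0// ltW.
  move=> h3; apply: (lt_le_trans h3); rewrite ler_pM2l ?exprn_gt0// ler_pM2r ?invr_gt0//.
have hR : `|complex.Re (tr th z)| < e / 2.
  have : (r * (expR (complex.Re z) - 1)) ^+ 2 < d1 ^+ 2.
    apply: le_lt_trans (sqdist_expC_ge_exp r0 th z) _; by rewrite sqdistE ltr_sqr ?nnegrE ?(ltW d10).
  rewrite -[X in X < _]real_normK ?num_real// ltr_sqr ?nnegrE ?normr_ge0 ?(ltW d10)// normrM (gtr0_norm r0) /d1 ltr_pM2l//.
  rewrite /= => h3; rewrite ltr_norml; apply/andP; split.
    rewrite ltNge; apply/negP => h4; have : expR (complex.Re z) <= expR (- (e / 2)) by rewrite ler_expR.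
    by have := ler_norm (1 - expR (complex.Re z)); rewrite distrC; lra.
  rewrite ltNge; apply/negP => h4; have h5 : expR (e / 2) <= expR (complex.Re z) by rewrite ler_expR.
  have := expRxMexpNx_1 (e / 2); have := ler_norm (expR (complex.Re z) - 1).
  have := expR_gt0 (- (e / 2)); move: x1 h3 h5.
  set p := expR (e / 2); set q := expR (- (e / 2)); set n := `|_|; set x := expR _ => *; nra.
have := modulusE (tr th z); move=> ->.
rewrite -(ger0_norm (ltW e0)) -sqrtr_sqr ltr_sqrt ?exprn_gt0//.
rewrite -[complex.Re _ ^+ 2]real_normK ?num_real// -[complex.Im _ ^+ 2]real_normK ?num_real//.
have := normr_ge0 (complex.Re (tr th z)); have := normr_ge0 (complex.Im (tr th z)); nra.
Qed.

End ArcGap.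

(** * The rounded potential with Neumann sides *)

Section StripComparison.
Context {R : realType}.
Local Notation C := R[i]^o.
Implicit Types (z w : C) (f : C -> R) (U : set C) (th d : R).
Variables (r l : R).
Hypotheses (r0 : 0 < r) (l0 : 0 < l) (l2 : l < 2 * pi).

(** The factor is the Jacobian of [expC r]: this is the density of the charge on the cylinder, and
    minus the Laplacian of [cyl_bump]. *)
Definition cyl_charge d th z : R := rho d (polar r th) (expC r z) * (r * expR (complex.Re z)) ^+ 2.
Definition cyl_bump d th z : R := log_bump d (polar r th) (expC r z).

Let m := pi / l.
Let m0 : 0 < m. Proof. by rewrite divr_gt0// pi_gt0. Qed.
Let ml : m * l = pi. Proof. by rewrite /m mulfVK// gt_eqF. Qed.
(** A margin: the strips of half-width [b = l + tau] about the two sides meet in an open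
    neighbourhood of the closed strip of width [l], while the two bounds on [tau] give [m b <= 2 pi]
    and [b <= 2 pi]. *)
Let tau := Num.min l (2 * pi - l).
Let tau0 : 0 < tau. Proof. by rewrite lt_min l0 subr_gt0. Qed.
Let taul : tau <= l. Proof. by rewrite ge_min lexx. Qed.
Let taup : tau <= 2 * pi - l. Proof. by rewrite ge_min lexx orbT. Qed.
Let b := l + tau.
Let b0 : 0 < b. Proof. by rewrite addr_gt0. Qed.
Let b2 : b <= 2 * pi. Proof. by rewrite /b addrC -lerBrDr. Qed.
Let mb : m * b <= 2 * pi.
Proof. by rewrite /b mulrDr ml mulr_natl mulr2n lerD2l -[leRHS]ml ler_pM2l. Qed.

Section Potential.
Variable q : C -> R.
Hypotheses (hq : harmonic_on (strip b) q)
  (qE : forall z, strip b z -> z != 0 -> q z = strip_log 1 z - strip_log m z) (q0 : q 0 = - ln m).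

Let cst : R := ln r + 2^-1 * ln 2.
(** The potential [- strip_log m] with its pole at [i th] rounded: [cyl_bump] supplies the rounded
    Euclidean pole, and the affine term with [q] converts one kind of pole into the other. *)
Definition pot d th z : R := cyl_bump d th z + (cst + 2^-1 * complex.Re z + 0 * complex.Im z) + q (tr th z).

Lemma C2_pot d th : 0 < d -> C2 (tr th @^-1` strip b) (pot d th) /\
  forall z, strip b (tr th z) -> lap (pot d th) z = - cyl_charge d th z.
Proof.
move=> d0; have oV := @open_tr R th _ (@open_strip R b).
have [c l1] := bump_C2 (polar r th) d0; have [c' l1'] := C2_expC r openT c.
have hq' := harmonic_tr th (@open_strip R b) hq.
have ha := harmonic_affine cst (2^-1) 0 oV.
have [c1 l3] := C2DE oV (C2S (@subsetT _ _) c') (harmonic_C2 ha).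
have [c2 l4] := C2DE oV c1 (harmonic_C2 hq').
split; first exact: c2.
move=> z Vz; have := l4 z Vz; rewrite (harmonic_lap hq' Vz) l3// (harmonic_lap ha Vz) !addr0 => ->.
by rewrite l1'// l1 mulNr.
Qed.

Lemma tr_neq0 d th z : 0 < d -> d <= modulus (expC r z - polar r th) -> tr th z != 0.
Proof.
move=> d0 hd; apply/eqP => z0; have : sqdist (polar r th) (expC r z) = 0.
  rewrite sqdist_chcos -[X in chcos 1 X]/(tr th z) z0 /chcos /= !mulr0 cos0 /ch oppr0 expR0.
  by rewrite (_ : (1 + 1) / 2 - 1 = 0) ?mulr0//; lra.
move/eqP; rewrite sqdistE sqrf_eq0 => /eqP h; move: hd; rewrite h; lra.
Qed.

Lemma pot_out d th z : 0 < d -> strip b (tr th z) -> d <= modulus (expC r z - polar r th) ->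
  pot d th z = - strip_log m (tr th z).
Proof.
move=> d0 zs hd; have w0 := tr_neq0 d0 hd.
have c0 : 0 < chcos 1 (tr th z) by apply: (strip_chcos_gt0 _ _ zs w0) => //; rewrite mul1r.
rewrite /pot /cyl_bump bump_out// ln_modulus_expC// -/(tr th z) qE// /cst; lra.
Qed.

(** The rounded pole depends on the angle only through [cos (Im z - th)], and [q] is even in the
    imaginary part, so [pot] is symmetric about its own side. *)
Lemma pot_dy0 d th s : 0 < d -> dy (pot d th) (s +i* th) = 0.
Proof.
move=> d0; have [c _] := C2_pot th d0.
have Vz : (tr th @^-1` strip b) (s +i* th) by rewrite /strip /tr /= subrr oppr_lt0 b0.
apply: (dy_even b0 erefl (C1_isd (C2_C1 c) Vz).2) => x; rewrite ltr_norml => /andP[xb bx] /=.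
have e1 : cyl_bump d th (s +i* (th + x)) = cyl_bump d th (s +i* (th - x)).
  by rewrite /cyl_bump /log_bump !sqdist_expC /= (addrC th) addrK (addrC th) addrK cosN.
rewrite /pot e1 /= !mul0r; congr (_ + _).
rewrite /tr /= (addrC th) addrK (addrC th) addrK.
have sb : strip b (s +i* x) by rewrite /strip /= xb bx.
have sb' : strip b (s +i* - x) by rewrite /strip /= ltrN2 bx ltrNl xb.
have [w0|w0] := eqVneq (s +i* x : C) 0.
  by congr q; move: w0 => [-> ->]; rewrite oppr0.
rewrite !qE// ?/strip_log ?/chcos /= ?mulrN ?cosN//.
by apply/eqP => -[s0 /eqP]; rewrite oppr_eq0 => /eqP x0; case/eqP: w0; rewrite s0 x0.
Qed.

Lemma strip_log_partials th z : 0 < chcos m (tr th z) ->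
  isdx (strip_log m \o tr th) z (m / 2 * sh (m * complex.Re z) / chcos m (tr th z)) /\
  isdy (strip_log m \o tr th) z (m / 2 * sin (m * (complex.Im z - th)) / chcos m (tr th z)).
Proof.
move=> c0; have dl := is_derive1_ln c0.
have d2 (g : R -> R) x a : is_derive (x : R) 1 g a -> g x = chcos m (tr th z) ->
    is_derive x 1 (fun t => 2^-1 * ln (g t)) (2^-1 * ((chcos m (tr th z))^-1 * a)).
  by move=> dg gx; apply: is_deriveCM; rewrite -gx in dl *; exact: (is_derive1_comp (g := g) dl dg).
split.
  have h1 : is_derive (complex.Re z) 1 (fun t => chcos m (t +i* (complex.Im z - th))) (sh (m * complex.Re z) * m).
    rewrite /chcos /= -[X in is_derive _ _ _ X]subr0; apply: is_deriveB.
    apply: (is_derive1_comp (g := fun t => m * t) (is_derive_ch _)).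
    by apply: (is_derive_congr (is_deriveCM m (is_derive_id (complex.Re z) (1 : R)))); rewrite mulr1.
  by apply: (is_derive_congr (d2 _ _ _ h1 erefl)); field; rewrite gt_eqF.
have h1 : is_derive (complex.Im z) 1 (fun t => chcos m (complex.Re z +i* (t - th))) (- (- sin (m * (complex.Im z - th)) * m)).
  rewrite /chcos /= -[X in is_derive _ _ _ X]sub0r; apply: is_deriveB.
  apply: (is_derive1_comp (g := fun t => m * (t - th)) (is_derive_cos _)).
  exact: is_derive_lin_shift.
by apply: (is_derive_congr (d2 _ _ _ h1 erefl)); field; rewrite gt_eqF.
Qed.

Lemma pot_partials d th z : 0 < d -> strip b (tr th z) -> d < modulus (expC r z - polar r th) ->
  dx (pot d th) z = - (m / 2 * sh (m * complex.Re z) / chcos m (tr th z)) /\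
  dy (pot d th) z = - (m / 2 * sin (m * (complex.Im z - th)) / chcos m (tr th z)).
Proof.
move=> d0 zs hd; have c0 : 0 < chcos m (tr th z).
  exact: (strip_chcos_gt0 m0 mb zs (tr_neq0 d0 (ltW hd))).
have oV := @open_tr R th _ (@open_strip R b).
have oW : open ((tr th @^-1` strip b) `&` (expC r @^-1` (~` cdisc (polar r th) d))).
  by apply: openI => //; apply: open_expC; apply: closed_openC; exact: closed_cdisc.
have Wz : ((tr th @^-1` strip b) `&` (expC r @^-1` (~` cdisc (polar r th) d))) z.
  by split => //=; apply/negP; rewrite -ltNge.
have E w : ((tr th @^-1` strip b) `&` (expC r @^-1` (~` cdisc (polar r th) d))) w ->
    pot d th w = -1 * (strip_log m \o tr th) w.
  by move=> [ws /= /negP]; rewrite -ltNge => wd; rewrite pot_out ?mulN1r//; exact: ltW.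
have [h1 h2] := strip_log_partials c0.
rewrite (eq_dx oW E Wz) (eq_dy oW E Wz); split.
  by have /isdxP[_ ->] : isdx (fun w => -1 * (strip_log m \o tr th) w) z _ := is_deriveCM (-1) h1; rewrite mulN1r.
by have /isdyP[_ ->] : isdy (fun w => -1 * (strip_log m \o tr th) w) z _ := is_deriveCM (-1) h2; rewrite mulN1r.
Qed.

End Potential.

Lemma ray_separation d th1 th2 z : cos (th1 - th2) = cos l -> 0 < d -> d ^+ 2 < r ^+ 2 * ((1 - cos l) / 2) ->
  complex.Im z = th1 -> d < modulus (expC r z - polar r th2).
Proof.
move=> hc d0 hd zt; rewrite -ltr_sqr ?nnegrE ?modulus_ge0 ?(ltW d0)// -sqdistE.
by apply: (lt_le_trans hd); rewrite -hc -zt; exact: sqdist_expC_ge_cos.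
Qed.

(** For [|Re z| >= 1] the radius differs from [r] by at least [r (1 - 1/e)], so smaller discs about
    points of the circle stay within [|Re z| < 1]. *)
Lemma end_separation d th z : 0 < d -> d < r * (1 - expR (-1)) -> 1 <= `|complex.Re z| ->
  d < modulus (expC r z - polar r th).
Proof.
move=> d0 hd hz; rewrite -ltr_sqr ?nnegrE ?modulus_ge0 ?(ltW d0)// -sqdistE.
apply: lt_le_trans (sqdist_expC_ge_exp r0 th z).
have x1 : expR (-1) < 1 :> R by rewrite expR_lt1 oppr_lt0.
rewrite -[ltRHS]real_normK ?num_real// ltr_sqr ?nnegrE ?normr_ge0 ?(ltW d0)//.
apply: (lt_le_trans hd); rewrite normrM (gtr0_norm r0) ler_pM2l//.
have xm := expR_gt0 (-1 : R); have pq := expRxMexpNx_1 (1 : R).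
move: hz; rewrite ler_normr => /orP[h1|h1].
  apply: le_trans (ler_norm _).
  have : expR 1 <= expR (complex.Re z) by rewrite ler_expR.
  move: x1 xm pq; set p := expR 1; set q := expR (-1); set x := expR _ => *; nra.
rewrite distrC; apply: le_trans (ler_norm _).
have : expR (complex.Re z) <= expR (-1) by rewrite ler_expR lerNr.
by move=> h; rewrite lerD2l lerN2.
Qed.

(** The constant left at one end of a strip of width [l] when the rounded pole is removed from the
    comparison potential, [ln (2 r / m)] with [m = pi / l]. *)
Definition gap_bound : R := ln (2 * r * l / pi).

(** The function is the difference of the potentials of the two sides; [m l = pi] makes the normal
    derivative of each vanish also on the side of the other. At the ends of the cylinder it is not
    0, but its modulus does not increase outwards, and that sign of [h dx h] is what the boundary
    terms require. The last clause bounds it where the charges sit. *)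
Lemma strip_comparison (e : R) : 0 < e -> exists2 d0 : R, 0 < d0 & forall d th1 th2, 0 < d -> d < d0 -> th2 = th1 + l ->
  exists U h, [/\ open U, forall z, th1 <= complex.Im z <= th2 -> U z, C2 U h &
    forall z, U z -> lap h z = cyl_charge d th2 z - cyl_charge d th1 z] /\
  [/\ forall s, dy h (s +i* th1) = 0 /\ dy h (s +i* th2) = 0,
    forall z, th1 <= complex.Im z <= th2 -> 1 <= complex.Re z -> h z * dx h z <= 0,
    forall z, th1 <= complex.Im z <= th2 -> complex.Re z <= -1 -> 0 <= h z * dx h z &
    forall z, th1 <= complex.Im z <= th2 -> (cyl_charge d th1 z - cyl_charge d th2 z) * h z <=
      cyl_charge d th1 z * (cyl_bump d th1 z + gap_bound + e) +
      cyl_charge d th2 z * (cyl_bump d th2 z + gap_bound + e)].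
Proof.
move=> e0.
have bb : 0 < b <= 2 * pi by rewrite b0 b2.
have [q [hq qE q0]] := regular_quotient m0 bb mb.
(* The comparison function seen from one end without its bump: the regular part of the own
   potential, minus the potential of the other end. By continuity it is within [e] of
   [F 0 = gap_bound] near the pole. *)
pose F w := ln r + 2^-1 * ln 2 + 2^-1 * complex.Re w + q w + strip_log m (tr l w).
have chcosl (t : R) : `|t| = l -> chcos m (0 +i* t) = 2.
  move=> tl; rewrite /chcos /= mulr0 /ch oppr0 expR0.
  have -> : cos (m * t) = cos (m * `|t|).
    by have [h'|h'] := leP 0 t; [rewrite ger0_norm|rewrite ltr0_norm// mulrN cosN].
  by rewrite tl ml cospi; lra.
have F0 : F 0 = gap_bound.
  rewrite /F q0 /tr /= sub0r mulr0 addr0 /strip_log chcosl; last by rewrite normrN gtr0_norm.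
  rewrite /gap_bound (_ : 2 * r * l / pi = 2 * r / m); last first.
    by rewrite /m invf_div mulrA.
  have -> : ln (2 * r / m) = ln 2 + ln r - ln m.
    have mp : m \is Num.pos by rewrite posrE.
    by rewrite ln_div ?posrE ?mulr_gt0 ?lnM ?posrE ?mp ?r0 ?ltr0n ?pi_gt0 ?invr_gt0.
  by move: (ln m) (ln 2) (ln r) => x y w; lra.
have cF : {for 0, continuous F}.
  have s0 : strip b 0 by rewrite /strip /= oppr_lt0 b0.
  have cq := harmonic_continuous (@open_strip R b) hq s0.
  have cR : {for 0, continuous (fun w : C => complex.Re w)} by exact: continuous_Re.
  have cs : {for 0, continuous (fun w : C => strip_log m (tr l w))}.
    have o1 : open [set w : C | 0 < complex.Im w + l] by
      apply: (@open_comp _ _ (fun w : C => complex.Im w + l) [set x : R | 0 < x]); 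
      [by move=> w _; apply: contD; [exact: continuous_Im|exact: cont_cst]|exact: open_gt].
    have h0 : chcos m (tr l 0) = 2 by rewrite /tr /= sub0r; apply: chcosl; rewrite normrN gtr0_norm.
    have cc : {for 0, continuous (fun w : C => chcos m (tr l w))}.
      rewrite /chcos /tr /=; apply: contB.
        apply: (@continuous_comp _ _ _ (fun w : C => m * complex.Re w) ch); last exact: continuous_ch.
        by apply: contM; [exact: cont_cst|exact: continuous_Re].
      apply: (@continuous_comp _ _ _ (fun w : C => m * (complex.Im w - l)) cos); last exact: continuous_cos.
      by apply: contM; [exact: cont_cst|apply: contB; [exact: continuous_Im|exact: cont_cst]].
    apply: contM; first exact: cont_cst.
    apply: (@continuous_comp _ _ _ (fun w : C => chcos m (tr l w)) (@ln R)); first exact: cc.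
    by apply: continuous_ln; rewrite h0.
  apply: contD; last exact: cs.
  apply: contD; last exact: cq.
  by apply: contD; [exact: cont_cst|apply: contM; [exact: cont_cst|exact: cR]].
have [k k0 Hk] := (continuous_modulusP _ _).1 cF e e0.
have ll : 0 < l < 2 * pi by rewrite l0 l2.
have [d1 d10 H1] := expC_near r0 ll k0.
have cl1 : 0 < (1 - cos l) / 2 by rewrite divr_gt0// subr_gt0 cos_lt1.
pose c := Num.sqrt (r ^+ 2 * ((1 - cos l) / 2)).
have c0 : 0 < c by rewrite sqrtr_gt0 mulr_gt0// exprn_gt0.
have c2 : c ^+ 2 = r ^+ 2 * ((1 - cos l) / 2) by rewrite sqr_sqrtr// mulr_ge0 ?sqr_ge0// ltW.
have x1 : 0 < r * (1 - expR (-1)) by rewrite mulr_gt0// subr_gt0 expR_lt1 oppr_lt0.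
(* [d1] brings [F] within [e] of [F 0] on the charged discs, [c / 2] keeps the discs of the two ends
   apart, and the last bound keeps them inside [|Re z| < 1]. *)
exists (Num.min d1 (Num.min (c / 2) (r * (1 - expR (-1))))).
  by rewrite !lt_min d10 x1 divr_gt0.
move=> d th1 th2 d0; rewrite !lt_min => /and3P[dd1 dc dx1] th2E.
have dc' : d < c by apply: (lt_trans dc); rewrite ltr_pdivrMr// ltr_pMr// ltr1n.
have dc2 : d ^+ 2 < r ^+ 2 * ((1 - cos l) / 2) by rewrite -c2 ltr_sqr ?nnegrE ?(ltW d0)// ltW.
have cos12 : cos (th1 - th2) = cos l by rewrite th2E opprD addrA subrr sub0r cosN.
have cos21 : cos (th2 - th1) = cos l by rewrite th2E addrC addKr.
have th12 : c <= modulus (polar r th2 - polar r th1).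
  rewrite -ler_sqr ?nnegrE ?modulus_ge0 ?(ltW c0)// -sqdistE c2 -(expC0 r th2) -cos21.
  exact: (sqdist_expC_ge_cos r0 th1 (0 +i* th2)).
pose U := (tr th1 @^-1` strip b) `&` (tr th2 @^-1` strip b).
have oU : open U by apply: openI; apply: open_tr; exact: open_strip.
have US z : th1 <= complex.Im z <= th2 -> U z.
  rewrite th2E => /andP[h1 h2]; have bl : l < b by rewrite /b ltrDl.
  by rewrite /U /strip /tr /= th2E; split; apply/andP; split; move: l0 b0 bl h1 h2; lra.
have [cp1 lp1] := C2_pot hq th1 d0; have [cp2 lp2] := C2_pot hq th2 d0.
have cp1' : C2 U (pot q d th1) by apply: C2S cp1 => z [].
have cp2' : C2 U (pot q d th2) by apply: C2S cp2 => z [].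
have [ch lh] := C2BE oU cp1' cp2'.
have [_ hx hy] := C1BE oU (C2_C1 cp1') (C2_C1 cp2').
exists U, (fun z => pot q d th1 z - pot q d th2 z).
have strip1 s : U (s +i* th1) by apply: US; rewrite /= lexx th2E lerDl ltW.
have strip2 s : U (s +i* th2) by apply: US; rewrite /= lexx th2E lerDl ltW.
have ends z : U z -> 1 <= `|complex.Re z| -> [/\ 0 < chcos m (tr th1 z), 0 < chcos m (tr th2 z),
    pot q d th1 z - pot q d th2 z = 2^-1 * (ln (chcos m (tr th2 z)) - ln (chcos m (tr th1 z))) &
    dx (fun z => pot q d th1 z - pot q d th2 z) z =
      m / 2 * sh (m * complex.Re z) * ((chcos m (tr th2 z))^-1 - (chcos m (tr th1 z))^-1)].
  move=> [U1 U2] zR; have s1 := end_separation th1 d0 dx1 zR; have s2 := end_separation th2 d0 dx1 zR.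
  have n1 := tr_neq0 d0 (ltW s1); have n2 := tr_neq0 d0 (ltW s2).
  have k1 := strip_chcos_gt0 m0 mb U1 n1; have k2 := strip_chcos_gt0 m0 mb U2 n2.
  split => //; first by rewrite !(pot_out qE)// ?(ltW s1) ?(ltW s2)// /strip_log mulrBr opprK addrC.
  rewrite hx//; have [-> _] := pot_partials qE d0 U1 s1; have [-> _] := pot_partials qE d0 U2 s2.
  by rewrite opprK mulrBr addrC.
(* Away from the poles [h] is half a difference of logarithms and [dx h] a multiple of the
   difference of the reciprocals, so the sign of [h dx h] comes from the opposite monotonicity of
   [ln] and inversion. *)
have lnmono x y : 0 < x -> 0 < y -> (ln x - ln y) * (x^-1 - y^-1) <= 0 :> R.
  move=> x0 y0; have [xy|yx] := leP x y.
    by rewrite mulr_le0_ge0// ?subr_le0 ?subr_ge0 ?ler_ln ?posrE// lef_pV2.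
  by rewrite mulr_ge0_le0// ?subr_le0 ?subr_ge0 ?ler_ln ?posrE ?lef_pV2// ltW.
have nr (a x y u v : R) : 2^-1 * (x - y) * (m / 2 * a * (u - v)) = (m / 4 * a) * ((x - y) * (u - v)) by field.
split; first by split => // z [U1 U2]; rewrite lh//; rewrite lp1// lp2//; ring.
split.
- move=> s; rewrite !hy//.
  have y1 := ray_separation cos12 d0 dc2 (erefl : complex.Im (s +i* th1 : C) = th1).
  have y2 := ray_separation cos21 d0 dc2 (erefl : complex.Im (s +i* th2 : C) = th2).
  rewrite (pot_dy0 hq qE th1 s d0) (pot_dy0 hq qE th2 s d0).
  have [_ ->] := pot_partials qE d0 (strip1 s).2 y1; have [_ ->] := pot_partials qE d0 (strip2 s).1 y2.
  have -> /= : th1 - th2 = - l by rewrite th2E opprD addrA subrr sub0r.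
  have -> : th2 - th1 = l by rewrite th2E addrC addKr.
  by rewrite mulrN ml sinN sinpi !(oppr0, mulr0, mul0r, addr0).
- move=> z /US Uz zR; have [|k1 k2 -> ->] := ends z Uz; first exact: le_trans zR (ler_norm _).
  rewrite nr; apply: mulr_ge0_le0; last exact: lnmono.
  apply: mulr_ge0; first by rewrite divr_ge0// ltW.
  by rewrite ltW// sh_gt0 mulr_gt0// (lt_le_trans ltr01).
- move=> z /US Uz zR; have [|k1 k2 -> ->] := ends z Uz.
    by rewrite ler_normr lerNr zR orbT.
  rewrite nr; apply: mulr_le0; last exact: lnmono.
  apply: mulr_ge0_le0; first by rewrite divr_ge0// ltW.
  rewrite -oppr_ge0 -shN ltW// sh_gt0 -mulrN mulr_gt0// oppr_gt0 (le_lt_trans zR)// oppr_lt0//.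
move=> z zt; have [U1 U2] := US z zt; move: (zt) => /andP[zt1 zt2].
have q1 : 0 <= cyl_charge d th1 z by rewrite mulr_ge0 ?sqr_ge0// rho_ge0.
have q2 : 0 <= cyl_charge d th2 z by rewrite mulr_ge0 ?sqr_ge0// rho_ge0.
have out th : d <= modulus (expC r z - polar r th) -> cyl_charge d th z = 0.
  by move=> h; rewrite /cyl_charge rho_out// mul0r.
have tri (a a' p : C) : c <= modulus (a - a') -> modulus (p - a) < d -> d <= modulus (p - a').
  move=> h1 h2; have := modulusD (a - p) (p - a'); rewrite subrKA (modulusC a p); move: dc h1 h2; lra.
have Hc w : modulus w < k -> F w <= gap_bound + e.
  by move=> wk; have := Hk w; rewrite subr0 => /(_ wk); rewrite F0 ltr_norml; move/andP => [_]; lra.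
have [in1|out1] := ltP (modulus (expC r z - polar r th1)) d.
  have out2 : d <= modulus (expC r z - polar r th2) by apply: tri in1; rewrite modulusC.
  rewrite (out th2 out2) subr0 mul0r addr0; apply: ler_wpM2l => //.
  have wk : modulus (tr th1 z) < k.
    apply: H1 (lt_trans in1 dd1); rewrite /tr /= ger0_norm ?subr_ge0// lerBlDr addrC -th2E//.
  have := Hc _ wk; rewrite /F tr_tr (addrC l) -th2E.
  rewrite (pot_out qE d0 U2 out2) /pot /tr /=; lra.
rewrite (out th1 out1) sub0r mul0r add0r.
have [in2|out2] := ltP (modulus (expC r z - polar r th2)) d; last by rewrite (out th2 out2) oppr0 !mul0r.
rewrite mulNr -mulrN; apply: ler_wpM2l => //.
have wk : modulus (tr th2 z) < k.
  apply: H1 (lt_trans in2 dd1); rewrite /tr /= ler0_norm ?subr_le0// opprB lerBlDr.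
  by move: zt1; rewrite th2E; lra.
have := Hc _ wk; rewrite /F.
(* At the upper side [tr l] leads a distance [l] further instead of back to [th1]; the two positions
   differ by [2 l], one full period of [cos (m t)]. *)
have -> : strip_log m (tr l (tr th2 z)) = strip_log m (tr th1 z).
  rewrite tr_tr /strip_log /chcos /tr /= th2E.
  have -> : m * (complex.Im z - (l + (th1 + l))) = m * (complex.Im z - th1) - 2 * pi by rewrite -ml; ring.
  have -> : cos (m * (complex.Im z - th1) - 2 * pi) = cos (m * (complex.Im z - th1)).
    by rewrite -[LHS]cosD2pi mulr_natl subrK.
  by [].
rewrite (pot_out qE d0 U1 out1) /pot /tr /=; lra.
Qed.

End StripComparison.

(** * The upper bound *)

Section StripInequality.
Context {R : realType}.
Local Notation C := R[i]^o.
Implicit Types (z w : C) (f h : C -> R) (U : set C).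

Lemma C1_sumE (I : Type) (s : seq I) U (f : I -> C -> R) : open U -> (forall i, C1 U (f i)) ->
  [/\ C1 U (fun z => \sum_(i <- s) f i z),
   forall z, U z -> dx (fun z => \sum_(i <- s) f i z) z = \sum_(i <- s) dx (f i) z &
   forall z, U z -> dy (fun z => \sum_(i <- s) f i z) z = \sum_(i <- s) dy (f i) z].
Proof.
move=> oU cf; elim: s => [|i s [c ex ey]].
  have [k1 k2 k3] := C1_cstE 0 oU.
  have E w : U w -> 0 = \sum_(i <- [::]) f i w by rewrite big_nil.
  split; first exact: (eq_C1 oU E k1).
    by move=> z Uz; rewrite -(eq_dx oU E Uz) k2// big_nil.
  by move=> z Uz; rewrite -(eq_dy oU E Uz) k3// big_nil.
have [k1 k2 k3] := C1DE oU (cf i) c.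
have E w : U w -> f i w + \sum_(i <- s) f i w = \sum_(i <- i :: s) f i w by rewrite big_cons.
split; first exact: (eq_C1 oU E k1).
  by move=> z Uz; rewrite -(eq_dx oU E Uz) k2// ex// big_cons.
by move=> z Uz; rewrite -(eq_dy oU E Uz) k3// ey// big_cons.
Qed.

Variables (I : finType) (u : I -> C -> R) (sg : I -> R) (T : I -> C -> R).
Variables (S th1 th2 : R) (U : set C) (h q : C -> R).
Hypotheses (S1 : 1 <= S) (th12 : th1 <= th2) (oU : open U)
  (US : forall z, th1 <= complex.Im z <= th2 -> U z) (ch : C2 U h)
  (lh : forall z, U z -> lap h z = - q z)
  (hy : forall s, dy h (s +i* th1) = 0 /\ dy h (s +i* th2) = 0)
  (hx1 : forall z, th1 <= complex.Im z <= th2 -> 1 <= complex.Re z -> h z * dx h z <= 0)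
  (hx2 : forall z, th1 <= complex.Im z <= th2 -> complex.Re z <= -1 -> 0 <= h z * dx h z)
  (cu : forall i, C1 setT (u i)) (u0 : forall i z, S <= `|complex.Re z| -> u i z = 0)
  (sg2 : forall i, sg i ^+ 2 = 1) (cT : forall i, cont_strip th1 th2 (T i)) (cq : cont_strip th1 th2 q)
  (active : forall z, exists i0, forall i, i != i0 -> dx (u i) z = 0 /\ dy (u i) z = 0)
  (TE : forall i z, th1 <= complex.Im z <= th2 -> T i z = 2 * sg i * u i z * q z - grad_sq (u i) z).

(** Let [W] be the sum of the [2 sg i u i]. At each point at most one [u i] has a nonzero gradient,
    so [h q] minus the sum of the [T i] minus the divergence of [(W - h) grad h] is a single square
    [|sg grad u - grad h|^2]. The divergence has a nonnegative integral: the sides contribute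
    nothing by the Neumann condition, and at the ends, where all [u i] vanish, the sign of [h dx h]
    decides. *)
Lemma strip_inequality : \sum_i Int2 (- S) S th1 th2 (T i) <= Int2 (- S) S th1 th2 (fun z => h z * q z).
Proof.
have SS : - S <= S by move: S1; lra.
have csu i : C1 U (fun z => 2 * sg i * u i z).
  exact: (C1M oU (C1_cst (2 * sg i) oU) (C1S (@subsetT _ _) (cu i))).
have [cW Wx Wy] := C1_sumE (index_enum I) oU csu.
pose W z := \sum_i 2 * sg i * u i z.
have dsu i z : U z -> dx (fun z => 2 * sg i * u i z) z = 2 * sg i * dx (u i) z /\
                      dy (fun z => 2 * sg i * u i z) z = 2 * sg i * dy (u i) z.
  move=> Uz; have [k1 k2 k3] := C1_cstE (2 * sg i) oU.
  have [_ m2 m3] := C1ME oU k1 (C1S (@subsetT _ _) (cu i)).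
  by rewrite m2// m3// k2// k3// !mulr0 !addr0.
have [cWh Whx Why] := C1BE oU cW (C2_C1 ch).
have [cP Px _] := C1ME oU cWh (C2_dx ch); have [cQ _ Qy] := C1ME oU cWh (C2_dy ch).
pose P z := (W z - h z) * dx h z; pose Q z := (W z - h z) * dy h z.
have W0 z : S <= `|complex.Re z| -> W z = 0.
  by move=> Sz; rewrite /W big1// => i _; rewrite u0// mulr0.
have cPx : cont_strip th1 th2 (dx P) by move=> z /US Uz; exact: (C1_cdx cP Uz).
have cQy : cont_strip th1 th2 (dy Q) by move=> z /US Uz; exact: (C1_cdy cQ Uz).
have chs : cont_strip th1 th2 h by move=> z /US Uz; exact: (C2_continuous oU ch Uz).
have cPs : cont_strip th1 th2 P by move=> z /US Uz; exact: (C1_continuous oU cP Uz).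
have div0 : 0 <= Int2 (- S) S th1 th2 (fun z => dx P z + dy Q z).
  have cP' : C1 U P by exact: cP.
  have cQ' : C1 U Q by exact: cQ.
  have E1 : Int2 (- S) S th1 th2 (fun z => dx P z + dy Q z) = Int2 (- S) S th1 th2 (dx P) + Int2 (- S) S th1 th2 (dy Q).
    exact: (Int2D (- S) S th12 cPx cQy).
  have E2 : Int2 (- S) S th1 th2 (dx P) = Int th1 th2 (fun t => P (S +i* t)) - Int th1 th2 (fun t => P (- S +i* t)).
    exact: (divergence_x SS th12 oU cP' US).
  have E3 : Int2 (- S) S th1 th2 (dy Q) = Int (- S) S (fun s => Q (s +i* th2) - Q (s +i* th1)).
    exact: (divergence_y (- S) S th12 oU cQ' US).
  rewrite (etrans E1 (congr2 +%R E2 E3)).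
  have S0 : 0 <= S := le_trans ler01 S1.
  apply: addr_ge0.
    rewrite subr_ge0; apply: (@le_trans _ _ 0).
      have Int0 : Int th1 th2 (fun=> 0 : R) = 0 by rewrite Int_cst ?mul0r.
      apply: (@le_trans _ _ (Int th1 th2 (fun=> 0 : R))); last by rewrite Int0.
      apply: le_Int; [exact: (cont_strip_section cPs)|exact: cont_on_cst|].
      move=> t ht; rewrite /P W0 /= ?normrN ?ger0_norm// sub0r mulNr oppr_le0.
      by apply: hx2; rewrite //= lerN2.
    apply: Int_ge0 => t ht; rewrite /P W0 /= ?ger0_norm//.
    by rewrite sub0r mulNr oppr_ge0; apply: hx1.
  apply: Int_ge0 => s _; have [h1 h2] := hy s.
  by rewrite /Q h1 h2 !mulr0 subrr.
have cdiv : cont_strip th1 th2 (fun z => dx P z + dy Q z) by exact: cont_stripD.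
have cTs : cont_strip th1 th2 (fun z => \sum_i T i z) by exact: cont_strip_sum.
have chq : cont_strip th1 th2 (fun z => h z * q z) by exact: cont_stripM.
rewrite -(Int2_sum _ _ _ th12 cT) -[leRHS]addr0 -subr_ge0.
apply: le_trans (_ : Int2 (- S) S th1 th2 (fun z => h z * q z - \sum_i T i z - (dx P z + dy Q z)) <= _); last first.
  by rewrite (Int2B _ _ th12 (cont_stripB chq cTs) cdiv) (Int2B _ _ th12 chq cTs) addr0 lerBlDr lerDl.
apply: Int2_ge0 => z _ hz; have Uz := US hz.
rewrite Px// Qy// Whx// Why// Wx// Wy//.
have -> : \sum_i T i z = W z * q z - \sum_i grad_sq (u i) z.
  rewrite /W mulr_suml -sumrB; apply: eq_bigr => i _; exact: TE.
have lz := lh Uz; rewrite /lap in lz.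
have [i0 H0] := active z.
have s1 : \sum_i dx (fun z => 2 * sg i * u i z) z = 2 * sg i0 * dx (u i0) z.
  rewrite (bigD1 i0)//= big1 ?addr0 ?(dsu i0 z Uz).1// => i /H0[h1 h2].
  by rewrite (dsu i z Uz).1 h1 mulr0.
have s2 : \sum_i dy (fun z => 2 * sg i * u i z) z = 2 * sg i0 * dy (u i0) z.
  rewrite (bigD1 i0)//= big1 ?addr0 ?(dsu i0 z Uz).2// => i /H0[h1 h2].
  by rewrite (dsu i z Uz).2 h2 mulr0.
have s3 : \sum_i grad_sq (u i) z = grad_sq (u i0) z.
  rewrite (bigD1 i0)//= big1 ?addr0// => i /H0[h1 h2].
  by rewrite /grad_sq h1 h2 expr0n /= addr0.
rewrite s1 s2 s3 -/(W z) /grad_sq.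
have -> : dx (dx h) z = - q z - dy (dy h) z by rewrite -lz; ring.
have e2 := sg2 i0.
set a := dx (u i0) z; set b := dy (u i0) z; set p := dx h z; set r := dy h z; set s := sg i0 in e2 *.
rewrite (_ : _ - _ - _ = (s * a - p) ^+ 2 + (s * b - r) ^+ 2 + (1 - s ^+ 2) * (a ^+ 2 + b ^+ 2)).
  by rewrite e2 subrr mul0r addr0 addr_ge0// sqr_ge0.
by gen_partials; ring.
Qed.

End StripInequality.

(** * Halves of the rounded charges *)

Section Masses.
Context {R : realType}.
Local Notation C := R[i]^o.
Implicit Types (z w : C) (d th : R).
Variable r : R.
Hypothesis r0 : 0 < r.

Lemma continuous_cyl_charge d th z : 0 < d -> {for z, continuous (cyl_charge r d th)}.
Proof.
move=> d0; apply: contM.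
  apply: (@continuous_comp _ _ _ (expC r) (rho d (polar r th))); first exact: continuous_expC.
  exact: rho_continuous.
apply: (contX (n := 2)); apply: contM; first exact: cont_cst.
by apply: (@continuous_comp _ _ _ (fun z : C => complex.Re z) expR); [exact: continuous_Re|exact: continuous_expR].
Qed.

Lemma continuous_cyl_bump d th z : 0 < d -> {for z, continuous (cyl_bump r d th)}.
Proof.
move=> d0; apply: (@continuous_comp _ _ _ (expC r) (log_bump d (polar r th))); first exact: continuous_expC.
exact: bump_continuous.
Qed.

Lemma cyl_charge_ge0 d th z : 0 < d -> 0 <= cyl_charge r d th z.
Proof. by move=> d0; rewrite mulr_ge0 ?sqr_ge0// rho_ge0. Qed.

Lemma cyl_charge_out d th z : 0 < d -> d <= modulus (expC r z - polar r th) -> cyl_charge r d th z = 0.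
Proof. by move=> d0 h; rewrite /cyl_charge rho_out// mul0r. Qed.

Lemma cyl_chargeE d th s t :
  cyl_charge r d th (s +i* t) = cyl_charge r d 0 (s +i* (t - th)) /\
  cyl_charge r d th (s +i* t) = cyl_charge r d 0 (s +i* (th - t)).
Proof. by rewrite /cyl_charge /rho !sqdist_expC /= !subr0 -(opprB t th) cosN. Qed.

(** A side of a strip through a pole cuts its charge in two. The mass of a half is left uncomputed:
    what counts is that it is positive and the same for all poles and both halves. *)
Definition half_mass d S k : R := Int2 (- S) S 0 k (cyl_charge r d 0).

Lemma cyl_charge_section d th s t : 0 < d -> {for t, continuous (fun t => cyl_charge r d th (s +i* t))}.
Proof.
move=> d0; apply: (@continuous_comp _ _ _ (fun t : R => s +i* t : C) (cyl_charge r d th)).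
  by apply: continuous_complex; [exact: cvg_cst|exact: cvg_id].
exact: continuous_cyl_charge.
Qed.

Lemma half_massE d S k l th : 0 < d -> 0 < k <= l ->
  (forall s t, k <= t <= l -> cyl_charge r d 0 (s +i* t) = 0) ->
  Int2 (- S) S th (th + l) (cyl_charge r d th) = half_mass d S k /\
  Int2 (- S) S (th - l) th (cyl_charge r d th) = half_mass d S k.
Proof.
move=> d0 /andP[k0 kl] H; have l0 : 0 <= l by lra.
have cut s : Int 0 l (fun t => cyl_charge r d 0 (s +i* t)) = Int 0 k (fun t => cyl_charge r d 0 (s +i* t)).
  rewrite (Int_cat (ltW k0) kl); last by move=> t _; exact: cyl_charge_section.
  have -> : Int k l (fun t => cyl_charge r d 0 (s +i* t)) = Int k l (fun=> 0).
    by apply: eq_Int => t ht; exact: H.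
  by rewrite Int_cst// mul0r addr0.
split; rewrite /half_mass /Int2; apply: eq_Int => s _; rewrite -cut.
  rewrite (eq_Int (g := fun t => cyl_charge r d 0 (s +i* (t - th)))); last first.
    by move=> t _; rewrite (cyl_chargeE d th s t).1.
  have ab : th <= th + l by rewrite lerDl.
  by rewrite (Int_shift th ab (fun t => @cyl_charge_section d 0 s t d0)) subrr addrC addKr.
rewrite (eq_Int (g := fun t => cyl_charge r d 0 (s +i* (th - t)))); last first.
  by move=> t _; rewrite (cyl_chargeE d th s t).2.
have ab : th - l <= th by rewrite gerBl.
by rewrite (Int_reflect th ab (fun t => @cyl_charge_section d 0 s t d0)) subrr opprB addrC subrK.
Qed.

Lemma half_mass_gt0 d S k : 0 < d -> 0 < S -> 0 < k -> 0 < half_mass d S k.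
Proof.
move=> d0 S0 k0.
have c1 : cont_strip 0 k (cyl_charge r d 0) by move=> z _; exact: continuous_cyl_charge.
apply: (Int_gt0 (t0 := 0)); [lra|by move=> s _; apply: cont_strip_Int => //; exact: ltW| |lra|].
  by move=> s _; apply: Int_ge0 => t _; exact: cyl_charge_ge0.
(* On the circle the squared distance at angle [t] is [2 r^2 (1 - cos t)]; this bound on [1 - cos t]
   makes it less than [d^2], where the density is positive. *)
have e0 : 0 < d ^+ 2 / (4 * r ^+ 2) by rewrite divr_gt0 ?mulr_gt0 ?exprn_gt0.
have /(@cvgrPdist_lt _ _ _ _ (nbhs_filter (0 : R))) /(_ _ e0) /nbhs_ballP[x /= x0 Hx] := @continuous_cos R 0.
have [t t0 [tk tx]] : exists2 t : R, 0 < t & t < k /\ t < x.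
  exists (Num.min k x / 2); first by rewrite divr_gt0// lt_min k0.
  have : Num.min k x / 2 < Num.min k x by rewrite ltr_pdivrMr// ltr_pMr ?ltr1n// lt_min k0.
  by rewrite lt_min => /andP[].
apply: (Int_gt0 (t0 := t)); [exact: k0|by move=> u _; exact: cyl_charge_section| |by rewrite t0|].
  by move=> u _; exact: cyl_charge_ge0.
rewrite /cyl_charge mulr_gt0 ?exprn_gt0 ?mulr_gt0 ?expR_gt0//.
have : `|cos 0 - cos t| < d ^+ 2 / (4 * r ^+ 2).
  by apply: Hx; rewrite /ball /= sub0r normrN gtr0_norm.
rewrite cos0 => /(le_lt_trans (ler_norm _)) hc.
rewrite /rho sqdist_expC /= expR0 subr0.
have r2 : 0 < r ^+ 2 by rewrite exprn_gt0.
have lt2 : r ^+ 2 * (1 ^+ 2 + 1 - 2 * 1 * cos t) < d ^+ 2.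
  move: hc; rewrite ltr_pdivlMr ?mulr_gt0// => hc; have := exprn_gt0 2 d0.
  by move: hc; set D := d ^+ 2; set c := cos t; set q := r ^+ 2 in r2 *; nra.
rewrite /bump_charge /glue_at; case: ifPn => [h|_]; first by move: (le_lt_trans h lt2); rewrite ltxx.
by rewrite mulr_gt0 ?divr_gt0 ?exprn_gt0// subr_gt0 ltr_pdivrMr ?mul1r ?exprn_gt0.
Qed.

End Masses.

Lemma uniform_small {R : realType} (I : finType) (P : I -> R -> Prop) :
  (forall i, exists2 e : R, 0 < e & forall d : R, 0 < d -> d < e -> P i d) ->
  exists2 e : R, 0 < e & forall d : R, 0 < d -> d < e -> forall i, P i d.
Proof.
move=> H.
have {}H i : exists e : R, 0 < e /\ forall d : R, 0 < d -> d < e -> P i d.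
  by have [e e0 h] := H i; exists e.
have [e He] := boolp.choice H.
have [e1 e10 h1] : exists2 e1 : R, 0 < e1 & forall i, i \in enum I -> e1 <= e i.
  elim: (enum I) => [|i s [e1 e10 h1]]; first by exists 1.
  exists (Num.min e1 (e i)); first by rewrite lt_min e10 (He i).1.
  by move=> k; rewrite inE ge_min => /orP[/eqP ->|/h1 ->//]; rewrite lexx orbT.
exists e1 => // d d0 de i; apply: (He i).2 => //; apply: (lt_le_trans de); apply: h1.
by rewrite mem_enum.
Qed.

(** * The cyclic order of the points *)

Section CircularOrder.
Context {R : realType}.

Lemma polarD2pi (r th : R) : polar r (th + 2 * pi) = polar r th.
Proof. by rewrite /polar mulr_natl cosD2pi sinD2pi. Qed.

(** Sorting by angle gives the order; index [N] is the first point again, one turn later, so that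
    consecutive indices describe all arcs including the closing one. In the last clause [cos < 1]
    says that no third point lies on the closed arc. *)
Lemma circular_order (I : finType) (th : I -> R) (N : nat) : #|I| = N -> (1 < N)%N ->
  injective th -> (forall i, 0 <= th i < 2 * pi) ->
  exists (J : nat -> I) (t : nat -> R), [/\ t N = t 0 + 2 * pi, J N = J 0 &
    forall f : I -> R, \sum_(j < N) f (J j) = \sum_i f i] /\
  [/\ forall j, (j < N)%N -> 0 < t j.+1 - t j < 2 * pi,
    forall j r, (j <= N)%N -> polar r (t j) = polar r (th (J j)),
    forall j, (j < N)%N -> J j != J j.+1 &
    forall j i x, (j < N)%N -> i != J j -> i != J j.+1 -> t j <= x <= t j.+1 -> cos (x - th i) < 1].
Proof.
move=> cI N1 inj_th th02; have N0 : (0 < N)%N := ltnW N1.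
pose le_th a b := th a <= th b.
pose s := sort le_th (enum I).
have us : uniq s by rewrite sort_uniq enum_uniq.
have sN : size s = N by rewrite size_sort -cardE.
have [x0 _] : exists x0 : I, x0 \in I by apply/existsP; rewrite -/(pred0b _); apply/pred0Pn/card_gt0P; rewrite cI.
have tot : total le_th by move=> a b; exact: le_total.
have trans : transitive le_th by move=> b a c; exact: le_trans.
have ss : sorted le_th s by exact: sort_sorted.
have mono a b : (a < b)%N -> (b < N)%N -> th (nth x0 s a) < th (nth x0 s b).
  move=> ab bN; have aN := ltn_trans ab bN.
  have := sorted_ltn_nth trans x0 ss; move=> /(_ a b); rewrite !inE sN aN bN => /(_ erefl erefl ab); rewrite /le_th => h.
  rewrite lt_neqAle h andbT; apply/eqP => /inj_th /eqP; rewrite nth_uniq ?sN// => /eqP e.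
  by move: ab; rewrite e ltnn.
pose idx j := if (j < N)%N then j else 0%N.
pose J j := nth x0 s (idx j).
pose t j := if (j < N)%N then th (nth x0 s j) else th (nth x0 s 0) + 2 * pi.
have tj j : (j < N)%N -> t j = th (nth x0 s j) by rewrite /t => ->.
have tN : t N = th (nth x0 s 0) + 2 * pi by rewrite /t ltnn.
have Jj j : (j < N)%N -> J j = nth x0 s j by rewrite /J /idx => ->.
have JN : J N = nth x0 s 0 by rewrite /J /idx ltnn.
have b02 (a : nat) : 0 <= th (nth x0 s a) /\ th (nth x0 s a) < 2 * pi by apply/andP; exact: th02.
have step j : (j < N)%N -> 0 < t j.+1 - t j < 2 * pi.
  move=> jN; rewrite (tj j jN); have [jN'|] := ltnP j.+1 N.
    by rewrite tj// ; have := mono _ _ (ltnSn j) jN'; have := b02 j; have := b02 j.+1; lra.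
  move=> Nj; have e : j.+1 = N by apply/eqP; rewrite eqn_leq jN.
  have j0 : (0 < j)%N by rewrite -ltnS e.
  by rewrite e tN; have := mono _ _ j0 jN; have := b02 j; have := b02 0%N; lra.
exists J, t; split; split.
- by rewrite tN tj.
- by rewrite JN Jj.
- move=> f; transitivity (\sum_(i <- s) f i).
    by rewrite (big_nth x0) sN big_mkord; apply: eq_bigr => j _; rewrite Jj.
  by rewrite /s (perm_big _ (permEl (perm_sort le_th (enum I)))) big_enum.
- exact: step.
- move=> j r; rewrite leq_eqVlt => /orP[/eqP ->|jN]; last by rewrite tj// Jj.
  by rewrite tN JN polarD2pi.
- move=> j jN; rewrite (Jj j jN); have [jN'|Nj] := ltnP j.+1 N.
    by rewrite Jj// nth_uniq ?sN// neq_ltn ltnSn.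
  have e : j.+1 = N by apply/eqP; rewrite eqn_leq jN.
  by rewrite e JN nth_uniq ?sN// -lt0n -ltnS e.
move=> j i x jN ij ij1 /andP[x1 x2].
have ins : i \in s by rewrite mem_sort mem_enum.
pose a := index i s; have aN : (a < N)%N by rewrite -sN index_mem.
have ia : i = nth x0 s a by rewrite nth_index.
rewrite (Jj j jN) ia nth_uniq ?sN// in ij.
rewrite (tj j jN) in x1; rewrite ia.
have [aj|ja|e] := ltngtP a j; last by rewrite e eqxx in ij.
  have h := mono _ _ aj jN; apply: cos_lt1.
  have [jN'|Nj] := ltnP j.+1 N.
    by rewrite tj// in x2; have := b02 a; have := b02 j.+1; lra.
  have e : j.+1 = N by apply/eqP; rewrite eqn_leq jN.
  rewrite e JN ia nth_uniq ?sN// -lt0n in ij1; rewrite e tN in x2.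
  by have := mono _ _ ij1 aN; have := b02 a; lra.
have jN' : (j.+1 < N)%N := leq_ltn_trans ja aN.
rewrite Jj// ia nth_uniq ?sN// in ij1; rewrite tj// in x2.
have h : th (nth x0 s j.+1) < th (nth x0 s a) by apply: mono => //; rewrite ltn_neqAle eq_sym ij1.
rewrite -cosN opprB; apply: cos_lt1.
by have := b02 a; have := b02 j; lra.
Qed.

Lemma ln_le_tangent (a x : R) : 0 < a -> 0 < x -> ln x <= ln a + x / a - 1.
Proof.
move=> a0 x0; have := expR_ge1Dx (ln (x / a)).
by rewrite lnK ?posrE ?divr_gt0// ln_div ?posrE//; lra.
Qed.

Lemma sum_gap_bound (r : R) (N : nat) (l : 'I_N -> R) : 0 < r -> (0 < N)%N -> (forall j, 0 < l j) ->
  \sum_j l j = 2 * pi -> \sum_j gap_bound r (l j) <= N%:R * ln (4 * r / N%:R).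
Proof.
move=> r0 N0 l0 sl; have p0 := pi_gt0 R; have Nr : 0 < N%:R :> R by rewrite ltr0n.
(* The tangent of [ln] is taken at the value of [2 r l / pi] for [N] equal gaps [l = 2 pi / N]. *)
pose a := 4 * r / N%:R; have a0 : 0 < a by rewrite !mulr_gt0// invr_gt0.
have h j : gap_bound r (l j) <= (ln a - 1) + N%:R / (2 * pi) * l j.
  have x0 : 0 < 2 * r * l j / pi by rewrite !mulr_gt0// invr_gt0.
  apply: le_trans (ln_le_tangent a0 x0) _.
  rewrite (_ : 2 * r * l j / pi / a = N%:R / (2 * pi) * l j); first lra.
  move: (gt_eqF p0) (gt_eqF r0) (gt_eqF Nr); rewrite /a; move: (N%:R : R) (pi : R) (l j) => M p x e1 e2 e3.
  by field; rewrite e1 e2 e3.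
apply: le_trans (ler_sum _ (fun j _ => h j)) _.
rewrite big_split /= sumr_const card_ord -mulr_sumr sl -[X in X + _]mulr_natl.
rewrite (_ : N%:R / (2 * pi) * (2 * pi) = N%:R); first by rewrite -/a; lra.
by move: (gt_eqF p0); move: (N%:R : R) (pi : R) => M p e1; field; rewrite e1.
Qed.

End CircularOrder.

Section Configuration.
Context {R : realType}.
Local Notation C := R[i]^o.
Variables (n : nat) (Om : 'I_n -> set C) (K : 'I_n * bool -> set C) (A q : 'I_n * bool -> C -> R).
Hypotheses (disj : forall j k z, Om j z -> Om k z -> j = k)
  (cK : forall i, closed (K i)) (KOm : forall i, K i `<=` Om i.1) (A0 : forall i z, ~ K i z -> A i z = 0)
  (cA : forall i, C2 setT (A i)) (q0 : forall i z, ~ Om i.1 z -> q i z = 0)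
  (cq : forall i z, {for z, continuous (q i)}).

(** [true] marks the pole [z_k] and [false] the pole [zeta_k]. *)
Definition pair_density k := energy_density (A (k, true)) (A (k, false)) (q (k, true)) (q (k, false)).

Lemma pair_active z : (0 < n)%N -> exists k0, forall k, k != k0 ->
  dx (fun z => A (k, true) z - A (k, false) z) z = 0 /\ dy (fun z => A (k, true) z - A (k, false) z) z = 0.
Proof.
move=> n0; have out k : ~ Om k z -> dx (fun z => A (k, true) z - A (k, false) z) z = 0 /\
    dy (fun z => A (k, true) z - A (k, false) z) z = 0.
  move=> Oz; have [_ -> // -> //] := C1BE openT (C2_C1 (cA (k, true))) (C2_C1 (cA (k, false))).
  have [-> -> _] := @dx_out R (K (k, true)) (A (k, true)) z (@cK (k, true)) (@A0 (k, true)) (fun h => Oz (@KOm (k, true) z h)).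
  have [-> -> _] := @dx_out R (K (k, false)) (A (k, false)) z (@cK (k, false)) (@A0 (k, false)) (fun h => Oz (@KOm (k, false) z h)).
  by rewrite subrr.
have [[k0 Ok0]|no] := pselect (exists k, Om k z).
  by exists k0 => k kk0; apply: out => Ok; move/eqP: kk0; apply; exact: (@disj k k0 z Ok Ok0).
by exists (Ordinal n0) => k _; apply: out => Ok; apply: no; exists k.
Qed.

Definition orient (b : bool) : R := if b then 1 else -1.

(** The comparison charge of a strip with ends [i1], [i2] is [q i1 - q i2], while [U_k] carries the
    charges of its own pair with their own signs. Where [U_k] lives only the charges of [k] are
    present, so one sign reconciles the two. If both ends belong to [k], they are its two different
    poles, and the signs demanded by either end agree. *)
Lemma pair_density_strip (i1 i2 : 'I_n * bool) k z : i1 != i2 -> (forall i, i != i1 -> i != i2 -> q i z = 0) ->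
  pair_density k z = 2 * (if k == i1.1 then orient i1.2 else - orient i2.2) * (A (k, true) z - A (k, false) z)
    * (q i1 z - q i2 z) - grad_sq (fun z => A (k, true) z - A (k, false) z) z.
Proof.
move=> i12 H; rewrite /pair_density /energy_density; congr (_ - _).
have [Oz|Oz] := pselect (Om k z); last first.
  rewrite (@A0 (k, true) z (fun h => Oz (@KOm (k, true) z h))) (@A0 (k, false) z (fun h => Oz (@KOm (k, false) z h))).
  by rewrite subrr !(mulr0, mul0r).
have off i : i.1 != k -> q i z = 0.
  by move=> ik; apply: q0 => Oi; move/eqP: ik; apply; exact: (@disj i.1 k z Oi Oz).
suff -> : q (k, true) z - q (k, false) z = (if k == i1.1 then orient i1.2 else - orient i2.2) * (q i1 z - q i2 z).
  by ring.
case: i1 i2 i12 H => [k1 b1] [k2 b2] i12 H /=.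
have [e1|n1] := eqVneq k k1; have [e2|n2] := eqVneq k k2.
- subst k1 k2; move: i12; rewrite xpair_eqE eqxx /= /orient => b12.
  by case: b1 b2 b12 {H} => [] [] // _; ring.
- subst k1; have h2 := off (k2, b2); rewrite /= eq_sym in h2; rewrite h2// subr0.
  have h b : b != b1 -> q (k, b) z = 0.
    by move=> bb; apply: H; rewrite xpair_eqE ?eqxx ?(negPf n2)//=.
  by case: b1 {i12 H} h => h; rewrite /orient; [rewrite (h false)//|rewrite (h true)//]; ring.
- subst k2; have h1 := off (k1, b1); rewrite /= eq_sym in h1; rewrite h1// sub0r.
  have h b : b != b2 -> q (k, b) z = 0.
    by move=> bb; apply: H; rewrite xpair_eqE ?eqxx ?(negPf n1)//=.
  by case: b2 {i12 H} h => h; rewrite /orient; [rewrite (h false)//|rewrite (h true)//]; ring.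
have h1 := off (k1, b1); have h2 := off (k2, b2); rewrite /= eq_sym in h1; rewrite /= eq_sym in h2.
rewrite h1// h2// !H ?subrr ?mulr0// xpair_eqE ?(negPf n1) ?(negPf n2)//.
Qed.

Lemma continuous_pair_density k z : {for z, continuous (pair_density k)}.
Proof. by apply: continuous_energy_density; [exact: cA|exact: cA|exact: cq|exact: cq]. Qed.

End Configuration.

Lemma compact_expC_bound {R : realType} (r : R) (K : set R[i]^o) : 0 < r -> compact K -> ~ K 0 ->
  exists2 S : R, 0 < S & forall z, K (expC r z) -> `|complex.Re z| < S.
Proof.
move=> r0 cK K0; have [M M0 HM] := compact_bounded_plane cK.
have oK := closed_openC (compact_closed (@hausdorff_plane R) cK).
have [d d0 Hd] := open_cdisc oK K0.
pose S := `|ln (M / r)| + `|ln (d / r)| + 1; exists S.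
  by rewrite /S ltr_wpDl// addr_ge0.
move=> z Kz; have h1 := HM _ Kz; rewrite modulus_expC// in h1.
have h2 : d < r * expR (complex.Re z).
  rewrite -(modulus_expC r0) ltNge; apply/negP => h; apply: (Hd (expC r z)) => //.
  by change (modulus (expC r z - 0) <= d); rewrite subr0.
have e1 : complex.Re z < ln (M / r).
  by rewrite -ltr_expR lnK ?posrE ?divr_gt0// ltr_pdivlMr// mulrC.
have e2 : ln (d / r) < complex.Re z.
  by rewrite -ltr_expR lnK ?posrE ?divr_gt0// ltr_pdivrMr// mulrC.
rewrite ltr_norml /S; have := ler_norm (ln (M / r)); have := ler_norm (- ln (d / r)); rewrite normrN.
have := normr_ge0 (ln (M / r)); have := normr_ge0 (ln (d / r)); move=> *; apply/andP; split; lra.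
Qed.

Lemma Int2_chain {R : realType} (S : R) (t : nat -> R) (N : nat) (F : R[i]^o -> R) : 0 <= S ->
  (forall j, (j < N)%N -> t j <= t j.+1) -> (forall z, {for z, continuous F}) ->
  t 0%N <= t N /\ Int2 (- S) S (t 0%N) (t N) F = \sum_(j < N) Int2 (- S) S (t j) (t j.+1) F.
Proof.
move=> S0 ht cF; have SS : - S <= S by lra.
elim: N ht => [|N IH] ht.
  split => //; rewrite big_ord0 /Int2 -[RHS](mul0r (S - - S)) -Int_cst//.
  by apply: eq_Int => s _; rewrite /Int set_itv1 Rintegral_set1.
have [h1 h2] := IH (fun j jN => ht j (ltnW jN)); have h3 := ht N (ltnSn N).
split; first exact: le_trans h1 h3.
by rewrite big_ord_recr /= -h2; apply: Int2_cat => // z _; exact: cF.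
Qed.

Section UpperBound.
Context {R : realType}.
Local Notation C := R[i]^o.
Variables (n : nat) (r : R) (Om : 'I_n -> set C) (pt : 'I_n * bool -> C) (h : 'I_n * bool -> C -> R).
Hypotheses (r0 : 0 < r) (n0 : (0 < n)%N) (oOm : forall k, open (Om k)) (Om0 : forall k, ~ Om k 0)
  (disj : forall j k z, Om j z -> Om k z -> j = k)
  (ptr : forall i, modulus (pt i) = r) (ptOm : forall i, Om i.1 (pt i)) (ptI : injective pt)
  (hh : forall i, harmonic_on (Om i.1) (h i)).
Hypothesis approx : forall i (d rad eta : R), 0 < d -> d < rad -> cdisc (pt i) rad `<=` Om i.1 -> 0 < eta ->
  exists V : C -> R, [/\ C2 setT V, forall z, 0 <= V z,
    exists K, [/\ compact K, K `<=` Om i.1 & forall z, ~ K z -> V z = 0],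
    forall z, - lap V z <= rho d (pt i) z &
    (forall z, Om i.1 z -> V z <= h i z + log_bump d (pt i) z) /\
    forall z, modulus (z - pt i) <= rad / 2 -> h i z + log_bump d (pt i) z - eta <= V z].

Local Notation I := ('I_n * bool)%type.

Definition mutual k z : R := h (k, false) z - ln (modulus (z - pt (k, false))).
(** The mutual term is attributed to the pole [z_k] alone, as in the lower bound for the energy.
    Over a pair the coefficients add up to the logarithm of the corresponding factor of the
    product. *)
Definition coef (i : I) : R := if i.2 then h i (pt i) - 2 * mutual i.1 (pt i) else h i (pt i).

Lemma pt_true_neq_false k : pt (k, true) != pt (k, false).
Proof. by apply/eqP => /ptI. Qed.

(** The discs in the domains exceed [2 d] in radius because the approximants are controlled from
    below only on half of such a disc. *)
Lemma small_radius (e : R) : 0 < e -> exists2 d0 : R, 0 < d0 & forall d : R, 0 < d -> d < d0 ->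
  (forall i, exists2 rad, 2 * d < rad & cdisc (pt i) rad `<=` Om i.1) /\
  (forall i z, modulus (z - pt i) < d -> `|h i z - h i (pt i)| < e) /\
  (forall k z, modulus (z - pt (k, true)) < d -> d <= modulus (z - pt (k, false)) /\
     mutual k z < mutual k (pt (k, true)) + e).
Proof.
move=> e0.
have [d1 d10 H1] : exists2 d1 : R, 0 < d1 & forall d : R, 0 < d -> d < d1 -> forall i,
    (exists2 rad, 2 * d < rad & cdisc (pt i) rad `<=` Om i.1) /\
    (forall z, modulus (z - pt i) < d -> `|h i z - h i (pt i)| < e).
  apply: uniform_small => i; have [rad rad0 Hr] := open_cdisc (@oOm i.1) (ptOm i).
  have [k k0 Hk] := (continuous_modulusP _ _).1 (harmonic_continuous (@oOm i.1) (hh i) (ptOm i)) e e0.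
  exists (Num.min (rad / 2) k); first by rewrite lt_min k0 divr_gt0.
  move=> d d0; rewrite lt_min => /andP[h1 h2]; split; first by exists rad => //; lra.
  by move=> z zd; apply: Hk; exact: lt_trans zd h2.
have [d2 d20 H2] : exists2 d2 : R, 0 < d2 & forall d : R, 0 < d -> d < d2 -> forall k,
    forall z, modulus (z - pt (k, true)) < d -> d <= modulus (z - pt (k, false)) /\
     mutual k z < mutual k (pt (k, true)) + e.
  apply: uniform_small => k.
  have cl : {for pt (k, true), continuous (fun z : C => ln (modulus (z - pt (k, false))))}.
    exact: (harmonic_continuous (@open_punctured R _) (harmonic_ln_modulus _) (pt_true_neq_false k)).
  have ch := harmonic_continuous (@oOm k) (hh (k, false)) (ptOm (k, true)).
  have [s s0 Hs] := (continuous_modulusP _ _).1 (contB ch cl) e e0.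
  have m0 : 0 < modulus (pt (k, true) - pt (k, false)) by rewrite modulus_sub_gt0 pt_true_neq_false.
  exists (Num.min (modulus (pt (k, true) - pt (k, false)) / 2) s); first by rewrite lt_min s0 divr_gt0.
  move=> d d0; rewrite lt_min => /andP[h1 h2] z zd; split.
    have := modulusD (pt (k, true) - z) (z - pt (k, false)); rewrite subrKA (modulusC _ z); lra.
  have := Hs z (lt_trans zd h2); rewrite ltr_norml => /andP[_]; rewrite -!/(mutual _ _); lra.
exists (Num.min d1 d2); first by rewrite lt_min d10.
move=> d d0; rewrite lt_min => /andP[h1 h2]; split; last split.
- by move=> i; have [] := H1 d d0 h1 i.
- by move=> i; have [] := H1 d d0 h1 i.
- by move=> k; exact: H2.
Qed.

Section Fixed.
Variables (N : nat) (J : nat -> I) (t : nat -> R).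
Hypotheses (N0 : (0 < N)%N) (tN : t N = t 0%N + 2 * pi) (tstep : forall j, (j < N)%N -> 0 < t j.+1 - t j < 2 * pi)
  (tJ : forall j, (j <= N)%N -> pt (J j) = polar r (t j))
  (JJ : forall j, (j < N)%N -> J j != J j.+1)
  (sep : forall j i, (j < N)%N -> i != J j -> i != J j.+1 -> exists2 th, pt i = polar r th &
     forall x, t j <= x <= t j.+1 -> cos (x - th) < 1).

Let gap (j : nat) := t j.+1 - t j.
Let chg d i z := rho d (pt i) (expC r z) * (r * expR (complex.Re z)) ^+ 2.
Let bmp d i z := log_bump d (pt i) (expC r z).

Let chgE d j : (j <= N)%N -> chg d (J j) = cyl_charge r d (t j).
Proof. by move=> jN; rewrite /chg tJ. Qed.

Let bmpE d j : (j <= N)%N -> bmp d (J j) = cyl_bump r d (t j).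
Proof. by move=> jN; rewrite /bmp tJ. Qed.

(** The conclusion of [strip_comparison], named so that a common radius can be chosen for the
    finitely many strips. *)
Definition strip_data (e d th1 th2 : R) := exists (U : set C) (g : C -> R),
  [/\ open U, forall z, th1 <= complex.Im z <= th2 -> U z, C2 U g &
    forall z, U z -> lap g z = cyl_charge r d th2 z - cyl_charge r d th1 z] /\
  [/\ forall s, dy g (s +i* th1) = 0 /\ dy g (s +i* th2) = 0,
    forall z, th1 <= complex.Im z <= th2 -> 1 <= complex.Re z -> g z * dx g z <= 0,
    forall z, th1 <= complex.Im z <= th2 -> complex.Re z <= -1 -> 0 <= g z * dx g z &
    forall z, th1 <= complex.Im z <= th2 -> (cyl_charge r d th1 z - cyl_charge r d th2 z) * g z <=
      cyl_charge r d th1 z * (cyl_bump r d th1 z + gap_bound r (th2 - th1) + e) +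
      cyl_charge r d th2 z * (cyl_bump r d th2 z + gap_bound r (th2 - th1) + e)].

(** Translation and reflection carry each half charge to [half_mass], provided it does not reach
    past its strip. For this [k] is a common lower bound of the gaps, and [d] is so small that the
    charges vanish at angles between [k] and the gap. *)
Lemma small_radius_strips (e : R) : 0 < e -> exists2 d0 : R, 0 < d0 & forall d : R, 0 < d -> d < d0 ->
  (forall j : 'I_N, strip_data e d (t j) (t j.+1)) /\
  (forall (j : 'I_N) i (z : C), i != J j -> i != J j.+1 -> t j <= complex.Im z <= t j.+1 -> chg d i z = 0) /\
  (forall S, 0 < S -> exists2 mu : R, 0 < mu & forall j : 'I_N,
     Int2 (- S) S (t j) (t j.+1) (cyl_charge r d (t j)) = mu /\
     Int2 (- S) S (t j) (t j.+1) (cyl_charge r d (t j.+1)) = mu).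
Proof.
move=> e0.
have [d1 d10 H1] : exists2 d1 : R, 0 < d1 & forall d : R, 0 < d -> d < d1 -> forall j : 'I_N,
    strip_data e d (t j) (t j.+1).
  apply: uniform_small => j; have /andP[g0 g2] := tstep (ltn_ord j).
  have [d0 d00 H] := strip_comparison r0 g0 g2 e0.
  exists d0; first exact: d00.
  by move=> d dp dd; apply: (H d (t j) (t j.+1) dp dd); rewrite addrC subrK.
have [d2 d20 H2] : exists2 d2 : R, 0 < d2 & forall d : R, 0 < d -> d < d2 -> forall ji : 'I_N * I,
    ji.2 != J ji.1 -> ji.2 != J ji.1.+1 -> forall z : C, t ji.1 <= complex.Im z <= t ji.1.+1 -> chg d ji.2 z = 0.
  apply: uniform_small => -[j i] /=.
  have [->|n1] := eqVneq i (J j); first by exists 1.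
  have [->|n2] := eqVneq i (J j.+1); first by exists 1.
  have [th thE Hth] := sep (ltn_ord j) n1 n2.
  have /andP[g0 g2] := tstep (ltn_ord j).
  have tj : t j <= t j.+1 by move: g0; rewrite subr_gt0 => /ltW.
  have [k k0 Hk] := arc_gap tj Hth.
  have k20 : 0 < r ^+ 2 * (k / 2) by rewrite mulr_gt0 ?exprn_gt0// divr_gt0.
  exists (Num.sqrt (r ^+ 2 * (k / 2))); first by rewrite sqrtr_gt0.
  move=> d d0 dk _ _ z zt; rewrite /chg thE; apply: (cyl_charge_out d0).
  rewrite -ler_sqr ?nnegrE ?modulus_ge0 ?(ltW d0)// -sqdistE.
  apply: le_trans (sqdist_expC_ge_cos r0 th z).
  apply: (@le_trans _ _ (r ^+ 2 * (k / 2))).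
    by rewrite -(sqr_sqrtr (ltW k20)) ler_sqr ?nnegrE ?sqrtr_ge0 ?(ltW d0)// ltW.
  by rewrite ler_pM2l ?exprn_gt0// ler_pM2r ?invr_gt0//; exact: Hk.
have [k k0 Hk] : exists2 k : R, 0 < k & forall j : 'I_N, k <= gap j.
  have [k k0 Hk] : exists2 k : R, 0 < k & forall d : R, 0 < d -> d < k -> forall j : 'I_N, d < gap j.
    by apply: uniform_small => j; have /andP[g0 g2] := tstep (ltn_ord j); exists (gap j).
  exists (k / 2); first by rewrite divr_gt0.
  by move=> j; apply/ltW/Hk; [rewrite divr_gt0|rewrite ltr_pdivrMr// ltr_pMr// ltr1n].
have [d3 d30 H3] : exists2 d3 : R, 0 < d3 & forall d : R, 0 < d -> d < d3 -> forall j : 'I_N,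
    forall s x, k <= x <= gap j -> cyl_charge r d 0 (s +i* x) = 0.
  apply: uniform_small => j; have [d4 d40 H4] := expC_near r0 (tstep (ltn_ord j)) k0.
  exists d4 => // d d0 dd s x /andP[x1 x2]; apply: (cyl_charge_out d0); rewrite leNgt; apply/negP => hd.
  have x0 : 0 <= x := le_trans (ltW k0) x1.
  have := H4 0 (s +i* x); rewrite /tr /= subr0 ger0_norm// => /(_ x2 (lt_trans hd dd)).
  apply/negP; rewrite -leNgt; apply: le_trans x1 _.
  by rewrite -[X in X <= _](ger0_norm x0) -sqrtr_sqr ler_wsqrtr// lerDr sqr_ge0.
exists (Num.min d1 (Num.min d2 d3)); first by rewrite !lt_min d10 d20.
move=> d d0; rewrite !lt_min => /and3P[h1 h2 h3]; split; last split.
- exact: H1.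
- by move=> j i z n1 n2 zt; exact: (H2 d d0 h2 (j, i)).
move=> S S0; exists (half_mass r d S k); first exact: half_mass_gt0.
move=> j; have kk : 0 < k <= gap j by rewrite k0 Hk.
have [e1 _] := half_massE S (t j) d0 kk (H3 d d0 h3 j).
have [_ e2] := half_massE S (t j.+1) d0 kk (H3 d d0 h3 j).
have t1 : t j + gap j = t j.+1 by rewrite /gap addrC subrK.
have t2 : t j.+1 - gap j = t j by rewrite /gap opprB addrC subrK.
by rewrite t1 in e1; rewrite t2 in e2.
Qed.

(** For each pair the energy over the whole cylinder is bounded below, and for each strip the sum of
    all energies is bounded above. Regrouped by strips, the self-energies [chg bmp] occur on both
    sides and cancel, and the remaining constants share the factor [mu]. Each end loses [4 e] below
    and [e] above, whence [10 e] per strip. *)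
Lemma chain_bound (e : R) : 0 < e ->
  \sum_(j < N) (coef (J j) + coef (J j.+1) - 2 * gap_bound r (gap j) - 10 * e) <= 0.
Proof.
move=> e0; have p0 := pi_gt0 R.
have [d1 d10 H1] := small_radius e0; have [d2 d20 H2] := small_radius_strips e0.
pose d := Num.min d1 d2 / 2; have dm : 0 < Num.min d1 d2 by rewrite lt_min d10.
have d0 : 0 < d by rewrite divr_gt0.
have dd : d < Num.min d1 d2 by rewrite ltr_pdivrMr// ltr_pMr// ltr1n.
have /andP[dd1 dd2] : (d < d1) && (d < d2) by rewrite -lt_min.
have [Hrad [Hh Hm]] := H1 d d0 dd1; have [Hstrip [Hsep Hmass]] := H2 d d0 dd2.
move: (d) d0 Hrad Hh Hm Hstrip Hsep Hmass => {dm dd dd1 dd2 H1 H2 d10 d20 d1 d2}dl d0 Hrad Hh Hm Hstrip Hsep Hmass {d}.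
have HV i : exists VK : (C -> R) * set C, [/\ C2 setT VK.1, forall z, 0 <= VK.1 z,
    [/\ compact VK.2, VK.2 `<=` Om i.1 & forall z, ~ VK.2 z -> VK.1 z = 0],
    forall z, - lap VK.1 z <= rho dl (pt i) z &
    (forall z, Om i.1 z -> VK.1 z <= h i z + log_bump dl (pt i) z) /\
    forall z, modulus (z - pt i) < dl -> h i z + log_bump dl (pt i) z - e <= VK.1 z].
  have [rad rad2 Hr] := Hrad i; have dr : dl < rad by move: d0 rad2; lra.
  have [V [v1 v2 [K [k1 k2 k3]] v4 [v5 v6]]] := approx d0 dr Hr e0.
  exists (V, K); split => //; split => // z zd; apply: v6; move: zd rad2; lra.
have [VK HVK] := boolp.choice HV; clear HV.
pose A i := (VK i).1 \o expC r; pose K i := expC r @^-1` (VK i).2.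
pose Omc k := expC r @^-1` Om k.
have oOmc k : open (Omc k) by apply: open_expC; exact: oOm.
have cK i : closed (K i).
  have [_ _ [k1 _ _] _ _] := HVK i; apply: closed_comp => [z _|]; first exact: continuous_expC.
  exact: (compact_closed (@hausdorff_plane R) k1).
have KOm i : K i `<=` Omc i.1 by have [_ _ [_ k2 _] _ _] := HVK i; move=> z; exact: k2.
have A0 i z : ~ K i z -> A i z = 0 by have [_ _ [_ _ k3] _ _] := HVK i; exact: k3.
have cA i : C2 setT (A i) by have [v1 _ _ _ _] := HVK i; have [] := C2_expC r openT v1.
have Age0 i z : 0 <= A i z by have [_ v2 _ _ _] := HVK i; exact: v2.
have lA i z : - lap (A i) z <= chg dl i z.
  have [v1 _ _ v4 _] := HVK i; have [_ l] := C2_expC r openT v1.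
  by rewrite l// -mulNr /chg ler_wpM2r ?sqr_ge0.
have discOm i z : modulus (z - pt i) < dl -> Om i.1 z.
  have [rad rad2 Hr] := Hrad i; move=> zd; apply: Hr; change (modulus (z - pt i) <= rad); move: d0 zd rad2; lra.
have chg_out i z : dl <= modulus (expC r z - pt i) -> chg dl i z = 0.
  by move=> hz; rewrite /chg rho_out// mul0r.
have chg0 i z : ~ Omc i.1 z -> chg dl i z = 0.
  by move=> Oz; apply: chg_out; rewrite leNgt; apply/negP => /discOm.
have chg_ge0 i z : 0 <= chg dl i z by rewrite mulr_ge0 ?sqr_ge0// rho_ge0.
have [th thE] : exists th : I -> R, forall i, pt i = polar r (th i).
  have hx i : exists x, pt i = polar r x by have [x _ xE] := polar_surj r0 (ptr i); exists x.
  have [th thE] := boolp.choice hx; exists th; exact: thE.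
have cchg i z : {for z, continuous (chg dl i)} by rewrite /chg thE; exact: continuous_cyl_charge.
have cbmp i z : {for z, continuous (bmp dl i)} by rewrite /bmp thE; exact: continuous_cyl_bump.
(* [S] lies beyond the supports of all approximants, and it is at least 1 so that the sign
   conditions on the comparison functions hold at the ends. *)
have [S S1 HS] : exists2 S : R, 1 <= S & forall i z, K i z -> `|complex.Re z| < S.
  have HSi i : exists s : R, 0 < s /\ forall z, K i z -> `|complex.Re z| < s.
    have [_ _ [k1 k2 _] _ _] := HVK i.
    by have [s s0 Hs] := compact_expC_bound r0 k1 (fun z0 => @Om0 i.1 (k2 0 z0)); exists s.
  have [s Hs] := boolp.choice HSi.
  exists (1 + \sum_i s i); first by rewrite lerDl sumr_ge0// => i _; exact: ltW (Hs i).1.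
  move=> i z Kz; apply: lt_le_trans ((Hs i).2 z Kz) _; rewrite (bigD1 i)//= addrCA lerDl.
  by rewrite addr_ge0// sumr_ge0// => k _; exact: ltW (Hs k).1.
have S0 : 0 <= S := le_trans ler01 S1.
have sA i z : S <= `|complex.Re z| -> A i z = 0.
  by move=> Sz; apply: A0 => /HS; rewrite ltNge Sz.
pose T k := pair_density A (chg dl) k.
(* The loss [4 e] is made of [e] from the approximation, [e] from the variation of [h], and [2 e]
   from the mutual term, which enters with the factor 2. *)
pose G i z := chg dl i z * (bmp dl i z + (coef i - 4 * e)).
have cG i z : {for z, continuous (G i)}.
  by apply: contM; [exact: cchg|apply: contD; [exact: cbmp|exact: cont_cst]].
(* [G] minorises the left side of [energy_density_ge]: outside its disc a charge is 0, inside it the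
   approximant is controlled from below. *)
have lower k : Int2 (- S) S (t 0%N) (t N) (fun z => G (k, true) z + G (k, false) z) <=
    Int2 (- S) S (t 0%N) (t N) (T k).
  have hf := harmonic_C2 (hh (k, false)).
  have [cb lb] := bump_C2 (pt (k, false)) d0.
  have [cbE lbE] := C2_expC r openT cb; have [chE lhE] := C2_expC r (@oOm k) hf.
  have [cg lg] := C2DE (oOmc k) chE (C2S (@subsetT _ _) cbE).
  pose g z := (h (k, false) \o expC r) z + (log_bump dl (pt (k, false)) \o expC r) z.
  have lg' z : Omc k z -> lap g z = - chg dl (k, false) z.
    move=> Oz; rewrite /g lg// lhE// lbE// lb (harmonic_lap (hh (k, false)) Oz) mul0r add0r.
    by rewrite mulNr.
  have Bg z : Omc k z -> A (k, false) z <= g z.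
    by move=> Oz; have [_ _ _ _ [v5 _]] := HVK (k, false); exact: v5.
  rewrite tN; apply: (@energy_lower_bound R (Omc k) (K (k, true)) (A (k, true)) (A (k, false)) g (oOmc k)
    (@cK _) (KOm (k, true)) (A0 (k, true)) (cA _) (cA _) cg _ _ (lA _) (lA _) (Age0 _) (Age0 _) (chg0 (k, true))
    lg' Bg S (t 0%N) (2 * pi) S0 _ (HS (k, true)) (sA (k, false)) (periodic_expC r _) (periodic_expC r _)
    (periodic_expC r (fun w => h (k, false) w + log_bump dl (pt (k, false)) w)) (cchg _) (cchg _)).
  - by lra.
  - by move=> z _; exact: contD (cG _ z) (cG _ z).
  move=> z; apply: lerD.
    have [in1|out1] := ltP (modulus (expC r z - pt (k, true))) dl; last by rewrite /G chg_out// !mul0r.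
    apply: ler_wpM2l => //.
    have [_ _ _ _ [_ v6]] := HVK (k, true); have a1 := v6 _ in1.
    have := Hh _ _ in1; rewrite ltr_norml => /andP[a2 _].
    have [a3 a4] := Hm k _ in1.
    have gE : g z = mutual k (expC r z) by rewrite /g /= bump_out.
    rewrite gE /coef /= /bmp /A /=; move: a1 a2 a4 => /=; lra.
  have [in1|out1] := ltP (modulus (expC r z - pt (k, false))) dl; last by rewrite /G chg_out// !mul0r.
  apply: ler_wpM2l => //.
  have [_ _ _ _ [_ v6]] := HVK (k, false); have a1 := v6 _ in1.
  have := Hh _ _ in1; rewrite ltr_norml => /andP[a2 _].
  rewrite /coef /= /bmp /A /=; move: a1 a2 e0 => /=; lra.
have cT k z : {for z, continuous (T k)} by apply: continuous_pair_density.
have tle j : (j < N)%N -> t j <= t j.+1 by move=> /tstep /andP[]; rewrite subr_gt0 => /ltW.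
have disjc j k z : Omc j z -> Omc k z -> j = k by exact: disj.
(* [strip_inequality] with the comparison function of this strip; the last clause of [strip_data]
   then bounds its right side. *)
have upper (j : 'I_N) : \sum_k Int2 (- S) S (t j) (t j.+1) (T k) <= Int2 (- S) S (t j) (t j.+1)
    (fun z => chg dl (J j) z * (bmp dl (J j) z + (gap_bound r (gap j) + e)) +
              chg dl (J j.+1) z * (bmp dl (J j.+1) z + (gap_bound r (gap j) + e))).
  have [U [g [[oU US cg lg] [gy gx1 gx2 gb]]]] := Hstrip j.
  have jN := ltn_ord j; have E1 := chgE dl (ltnW jN); have E2 := chgE dl jN.
  pose qq z := cyl_charge r dl (t j) z - cyl_charge r dl (t j.+1) z.
  have cqq z : {for z, continuous qq} by rewrite /qq -E1 -E2; exact: contB (cchg _ z) (cchg _ z).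
  have lg' z : U z -> lap g z = - qq z by move=> Uz; rewrite lg// /qq opprB.
  apply: le_trans (@strip_inequality R 'I_n (fun k z => A (k, true) z - A (k, false) z)
    (fun k => if k == (J j).1 then orient (J j).2 else - orient (J j.+1).2) T S (t j) (t j.+1) U g qq
    S1 (tle j jN) oU US cg lg' gy gx1 gx2 _ _ _ _ _ _ _) _.
  - by move=> k; have [c _ _] := C1BE openT (C2_C1 (cA (k, true))) (C2_C1 (cA (k, false))).
  - by move=> k z Sz; rewrite !sA// subrr.
  - by move=> k; case: ifP => _; rewrite /orient; case: ifP => _; rewrite ?sqrrN ?expr1n.
  - by move=> k z _; exact: cT.
  - by move=> z _; exact: cqq.
  - by move=> z; exact: (pair_active disjc cK KOm A0 cA).
  - move=> k z zt; rewrite /qq -E1 -E2; apply: (pair_density_strip disjc KOm A0 chg0); first exact: JJ.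
    by move=> i i1 i2; exact: (Hsep j i z).
  apply: le_Int2; first exact: tle.
  - move=> z zt; apply: contM; last exact: cqq.
    exact: (C2_continuous oU cg (US z zt)).
  - move=> z _; apply: contD; apply: contM; try exact: cchg.
      by apply: contD; [exact: cbmp|exact: cont_cst].
    by apply: contD; [exact: cbmp|exact: cont_cst].
  by move=> z _ zt; have := gb z zt; rewrite -/(gap j) E1 E2 (bmpE dl (ltnW jN)) (bmpE dl jN) !addrA mulrC.
have [mu mu0 Hmu] := Hmass S (lt_le_trans ltr01 S1).
have main : \sum_(j < N) Int2 (- S) S (t j) (t j.+1) (fun z => G (J j) z + G (J j.+1) z) <=
    \sum_(j < N) Int2 (- S) S (t j) (t j.+1)
    (fun z => chg dl (J j) z * (bmp dl (J j) z + (gap_bound r (gap j) + e)) +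
              chg dl (J j.+1) z * (bmp dl (J j.+1) z + (gap_bound r (gap j) + e))).
  apply: le_trans (ler_sum _ (fun j _ => upper j)).
  rewrite exchange_big /=.
  have -> : \sum_(j < N) Int2 (- S) S (t j) (t j.+1) (fun z => G (J j) z + G (J j.+1) z) =
     \sum_k Int2 (- S) S (t 0%N) (t N) (fun z => G (k, true) z + G (k, false) z).
    have cGk k z : {for z, continuous (fun z => G (k, true) z + G (k, false) z)} by exact: contD (cG _ z) (cG _ z).
    under [RHS]eq_bigr => k _ do rewrite (Int2_chain S0 tle (cGk k)).2.
    rewrite exchange_big /=; apply: eq_bigr => j _; have jN := ltn_ord j.
    rewrite -Int2_sum ?tle//; last by move=> k z _; exact: cGk.
    (* On a strip only the charges of its two ends are nonzero, so these two terms already make up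
       the sum over all poles. *)
    apply: eq_Int2 => z _ zt; transitivity (\sum_i G i z).
      rewrite (bigD1 (J j))//= (bigD1 (J j.+1))/= 1?eq_sym ?JJ// big1 ?addr0// => i /andP[i1 i2].
      by rewrite /G (Hsep j i z i1 i2 zt) mul0r.
    transitivity (\sum_(p : I) G (p.1, p.2) z); first by apply: eq_bigr => -[].
    rewrite -(pair_bigA _ (fun k b => G (k, b) z)) /=.
    by apply: eq_bigr => k _; rewrite big_bool.
  apply: ler_sum => k _; rewrite -(Int2_chain S0 tle (cT k)).2; exact: lower.
have split_sum (j : 'I_N) (x y : R) : Int2 (- S) S (t j) (t j.+1)
    (fun z => chg dl (J j) z * (bmp dl (J j) z + x) + chg dl (J j.+1) z * (bmp dl (J j.+1) z + y)) =
    Int2 (- S) S (t j) (t j.+1) (fun z => chg dl (J j) z * bmp dl (J j) z + chg dl (J j.+1) z * bmp dl (J j.+1) z)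
    + (x + y) * mu.
  have jN := ltn_ord j; have [m1 m2] := Hmu j.
  rewrite -(chgE dl (ltnW jN)) in m1; rewrite -(chgE dl jN) in m2.
  have c1 i : cont_strip (t j) (t j.+1) (chg dl i) by move=> z _; exact: cchg.
  have c2 i : cont_strip (t j) (t j.+1) (bmp dl i) by move=> z _; exact: cbmp.
  have e1 : x * mu = Int2 (- S) S (t j) (t j.+1) (fun z => x * chg dl (J j) z) by rewrite Int2Z ?tle// m1.
  have e2 : y * mu = Int2 (- S) S (t j) (t j.+1) (fun z => y * chg dl (J j.+1) z) by rewrite Int2Z ?tle// m2.
  have k1 : cont_strip (t j) (t j.+1) (fun z => chg dl (J j) z * bmp dl (J j) z + chg dl (J j.+1) z * bmp dl (J j.+1) z).
    exact: (cont_stripD (cont_stripM (c1 (J j)) (c2 (J j))) (cont_stripM (c1 (J j.+1)) (c2 (J j.+1)))).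
  have k2 := cont_stripZ (k := x) (c1 (J j)); have k3 := cont_stripZ (k := y) (c1 (J j.+1)).
  have ab := tle j jN.
  rewrite mulrDl e1 e2 addrA -(Int2D _ _ ab k1 k2) -(Int2D _ _ ab (cont_stripD k1 k2) k3).
  by apply: eq_Int2 => z _ _; ring.
(* Multiplication by the mass of half a charge turns the claim into a comparison of integrals. *)
rewrite -(pmulr_lle0 _ mu0) mulr_suml.
have -> : \sum_(j < N) (coef (J j) + coef (J j.+1) - 2 * gap_bound r (gap j) - 10 * e) * mu =
   \sum_(j < N) Int2 (- S) S (t j) (t j.+1) (fun z => G (J j) z + G (J j.+1) z) -
    \sum_(j < N) Int2 (- S) S (t j) (t j.+1)
    (fun z => chg dl (J j) z * (bmp dl (J j) z + (gap_bound r (gap j) + e)) +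
              chg dl (J j.+1) z * (bmp dl (J j.+1) z + (gap_bound r (gap j) + e))).
  rewrite -sumrB; apply: eq_bigr => j _; rewrite /G !split_sum; ring.
by rewrite subr_le0.
Qed.

End Fixed.

Lemma sum_coef_le : \sum_i coef i <= (2 * n)%:R * ln (2 * r / n%:R).
Proof.
have p0 := pi_gt0 R.
have hx i : exists x, 0 <= x < 2 * pi /\ pt i = polar r x.
  by have [x x0 xE] := polar_surj r0 (ptr i); exists x.
have [th thE] := boolp.choice hx.
have thI : injective th by move=> i j e; apply: ptI; rewrite (thE i).2 (thE j).2 e.
pose N := (2 * n)%N; have NI : #|{: I}| = N by rewrite card_prod card_ord card_bool mulnC.
have N1 : (1 < N)%N by rewrite /N -[1%N]/(1 * 1)%N ltn_mull.
have N0 : (0 < N)%N := ltnW N1.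
have [J [t [[tN JN sumJ] [tstep tJ JJ sep]]]] := circular_order NI N1 thI (fun i => (thE i).1).
have tJ' j : (j <= N)%N -> pt (J j) = polar r (t j) by move=> jN; rewrite tJ// -(thE (J j)).2.
have sep' j i : (j < N)%N -> i != J j -> i != J j.+1 -> exists2 x, pt i = polar r x &
     forall y, t j <= y <= t j.+1 -> cos (y - x) < 1.
  by move=> jN i1 i2; exists (th i); [exact: (thE i).2|move=> y; exact: sep].
have gap0 (j : 'I_N) : 0 < t j.+1 - t j by have /andP[] := tstep j (ltn_ord j).
have sumgap : \sum_(j < N) (t j.+1 - t j) = 2 * pi.
  rewrite -(big_mkord xpredT (fun j => t j.+1 - t j)) telescope_sumr// tN; lra.
have sumJ1 : \sum_(j < N) coef (J j.+1) = \sum_i coef i.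
  rewrite -sumJ; apply: (addrI (coef (J 0%N))).
  by rewrite -(big_ord_recl N (fun j : 'I_N.+1 => coef (J j))) big_ord_recr /= JN addrC.
have Nr : 0 < N%:R :> R by rewrite ltr0n.
apply: le_trans (_ : \sum_(j < N) gap_bound r (t j.+1 - t j) <= _).
  (* Each point ends one strip and starts the next, so the coefficients and the gap bounds both come
     with a factor 2; the total error [10 N e'] is then [2 e]. *)
  apply/ler_addgt0Pr => e e0; pose e' := e / (5 * N%:R).
  have e'0 : 0 < e' by rewrite divr_gt0// mulr_gt0.
  have := chain_bound tN tstep tJ' JJ sep' e'0.
  rewrite !sumrB big_split /= sumJ sumJ1 -mulr_sumr sumr_const card_ord -[_ *+ N]mulr_natl.
  have -> : N%:R * (10 * e') = 2 * e.
    by rewrite /e'; move: (gt_eqF Nr); move: (N%:R : R) => M e1; field; rewrite e1.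
  lra.
apply: le_trans (sum_gap_bound r0 N0 gap0 sumgap) _.
rewrite (_ : 4 * r / N%:R = 2 * r / n%:R)//.
have n1 : 0 < n%:R :> R by rewrite ltr0n.
by rewrite /N natrM; move: (gt_eqF n1); move: (n%:R : R) => M e1; field; rewrite e1.
Qed.

End UpperBound.

(** * From Green functions to the inequality *)

Section GreenValues.
Context {R : realType}.
Local Notation C := R[i]^o.
Local Notation Chat := (riemann_sphere R).
Implicit Types (D : set Chat) (a z : C) (u : Chat -> R) (h : C -> R).

Lemma is_green_green D a : (exists u, is_green D a u) -> is_green D a (fun p => green D p a).
Proof. by move=> [u gu]; exact: (xgetPex (fun=> 0) (ex_intro _ u gu)). Qed.

Lemma greenE D a u p : is_green D a u -> (D `\ Some a) p -> green D p a = u p.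
Proof.
move=> gu Dp; have [c1 m1] := is_green_green (ex_intro _ u gu); have [c2 m2] := gu.
by apply/eqP; rewrite eq_le m1// m2.
Qed.

Lemma inner_radius_green D a h (U : set C) : open U -> U a -> {for a, continuous h} ->
  (forall z, U z -> z != a -> green D (Some z) a = h z - ln (modulus (z - a))) ->
  inner_radius D a = expR (h a).
Proof.
move=> oU Ua ch Uh; congr expR; apply: cvg_lim => //.
have h1 : h z @[z --> a^'] --> h a.
  by apply: cvg_trans ch; apply: cvg_app; exact: cvg_within.
apply: cvg_trans h1; apply: near_eq_cvg.
have hU : nbhs a U by exact: open_nbhs_nbhs.
have hU' : \forall z \near a^', U z.
  by apply: (@filterS _ (nbhs a) (nbhs_filter a) U (fun w => w != a -> U w)) hU => w Uw _.
near=> z; rewrite Uh ?subrK//.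
  by near: z; exact: hU'.
by near: z; exact: nbhs_dnbhs_neq.
Unshelve. all: by end_near. Qed.

Lemma radii_product_le (n : nat) (r : R) (D : 'I_n -> set Chat) (z zeta : 'I_n -> C) : (0 < n)%N -> 0 < r ->
  configuration r D z zeta -> radii_product D z zeta <= (2 * r / n%:R) ^+ (2 * n).
Proof.
move=> n0 r0 [modr domD disjD ptD].
have x0 : 0 < 2 * r / n%:R by rewrite !mulr_gt0// invr_gt0 ltr0n.
(* If some [z k = zeta k], the product vanishes. Otherwise all 2n points are distinct, those of
   different [k] by disjointness of the domains. *)
have [[k zk]|zz] := pselect (exists k, z k = zeta k).
  have e0 : exp_m2green (D k) (z k) (zeta k) = 0 by rewrite /exp_m2green ifT//; exact/eqP.
  have -> : radii_product D z zeta = 0.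
    by apply/eqP/prodf_eq0; exists k; [exact: isT|rewrite e0 mulr0].
  exact: exprn_ge0 (ltW x0).
pose pt (i : 'I_n * bool) : C := if i.2 then z i.1 else zeta i.1.
(* The part of [D k] seen by logarithmic coordinates: neither 0 nor the point at infinity. *)
pose Om k : set C := [set w | D k (Some w) /\ w != 0].
have oD k : open (D k) by have [[]] := domD k.
have ptDi i : D i.1 (Some (pt i)) by case: i => k []; rewrite /pt /=; have [] := ptD k.
have ptr i : modulus (pt i) = r by case: i => k []; rewrite /pt /=; have [] := modr k.
have pt0 i : pt i != 0 by rewrite -modulus_gt0 ptr.
have gr i : is_green (D i.1) (pt i) (fun p => green (D i.1) p (pt i)).
  by apply: is_green_green; have [_] := domD i.1; apply; exact: ptDi.
have hx i : exists h : C -> R, harmonic_on [set w | D i.1 (Some w)] h /\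
    forall w, w != pt i -> green (D i.1) (Some w) (pt i) = h w - ln (modulus (w - pt i)).
  by have [h h1 h2] := green_regular_part (oD i.1) (gr i); exists h.
have [h hE] := boolp.choice hx; clear hx.
have oDom k : open [set w : C | D k (Some w)] by exact: open_finite_part.
have disj j k w : Om j w -> Om k w -> j = k.
  move=> [Dj _] [Dk _]; apply/eqP; apply/negP => /negP jk.
  by have : (D j `&` D k) (Some w) by []; rewrite disjD.
have ptI : injective pt.
  move=> [j b] [k c] e; have jk : j = k.
    apply: (disj j k (pt (j, b))); first by split; [exact: (ptDi (j, b))|exact: pt0].
    by rewrite e; split; [exact: (ptDi (k, c))|exact: pt0].
  subst k; congr (_, _); move: e; rewrite /pt /=; case: b; case: c => // e; exfalso; apply: zz; exists j => //.
have oOm k : open (Om k) by apply: openI; [exact: oDom|exact: open_punctured].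
have hh i : harmonic_on (Om i.1) (h i) by apply: harmonicS (hE i).1 => w [].
have approx i (d rad eta : R) (d0 : 0 < d) (dr : d < rad) (cd : cdisc (pt i) rad `<=` Om i.1) (e0 : 0 < eta) :=
  green_smooth_approximant (oD i.1) (ptDi i) (pt0 i) (gr i) (hE i).1 (hE i).2 d0 dr cd e0.
have main := @sum_coef_le R n r Om pt h r0 n0 oOm (fun k => @id (~ Om k 0) (fun H => negP (H.2) (eqxx _))) disj ptr
  (fun i => conj (ptDi i) (pt0 i)) ptI hh approx.
have radE i : inner_radius (D i.1) (pt i) = expR (h i (pt i)).
  apply: (inner_radius_green (oDom i.1) (ptDi i)).
    exact: (harmonic_continuous (oDom i.1) (hE i).1 (ptDi i)).
  by move=> w _ wp; exact: (hE i).2.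
have -> : radii_product D z zeta = expR (\sum_i coef pt h i).
  rewrite (big_morph expR (@expRD R) (@expR0 R)) /radii_product.
  rewrite [RHS](eq_bigr (fun p => expR (coef pt h (p.1, p.2)))); last by move=> [].
  rewrite -(pair_bigA _ (fun k b => expR (coef pt h (k, b)))) /=; apply: eq_bigr => k _.
  rewrite big_bool /= /exp_m2green.
  have zk : z k != zeta k by apply/eqP => e; apply: zz; exists k.
  rewrite (negPf zk) /coef /mutual /= expRD /pt /=.
  rewrite -(radE (k, true)) -(radE (k, false)) /pt /=.
  have := (hE (k, false)).2 (z k); rewrite /pt /= => -> //.
  by rewrite mulNr -!mulrA; congr (_ * _); rewrite mulrC.
apply: le_trans (_ : expR ((2 * n)%:R * ln (2 * r / n%:R)) <= _); first by rewrite ler_expR.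
by rewrite expRM_natl lnK.
Qed.

End GreenValues.

(** * The extremal sectors *)

Section LocalLogarithm.
Context {R : realType}.
Local Notation C := R[i]^o.
Implicit Types (z w : C).
Variable t0 : R.

(** [X] and [Y] are coordinates rotated by [t0]: the half plane around the direction [t0] is
    [X > 0], and there [t0 + atan (Y / X)] is a smooth branch of the argument. *)
Let X z : R := cos t0 * complex.Re z + sin t0 * complex.Im z.
Let Y z : R := cos t0 * complex.Im z - sin t0 * complex.Re z.
Let ang z : R := t0 + atan (Y z / X z).
Definition half_plane : set C := [set z | 0 < X z].
Definition local_log z : C := ln (modulus z) +i* ang z.

Let XYE z : X z ^+ 2 + Y z ^+ 2 = complex.Re z ^+ 2 + complex.Im z ^+ 2.
Proof.
transitivity ((cos t0 ^+ 2 + sin t0 ^+ 2) * (complex.Re z ^+ 2 + complex.Im z ^+ 2)); first by rewrite /X /Y; ring.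
by rewrite cos2Dsin2 mul1r.
Qed.

Lemma open_half_plane : open half_plane.
Proof.
have cX z : {for z, continuous X}.
  exact: (contD (contM (@cont_cst _ _ (cos t0) z) (@continuous_Re R z)) (contM (@cont_cst _ _ (sin t0) z) (@continuous_Im R z))).
by apply: (@open_comp _ _ X [set x : R | 0 < x]); [move=> z _; exact: cX|exact: open_gt].
Qed.

Let hp_neq0 z : half_plane z -> z != 0.
Proof. by rewrite /half_plane /= => h; apply/eqP => z0; move: h; rewrite z0 /X /= !mulr0 addr0 ltxx. Qed.

Lemma expC_local_log z : half_plane z -> expC 1 (local_log z) = z.
Proof.
move=> hz; have z0 := hp_neq0 hz; have X0 : 0 < X z := hz.
have m0 : 0 < modulus z by rewrite modulus_gt0.
have mE : modulus z ^+ 2 = X z ^+ 2 + Y z ^+ 2 by rewrite sqr_modulus XYE.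
have cE : cos (atan (Y z / X z)) = X z / modulus z.
  rewrite cos_atan (_ : 1 + (Y z / X z) ^+ 2 = (modulus z / X z) ^+ 2).
    by rewrite sqrtr_sqr ger0_norm ?invf_div// divr_ge0// ltW.
  by rewrite !expr_div_n mE; field; rewrite gt_eqF.
have sE : sin (atan (Y z / X z)) = Y z / modulus z.
  have := (atan_def (Y z / X z)).2; rewrite /tan cE => h.
  have -> : sin (atan (Y z / X z)) = Y z / X z * (X z / modulus z).
    have xn : X z / modulus z != 0 by rewrite mulf_neq0 ?invr_eq0 ?gt_eqF.
    by rewrite -{2}h divfK.
  by move: (gt_eqF X0) (gt_eqF m0); move: (X z) (modulus z) (Y z) => x m y e1 e2; field; rewrite e1 e2.
rewrite /expC /expX /expY /local_log /= lnK ?posrE// mul1r /ang cosD sinD cE sE.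
have mn : modulus z != 0 by rewrite gt_eqF.
rewrite -[RHS]complex_eta; congr (_ +i* _).
  transitivity (cos t0 * X z - sin t0 * Y z); first by field.
  transitivity ((cos t0 ^+ 2 + sin t0 ^+ 2) * complex.Re z); first by rewrite /X /Y; ring.
  by rewrite cos2Dsin2 mul1r.
transitivity (sin t0 * X z + cos t0 * Y z); first by field.
transitivity ((cos t0 ^+ 2 + sin t0 ^+ 2) * complex.Im z); first by rewrite /X /Y; ring.
by rewrite cos2Dsin2 mul1r.
Qed.

Lemma local_log_expC z : complex.Im z = t0 -> half_plane (expC 1 z) /\ local_log (expC 1 z) = z.
Proof.
move=> zt; have e0 := expR_gt0 (complex.Re z).
have XE : X (expC 1 z) = expR (complex.Re z).
  rewrite /X /expC /expX /expY /= zt; transitivity (expR (complex.Re z) * (cos t0 ^+ 2 + sin t0 ^+ 2)); first by ring.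
  by rewrite cos2Dsin2 mulr1.
have YE : Y (expC 1 z) = 0 by rewrite /Y /expC /expX /expY /= zt; ring.
split; first by rewrite /half_plane /= XE.
rewrite /local_log /ang YE mul0r atan0 addr0 modulus_expC// mul1r expRK -zt; exact: complex_eta.
Qed.

Let A z : R := ratA (complex.Re z) (complex.Im z).
Let B z : R := - ratB (complex.Re z) (complex.Im z).

Lemma harmonic_local_log : [/\ harmonic_on half_plane (fun z => ln (modulus z)), harmonic_on half_plane ang &
  forall z, half_plane z -> dx (fun z : C => ln (modulus z)) z = dy ang z /\ dy (fun z : C => ln (modulus z)) z = - dx ang z].
Proof.
have [hA hB crAB] := @harmonic_inverse R; have oV := open_half_plane.
have hA' : harmonic_on half_plane A by apply: harmonicS hA => z /hp_neq0.
have hB' : harmonic_on half_plane B by apply: harmonicS hB => z /hp_neq0.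
have dXx z : is_derive (complex.Re z) 1 (fun x => X (x +i* complex.Im z)) (cos t0).
  by rewrite /X /=; apply: is_derive_eq; rewrite /GRing.scale /=; ring.
have dXy z : is_derive (complex.Im z) 1 (fun y => X (complex.Re z +i* y)) (sin t0).
  by rewrite /X /=; apply: is_derive_eq; rewrite /GRing.scale /=; ring.
have dYx z : is_derive (complex.Re z) 1 (fun x => Y (x +i* complex.Im z)) (- sin t0).
  by rewrite /Y /=; apply: is_derive_eq; rewrite /GRing.scale /=; ring.
have dYy z : is_derive (complex.Im z) 1 (fun y => Y (complex.Re z +i* y)) (cos t0).
  by rewrite /Y /=; apply: is_derive_eq; rewrite /GRing.scale /=; ring.
have ax z : half_plane z -> isdx ang z (B z).
  move=> hz; have Xn : X (complex.Re z +i* complex.Im z) != 0 by rewrite complex_eta gt_eqF.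
  have Nn := norm2_neq0 (hp_neq0 hz).
  have h1 := is_derive_quot (dYx z) (dXx z) Xn.
  have h2 := is_derive1_comp (g := fun x => Y (x +i* complex.Im z) / X (x +i* complex.Im z)) (is_derive1_atan _) h1.
  apply: (is_derive_congr (is_deriveD (is_derive_cst t0 (complex.Re z) 1) h2)).
  rewrite add0r /B /ratB -XYE; rewrite -XYE in Nn; move: Xn; rewrite !complex_eta => Xn.
  have sXY : sin t0 * X z + cos t0 * Y z = complex.Im z.
    transitivity ((cos t0 ^+ 2 + sin t0 ^+ 2) * complex.Im z); first by rewrite /X /Y; ring.
    by rewrite cos2Dsin2 mul1r.
  rewrite -sXY; move: (X z) (Y z) (cos t0) (sin t0) Xn Nn => x y c s xn nn.
  have n2 : 1 + (y / x) ^+ 2 != 0.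
    by rewrite (_ : 1 + (y / x) ^+ 2 = (x ^+ 2 + y ^+ 2) / x ^+ 2) ?mulf_neq0 ?invr_eq0 ?sqrf_eq0//; field.
  by field; rewrite xn nn.
have ay z : half_plane z -> isdy ang z (A z).
  move=> hz; have Xn : X (complex.Re z +i* complex.Im z) != 0 by rewrite complex_eta gt_eqF.
  have Nn := norm2_neq0 (hp_neq0 hz).
  have h1 := is_derive_quot (dYy z) (dXy z) Xn.
  have h2 := is_derive1_comp (g := fun x => Y (complex.Re z +i* x) / X (complex.Re z +i* x)) (is_derive1_atan _) h1.
  apply: (is_derive_congr (is_deriveD (is_derive_cst t0 (complex.Im z) 1) h2)).
  rewrite add0r /A /ratA -XYE; rewrite -XYE in Nn; move: Xn; rewrite !complex_eta => Xn.
  have sXY : cos t0 * X z - sin t0 * Y z = complex.Re z.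
    transitivity ((cos t0 ^+ 2 + sin t0 ^+ 2) * complex.Re z); first by rewrite /X /Y; ring.
    by rewrite cos2Dsin2 mul1r.
  rewrite -sXY; move: (X z) (Y z) (cos t0) (sin t0) Xn Nn => x y c s xn nn.
  by field; rewrite xn nn.
have [c1 c2 c3] := C1I oV ax ay (fun z hz => harmonic_continuous oV hB' hz) (fun z hz => harmonic_continuous oV hA' hz).
have [d1 d2] := C2I oV c1 c2 c3 (C2_C1 (harmonic_C2 hB')) (C2_C1 (harmonic_C2 hA')).
have hl : harmonic_on half_plane (fun z => ln (modulus z)).
  apply: (eq_harmonic oV _ (harmonicS _ (harmonic_ln_modulus (0 : C)))); first by move=> z _; rewrite subr0.
  by move=> z /hp_neq0.
split; first exact: hl.
  apply: harmonicI => [|z hz]; first exact: d1.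
  by rewrite d2//; have [_ ->] := crAB z (hp_neq0 hz); rewrite subrr.
move=> z hz; rewrite c2// c3//; have z0 := hp_neq0 hz; have Nn := norm2_neq0 z0.
have s0 : 0 < sqdist 0 z by rewrite sqdist_gt0.
have lE w : ln (modulus w) = 2^-1 * ln (sqdist (0 : C) w) by rewrite -ln_modulusE subr0.
have sE (x y : R) : sqdist 0 (x +i* y : C) = x ^+ 2 + y ^+ 2 by rewrite /sqdist /= !subr0.
have q0 : 0 < complex.Re z ^+ 2 + complex.Im z ^+ 2 by rewrite -sE complex_eta.
split.
  have h : isdx (fun z : C => ln (modulus z)) z (A z).
    rewrite /isdx (_ : (fun x => _) = fun x => 2^-1 * ln (x ^+ 2 + complex.Im z ^+ 2)); last first.
      by apply/funext => x; rewrite lE sE.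
    apply: (is_derive_congr (is_deriveCM 2^-1 (is_derive1_comp (g := fun x : R => x ^+ 2 + complex.Im z ^+ 2)
      (is_derive1_ln q0) (is_derive_norm2_q _ _)))).
    by rewrite /A /ratA; field.
  by have /isdxP[_ ->] := h.
have h : isdy (fun z : C => ln (modulus z)) z (- B z).
  rewrite /isdy (_ : (fun x => _) = fun y => 2^-1 * ln (y ^+ 2 + complex.Re z ^+ 2)); last first.
    by apply/funext => x; rewrite lE sE addrC.
  rewrite addrC in q0.
  apply: (is_derive_congr (is_deriveCM 2^-1 (is_derive1_comp (g := fun y : R => y ^+ 2 + complex.Re z ^+ 2)
    (is_derive1_ln q0) (is_derive_norm2_q _ _)))).
  by rewrite /B /ratB opprK (addrC (complex.Im z ^+ 2)); field.
by have /isdyP[_ ->] := h.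
Qed.

End LocalLogarithm.

(** * Sectors as images of strips *)

Section Sector.
Context {R : realType}.
Local Notation C := R[i]^o.
Local Notation Chat := (riemann_sphere R).
Implicit Types (z w x : C) (f : C -> R) (U : set C).
Variables (al l : R).
Hypotheses (l0 : 0 < l) (l2 : l <= 2 * pi).

Definition log_strip : set C := [set x | al < complex.Im x < al + l].
Definition sector : set C := expC 1 @` log_strip.
(** The inverse of [expC 1] on the strip, obtained by choice, with the default 0 off the sector. Its
    regularity comes from the local branches, through [sector_chart]. *)
Definition sector_log z : C := xget 0 [set x | log_strip x /\ expC 1 x = z].

Lemma open_log_strip : open log_strip.
Proof.
have -> : log_strip = [set z | al < complex.Im z] `&` [set z | complex.Im z < al + l].
  by apply/seteqP; split=> z /=; [move/andP|case=> h1 h2; apply/andP].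
by apply: openI; [exact: open_Im_gt|exact: open_Im_lt].
Qed.

(** Equal images have equal moduli and angles whose difference has cosine 1, and these angles differ
    by less than [l <= 2 pi]. The case [l = 2 pi] is a slit plane, which occurs for [n = 1]. *)
Lemma expC_inj x y : log_strip x -> log_strip y -> expC 1 x = expC 1 y -> x = y.
Proof.
move=> /andP[x1 x2] /andP[y1 y2] e.
have r1 : (0 : R) < 1 := ltr01.
have eR : expR (complex.Re x) = expR (complex.Re y).
  by have := modulus_expC r1 x; rewrite e modulus_expC// !mul1r.
move: (e) => [eX eY]; move: eX eY; rewrite /expX /expY !mul1r eR => eX eY.
have p0 : expR (complex.Re y) != 0 by rewrite gt_eqF ?expR_gt0.
have c1 : cos (complex.Im x - complex.Im y) = 1.
  by rewrite cosB (mulfI p0 eX) (mulfI p0 eY) -!expr2 cos2Dsin2.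
have eI : complex.Im x = complex.Im y.
  apply/eqP; case: (ltgtP (complex.Im x) (complex.Im y)) => // h; exfalso.
    have : cos (complex.Im y - complex.Im x) < 1 by apply: cos_lt1; move: x1 x2 y1 y2 h l2; lra.
    by rewrite -cosN opprB c1 ltxx.
  have : cos (complex.Im x - complex.Im y) < 1 by apply: cos_lt1; move: x1 x2 y1 y2 h l2; lra.
  by rewrite c1 ltxx.
by rewrite -(complex_eta x) -(complex_eta y) eI (expR_inj eR).
Qed.

Lemma sector_logK x : log_strip x -> sector_log (expC 1 x) = x.
Proof.
move=> hx; have h := xgetPex (0 : C) (ex_intro (fun y => log_strip y /\ expC 1 y = expC 1 x) x (conj hx erefl)).
by apply: expC_inj; [exact: h.1|exact: hx|exact: h.2].
Qed.

Lemma sector_log_strip z : sector z -> log_strip (sector_log z) /\ expC 1 (sector_log z) = z.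
Proof. by move=> [x hx <-]; rewrite sector_logK. Qed.

Lemma continuous_local_log t z : half_plane t z -> {for z, continuous (local_log t)}.
Proof.
move=> hz; have [h1 h2 _] := harmonic_local_log t; have oV := @open_half_plane R t.
by apply: continuous_complex; [exact: (harmonic_continuous oV h1 hz)|exact: (harmonic_continuous oV h2 hz)].
Qed.

(** Near [z] the local branch centred at the argument of [z] stays in the open strip, and
    injectivity of [expC 1] there identifies it with [sector_log]. *)
Lemma sector_chart z U : sector z -> open U -> U (sector_log z) -> exists t (W : set C),
  [/\ open W, W z, W `<=` half_plane t & forall w, W w ->
    [/\ sector w, sector_log w = local_log t w & U (sector_log w)]].
Proof.
move=> sz oU Uz; have [h1 h2] := sector_log_strip sz.
pose t := complex.Im (sector_log z).
have [hp lp] := local_log_expC (erefl : complex.Im (sector_log z) = t).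
rewrite h2 in hp lp.
pose V := log_strip `&` U; have oV : open V by apply: openI => //; exact: open_log_strip.
have Vz : V (local_log t z) by rewrite lp; split.
have nW : \forall w \near z, half_plane t w /\ V (local_log t w).
  apply: filterI; first by apply: open_nbhs_nbhs; split; [exact: (@open_half_plane R t)|exact: hp].
  by apply: (continuous_local_log hp); apply: open_nbhs_nbhs.
have /nbhs_modulus[e e0 He] := nW.
exists t, (odisc z e); split; [exact: open_odisc|exact: odisc_center|by move=> w /He[]|].
move=> w /He[hw [v1 v2]]; have ew := expC_local_log hw.
have sw : sector w by exists (local_log t w).
have lw : sector_log w = local_log t w by rewrite -{1}ew sector_logK.
by split => //; rewrite lw.
Qed.

Lemma open_sector : open sector.
Proof.
rewrite openE => z sz; have [t [W [oW Wz _ HW]]] := sector_chart sz (@openT C) I.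
by apply: (@filterS _ (nbhs z) (nbhs_filter z) W) => [w /HW[]//|]; exact: open_nbhs_nbhs.
Qed.

Lemma harmonic_sector_log U V f : open V -> harmonic_on V f -> U `<=` sector ->
  (forall z, U z -> V (sector_log z)) -> harmonic_on U (fun z => f (sector_log z)).
Proof.
move=> oV hf Us UV; apply: harmonic_local => z Uz.
have [t [W [oW Wz Wt HW]]] := sector_chart (Us z Uz) oV (UV z Uz).
have [h1 h2 cr] := harmonic_local_log t.
exists W; split; [exact: oW|exact: Wz|].
have h3 : harmonic_on W (fun w => f (ln (modulus w) +i* (t + atan ((cos t * complex.Im w - sin t * complex.Re w) /
   (cos t * complex.Re w + sin t * complex.Im w))))).
  apply: (harmonic_comp oV oW hf (harmonicS Wt h1) (harmonicS Wt h2)).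
    by move=> w Ww; have [_ lw Vw] := HW w Ww; rewrite lw in Vw.
  by move=> w /Wt; exact: cr.
by apply: (eq_harmonic oW _ h3) => w /HW[_ -> _].
Qed.

(** The strip is star-shaped about the point [c] on its middle line, so the sector is a union of
    images of segments through one common point. *)
Lemma connected_sector : connected (Some @` sector : set Chat).
Proof.
pose c : C := 0 +i* (al + l / 2).
pose seg x (s : R) : C := (s * complex.Re x) +i* ((1 - s) * (al + l / 2) + s * complex.Im x).
have cseg x s : {for s, continuous (seg x)}.
  have cs : {for s, continuous (fun s : R => s)} by exact: cvg_id.
  apply: continuous_complex; first exact: (contM cs (@cont_cst _ _ (complex.Re x) s)).
  exact: (contD (contM (contB (@cont_cst _ _ 1 s) cs) (@cont_cst _ _ (al + l / 2) s)) (contM cs (@cont_cst _ _ (complex.Im x) s))).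
pose A x : set Chat := [set Some (expC 1 (seg x s)) | s in `[0, 1]].
have sx s x : log_strip x -> 0 <= s <= 1 -> log_strip (seg x s).
  move=> /andP[h1 h2] /andP[s0 s1]; rewrite /log_strip /seg /=; apply/andP; split; nra.
have -> : Some @` sector = \bigcup_(x in log_strip) A x.
  apply/seteqP; split=> p.
    move=> [z [x hx <-] <-]; exists x => //; exists 1; first by rewrite /= in_itv /= ler01 lexx.
    by congr (Some (expC 1 _)); rewrite /seg subrr mul0r add0r !mul1r complex_eta.
  move=> [x hx [s]]; rewrite /= in_itv /= => hs <-; exists (expC 1 (seg x s)) => //.
  by exists (seg x s) => //; exact: sx.
apply: bigcup_connected.
  exists (Some (expC 1 c)) => x hx; exists 0; first by rewrite /= in_itv /= lexx ler01.
  by congr (Some (expC 1 _)); rewrite /seg /c !mul0r subr0 mul1r addr0.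
move=> x hx; apply: connected_continuous_connected; first exact: segment_connected.
apply: continuous_subspaceT => s.
apply: (@continuous_comp _ _ _ (seg x) (fun y => Some (expC 1 y) : Chat)); first exact: cseg.
apply: (@continuous_comp _ _ _ (expC 1) (fun y => Some y : Chat)); first exact: continuous_expC.
exact: one_point_compactification_some_continuous.
Qed.

Lemma domain_sector : domain (Some @` sector : set Chat).
Proof.
split; [exact/one_point_compactification_open_some/open_sector|exact: connected_sector|].
exists (Some (expC 1 (0 +i* (al + l / 2)))); exists (expC 1 (0 +i* (al + l / 2))) => //.
exists (0 +i* (al + l / 2)) => //=; rewrite /log_strip /=; move: l0; lra.
Qed.

Let m := pi / l.
Let m0 : 0 < m. Proof. by rewrite divr_gt0 ?pi_gt0. Qed.
Let ml : m * l = pi. Proof. by rewrite /m mulfVK// gt_eqF. Qed.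

Section Pole.
Variable x0 : C.
Hypothesis hx0 : log_strip x0.

Let s0 := complex.Re x0.
Let t0 := complex.Im x0.
Let w := expC 1 x0.
(** [src x] is [x - x0], and [img x] is the difference of [x] and the mirror image of [x0] in the
    lower side [Im = al]. With [m = pi / l], [chcos m] has vertical period [2 l], so these two terms
    account for all repeated reflections in both sides: the method of images. *)
Definition src x : C := dilate 1 (- s0) (- t0) x.
Definition img x : C := dilate 1 (- s0) (t0 - 2 * al) x.
Definition green_strip x : R := strip_log m (img x) - strip_log m (src x).

Let img_gt0 x : al <= complex.Im x <= al + l -> 0 < chcos m (img x).
Proof.
move=> /andP[h1 h2]; have /andP[a1 a2] := hx0; rewrite -/t0 in a1 a2.
have i1 : 0 < complex.Im (img x) < 2 * l by rewrite /img /dilate /= mul1r; move: h1 h2 a1 a2; lra.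
have /andP[i2 i3] := i1; apply: chcos_gt0; first by rewrite gt_eqF.
  have -> : 2 * pi = m * (2 * l) by rewrite -ml; ring.
  by rewrite normrM (gtr0_norm m0) (gtr0_norm i2) ltr_pM2l.
by apply/eqP => e; move: i2; rewrite e /= ltxx.
Qed.

Let src_eq0 x : (src x == 0) = (x == x0).
Proof.
apply/eqP/eqP => [[]|->]; last by rewrite /src /dilate /= !mul1r /s0 /t0 !addNr.
rewrite !mul1r => e1 e2; rewrite -(complex_eta x) -(complex_eta x0) -/s0 -/t0.
by congr (_ +i* _); [move: e1|move: e2]; lra.
Qed.

Let src_gt0 x : al <= complex.Im x <= al + l -> x != x0 -> 0 < chcos m (src x).
Proof.
move=> /andP[h1 h2] xx; have /andP[a1 a2] := hx0; rewrite -/t0 in a1 a2.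
apply: chcos_gt0; [by rewrite gt_eqF| |by rewrite src_eq0].
rewrite normrM (gtr0_norm m0); apply: (@lt_le_trans _ _ (m * l)); last by rewrite ml; have := pi_gt0 R; lra.
rewrite ltr_pM2l// ltr_norml /src /dilate /= mul1r; move: h1 h2 a1 a2; lra.
Qed.

(** The difference is twice the product of the sines of [m (Im x - al)] and [m (Im x0 - al)], two
    angles between 0 and [pi]. *)
Lemma chcos_src_le_img x : log_strip x -> chcos m (src x) <= chcos m (img x).
Proof.
move=> /andP[h1 h2]; have /andP[a1 a2] := hx0; rewrite -/t0 in a1 a2.
rewrite /chcos /src /img /dilate /= !mul1r lerD2l lerN2.
have -> : m * (t0 - 2 * al + complex.Im x) = m * (complex.Im x - al) + m * (t0 - al) by ring.
have -> : m * (- t0 + complex.Im x) = m * (complex.Im x - al) - m * (t0 - al) by ring.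
have sp (y : R) : al < y -> y < al + l -> 0 <= sin (m * (y - al)).
  move=> y1 y2; apply/ltW/sin_gt0_pi; rewrite mulr_gt0 ?subr_gt0//= -ml ltr_pM2l//; move: y2; lra.
rewrite cosD cosB; have := mulr_ge0 (sp _ h1 h2) (sp _ a1 a2); lra.
Qed.

Lemma green_strip_ge0 x : log_strip x -> x != x0 -> 0 <= green_strip x.
Proof.
move=> hx xx; have /andP[h1 h2] := hx; have hx' : al <= complex.Im x <= al + l by rewrite !ltW.
by rewrite /green_strip subr_ge0 /strip_log ler_pM2l ?invr_gt0// ler_ln ?posrE ?src_gt0 ?img_gt0 ?chcos_src_le_img.
Qed.

(** Freed of logarithms, the condition on superlevel sets is continuous on the whole plane, hence
    meaningful on the sides of the strip and at the pole. *)
Lemma green_strip_gt (e : R) x : log_strip x -> x != x0 ->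
  (e < green_strip x) = (0 < chcos m (img x) - expR (2 * e) * chcos m (src x)).
Proof.
move=> hx xx; have /andP[h1 h2] := hx; have hx' : al <= complex.Im x <= al + l by rewrite !ltW.
have k1 := img_gt0 hx'; have k2 := src_gt0 hx' xx.
rewrite subr_gt0 -{1}(lnK (x := chcos m (src x))) ?posrE// -{1}(lnK (x := chcos m (img x))) ?posrE// -expRD ltr_expR.
rewrite /green_strip /strip_log; apply/idP/idP; lra.
Qed.

Let cont_chcos x : {for x, continuous (chcos m)}.
Proof.
apply: contB.
  apply: (@continuous_comp _ _ _ (fun w : C => m * complex.Re w) ch); last exact: continuous_ch.
  by apply: contM; [exact: cont_cst|exact: continuous_Re].
apply: (@continuous_comp _ _ _ (fun w : C => m * complex.Im w) cos); last exact: continuous_cos.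
by apply: contM; [exact: cont_cst|exact: continuous_Im].
Qed.

Let oP : open [set y | 0 < chcos m y].
Proof. by apply: (@open_comp _ _ (chcos m) [set t : R | 0 < t]); [move=> y _; exact: cont_chcos|exact: open_gt]. Qed.

Let hP : harmonic_on [set y | 0 < chcos m y] (strip_log m).
Proof. by apply: harmonic_strip_log; [exact: oP|]. Qed.

Lemma harmonic_img : harmonic_on log_strip (strip_log m \o img).
Proof.
apply: harmonicS (harmonic_dilate 1 (- s0) (t0 - 2 * al) oP hP) => x /andP[h1 h2] /=.
by apply: img_gt0; rewrite !ltW.
Qed.

Lemma harmonic_green_strip : harmonic_on (log_strip `&` [set x | x != x0]) green_strip.
Proof.
have oU : open (log_strip `&` [set x | x != x0]) by apply: openI; [exact: open_log_strip|exact: open_punctured].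
apply: (harmonicB oU); first by apply: harmonicS harmonic_img => x [].
apply: harmonicS (harmonic_dilate 1 (- s0) (- t0) oP hP) => x [/andP[h1 h2] xx] /=.
by apply: src_gt0 => //; rewrite !ltW.
Qed.

(** The pole of [strip_log m] at [src x = 0] is converted into a Euclidean one by [q]. At [x0] the
    image term is the logarithm of [2 sin^2 (m (t0 - al))], halved, and [q 0 = - ln m]; together
    they give the logarithm of the inner radius of the sector. *)
Lemma green_strip_regular : exists2 H : C -> R, harmonic_on log_strip H &
  (forall x, log_strip x -> x != x0 -> green_strip x = H x - ln (modulus (expC 1 x - w))) /\
  H x0 = ln (2 * expR s0 * sin (m * (t0 - al)) / m).
Proof.
have lb : 0 < l <= 2 * pi by rewrite l0 l2.
have mlb : m * l <= 2 * pi by rewrite ml; have := pi_gt0 R; lra.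
have [q [hq qE q0]] := regular_quotient m0 lb mlb.
have /andP[a1 a2] := hx0; rewrite -/t0 in a1 a2.
have src_strip x : log_strip x -> strip l (src x).
  by move=> /andP[h1 h2]; rewrite /strip /src /dilate /= mul1r; move: h1 h2 a1 a2; lra.
have hqs : harmonic_on log_strip (q \o src).
  by apply: harmonicS (harmonic_dilate 1 (- s0) (- t0) (@open_strip R l) hq) => x; exact: src_strip.
have oS := open_log_strip.
have ha := harmonic_affine (s0 + 2^-1 * ln 2 - 2^-1 * s0) (2^-1) 0 oS.
exists (fun x => (strip_log m \o img) x + (s0 + 2^-1 * ln 2 - 2^-1 * s0 + 2^-1 * complex.Re x + 0 * complex.Im x) + (q \o src) x).
  exact: harmonicD oS (harmonicD oS harmonic_img ha) hqs.
split.
  move=> x hx xx; have k0 : src x != 0 by rewrite src_eq0.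
  have c1 : 0 < chcos 1 (src x) by apply: (strip_chcos_gt0 _ _ (src_strip x hx) k0) => //; rewrite mul1r.
  have -> : ln (modulus (expC 1 x - w)) = s0 + 2^-1 * ln 2 + (complex.Re x - s0) / 2 + strip_log 1 (src x).
    have e0 := expR_gt0 s0.
    have -> : expC 1 x = expC (expR s0) ((complex.Re x - s0) +i* complex.Im x).
      by rewrite /expC /expX /expY /= -expRD mul1r addrC subrK.
    have -> : w = polar (expR s0) t0 by rewrite /w expCE mul1r.
    have sE : complex.Re (((complex.Re x - s0) +i* complex.Im x) : C) +i* (complex.Im (((complex.Re x - s0) +i* complex.Im x) : C) - t0) = src x.
      by rewrite /src /dilate /= !mul1r (addrC (- s0)) (addrC (- t0)).
    by rewrite ln_modulus_expC ?sE// expRK.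
  rewrite /green_strip /= (qE _ (src_strip x hx) k0).
  move: (strip_log m (img x)) (strip_log m (src x)) (strip_log 1 (src x)) (ln 2) s0 => a b c d s.
  by field.
have src0 : src x0 = 0 by apply/eqP; rewrite src_eq0.
have sp : 0 < sin (m * (t0 - al)).
  apply: sin_gt0_pi; rewrite mulr_gt0 ?subr_gt0//= -ml ltr_pM2l//; move: a2; lra.
have imgE : chcos m (img x0) = 2 * sin (m * (t0 - al)) ^+ 2.
  rewrite chcosE /img /dilate /= -/s0 -/t0 !mul1r addNr mulr0 mul0r.
  have -> : m * (t0 - 2 * al + t0) / 2 = m * (t0 - al) by field.
  by rewrite /sh oppr0 subrr mul0r expr0n /= add0r.
rewrite /= src0 q0 /strip_log imgE -/s0 -/t0.
have e0 := expR_gt0 s0.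
have p2 : (2 : R) \is Num.pos by rewrite posrE.
have pe : expR s0 \is Num.pos by rewrite posrE.
have ps : sin (m * (t0 - al)) \is Num.pos by rewrite posrE.
have mp : m \is Num.pos by rewrite posrE.
have p3 : sin (m * (t0 - al)) ^+ 2 \is Num.pos by rewrite posrE exprn_gt0.
have p4 : 2 * expR s0 \is Num.pos by rewrite posrE mulr_gt0.
have p5 : 2 * expR s0 * sin (m * (t0 - al)) \is Num.pos by move: p4 ps; rewrite !posrE => h1 h2; rewrite mulr_gt0.
rewrite (lnM p2 p3) (ln_div p5 mp) (lnM p4 ps) (lnM p2 pe) expRK lnXn//.
rewrite -[ln (sin _) *+ 2]mulr_natl.
move: (ln (sin (m * (t0 - al)))) (ln m) (ln 2) => a b c; by [field|].
Qed.

End Pole.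
End Sector.

Section OpenPositive.
Context {R : realType}.
Local Notation C := R[i]^o.

Lemma open_positive (U : set C) (f : C -> R) : open U -> (forall z, U z -> {for z, continuous f}) ->
  open [set z | U z /\ 0 < f z].
Proof.
move=> /openP_modulus oU cf; apply/openP_modulus => z [Uz fz].
have [e e0 He] := oU z Uz; have [d d0 Hd] := (continuous_modulusP _ _).1 (cf z Uz) (f z) fz.
exists (Num.min e d); first by rewrite lt_min e0.
move=> w; rewrite lt_min => /andP[w1 w2]; split; first exact: He.
by have := Hd w w2; rewrite ltr_norml; lra.
Qed.

End OpenPositive.

(** * The Green function of a sector *)

Section SectorGreen.
Context {R : realType}.
Local Notation C := R[i]^o.
Local Notation Chat := (riemann_sphere R).
Variables (al l : R) (x0 : C).
Hypotheses (l0 : 0 < l) (l2 : l <= 2 * pi) (hx0 : log_strip al l x0).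

Let w := expC 1 x0.
Let D : set Chat := Some @` sector al l.
Let m := pi / l.
Let m0 : 0 < m. Proof. by rewrite divr_gt0 ?pi_gt0. Qed.
Let ml : m * l = pi. Proof. by rewrite /m mulfVK// gt_eqF. Qed.

Definition sector_green (p : Chat) : R := if p is Some z then green_strip al l x0 (sector_log al l z) else 0.

Let Sw : sector al l w. Proof. by exists x0. Qed.
Let oS : open (sector al l). Proof. exact: open_sector. Qed.
Let DS z : D (Some z) -> sector al l z. Proof. by move=> [y Sy [<-]]. Qed.

Let punct : set C := [set z | sector al l z /\ z != w].
Let oPunct : open punct. Proof. by apply: openI; [exact: oS|exact: open_punctured]. Qed.
Let DP z : (D `\ Some w) (Some z) -> punct z.
Proof. by move=> [Dz zw]; split; [exact: DS|apply/eqP => e; apply: zw; rewrite /= e]. Qed.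
Let PD z : punct z -> (D `\ Some w) (Some z).
Proof. by move=> [Sz zw]; split; [exists z|move=> /= -[] /eqP; rewrite (negPf zw)]. Qed.

Let log_neq z : punct z -> log_strip al l (sector_log al l z) /\ sector_log al l z != x0.
Proof.
move=> [Sz zw]; have [h1 h2] := sector_log_strip l2 Sz; split; first exact: h1.
by apply/eqP => e; move: zw; rewrite -h2 e eqxx.
Qed.

Let hpunct : harmonic_on punct (fun z => green_strip al l x0 (sector_log al l z)).
Proof.
have oV : open (log_strip al l `&` [set x : C | x != x0]) by apply: openI; [exact: open_log_strip|exact: open_punctured].
apply: (harmonic_sector_log l2 oV (harmonic_green_strip l0 hx0)) => [z []//|z /log_neq[h1 h2]].
by split.
Qed.

Lemma sector_green_regular : exists2 h : C -> R, harmonic_on (sector al l) h &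
  (forall z, punct z -> sector_green (Some z) = h z - ln (modulus (z - w))) /\
  h w = ln (2 * expR (complex.Re x0) * sin (m * (complex.Im x0 - al)) / m).
Proof.
have [H hH [HE H0]] := green_strip_regular l0 l2 hx0.
exists (fun z => H (sector_log al l z)).
  exact: (harmonic_sector_log l2 (@open_log_strip R al l) hH (@subset_refl _ _) (fun z Sz => (sector_log_strip l2 Sz).1)).
split; last by rewrite /w (sector_logK l2 hx0) H0.
move=> z Pz; have [h1 h2] := log_neq Pz; have [_ h3] := sector_log_strip l2 Pz.1.
by rewrite /= HE// h3.
Qed.

Lemma sector_green_competitor : green_competitor D w sector_green.
Proof.
split; first split.
- by apply: harmonicS hpunct => z; exact: DP.
(* The sector omits infinity, so the chart has no point over it and harmonicity follows by composing
   with the inversion. *)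
- have oV : open [set z : C | z != 0 /\ punct z^-1] by exact: open_inverse_preimage.
  have hV := harmonic_comp_inverse oPunct oV hpunct (fun z Vz => Vz).
  have VE : (@chart_infty R) @^-1` (D `\ Some w) `<=` [set z : C | z != 0 /\ punct z^-1].
    move=> z; rewrite /= /chart_infty; case: eqVneq => [_ [[y _ //]]|z0 h]; split => //; exact: DP.
  apply: harmonicS VE _; apply: (eq_harmonic oV _ hV) => z [/negPf z0 _].
  by rewrite /= /chart_infty z0.
- move=> [z|] [Dz zw]; last by case: Dz.
  have [h1 h2] := log_neq (DP (conj Dz zw)); exact: green_strip_ge0.
have [h hh [hE _]] := sector_green_regular.
exists (sector al l), h; split; [exact: oS|exact: Sw|exact: hh|].
by move=> z Sz zw; exact: hE.
Qed.

(** Since [v >= 0], the points where [sector_green - v] exceeds [e] lie in a superlevel set of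
    [sector_green], which together with the pole is contained in a compact part of the sector. The
    maximum principle applies there to the difference, and nothing about the boundary behaviour of
    [v] enters. *)
Lemma sector_green_minimal v : green_competitor D w v ->
  forall p, (D `\ Some w) p -> sector_green p <= v p.
Proof.
move=> cv [z1|] Dp; last by case: Dp => -[].
have P1 := DP Dp; rewrite leNgt; apply/negP => lt1.
pose e := (sector_green (Some z1) - v (Some z1)) / 2.
have e0 : 0 < e by rewrite divr_gt0// subr_gt0.
have [_ v0 _] := cv.
have oD : open D by exact/one_point_compactification_open_some/oS.
have [hv hhv hvE] := competitor_regular_part oD cv.
have [h hh [hE _]] := sector_green_regular.
have hhv' : harmonic_on (sector al l) hv by apply: harmonicS hhv => z Sz; exists z.
(* Written with the regular parts, so that the poles cancel and [f] is harmonic across [w] as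
   well. *)
pose f z := h z - hv z - e.
have hf : harmonic_on (sector al l) f.
  exact: (harmonicB oS (harmonicB oS hh hhv') (harmonic_cst e oS)).
have fE z : punct z -> f z = sector_green (Some z) - v (Some z) - e.
  by move=> Pz; rewrite /f hE// hvE ?Pz.2//; lra.
have f1 : 0 < f z1 by rewrite fE//; rewrite /e in e0 *; lra.
pose Psi x := chcos m (img al x0 x) - expR (2 * e) * chcos m (src x0 x).
have cch x : {for x, continuous (chcos m)}.
  apply: contB.
    apply: (@continuous_comp _ _ _ (fun w : C => m * complex.Re w) ch); last exact: continuous_ch.
    exact: (contM (@cont_cst _ _ m x) (@continuous_Re R x)).
  apply: (@continuous_comp _ _ _ (fun w : C => m * complex.Im w) cos); last exact: continuous_cos.
  exact: (contM (@cont_cst _ _ m x) (@continuous_Im R x)).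
have cPsi x : {for x, continuous Psi}.
  apply: contB; first by apply: (@continuous_comp _ _ _ (img al x0) (chcos m)); [exact: continuous_dilate|exact: cch].
  apply: contM; first exact: cont_cst.
  by apply: (@continuous_comp _ _ _ (src x0) (chcos m)); [exact: continuous_dilate|exact: cch].
have E1 : 1 < expR (2 * e) by rewrite expR_gt1 mulr_gt0.
have /andP[a1 a2] := hx0.
pose K0 : set C := [set x | al <= complex.Im x <= al + l /\ 0 <= Psi x].
have K0S : K0 `<=` log_strip al l.
  (* On either side of the strip [src x] and [img x] have the same positive [chcos], so [Psi x] is
     this value times [1 - expR (2 e)], which is negative. *)
  move=> x [/andP[h1 h2] hP]; rewrite /log_strip /=; apply/andP; split; rewrite lt_neqAle ?h1 ?h2 andbT; apply/eqP => xe.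
    have c0 : 0 < chcos m (src x0 x).
      apply: chcos_gt0; [by rewrite gt_eqF| |].
        rewrite normrM (gtr0_norm m0); apply: (@lt_le_trans _ _ (m * l)); last by rewrite ml; have := pi_gt0 R; lra.
        by rewrite ltr_pM2l// ltr_norml /src /dilate /= mul1r -xe; move: a1 a2 l0; lra.
      apply/eqP => -[_ /eqP]; rewrite mul1r -xe; apply/negP; rewrite lt_eqF//; move: a1; lra.
    have ce : chcos m (img al x0 x) = chcos m (src x0 x).
      rewrite /chcos /img /src /dilate /= !mul1r -xe -[in RHS]cosN; congr (_ - cos _); ring.
    move: hP; rewrite /Psi ce; move: c0 E1; set c := chcos _ _; set E := expR _; nra.
  have c0 : 0 < chcos m (src x0 x).
    apply: chcos_gt0; [by rewrite gt_eqF| |].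
      rewrite normrM (gtr0_norm m0); apply: (@lt_le_trans _ _ (m * l)); last by rewrite ml; have := pi_gt0 R; lra.
      by rewrite ltr_pM2l// ltr_norml /src /dilate /= mul1r xe; move: a1 a2 l0; lra.
    apply/eqP => -[_ /eqP]; rewrite mul1r xe; apply/negP; rewrite gt_eqF//; move: a2; lra.
  have ce : chcos m (img al x0 x) = chcos m (src x0 x).
    rewrite /chcos /img /src /dilate /= !mul1r xe; congr (_ - _).
    have -> : m * (complex.Im x0 - 2 * al + (al + l)) = - (m * (- complex.Im x0 + (al + l))) + m * l *+ 2.
      by rewrite mulr2n; ring.
    by rewrite ml cosD2pi cosN.
  move: hP; rewrite /Psi ce; move: c0 E1; set c := chcos _ _; set E := expR _; nra.
have cK0 : compact K0.
  have cl : closed K0.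
    have -> : K0 = ~` ([set x : C | complex.Im x < al] `|` [set x | al + l < complex.Im x] `|` [set x | Psi x < 0]).
      apply/seteqP; split=> x /=.
        by move=> [/andP[h1 h2] hP] [[|]|]; rewrite ltNge ?h1 ?h2 ?hP.
      move=> nx; split.
        apply/andP; split; rewrite leNgt; apply/negP => k; apply: nx; left; [left|right]; exact: k.
      by rewrite leNgt; apply/negP => k; apply: nx; right.
    apply: open_closedC; apply: openU; first by apply: openU; [exact: open_Im_lt|exact: open_Im_gt].
    by apply: (@open_comp _ _ Psi [set t : R | t < 0]); [move=> y _; exact: cPsi|exact: open_lt].
  (* With [E = expR (2 e)], [Psi x >= 0] and the bounds on the cosines give [ch y (E - 1) <= E + 1],
     which limits the extent of [K0] along the strip. *)
  pose M := (expR (2 * e) + 1) / (expR (2 * e) - 1).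
  have M0 : 0 < M by rewrite divr_gt0 ?subr_gt0// addr_gt0// expR_gt0.
  apply: (@bounded_closed_compact_plane R K0 (`|complex.Re x0| + 2 * M / m + (`|al| + l))); first exact: cl.
  move=> x [/andP[h1 h2] hP].
  have mI : `|complex.Im x| <= `|al| + l.
    by rewrite ler_norml; have := ler_norm al; have := ler_norm (- al); rewrite normrN; move: h1 h2 l0; lra.
  pose y := m * (- complex.Re x0 + complex.Re x).
  have hc : ch y <= M.
    rewrite /M ler_pdivlMr ?subr_gt0//; move: hP; rewrite /Psi /chcos /img /src /dilate /= !mul1r -/y.
    set c1 := cos _; set c2 := cos _; have k1 : -1 <= c1 := cos_geN1 _; have k2 : c2 <= 1 := cos_le1 _.
    move: E1; set E := expR _; nra.
  have hy : `|y| <= 2 * M.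
    have ge (t : R) : t <= 2 * ch t.
      by rewrite /ch; have := expR_ge1Dx t; have := expR_gt0 (- t); lra.
    rewrite ler_norml; have := ge y; have := ge (- y); rewrite chN; lra.
  have mR : `|complex.Re x| <= `|complex.Re x0| + 2 * M / m.
    have yE : complex.Re x = complex.Re x0 + y / m.
      by rewrite /y; move: (gt_eqF m0); move: (m) => k k0; field; rewrite k0.
    rewrite yE; apply: le_trans (ler_normD _ _) _; rewrite lerD2l normrM normfV (gtr0_norm m0).
    by rewrite ler_pM2r ?invr_gt0.
  apply: le_trans (_ : `|complex.Re x| + `|complex.Im x| <= _); last exact: lerD mR mI.
  rewrite modulusE -[leRHS]ger0_norm ?addr_ge0// -sqrtr_sqr ler_wsqrtr//.
  rewrite sqrrD !real_normK ?num_real// -addrA lerD2l lerDr mulrn_wge0// mulr_ge0//.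
pose K := expC 1 @` K0.
have cK : compact K.
  by apply: continuous_compact cK0; apply: continuous_subspaceT => x; exact: continuous_expC.
have KS : K `<=` sector al l by move=> _ [x /K0S Sx <-]; exists x.
have PsiK z : sector al l z -> 0 < f z -> 0 < Psi (sector_log al l z).
  move=> Sz fz; have [s1 s2] := sector_log_strip l2 Sz; have [zw|zw] := eqVneq z w.
    (* At the pole [green_strip_gt] does not apply, but [chcos m (src x0)] vanishes and [Psi x0]
       reduces to its positive first term. *)
    have -> : sector_log al l z = x0 by rewrite zw /w sector_logK.
    have -> : Psi x0 = chcos m (img al x0 x0).
      rewrite /Psi (_ : chcos m (src x0 x0) = 0) ?mulr0 ?subr0//.
      rewrite /chcos /src /dilate /= !mul1r !addNr !mulr0 cos0 /ch oppr0 expR0; lra.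
    apply: chcos_gt0; first by rewrite gt_eqF.
      rewrite /img /dilate /= mul1r normrM (gtr0_norm m0) gtr0_norm; last by move: a1; lra.
      have -> : 2 * pi = m * (2 * l) by rewrite -ml; ring.
      by rewrite ltr_pM2l//; move: a2; lra.
    apply/eqP => -[_ /eqP]; rewrite mul1r; apply/negP; rewrite gt_eqF//; move: a1; lra.
  have Pz : punct z by split.
  have [n1 n2] := log_neq Pz; rewrite -(green_strip_gt l0 hx0 e n1 n2).
  have := fE z Pz; rewrite /sector_green => fz'; rewrite fz' in fz.
  have := v0 (Some z) (PD Pz); lra.
have logK z : sector al l z -> 0 < Psi (sector_log al l z) -> K z.
  move=> Sz hP; have [/andP[s1 s2] s3] := sector_log_strip l2 Sz.
  exists (sector_log al l z) => //; split; [by rewrite !ltW|exact: ltW].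
have cf : {within K, continuous f}.
  by apply: continuous_within => z /KS Sz; exact: (harmonic_continuous oS hf Sz).
have Kz1 : K z1 by apply: logK; [exact: P1.1|exact: (PsiK _ P1.1 f1)].
have := maximum_principle cK cf _ Kz1; rewrite leNgt f1 => H; apply: (notF (H _)).
move=> z Kz fz; exists [set y | sector al l y /\ 0 < f y]; split.
- by apply: open_positive => // y Sy; exact: (harmonic_continuous oS hf Sy).
- by split; [exact: KS|exact: fz].
- by move=> y [Sy fy]; apply: logK => //; exact: PsiK.
by apply: harmonicS hf => y [].
Qed.

Lemma is_green_sector : is_green D w sector_green.
Proof. by split; [exact: sector_green_competitor|exact: sector_green_minimal]. Qed.

Lemma inner_radius_sector : inner_radius D w = 2 * expR (complex.Re x0) * sin (m * (complex.Im x0 - al)) / m.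
Proof.
have [h hh [hE h0]] := sector_green_regular.
rewrite (@inner_radius_green R D w h (sector al l) oS Sw (harmonic_continuous oS hh Sw)).
  have /andP[a1 a2] := hx0.
  rewrite h0 lnK// posrE divr_gt0// !mulr_gt0 ?expR_gt0//.
  by apply: sin_gt0_pi; rewrite mulr_gt0 ?subr_gt0//= -ml ltr_pM2l//; move: a2; lra.
by move=> z Sz zw; rewrite (greenE is_green_sector (PD (conj Sz zw))) hE.
Qed.

Lemma exp_m2green_sector x1 : log_strip al l x1 -> x1 != x0 ->
  exp_m2green D (expC 1 x1) w = chcos m (src x0 x1) / chcos m (img al x0 x1).
Proof.
move=> hx1 x10; have ne : expC 1 x1 != w.
  by apply/eqP => e; move/eqP: x10; apply; exact: (expC_inj l2 hx1 hx0 e).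
have P1 : punct (expC 1 x1) by split => //; exists x1.
rewrite /exp_m2green (negPf ne) (greenE is_green_sector (PD P1)) /sector_green sector_logK//.
have hgt := green_strip_gt l0 hx0.
have [c1 c2] : 0 < chcos m (src x0 x1) /\ 0 < chcos m (img al x0 x1).
  have k := hgt (green_strip al l x0 x1 - 1) x1 hx1 x10.
  have s : 0 < chcos m (src x0 x1).
    have /andP[a1 a2] := hx0; have /andP[b1 b2] := hx1; apply: chcos_gt0; [by rewrite gt_eqF| |].
      rewrite normrM (gtr0_norm m0); apply: (@lt_le_trans _ _ (m * l)); last by rewrite ml; have := pi_gt0 R; lra.
      by rewrite ltr_pM2l// ltr_norml /src /dilate /= mul1r; move: a1 a2 b1 b2 l0; lra.
    apply/eqP => -[]; rewrite !mul1r => e1 e2; move/eqP: x10; apply.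
    by rewrite -(complex_eta x1) -(complex_eta x0); congr (_ +i* _); [move: e1|move: e2]; lra.
  split=> //; have : green_strip al l x0 x1 - 1 < green_strip al l x0 x1 by lra.
  by rewrite k subr_gt0; apply: le_lt_trans; rewrite mulr_ge0 ?expR_ge0// ltW.
rewrite /green_strip /strip_log -/m.
have -> : -2 * (2^-1 * ln (chcos m (img al x0 x1)) - 2^-1 * ln (chcos m (src x0 x1))) =
  ln (chcos m (src x0 x1)) - ln (chcos m (img al x0 x1)) by field.
by rewrite expRB !lnK ?posrE.
Qed.

End SectorGreen.

(** * The extremal configuration *)

Section Extremal.
Context {R : realType}.
Local Notation C := R[i]^o.
Local Notation Chat := (riemann_sphere R).
Variables (n : nat) (r : R).
Hypotheses (n0 : (0 < n)%N) (r0 : 0 < r).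

Let N : R := n%:R.
Let N0 : 0 < N. Proof. by rewrite ltr0n. Qed.
Let N1 : 1 <= N. Proof. by rewrite ler1n. Qed.
Let l : R := 2 * pi / N.
Let l0 : 0 < l. Proof. by rewrite !mulr_gt0 ?pi_gt0// invr_gt0. Qed.
Let l2 : l <= 2 * pi.
Proof. by rewrite ler_pdivrMr// ler_peMr// mulr_ge0// pi_ge0. Qed.
Let al (k : 'I_n) : R := 2 * pi * k.+1%:R / N.

Let alS (k : 'I_n) : 2 * pi * k.+2%:R / N = al k + l.
Proof. by rewrite /al /l -[k.+2%:R]/((k.+1).+1%:R) -(addn1 k.+1) natrD mulrDr mulr1 mulrDl. Qed.

Lemma DstarE (k : 'I_n) : Dstar k = Some @` sector (al k) l :> set Chat.
Proof.
apply/seteqP; split=> p.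
  move=> [rho [th [rho0 h1 h2 ->]]]; exists (polar rho th) => //.
  exists (ln rho +i* th); first by rewrite /log_strip /= h1 -alS h2.
  by rewrite expCE /= lnK ?posrE// mul1r.
move=> [_ [x /andP[h1 h2] <-] <-]; exists (expR (complex.Re x)), (complex.Im x); split => //.
- exact: expR_gt0.
- by rewrite alS.
by rewrite expCE mul1r.
Qed.

(** The logarithm of the point of the circle at the fraction [c] of the opening of the sector; [1/4]
    and [3/4] give the two extremal points. *)
Let pole (k : 'I_n) (c : R) : C := ln r +i* (c * l + al k).

Let poleE k c : expC 1 (pole k c) = polar r (c * l + al k).
Proof. by rewrite expCE /= lnK ?posrE// mul1r. Qed.

Let pole_strip k c : 0 < c < 1 -> log_strip (al k) l (pole k c).
Proof.
move=> /andP[c0 c1]; rewrite /log_strip /pole /= ltrDr mulr_gt0//= addrC ltrD2l.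
by rewrite gtr_pMl.
Qed.

Let zstarE k : zstar r k = expC 1 (pole k 4^-1).
Proof.
rewrite poleE /zstar -/N -/(al k); congr (polar r (_ + _)).
by rewrite /l; field; rewrite gt_eqF.
Qed.

Let zetastarE k : zetastar r k = expC 1 (pole k (3 / 4)).
Proof.
rewrite poleE /zetastar -/N -/(al k); congr (polar r (_ + _)).
by rewrite /l; field; rewrite gt_eqF.
Qed.

Lemma configuration_star : configuration r (@Dstar R n) (@zstar R n r) (@zetastar R n r).
Proof.
have q1 : is_true ((0 < (4^-1 : R)) && ((4^-1 : R) < 1)) by lra.
have q3 : is_true ((0 < (3 / 4 : R)) && ((3 / 4 : R) < 1)) by lra.
split.
- by move=> k; rewrite !modulus_polar// ltW.
- move=> k; rewrite DstarE; split; first exact: domain_sector.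
  move=> w [_ [x hx <-] [<-]]; exists (sector_green (al k) l x); exact: is_green_sector.
- move=> j k jk; apply/seteqP; split=> // p; rewrite !DstarE => -[[_ [x hx <-] <-] [_ [y hy <-] /Some_inj e]].
  (* All strips lie in the single period from [l] to [l + 2 pi], as the mathematical index runs from
     1 to [n]. Injectivity of [expC 1] there reduces disjointness of sectors to that of
     intervals. *)
  have wide (i : 'I_n) u : log_strip (al i) l u -> log_strip l (2 * pi) u.
    move=> /andP[u1 u2]; apply/andP; split.
      by apply: le_lt_trans u1; rewrite /al /l ler_pM2r ?invr_gt0// ler_peMr ?ler1n// mulr_ge0// pi_ge0.
    apply: (lt_le_trans u2); rewrite -alS.
    have -> : l + 2 * pi = 2 * pi * (1 + N) / N by rewrite /l; field; rewrite gt_eqF.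
    rewrite ler_pM2r ?invr_gt0// ler_pM2l ?mulr_gt0 ?pi_gt0// /N -[1]/(1%:R) -natrD ler_nat add1n ltnS.
    exact: ltn_ord.
  have xy : y = x by exact: (expC_inj (lexx _) (wide k y hy) (wide j x hx) e).
  have mono (a b : 'I_n) u : (a < b)%N -> log_strip (al a) l u -> log_strip (al b) l u -> False.
    move=> ab /andP[_ u2] /andP[u3 _]; have := lt_trans u3 u2; apply/negP; rewrite -leNgt -alS /al.
    by rewrite ler_pM2r ?invr_gt0// ler_pM2l ?mulr_gt0 ?pi_gt0// ler_nat ltnS.
  rewrite xy in hy; case: (ltngtP j k) => [h|h|h].
  + exact: (mono j k x h hx hy).
  + exact: (mono k j x h hy hx).
  by case/negP: jk; apply/eqP/val_inj.
- move=> k; rewrite DstarE; split; eexists; [|by []| |by []].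
    by rewrite zstarE; exists (pole k 4^-1) => //; exact: pole_strip.
  by rewrite zetastarE; exists (pole k (3 / 4)) => //; exact: pole_strip.
Qed.

Lemma radii_product_star : radii_product (@Dstar R n) (@zstar R n r) (@zetastar R n r) = (2 * r / N) ^+ (2 * n).
Proof.
have q1 : is_true ((0 < (4^-1 : R)) && ((4^-1 : R) < 1)) by lra.
have q3 : is_true ((0 < (3 / 4 : R)) && ((3 / 4 : R) < 1)) by lra.
have lml (c : R) : pi / l * (c * l) = c * pi by field; rewrite gt_eqF.
have s1 : sin (4^-1 * pi) ^+ 2 = 2^-1 :> R.
  have := cos_mulr2n (4^-1 * pi : R); have -> : (4^-1 * pi) *+ 2 = pi / 2 :> R by rewrite mulr2n; field.
  rewrite cos_pihalf; have := cos2Dsin2 (4^-1 * pi : R); rewrite mulr2n; lra.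
have s3 : sin (3 / 4 * pi) = sin (4^-1 * pi) :> R.
  have -> : 3 / 4 * pi = pi - 4^-1 * pi :> R by field.
  by rewrite sinB sinpi cospi mul0r sub0r mulN1r opprK.
(* Both inner radii are [(4 r / n) sin (pi / 4)], and the Green factor is
   [(1 - cos (pi / 2)) / (1 - cos pi) = 1/2]; with [sin^2 (pi / 4) = 1/2] this is [(2 r / n)^2]. *)
have factor (k : 'I_n) : inner_radius (Dstar k) (zstar r k) * inner_radius (Dstar k) (zetastar r k) *
    exp_m2green (Dstar k) (zstar r k) (zetastar r k) = (2 * r / N) ^+ 2.
  have p1 := pole_strip k q1; have p3 := pole_strip k q3.
  have ne : pole k 4^-1 != pole k (3 / 4).
    by apply/eqP => -[/addIr /(mulIf (lt0r_neq0 l0))]; lra.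
  rewrite DstarE zstarE zetastarE !inner_radius_sector// exp_m2green_sector//.
  rewrite /chcos /src /img /dilate /= !mul1r !addNr !mulr0 /ch oppr0 expR0 (lnK (x := r)) ?posrE// !addrK !lml s3.
  have -> : pi / l * (- (3 / 4 * l + al k) + (4^-1 * l + al k)) = - (pi / 2) by field; rewrite gt_eqF.
  have -> : pi / l * (3 / 4 * l + al k - 2 * al k + (4^-1 * l + al k)) = pi by field; rewrite gt_eqF.
  rewrite cosN cos_pihalf cospi.
  have pn : (pi : R) != 0 by rewrite gt_eqF ?pi_gt0.
  have Nn : N != 0 by rewrite gt_eqF.
  transitivity ((2 * r / (pi / l)) ^+ 2 * sin (4^-1 * pi) ^+ 2 / 2).
    have : pi / l != 0 by apply/lt0r_neq0/divr_gt0 => //; exact: pi_gt0.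
    by move: (pi / l) (sin _) => q S qn; field.
  have simp (M p : R) : M != 0 -> p != 0 -> (2 * r / (p / (2 * p / M))) ^+ 2 * 2^-1 / 2 = (2 * r / M) ^+ 2.
    by move=> h1 h2; field; rewrite h1 h2.
  by rewrite s1; exact: simp.
rewrite /radii_product (eq_bigr _ (fun k _ => factor k)) prodr_const card_ord -exprM; congr (_ ^+ _).
Qed.

End Extremal.

Theorem theorem6 (R : realType) (n : nat) (r : R) (hn : (1 <= n)%N) (hr : 0 < r) :
  (forall (D : 'I_n -> set (riemann_sphere R)) (z zeta : 'I_n -> R[i]),
     configuration r D z zeta ->
     radii_product D z zeta <= (2 * r / n%:R) ^+ (2 * n)) /\
  (configuration r (@Dstar R n) (@zstar R n r) (@zetastar R n r) /\
   radii_product (@Dstar R n) (@zstar R n r) (@zetastar R n r)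
     = (2 * r / n%:R) ^+ (2 * n)).
Proof.
split; first by move=> D z zeta; exact: radii_product_le.
by split; [exact: configuration_star|exact: radii_product_star].
Qed.
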